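(* Assume that for each $i=1,2,3,4$ the following hold: (1) there are $L_i>0$ and a positive function $g_i$ on $E_i$ of at most polynomial growth such that $|a_i(x)-a_i(y)|\le L_i|x-y|$, $|c_i(x,z)-c_i(y,z)|\le g_i(z)|x-y|$ and $|c_i(x,z)|\le g_i(z)(1+|x|)$ for all $x,y\in\mathbb{R}^{d_i}$, $z\in E_i$; (2) $a_i$ is four times continuously differentiable and $a_i$ and all its derivatives up to order $4$ are of polynomial growth; (3) there are $\varrho_i>0$, $K_i>0$ with $f_i(z)\mathbf{1}_{\{|z|\le \varrho_i\}}\le K_i|z|^{1-d_i}$, and $\int |z|^l f_i(z)\,dz<\infty$ for every $l\ge 1$; (4) there is $c_{i,0}>0$ such that $\inf_{x}|c_i(x,z)|\ge c_{i,0}|z|$ for $z$ near the origin. Assume moreover that (a) for $\theta\in\Theta$, $\Sigma(\theta)=\Sigma(\theta_0)$ implies $\theta=\theta_0$, and (b) $\Delta_0$ has full column rank. Then, under $H_0$ (i.e. under $\mathbf{P}_{\theta_0}$), as $n\to\infty$, $$\mathbf{T}_n\overset{d}{\longrightarrow}\chi^2_{\bar p-q}.$$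
   Context: Model. Let $(\Omega,\mathcal{F},(\mathcal{F}_t)_{t\ge0},\mathbf{P})$ be a stochastic basis, $p_1,p_2,k_1,k_2$ positive integers with $k_1\le p_1$, $k_2\le p_2$; put $p=p_1+p_2$, $\bar p=p(p+1)/2$, $(d_1,d_2,d_3,d_4)=(k_1,p_1,p_2,k_2)$, $E_i=\mathbb{R}^{d_i}\setminus\{0\}$. The latent càdlàg $(\mathcal{F}_t)$-adapted processes $S^1=\xi$, $S^2=\delta$, $S^3=\varepsilon$, $S^4=\zeta$, with $S^i$ being $\mathbb{R}^{d_i}$-valued, satisfy $$dS^i_t=a_i(S^i_{t-})dt+\mathbf{S}_i\,dW_{i,t}+\int_{E_i}c_i(S^i_{t-},z)\,\mu_i(dt,dz),\qquad S^i_0=x_{i,0},$$ where $x_{i,0}\in\mathbb{R}^{d_i}$ is non-random, $a_i:\mathbb{R}^{d_i}\to\mathbb{R}^{d_i}$ and $c_i:\mathbb{R}^{d_i}\times E_i\to\mathbb{R}^{d_i}$ are (unknown) Borel functions, $\mathbf{S}_i\in\mathbb{R}^{d_i\times r_i}$ is constant, $W_i$ is an $r_i$-dimensional standard $(\mathcal{F}_t)$-Wiener process, and $\mu_i$ is a Poisson random measure on $\mathbb{R}_+\times E_i$ with compensator $f_i(z)\,dz\,dt$, $f_i=\lambda_{i,0}F_i$, $\lambda_{i,0}>0$, $F_i$ a probability density. For every $t\ge0$ the $\sigma$-fields $\mathcal{F}_t$, $\sigma(W_{i,u}-W_{i,t};u\ge t)$ and $\sigma(\mu_i(A\cap((t,\infty)\times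 E_i));A\subset\mathbb{R}_+\times E_i\text{ Borel})$, $i=1,2,3,4$, are independent. The observable processes are $X_{1,t}=\Lambda_1\xi_t+\delta_t\in\mathbb{R}^{p_1}$ and $X_{2,t}=\Lambda_2\eta_t+\varepsilon_t\in\mathbb{R}^{p_2}$, where the $k_2$-dimensional process $\eta$ satisfies $\eta_t=B_0\eta_t+\Gamma\xi_t+\zeta_t$; $X_t=(X_{1,t}^\top,X_{2,t}^\top)^\top$. Here $\Lambda_1\in\mathbb{R}^{p_1\times k_1}$, $\Lambda_2\in\mathbb{R}^{p_2\times k_2}$ have full column rank, $\Gamma\in\mathbb{R}^{k_2\times k_1}$, $B_0\in\mathbb{R}^{k_2\times k_2}$ has zero diagonal, and $\Psi=\mathbb{I}_{k_2}-B_0$ is non-singular. Put $\Sigma_{\xi\xi}=\mathbf{S}_1\mathbf{S}_1^\top$, $\Sigma_{\delta\delta}=\mathbf{S}_2\mathbf{S}_2^\top$, $\Sigma_{\varepsilon\varepsilon}=\mathbf{S}_3\mathbf{S}_3^\top$, $\Sigma_{\zeta\zeta}=\mathbf{S}_4\mathbf{S}_4^\top$, and $$\Sigma=\begin{pmatrix}\Sigma^{11}&\Sigma^{12}\\ \Sigma^{12\top}&\Sigma^{22}\end{pmatrix},\quad \Sigma^{11}=\Lambda_1\Sigma_{\xi\xi}\Lambda_1^\top+\Sigma_{\delta\delta},\quad \Sigma^{12}=\Lambda_1\Sigma_{\xi\xi}\Gamma^\top\Psi^{-1\top}\Lambda_2^\top,$$ $$\Sigma^{22}=\Lambda_2\Psi^{-1}(\Gamma\Sigma_{\xi\xi}\Gamma^\top+\Sigma_{\zeta\zeta})\Psi^{-1\top}\Lambda_2^\top+\Sigma_{\varepsilon\varepsilon}.$$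 $\Sigma$ is assumed positive definite. $\mathbf{P}_{\Sigma}$ denotes the law of $X$ under the model with this $\Sigma$. Parametrization. Constraints are imposed on $\Lambda_1,\Lambda_2,\Gamma,\Psi,\Sigma_{\xi\xi},\Sigma_{\delta\delta},\Sigma_{\varepsilon\varepsilon},\Sigma_{\zeta\zeta}$ (e.g. some entries are set to $0$ or $1$); $\theta\in\Theta\subset\mathbb{R}^q$ is the vector of their unknown non-duplicated elements, and the matrices are written $\Lambda_1^\theta,\Lambda_2^\theta,\Gamma^\theta,\Psi^\theta,\Sigma_{\xi\xi}^\theta,\Sigma_{\delta\delta}^\theta,\Sigma_{\varepsilon\varepsilon}^\theta,\Sigma_{\zeta\zeta}^\theta$. $\Theta$ is convex and compact. $\Sigma(\theta)$ is the (positive definite) matrix $$\Sigma(\theta)=\begin{pmatrix}\Sigma(\theta)^{11}&\Sigma(\theta)^{12}\\ \Sigma(\theta)^{12\top}&\Sigma(\theta)^{22}\end{pmatrix},\quad \Sigma(\theta)^{11}=\Lambda_1^\theta\Sigma_{\xi\xi}^\theta\Lambda_1^{\theta\top}+\Sigma_{\delta\delta}^\theta,\quad \Sigma(\theta)^{12}=\Lambda_1^\theta\Sigma_{\xi\xi}^\theta\Gamma^{\theta\top}(\Psi^\theta)^{-1\top}\Lambda_2^{\theta\top},$$ $$\Sigma(\theta)^{22}=\Lambda_2^\theta(\Psi^\theta)^{-1}(\Gamma^\theta\Sigma_{\xi\xi}^\theta\Gamma^{\theta\top}+\Sigma_{\zeta\zeta}^\theta)(\Psi^\theta)^{-1\top}\Lambda_2^{\theta\top}+\Sigma_{\varepsilon\varepsilon}^\theta;$$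 it is twice continuously differentiable in $\theta$. The test is $H_0:\Sigma=\Sigma(\theta)$ against $H_1:\Sigma\ne\Sigma(\theta)$; under $H_0$ the true value of $\Sigma$ is $\Sigma(\theta_0)$ with $\theta_0\in\operatorname{Int}(\Theta)$, and $\mathbf{P}_{\theta_0}=\mathbf{P}_{\Sigma(\theta_0)}$. Observations. $X_{t_i^n}$, $i=0,\dots,n$, with $t_i^n=ih_n$ and $T=nh_n$ fixed. $\Delta_i^nX=X_{t_i^n}-X_{t_{i-1}^n}$. The constants $D>0$ and $\rho\in[1/3,1/2)$ are fixed. Estimators and test statistic. $N_n=\sum_{i=1}^n\mathbf{1}_{\{|\Delta_i^nX|\le Dh_n^\rho\}}$; $\tilde N_n=N_n$ if $N_n\ne0$ and $\tilde N_n=n$ if $N_n=0$; $$\hat\Sigma_n=\frac{1}{\tilde N_nh_n}\sum_{i=1}^n(\Delta_i^nX)(\Delta_i^nX)^\top\mathbf{1}_{\{|\Delta_i^nX|\le Dh_n^\rho\}},$$ $$\mathbf{H}_n(\theta)=-\frac12\sum_{i=1}^n\log\det\Sigma(\theta)\,\mathbf{1}_{\{|\Delta_i^nX|\le Dh_n^\rho\}}-\frac{1}{2h_n}\sum_{i=1}^n(\Delta_i^nX)^\top\Sigma(\theta)^{-1}(\Delta_i^nX)\,\mathbf{1}_{\{|\Delta_i^nX|\le Dh_n^\rho\}},$$ and $\hat\theta_n\in\Theta$ satisfies $\mathbf{H}_n(\hat\theta_n)=\sup_{\theta\in\Theta}\mathbf{H}_n(\theta)$. With $J_n=\{\hat\Sigma_n\text{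 is positive definite}\}$, let $\tilde\Sigma_n=\hat\Sigma_n$ on $J_n$ and $\tilde\Sigma_n=\mathbb{I}_p$ on $J_n^c$. The quasi-likelihood ratio statistic is $$\mathbf{T}_n=N_n\log\det\Sigma(\hat\theta_n)-N_n\log\det\tilde\Sigma_n+N_n\operatorname{tr}\{\Sigma(\hat\theta_n)^{-1}\tilde\Sigma_n\}-N_np.$$ Notation. $\operatorname{vech}$ is half-vectorization; $\Delta_0=\frac{\partial}{\partial\theta^\top}\operatorname{vech}\Sigma(\theta)\big|_{\theta=\theta_0}$. $\chi^2_r$ is a chi-squared random variable with $r$ degrees of freedom. $|\cdot|$ is the Euclidean (Frobenius) norm. *)

(* Defs.v *)
From HB Require Import structures.
From mathcomp Require Import all_boot all_order all_algebra.
From mathcomp Require Import all_classical all_reals all_analysis.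
From mathcomp Require Import measurable_realfun.
Set Implicit Arguments.
Unset Strict Implicit.
Unset Printing Implicit Defensive.
Import Order.TTheory GRing.Theory Num.Theory.
Import numFieldNormedType.Exports.
Local Open Scope classical_set_scope.
Local Open Scope ring_scope.

(* The library has no sigma-algebra on 'M[R]_(m, n); we equip it with the one
   generated by the entries, i.e. the Borel sigma-algebra of R^(m * n). *)
Fact matrix_display : measure_display.
Proof. exact: default_measure_display. Qed.

Section matrix_measurable.
Context (R : realType) (m n : nat).

Definition matrix_cylinders : set (set 'M[R]_(m, n)) :=
  [set A | exists i j (B : set R),
     measurable B /\ A = (fun M : 'M[R]_(m, n) => M i j) @^-1` B].

Let mx0 : <<s matrix_cylinders >> set0.
Proof. exact: sigma_algebra0. Qed.

Let mxC A : <<s matrix_cylinders >> A -> <<s matrix_cylinders >> (~` A).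
Proof. exact: sigma_algebraC. Qed.

Let mxU (F : (set 'M[R]_(m, n))^nat) :
  (forall i, <<s matrix_cylinders >> (F i)) ->
  <<s matrix_cylinders >> (\bigcup_i F i).
Proof. exact: sigma_algebra_bigcup. Qed.

HB.instance Definition _ := @isMeasurable.Build matrix_display
  'M[R]_(m, n) <<s matrix_cylinders >> mx0 mxC mxU.

Lemma measurable_entry i j :
  measurable_fun setT (fun M : 'M[R]_(m, n) => M i j).
Proof.
move=> _ B mB; rewrite setTI; apply: sub_sigma_algebra.
by exists i, j, B.
Qed.

Lemma measurable_fun_matrix d (T : measurableType d) (f : T -> 'M[R]_(m, n)) :
  (forall i j, measurable_fun setT (fun x => f x i j)) -> measurable_fun setT f.
Proof.
move=> mf; apply: (measurability matrix_cylinders) => //.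
by move=> _ [_ [i [j [B [mB ->]]]] <-]; exact: mf.
Qed.

End matrix_measurable.

Section lebesgue_vec.
Context (R : realType).

Definition vcons d (u : R * 'cV[R]_d) : 'cV[R]_d.+1 :=
  \col_i oapp (fun k => u.2 k 0) u.1 (unlift ord0 i).

Definition vuncons d (v : 'cV[R]_d.+1) : R * 'cV[R]_d :=
  (v ord0 0, \col_k v (lift ord0 k) 0).

Lemma vconsK d : cancel (@vcons d) (@vuncons d).
Proof.
move=> [x v]; congr pair; first by rewrite mxE unlift_none.
by apply/colP => k; rewrite !mxE liftK.
Qed.

Lemma measurable_vcons d : measurable_fun setT (@vcons d).
Proof.
apply: measurable_fun_matrix => i j; case: (unliftP ord0 i) => [k|] ->.
  under eq_fun do rewrite mxE liftK.
  exact: (measurableT_comp (measurable_entry k 0) measurable_snd).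
by under eq_fun do rewrite mxE unlift_none; exact: measurable_fst.
Qed.

Lemma measurable_vuncons d : measurable_fun setT (@vuncons d).
Proof.
apply: measurable_fun_pair; first exact: measurable_entry.
apply: measurable_fun_matrix => i j; under eq_fun do rewrite mxE.
exact: measurable_entry.
Qed.

HB.instance Definition _ d :=
  isMeasurableFun.Build _ _ _ _ (@vcons d) (@measurable_vcons d).

Section lebesgue_vec_step.
Context d (mu : {sigma_finite_measure set 'cV[R]_d -> \bar R}).

Definition lebesgue_vec_step :=
  pushforward (@lebesgue_measure R \x mu)%E (@vcons d).

Let step0 : lebesgue_vec_step set0 = 0%E.
Proof. by rewrite /lebesgue_vec_step /pushforward preimage_set0 measure0. Qed.

Let step_ge0 A : (0 <= lebesgue_vec_step A)%E.
Proof. by rewrite /lebesgue_vec_step /pushforward measure_ge0. Qed.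

Let step_sigma_additive : semi_sigma_additive lebesgue_vec_step.
Proof.
move=> F mF tF mUF; rewrite /lebesgue_vec_step /pushforward preimage_bigcup.
apply: measure_semi_sigma_additive.
- by move=> n; rewrite -[X in measurable X]setTI; exact: measurable_vcons.
- apply/trivIsetP => /= i j _ _ ij; rewrite -preimage_setI.
  by move/trivIsetP : tF => /(_ _ _ _ _ ij) ->//; rewrite preimage_set0.
- by rewrite -preimage_bigcup -[X in measurable X]setTI; exact: measurable_vcons.
Qed.

HB.instance Definition _ := isMeasure.Build _ _ _
  lebesgue_vec_step step0 step_ge0 step_sigma_additive.

Let step_sigma_finite : sigma_finite setT lebesgue_vec_step.
Proof.
have /sigma_finiteP[G [UG ndG mG]] := sigma_finiteT mu.
have /sigma_finiteP[F [UF ndF mF]] := sigma_finiteT (@lebesgue_measure R).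
exists (fun k => @vuncons d @^-1` (F k `*` G k)).
  rewrite -preimage_bigcup (_ : \bigcup_k _ = setT) ?preimage_setT //.
  rewrite -subTset => -[x v] _.
  have [k _ Fx] : (\bigcup_k F k) x by rewrite -UF.
  have [l _ Gv] : (\bigcup_k G k) v by rewrite -UG.
  exists (maxn k l) => //; split.
  - exact: (subsetPset _ _ (ndF _ _ (leq_maxl k l))).
  - exact: (subsetPset _ _ (ndG _ _ (leq_maxr k l))).
move=> k; have [mFk Fk] := mF k; have [mGk Gk] := mG k; split.
  rewrite -[X in measurable X]setTI; apply: measurable_vuncons => //.
  exact: measurableX.
rewrite /lebesgue_vec_step /pushforward -comp_preimage.
rewrite (_ : _ \o _ = idfun) ?preimage_id; last by apply/funext => u; exact: vconsK.
by rewrite product_measure1E// lte_mul_pinfty// ge0_fin_numE.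
Qed.

HB.instance Definition _ :=
  Measure_isSigmaFinite.Build _ _ _ lebesgue_vec_step step_sigma_finite.

End lebesgue_vec_step.

(* Lebesgue measure on R^d, as the iterated product of the one on R; R^0 is a
   point of mass 1. *)
Fixpoint lebesgue_vec d : {sigma_finite_measure set 'cV[R]_d -> \bar R} :=
  match d with
  | 0 => dirac (0 : 'cV[R]_0)
  | d'.+1 => lebesgue_vec_step (lebesgue_vec d')
  end.

End lebesgue_vec.

Section chi2.
Context (R : realType).

Local Notation RB := (measurableTypeR R).

Definition add_sqr (u : RB * RB) : RB := u.1 + u.2 ^+ 2.

Lemma measurable_add_sqr : measurable_fun setT add_sqr.
Proof.
apply: measurable_funD => /=; first exact: measurable_fst.
by apply: measurable_funX => /=; exact: measurable_snd.
Qed.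

HB.instance Definition _ :=
  isMeasurableFun.Build _ _ _ _ add_sqr measurable_add_sqr.

(* Law of the sum of squares of r independent standard normal variables; chi2 0
   is the point mass at 0. *)
Fixpoint chi2 (r : nat) : probability RB R :=
  match r with
  | 0 => dirac (0 : RB)
  | r'.+1 => distribution (chi2 r' \x normal_prob 0 1)%E add_sqr
  end.

End chi2.

Section linear_algebra.
Context (R : realType).

(* The library norm `|A| on matrices is the maximum norm. *)
Definition enorm m n (A : 'M[R]_(m, n)) : R :=
  Num.sqrt (\sum_i \sum_j A i j ^+ 2).

Definition posdef n (A : 'M[R]_n) : Prop :=
  A^T = A /\ forall x : 'cV[R]_n, x != 0 -> 0 < (x^T *m A *m x) 0 0.

(* Entries on and below the diagonal, column by column. *)
Definition vech_seq n (A : 'M[R]_n) : seq R :=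
  [seq A i j | j <- enum 'I_n, i <- [seq i : 'I_n <- enum 'I_n | (j <= i)%N]].

Lemma size_vech_seq n (A : 'M[R]_n) : size (vech_seq A) = ((n * n.+1)./2)%N.
Proof.
have szj (j : 'I_n) : size [seq i : 'I_n <- enum 'I_n | (j <= i)%N] = (n - j)%N.
  rewrite size_filter -(count_map val (leq j)) val_enum_ord.
  have -> : iota 0 n = iota 0 (j + (n - j)) by rewrite subnKC // ltnW.
  rewrite iotaD count_cat add0n.
  rewrite (eq_in_count (a2 := pred0)) ?count_pred0; last first.
    by move=> i; rewrite mem_iota /= => ij; apply/negbTE; rewrite -ltnNge.
  rewrite (eq_in_count (a2 := predT)) ?count_predT ?size_iota //.
  by move=> i; rewrite mem_iota => /andP[->].
rewrite size_allpairs_dep (eq_map szj) sumnE big_map big_enum /=.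
rewrite (reindex_inj rev_ord_inj) /=.
rewrite (eq_bigr (fun i : 'I_n => i.+1)) => [|i _]; last by rewrite subKn.
have := bin2_sum n.+1.
by rewrite big_mkord big_ord_recl add0n bin2 mulnC => <-; exact: eq_bigr.
Qed.

Definition vech n (A : 'M[R]_n) : 'cV[R]_((n * n.+1)./2) :=
  \col_k (vech_seq A)`_k.

Definition matrix_entries m n (A : 'M[R]_(m, n)) : seq R :=
  [seq A i j | i <- enum 'I_m, j <- enum 'I_n].

End linear_algebra.

Section smoothness.
Context (R : realType) (d : nat).

Definition pderivs (js : seq 'I_d) (f : 'cV[R]_d -> R) : 'cV[R]_d -> R :=
  foldr (fun j (h : 'cV[R]_d -> R) x => 'D_(delta_mx j 0) h x) f js.

(* U is meant to be open. *)
Definition class_C (k : nat) (U : set 'cV[R]_d) (f : 'cV[R]_d -> R) : Prop :=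
  forall js, (size js <= k)%N -> forall x, U x ->
    {for x, continuous (pderivs js f)} /\
    ((size js < k)%N -> forall j, derivable (pderivs js f) x (delta_mx j 0)).

Definition poly_growth (A : set 'cV[R]_d) (f : 'cV[R]_d -> R) : Prop :=
  exists (C : R) (m : nat), forall x, A x -> `|f x| <= C * (1 + enorm x) ^+ m.

End smoothness.

(* The Jacobian matrix of th |-> vech (Sg th). *)
Definition vech_jacobian (R : realType) p q (Sg : 'cV[R]_q -> 'M[R]_p)
    (th : 'cV[R]_q) : 'M[R]_((p * p.+1)./2, q) :=
  \matrix_(k, j) 'D_(delta_mx j 0) (fun th' => vech (Sg th') k 0) th.

Section stochastic_basis.
Context (R : realType) (dO : measure_display) (Om : measurableType dO).
Context (P : probability Om R).

Definition mutually_independent (G : seq (set (set Om))) : Prop :=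
  forall A : 'I_(size G) -> set Om, (forall i : 'I_(size G), nth set0 G i (A i)) ->
    P [set w | forall i, A i w] = (\prod_(i < size G) P (A i))%E.

Definition filtration (F : R -> set (set Om)) : Prop :=
  [/\ forall t : R, 0 <= t -> sigma_algebra setT (F t),
      forall t : R, 0 <= t -> F t `<=` measurable &
      forall s t : R, 0 <= s -> s <= t -> F s `<=` F t].

Definition adapted (F : R -> set (set Om)) n (X : R -> Om -> 'cV[R]_n) : Prop :=
  forall t : R, 0 <= t -> forall B, measurable B -> F t (X t @^-1` B).

Definition cadlag n (x : R -> 'cV[R]_n) : Prop :=
  (forall t : R, 0 <= t -> x s @[s --> t^'+] --> x t) /\
  (forall t : R, 0 < t -> cvg (x s @[s --> t^'-])).

Definition left_limit n (x : R -> 'cV[R]_n) (t : R) : 'cV[R]_n :=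
  lim (x s @[s --> t^'-]).

Definition wiener (F : R -> set (set Om)) r (W : R -> Om -> 'cV[R]_r) : Prop :=
  [/\ adapted F W,
      {ae P, forall w, W 0 w = 0 /\
        {within [set t | 0 <= t], continuous (fun t => W t w)}},
      forall (s t : R) A B, 0 <= s -> s <= t -> F s A -> measurable B ->
        let dW := fun w => W t w - W s w in
        P (A `&` dW @^-1` B) = (P A * P (dW @^-1` B))%E &
      forall (s t : R) (B : 'I_r -> set R), 0 <= s -> s < t ->
        (forall j, measurable (B j)) ->
        P [set w | forall j, B j ((W t w - W s w) j 0)] =
        (\prod_(j < r) normal_prob 0 (Num.sqrt (t - s)) (B j))%E].

Definition punctured d : set 'cV[R]_d := [set z | z != 0].

Definition jump_space d : set (R * 'cV[R]_d) :=
  [set u | 0 <= u.1 /\ punctured u.2].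

(* Poisson random measure relative to F with intensity m on jump_space d; the
   mass of mu outside jump_space d is irrelevant.  The second argument of
   poisson_prob is a dummy. *)
Definition poisson_random_measure (F : R -> set (set Om)) d
    (m : set (R * 'cV[R]_d) -> \bar R)
    (mu : Om -> {measure set (R * 'cV[R]_d) -> \bar R}) : Prop :=
  [/\ forall w A, measurable A -> A `<=` @jump_space d ->
        mu w A = +oo%E \/ exists k : nat, mu w A = k%:R%:E,
      forall (t : R) A B, 0 <= t -> measurable A ->
        A `<=` @jump_space d `&` [set u | u.1 <= t] -> measurable B ->
        F t ((fun w => mu w A) @^-1` B),
      forall A, measurable A -> A `<=` @jump_space d ->
        ((m A < +oo)%E -> forall k : nat,
          P [set w | mu w A = k%:R%:E] = poisson_prob (fine (m A)) 0 [set k]) /\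
        (m A = +oo%E -> P [set w | mu w A = +oo%E] = 1%E) &
      forall n (A : 'I_n -> set (R * 'cV[R]_d)) (B : 'I_n -> set \bar R),
        (forall i, measurable (A i) /\ A i `<=` @jump_space d) ->
        trivIset setT A -> (forall i, measurable (B i)) ->
        P [set w | forall i, B i (mu w (A i))] =
        (\prod_(i < n) P ((fun w => mu w (A i)) @^-1` B i))%E].

Definition wiener_future (t : R) r (W : R -> Om -> 'cV[R]_r) : set (set Om) :=
  <<s [set A | exists u B, [/\ t <= u, measurable B &
    A = (fun w => W u w - W t w) @^-1` B] ] >>.

Definition jump_future (t : R) d
    (mu : Om -> {measure set (R * 'cV[R]_d) -> \bar R}) : set (set Om) :=
  <<s [set A | exists C B, [/\ measurable C /\ C `<=` @jump_space d,
    measurable B &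
    A = (fun w => mu w (C `&` [set u | t < u.1])) @^-1` B] ] >>.

Definition cvg_in_law (Z : nat -> Om -> R)
    (nu : probability (measurableTypeR R) R) : Prop :=
  (forall n, measurable_fun setT (Z n)) /\
  forall f : R -> R, continuous f -> (exists M : R, forall x, `|f x| <= M) ->
    \int[P]_w f (Z n w) @[n --> \oo] --> \int[nu]_x f x.

End stochastic_basis.

Section latent_processes.
Context (R : realType) (dO : measure_display) (Om : measurableType dO).

(* Data of one equation
     dS_t = a(S_{t-}) dt + S dW_t + \int_E c(S_{t-}, z) mu(dt, dz),  S_0 = x0,
   where mu has compensator  rate * dens(z) dz dt. *)
Record latent (d : nat) := Latent {
  process : R -> Om -> 'cV[R]_d;
  start : 'cV[R]_d;
  drift : 'cV[R]_d -> 'cV[R]_d;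
  noise_dim : nat;
  diffusion : 'M[R]_(d, noise_dim);
  noise : R -> Om -> 'cV[R]_noise_dim;
  jump_coef : 'cV[R]_d -> 'cV[R]_d -> 'cV[R]_d;
  jump_rate : R;
  jump_dens : 'cV[R]_d -> R;
  jump_meas : Om -> {measure set (R * 'cV[R]_d) -> \bar R} }.

Definition levy_dens d (L : latent d) (z : 'cV[R]_d) : R :=
  jump_rate L * jump_dens L z.

Definition jump_intensity d (L : latent d) (A : set (R * 'cV[R]_d)) : \bar R :=
  (\int[@lebesgue_measure R \x lebesgue_vec R d]_(u in A)
     (levy_dens L u.2)%:E)%E.

Definition latent_cov d (L : latent d) : 'M[R]_d :=
  diffusion L *m (diffusion L)^T.

(* The coefficient of dW is constant and mu has finite activity, so that the
   stochastic integrals are pathwise. *)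
Definition latent_sde (P : probability Om R) d (L : latent d) : Prop :=
  {ae P, forall w, forall t : R, 0 <= t ->
    let x := fun s => left_limit (fun r => process L r w) s in
    process L t w = start L
      + \col_j (\int[@lebesgue_measure R]_(s in `]0, t]) (drift L (x s) j 0))
      + diffusion L *m noise L t w
      + \col_j (\int[jump_meas L w]_(u in `]0, t] `*` @punctured R d)
                  (jump_coef L (x u.1) u.2 j 0))}.

Definition latent_model (P : probability Om R) (F : R -> set (set Om)) d
    (L : latent d) : Prop :=
  [/\ adapted F (process L) /\ (forall w, cadlag (fun t => process L t w)),
      measurable_fun setT (drift L) /\
        measurable_fun (setT `*` @punctured R d)
          (fun u : 'cV[R]_d * 'cV[R]_d => jump_coef L u.1 u.2),
      [/\ 0 < jump_rate L, measurable_fun (@punctured R d) (jump_dens L),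
          forall z, punctured z -> 0 <= jump_dens L z &
          (\int[lebesgue_vec R d]_(z in @punctured R d)
             (jump_dens L z)%:E)%E = 1%E],
      wiener P F (noise L) /\
        poisson_random_measure P F (jump_intensity L) (jump_meas L) &
      latent_sde P L].

Definition lipschitz_growth d (L : latent d) : Prop :=
  exists (l : R) (g : 'cV[R]_d -> R),
  [/\ 0 < l, forall z, punctured z -> 0 < g z, poly_growth (@punctured R d) g,
      forall x y, enorm (drift L x - drift L y) <= l * enorm (x - y) &
      forall z, punctured z ->
        (forall x y, enorm (jump_coef L x z - jump_coef L y z)
                     <= g z * enorm (x - y)) /\
        (forall x, enorm (jump_coef L x z) <= g z * (1 + enorm x))].

Definition smooth_drift d (L : latent d) : Prop :=
  forall i, let ai := fun x : 'cV[R]_d => drift L x i 0 in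
    class_C 4 setT ai /\
    forall js, (size js <= 4)%N -> poly_growth setT (pderivs js ai).

Definition levy_dens_bound d (L : latent d) : Prop :=
  (exists r K : R, [/\ 0 < r, 0 < K &
    forall z, punctured z ->
      levy_dens L z * (enorm z <= r)%R%:R <= K * enorm z ^ (1 - d%:Z)]) /\
  forall l : nat, (1 <= l)%N ->
    (\int[lebesgue_vec R d]_(z in @punctured R d)
       (enorm z ^+ l * levy_dens L z)%:E < +oo)%E.

Definition jumps_nondegenerate d (L : latent d) : Prop :=
  exists2 c0 : R, 0 < c0 &
    \forall z \near (0 : 'cV[R]_d)^',
      c0 * enorm z <= inf [set enorm (jump_coef L x z) | x in setT].

Definition latent_assumptions d (L : latent d) : Prop :=
  [/\ lipschitz_growth L, smooth_drift L, levy_dens_bound L &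
      jumps_nondegenerate L].

End latent_processes.

Section sem.
Context (R : realType) (p1 p2 k1 k2 : nat).

Record sem_matrices := Sem {
  Lam1 : 'M[R]_(p1, k1);
  Lam2 : 'M[R]_(p2, k2);
  Gam : 'M[R]_(k2, k1);
  Psi : 'M[R]_k2;
  Sxx : 'M[R]_k1;
  Sdd : 'M[R]_p1;
  See : 'M[R]_p2;
  Szz : 'M[R]_k2 }.

Definition sem_cov (s : sem_matrices) : 'M[R]_(p1 + p2) :=
  let S11 := Lam1 s *m Sxx s *m (Lam1 s)^T + Sdd s in
  let S12 := Lam1 s *m Sxx s *m (Gam s)^T *m (invmx (Psi s))^T *m (Lam2 s)^T in
  let S22 := Lam2 s *m invmx (Psi s) *m
               (Gam s *m Sxx s *m (Gam s)^T + Szz s) *m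
               (invmx (Psi s))^T *m (Lam2 s)^T + See s in
  block_mx S11 S12 S12^T S22.

Definition sem_entries (s : sem_matrices) : seq R :=
  matrix_entries (Lam1 s) ++ matrix_entries (Lam2 s) ++
  matrix_entries (Gam s) ++ matrix_entries (Psi s) ++
  matrix_entries (Sxx s) ++ matrix_entries (Sdd s) ++
  matrix_entries (See s) ++ matrix_entries (Szz s).

(* Each coordinate of theta is an entry of one of the matrices, at a fixed
   position; the constraints determine the other entries as functions of
   theta. *)
Definition sem_parametrization q (Theta : set 'cV[R]_q)
    (par : 'cV[R]_q -> sem_matrices) : Prop :=
  [/\ forall j : 'I_q, exists k : nat, forall th, Theta th ->
        (k < size (sem_entries (par th)))%N /\
        (sem_entries (par th))`_k = th j 0,
      forall th, Theta th ->
        [/\ (Sxx (par th))^T = Sxx (par th), (Sdd (par th))^T = Sdd (par th),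
            (See (par th))^T = See (par th) & (Szz (par th))^T = Szz (par th)],
      forall th, Theta th -> Psi (par th) \in unitmx,
      forall th, Theta th -> posdef (sem_cov (par th)) &
      exists U : set 'cV[R]_q, [/\ open U, Theta `<=` U &
        forall i j, class_C 2 U (fun th => sem_cov (par th) i j)] ].

End sem.

Section test_statistic.
Context (R : realType) (Om : Type) (p q : nat).
Variables (X : R -> Om -> 'cV[R]_p) (Sg : 'cV[R]_q -> 'M[R]_p).
Variables (T D rho : R) (n : nat).

Definition mesh : R := T / n%:R.

Definition incr (i : nat) (w : Om) : 'cV[R]_p :=
  X (i%:R * mesh) w - X (i.-1%:R * mesh) w.

Definition small_incr (i : nat) (w : Om) : bool :=
  enorm (incr i w) <= D * mesh `^ rho.

Definition n_small (w : Om) : nat := (\sum_(1 <= i < n.+1 | small_incr i w) 1)%N.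

Definition Sigma_hat (w : Om) : 'M[R]_p :=
  ((if n_small w == 0%N then n else n_small w)%:R * mesh)^-1 *:
  \sum_(1 <= i < n.+1 | small_incr i w) (incr i w *m (incr i w)^T).

Definition quasi_loglik (w : Om) (th : 'cV[R]_q) : R :=
  - 2^-1 * (\sum_(1 <= i < n.+1 | small_incr i w) ln (\det (Sg th)))
  - (2 * mesh)^-1 *
    (\sum_(1 <= i < n.+1 | small_incr i w)
       ((incr i w)^T *m invmx (Sg th) *m incr i w) 0 0).

Definition Sigma_tilde (w : Om) : 'M[R]_p :=
  if `[< posdef (Sigma_hat w) >] then Sigma_hat w else 1%:M.

Definition qlr_statistic (th_hat : Om -> 'cV[R]_q) (w : Om) : R :=
  let N := (n_small w)%:R in
  let S := Sg (th_hat w) in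
  N * ln (\det S) - N * ln (\det (Sigma_tilde w))
  + N * \tr (invmx S *m Sigma_tilde w) - N * p%:R.

End test_statistic.

(* Main.v *)
(* Almost surely the latent processes jump finitely often on [0, T], so that, apart from
   boundedly many indices i, the increment of X over the i-th interval is a Gaussian
   increment plus a drift increment. The discarded or contaminated intervals contribute
   O(h^(2 rho)) = o(sqrt h) because rho > 1/4, and the drift-noise cross terms are o(sqrt h)
   by summation by parts against a step-function approximation of the drift. Hence, with
   Sigma(theta_0) = L L^T, sqrt n (Sigma_hat - L Q L^T) tends to 0 in probability, where Q is
   the empirical second moment of n independent standard Gaussian vectors.

   Maximising H_n amounts to minimising KL(Sigma_hat, Sigma(theta)) over theta, and T_n is N_n
   times the minimum. At the identity KL is half the squared Frobenius distance up to higher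
   order, so the minimum is the squared distance of a rescaled vech(Q - 1) to the column space
   of the whitened Jacobian, i.e. |W svech(Q - 1)|^2 where the rows of W are an orthonormal
   basis of the complement of that space. The Laplace transform of n |W svech(Q - 1)|^2
   tends to that of the chi-squared law by a Lindeberg replacement along the heat flow started
   at exp(-k |x|^2); convergence of Laplace transforms at the integers gives convergence in law
   by Weierstrass approximation in the variable exp(-x). *)
Require Import Defs.
From HB Require Import structures.
From mathcomp Require Import all_boot all_order all_algebra.
From mathcomp Require Import all_classical all_reals all_analysis.
From mathcomp Require Import measurable_realfun ring lra.
Set Implicit Arguments.
Unset Strict Implicit.
Unset Printing Implicit Defensive.
Import Order.TTheory GRing.Theory Num.Theory.
Import numFieldNormedType.Exports.
Local Open Scope classical_set_scope.
Local Open Scope ring_scope.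

(** * Convergence in law from Laplace transforms *)

(** Only the Gaussian noise is treated by probability. The drift of a latent path depends on that
    same noise, and its regularity constants depend on the path; so drift, jumps and truncation are
    compared with the noise path by path, and a statement that holds eventually on almost every path
    is then turned into one of high probability. Conditioning on the past is replaced by identities
    [E[W f] = E[W] m] for all bounded past weights [W]; they follow from the product formula on
    boxes. The heat flow serves because a Gaussian bump stays a Gaussian bump: the solution and its
    derivatives are explicit, bounds are uniform in space, and the value at the origin after unit
    time is the chi-squared Laplace transform itself. Positivity, expansion, coercivity and
    measurability questions about matrices rest on inductions over the Schur complement, so that no
    spectral decomposition enters. The matrix estimates are made for the congruence that carries the
    true covariance to the identity; there the expansion of KL has constant coefficients. *)

Section bernstein.
Context (R : realType).
Implicit Types (x : R) (n : nat).

Definition bern n x (k : nat) : R := 'C(n, k)%:R * x ^+ k * (1 - x) ^+ (n - k).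

Lemma bern_ge0 n x k : 0 <= x <= 1 -> 0 <= bern n x k.
Proof.
move=> /andP[x0 x1]; rewrite /bern mulr_ge0// ?exprn_ge0 ?subr_ge0//.
by rewrite mulr_ge0// exprn_ge0.
Qed.

Lemma sum_bern n x : \sum_(k < n.+1) bern n x k = 1.
Proof.
rewrite -[RHS](expr1n _ n) -[X in X ^+ n](subrK x 1) exprDn.
apply: eq_bigr => i _; rewrite /bern -mulr_natl; ring.
Qed.

Lemma sum_bern1 n x : \sum_(k < n.+2) bern n.+1 x k * k%:R = n.+1%:R * x.
Proof.
rewrite big_ord_recl mulr0 add0r.
rewrite (eq_bigr (fun i : 'I_n.+1 => n.+1%:R * x * bern n x i)); last first.
  move=> i _; rewrite lift0 /bern subSS exprS.
  rewrite [LHS](_ : _ = (i.+1 * 'C(n.+1, i.+1))%:R * x * x ^+ i * (1 - x) ^+ (n - i)).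
    by rewrite -mul_bin_diag natrM; ring.
  by rewrite natrM; ring.
by rewrite -mulr_sumr sum_bern mulr1.
Qed.

Lemma sum_bern2 n x : \sum_(k < n.+2) bern n.+1 x k * k%:R ^+ 2
  = n.+1%:R * x + n.+1%:R * n%:R * x ^+ 2.
Proof.
rewrite big_ord_recl expr0n mulr0 add0r.
rewrite (eq_bigr (fun i : 'I_n.+1 => n.+1%:R * x * (bern n x i * i%:R + bern n x i))); last first.
  move=> i _; rewrite lift0 /bern subSS exprS.
  rewrite [LHS](_ : _ = (i.+1 * 'C(n.+1, i.+1))%:R * x * x ^+ i * (1 - x) ^+ (n - i) * i.+1%:R).
    by rewrite -mul_bin_diag natrM -[i.+1%:R]natr1; ring.
  by rewrite natrM; ring.
rewrite -mulr_sumr big_split /= sum_bern.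
case: n => [|n]; last by rewrite sum_bern1; ring.
by rewrite big_ord_recl big_ord0 /=; ring.
Qed.

(** The variance of the frequency of successes in [n.+1] binomial trials; it is the quadratic
    average that the Chebyshev argument of [weierstrass01] needs. *)
Lemma bern_variance n x :
  \sum_(k < n.+2) bern n.+1 x k * (k%:R / n.+1%:R - x) ^+ 2 = x * (1 - x) / n.+1%:R.
Proof.
have n0 : n.+1%:R != 0 :> R by rewrite pnatr_eq0.
rewrite (eq_bigr (fun k : 'I_n.+2 => n.+1%:R ^- 2 * (bern n.+1 x k * k%:R ^+ 2)
   - (2 * x / n.+1%:R) * (bern n.+1 x k * k%:R) + x ^+ 2 * bern n.+1 x k)); last first.
  by move=> i _; field.
rewrite big_split /= sumrB -!mulr_sumr sum_bern sum_bern1 sum_bern2 -natr1.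
by field; rewrite natr1.
Qed.


(** The pairs of [[a, b]] on which [g] varies by at least [e] form a compact set on which [|x - y|]
    has a positive minimum; that minimum is [d]. *)
Lemma heine_segment (g : R -> R) (a b e : R) : continuous g -> 0 < e ->
  exists2 d : R, 0 < d & forall x y, x \in `[a, b] -> y \in `[a, b] ->
    `|x - y| < d -> `|g x - g y| < e.
Proof.
move=> cg e0.
pose K := (`[a, b] `*` `[a, b]) `&` [set u : R * R | e <= `|g u.1 - g u.2|].
have cK : compact K.
  apply: compact_closedI; first by apply: compact_setX; exact: segment_compact.
  apply: (@closed_comp _ _ (fun u : R * R => `|g u.1 - g u.2|) [set x | e <= x]).
    move=> u _; apply: cvg_norm; apply: cvgB.
      by apply: continuous_comp; [exact: cvg_fst|exact: cg].
    by apply: continuous_comp; [exact: cvg_snd|exact: cg].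
  exact: closed_ge.
have [K0|/set0P K0] := eqVneq K set0.
  exists 1 => // x y xab yab _; rewrite ltNge; apply/negP => exy.
  by have : K (x, y) by []; rewrite K0.
have [|u uK um] := @compact_EVT_min _ R (fun u : R * R => `|u.1 - u.2|) K K0 cK.
  apply: continuous_subspaceT => u; apply: cvg_norm; apply: cvgB.
    exact: cvg_fst.
  exact: cvg_snd.
move: uK; rewrite inE => -[_ /= eu].
exists `|u.1 - u.2|.
  rewrite normr_gt0 subr_eq0; apply/eqP => u12.
  by move: eu; rewrite u12 subrr normr0 leNgt e0.
move=> x y xab yab xy; rewrite ltNge; apply/negP => exy.
by have := um (x, y); rewrite inE /= leNgt xy => /(_ (conj (conj xab yab) exy)).
Qed.

Lemma continuous_bounded_segment (g : R -> R) (a b : R) : continuous g ->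
  exists2 M : R, 0 < M & forall x, x \in `[a, b] -> `|g x| <= M.
Proof.
move=> cg.
have : compact (g @` `[a, b]).
  by apply: continuous_compact; [exact: continuous_subspaceT|exact: segment_compact].
move=> /compact_bounded[M [_ HM]].
exists (Num.max M 0 + 1); first by rewrite ltr_pwDr// le_max lexx orbT.
move=> x x01; apply: HM; first by rewrite ltr_pwDr// le_max lexx.
by exists x.
Qed.

(** Bernstein's proof. One bound [e / 2 + C * (y - x) ^+ 2] covers near points, by uniform
    continuity, and far ones, where [C * d ^+ 2 = 2 * M]; averaging it under the binomial weights
    leaves [C] times the variance. *)
Lemma weierstrass01 (g : R -> R) (e : R) : continuous g -> 0 < e ->
  exists p : {poly R}, forall x, 0 <= x <= 1 -> `|g x - p.[x]| <= e.
Proof.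
move=> cg e0.
have [M M0 gM] := continuous_bounded_segment 0 1 cg.
have [d d0 gd] := heine_segment 0 1 cg (divr_gt0 e0 (ltr0n R 2)).
pose C := 2 * M / d ^+ 2.
have C0 : 0 <= C by rewrite divr_ge0 ?mulr_ge0 ?sqr_ge0 ?ltW.
have gC x y : 0 <= x <= 1 -> 0 <= y <= 1 ->
    `|g x - g y| <= e / 2 + C * (y - x) ^+ 2.
  move=> x01 y01; have [xyd|dxy] := ltP `|x - y| d.
    rewrite (le_trans (ltW (gd _ _ _ _ xyd))) ?in_itv// lerDl.
    by rewrite mulr_ge0 ?sqr_ge0.
  apply: (@le_trans _ _ (C * (y - x) ^+ 2)); last first.
    by rewrite lerDr divr_ge0 ?ltW.
  apply: (@le_trans _ _ (2 * M)).
    rewrite (le_trans (ler_normB _ _))// mulr2n mulrDl mul1r.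
    by rewrite lerD// gM// in_itv.
  rewrite /C mulrAC ler_pdivlMr ?exprn_gt0// ler_wpM2l ?mulr_ge0 ?(ltW M0)//.
  rewrite -[leRHS]real_normK ?num_real// ler_pXn2r ?nnegrE ?normr_ge0 ?(ltW d0)//.
  by rewrite distrC.
have [n nC] : exists n : nat, C / e < n.+1%:R.
  exists (Num.truncn (C / e)); exact: truncnS_gt.
pose p : {poly R} := \sum_(k < n.+2) (g (k%:R / n.+1%:R) * 'C(n.+1, k)%:R)%:P
   * 'X^k * (1 - 'X) ^+ (n.+1 - k).
exists p => x x01.
have -> : p.[x] = \sum_(k < n.+2) bern n.+1 x k * g (k%:R / n.+1%:R).
  rewrite /p horner_sum; apply: eq_bigr => k _.
  by rewrite !hornerE /bern; ring.
rewrite -[g x]mul1r -[X in X * g x](sum_bern n.+1 x) mulr_suml -sumrB.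
rewrite (eq_bigr (fun k : 'I_n.+2 => bern n.+1 x k * (g x - g (k%:R / n.+1%:R)))); last first.
  by move=> k _; rewrite mulrBr.
apply: (le_trans (ler_norm_sum _ _ _)).
apply: (@le_trans _ _ (\sum_(k < n.+2) (e / 2 * bern n.+1 x k +
   C * (bern n.+1 x k * (k%:R / n.+1%:R - x) ^+ 2)))).
  apply: ler_sum => k _; rewrite normrM ger0_norm ?bern_ge0//.
  rewrite [leRHS](_ : _ = bern n.+1 x k * (e / 2 + C * (k%:R / n.+1%:R - x) ^+ 2)); last by ring.
  rewrite ler_wpM2l ?bern_ge0// gC//.
  by rewrite divr_ge0 ?ler0n//= ler_pdivrMr ?ltr0n// mul1r ler_nat -ltnS.
rewrite big_split /= -!mulr_sumr sum_bern bern_variance mulr1.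
rewrite [leRHS](splitr e) lerD2l.
have /andP[x0 x1] := x01.
have xx : x * (1 - x) <= 2^-1 by have := sqr_ge0 (x - 2^-1); nra.
rewrite mulrA ler_pdivrMr//.
apply: (@le_trans _ _ (C * 2^-1)); first exact: ler_wpM2l.
by move: nC; rewrite ltr_pdivrMr// => /ltW nC; lra.
Qed.

End bernstein.

(** * Real-valued integrals, bounded integrands and events of high probability *)

Section real_integral.
Context (R : realType) d (T : measurableType d) (P : {measure set T -> \bar R}).
Implicit Types f g : T -> R.

Lemma integrableDR f g : P.-integrable setT (EFin \o f) ->
  P.-integrable setT (EFin \o g) ->
  P.-integrable setT (EFin \o (fun x => f x + g x)).
Proof. by move=> intf intg; exact: (integrableD measurableT intf intg). Qed.

Lemma integrableBR f g : P.-integrable setT (EFin \o f) ->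
  P.-integrable setT (EFin \o g) ->
  P.-integrable setT (EFin \o (fun x => f x - g x)).
Proof. by move=> intf intg; exact: (integrableB measurableT intf intg). Qed.

Lemma integrableZR (c : R) f : P.-integrable setT (EFin \o f) ->
  P.-integrable setT (EFin \o (fun x => c * f x)).
Proof. by move=> intf; exact: (integrableZl measurableT c intf). Qed.

Lemma integrable_normR f : P.-integrable setT (EFin \o f) ->
  P.-integrable setT (EFin \o (fun x => `|f x|)).
Proof. by move=> intf; exact: (integrable_abse intf). Qed.

Lemma integrable0R : P.-integrable setT (EFin \o (fun=> 0 : R)).
Proof. exact: (@integrable0 _ _ _ P setT). Qed.

Lemma integrable_sumR (I : Type) (s : seq I) (Q : pred I) (F : I -> T -> R) :
  (forall i, Q i -> P.-integrable setT (EFin \o F i)) ->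
  P.-integrable setT (EFin \o (fun x => \sum_(i <- s | Q i) F i x)) /\
  \int[P]_x (\sum_(i <- s | Q i) F i x) = \sum_(i <- s | Q i) \int[P]_x F i x.
Proof.
move=> intF; elim: s => [|i s [IH1 IH2]].
  split; first by under [X in EFin \o X]funext do rewrite big_nil; exact: integrable0R.
  under eq_Rintegral do rewrite big_nil.
  by rewrite big_nil /Rintegral integral0.
case Qi : (Q i); last first.
  rewrite big_cons Qi -IH2.
  under [X in EFin \o X]funext do rewrite big_cons Qi.
  by under eq_Rintegral do rewrite big_cons Qi.
rewrite big_cons Qi -IH2 -RintegralD//; last exact: intF.
split.
  under [X in EFin \o X]funext do rewrite big_cons Qi.
  by apply: integrableDR => //; exact: intF.
by under eq_Rintegral do rewrite big_cons Qi.
Qed.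

Lemma le_integrableR f g : measurable_fun setT f ->
  (forall x, `|f x| <= g x) -> P.-integrable setT (EFin \o g) ->
  P.-integrable setT (EFin \o f).
Proof.
move=> mf fg intg; apply: (le_integrable _ _ _ intg) => //.
  exact/measurable_EFinP.
by move=> x _ /=; rewrite lee_fin (le_trans (fg x))// ler_norm.
Qed.

Lemma Rintegral_dist f g (h : T -> R) :
  P.-integrable setT (EFin \o f) -> P.-integrable setT (EFin \o g) ->
  P.-integrable setT (EFin \o h) ->
  (forall x, `|f x - g x| <= h x) ->
  `|\int[P]_x f x - \int[P]_x g x| <= \int[P]_x h x.
Proof.
move=> intf intg inth fgh; have intfg := integrableBR intf intg.
rewrite -RintegralB//; apply: (le_trans (le_normr_Rintegral _ _)) => //.
by apply: le_Rintegral => //; exact: integrable_normR.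
Qed.

End real_integral.

Lemma cvg_sum (R : realType) (T : Type) (F : set_system T) {FF : Filter F} (I : Type)
    (s : seq I) (f : I -> T -> R) (l : I -> R) :
  (forall i, f i x @[x --> F] --> l i) -> \sum_(i <- s) f i x @[x --> F] --> \sum_(i <- s) l i.
Proof.
move=> fl; elim: s => [|i s IH].
  by rewrite big_nil; under eq_fun do rewrite big_nil; exact: cvg_cst.
by rewrite big_cons; under eq_fun do rewrite big_cons; exact: cvgD.
Qed.

Lemma measurable_abs_ge (R : realType) d (T : measurableType d) (f : T -> R) (c : R) :
  measurable_fun setT f -> measurable [set w | c <= `|f w|].
Proof.
move=> mf.
have mg : measurable_fun setT (fun w => `|f w|) by exact: measurableT_comp.
rewrite (_ : [set w | _] = setT `&` (fun w => `|f w|) @^-1` `[c, +oo[%classic).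
  exact: mg.
by apply/seteqP; split => x /=; rewrite in_itv/= andbT// => -[].
Qed.

Section bounded_integral.
Context (R : realType) d (T : measurableType d) (P : probability T R).
Implicit Types f g : T -> R.

Lemma bounded_integrable f (M : R) : measurable_fun setT f ->
  (forall x, `|f x| <= M) -> P.-integrable setT (EFin \o f).
Proof.
move=> mf fM; apply: measurable_bounded_integrable => //.
  by rewrite (le_lt_trans (probability_le1 _ _))// ltry.
exists M; split; first exact: num_real.
by move=> x Mx t _ /=; rewrite (le_trans (fM t))// ltW.
Qed.

Lemma Rintegral_cst_prob (r : R) : \int[P]_x r = r.
Proof.
by rewrite Rintegral_cst//; have := probability_setT P => /= ->; rewrite mulr1.
Qed.

Lemma integrable_cst_prob (r : R) : P.-integrable setT (EFin \o (fun=> r)).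
Proof. exact: (@bounded_integrable _ `|r|). Qed.

Lemma Rintegral_onem f : P.-integrable setT (EFin \o f) ->
  1 - \int[P]_x f x = \int[P]_x (1 - f x).
Proof.
move=> intf; rewrite RintegralB ?Rintegral_cst_prob//; exact: integrable_cst_prob.
Qed.

Lemma Rintegral_addc (c : R) f : P.-integrable setT (EFin \o f) ->
  c + \int[P]_x f x = \int[P]_x (c + f x).
Proof.
move=> intf; rewrite RintegralD ?Rintegral_cst_prob//; exact: integrable_cst_prob.
Qed.

Lemma fine_prob_Rintegral (A : set T) : measurable A ->
  fine (P A) = \int[P]_x \1_A x.
Proof. by move=> mA; rewrite /Rintegral integral_indic// setIT. Qed.

End bounded_integral.

Section whp.
Context (R : realType) d (T : measurableType d) (P : probability T R).

(* [Q n] holds outside a measurable set of vanishing probability; [Q n] itself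
   need not be measurable. *)
Definition whp (Q : nat -> set T) : Prop :=
  forall e : R, 0 < e -> \forall n \near \oo,
    exists A, [/\ measurable A, (P A <= e%:E)%E & ~` A `<=` Q n].

Lemma whpI (Q Q' : nat -> set T) : whp Q -> whp Q' ->
  whp (fun n => Q n `&` Q' n).
Proof.
move=> hQ hQ' e e0; have e20 : 0 < e / 2 by rewrite divr_gt0.
near=> n.
have [] : exists A, [/\ measurable A, (P A <= (e / 2)%:E)%E & ~` A `<=` Q n].
  by near: n; exact: hQ.
move=> A [mA PA AQ].
have [] : exists A, [/\ measurable A, (P A <= (e / 2)%:E)%E & ~` A `<=` Q' n].
  by near: n; exact: hQ'.
move=> B [mB PB BQ]; exists (A `|` B); split.
- exact: measurableU.
- rewrite [e]splitr EFinD (le_trans (measureU2 _ _ _))//; exact: leeD.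
- by move=> x /not_orP[nA nB]; split; [exact: AQ|exact: BQ].
Unshelve. all: by end_near. Qed.

End whp.

(** * From Laplace transforms at the integers to convergence in law *)

Section laplace.
Context (R : realType) d (T : measurableType d) (P : probability T R).
Variables (Z : nat -> T -> R) (nu : probability (measurableTypeR R) R).
Hypothesis mZ : forall n, measurable_fun setT (Z n).
Hypothesis ZL : forall k : nat,
  \int[P]_w expR (- (k%:R * `|Z n w|)) @[n --> \oo]
    --> \int[nu]_x expR (- (k%:R * `|x|)).

(** A continuous cut-off, equal to 1 up to [M] and to 0 from [M + 1] on: a test function for
    tightness and a truncation of bounded test functions. *)
Definition ramp (M x : R) : R := Num.min 1 (Num.max 0 (M + 1 - `|x|)).

Lemma ramp01 M x : 0 <= ramp M x <= 1.
Proof. by rewrite /ramp le_min ler01 le_max lexx ge_min lexx. Qed.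

Lemma ramp1 M x : `|x| <= M -> ramp M x = 1.
Proof.
by move=> xM; rewrite /ramp; apply/min_idPl; rewrite le_max; apply/orP; right; lra.
Qed.

Lemma ramp0 M x : M + 1 <= `|x| -> ramp M x = 0.
Proof.
move=> xM; rewrite /ramp (max_idPl _); last by rewrite subr_le0.
by apply/min_idPr; exact: ler01.
Qed.

Lemma continuous_ramp M : continuous (ramp M).
Proof.
move=> x; rewrite /ramp.
apply: (@continuous_min _ _ (fun=> 1) (fun x => Num.max 0 (M + 1 - `|x|))).
  exact: cvg_cst.
apply: (@continuous_max _ _ (fun=> 0) (fun x => M + 1 - `|x|)).
  exact: cvg_cst.
by apply: cvgB; [exact: cvg_cst|apply: cvg_norm; exact: cvg_id].
Qed.

Lemma measurable_exp_abs (k : nat) d' (T' : measurableType d') (f : T' -> R) :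
  measurable_fun setT f -> measurable_fun setT (fun x => expR (- (k%:R * `|f x|))).
Proof.
move=> mf; apply: measurableT_comp => //; apply: measurableT_comp => //.
by apply: measurable_funM => //; exact: measurableT_comp.
Qed.

Lemma exp_abs_bound (k : nat) (x : R) : `|expR (- (k%:R * `|x|))| <= 1.
Proof.
by rewrite ger0_norm ?expR_ge0// -[leRHS]expR0 ler_expR oppr_le0 mulr_ge0.
Qed.

Lemma poly_exp_abs (p : {poly R}) (x : R) :
  p.[expR (- `|x|)] = \sum_(i < size p) p`_i * expR (- (i%:R * `|x|)).
Proof.
rewrite horner_coef; apply: eq_bigr => i _.
by rewrite -expRM_natl mulrN.
Qed.

Lemma poly_exp_integrable d' (T' : measurableType d') (Q : probability T' R)
  (f : T' -> R) (p : {poly R}) : measurable_fun setT f ->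
  Q.-integrable setT (EFin \o (fun x => p.[expR (- `|f x|)])) /\
  \int[Q]_x p.[expR (- `|f x|)] =
     \sum_(i < size p) p`_i * \int[Q]_x expR (- (i%:R * `|f x|)).
Proof.
move=> mf.
have E : (fun x => p.[expR (- `|f x|)]) =
    (fun x => \sum_(i < size p) p`_i * expR (- (i%:R * `|f x|))).
  by apply/funext => x; rewrite poly_exp_abs.
have int_i i : Q.-integrable setT (EFin \o (fun x => expR (- (i%:R * `|f x|)))).
  apply: (@bounded_integrable _ _ _ _ _ 1); first exact: measurable_exp_abs.
  by move=> x; exact: exp_abs_bound.
have [] := @integrable_sumR _ _ _ Q _ (index_enum 'I_(size p)) xpredT
  (fun i x => p`_i * expR (- (i%:R * `|f x|))).
  by move=> i _; exact: integrableZR.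
rewrite E => -> ->; split=> //; apply: eq_bigr => i _.
by rewrite RintegralZl.
Qed.

(** In the variable [exp(-|x|)] a compactly supported function becomes a continuous function on
    [[0, 1]], and the approximating polynomials are combinations of the [exp(-i|x|)], whose means
    are known to converge. *)
Lemma compact_test_poly (f : R -> R) (e : R) : 0 < e ->
  continuous f -> (exists2 M : R, 0 <= M & forall x : R, M <= `|x| -> f x = 0) ->
  exists p : {poly R}, forall x : R, `|f `|x| - p.[expR (- `|x|)]| <= e.
Proof.
move=> e0 cf [M M0 fM].
(* The clamp at [expR (- M)] removes the singularity of [ln] at 0 and changes nothing, because [f]
   vanishes beyond [M]. *)
pose g (y : R) := f (- ln (Num.max y (expR (- M)))).
have gE x : g (expR (- `|x|)) = f `|x|.
  rewrite /g; have [xM|Mx] := leP `|x| M.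
    by rewrite (max_idPl _) ?ler_expR ?lerN2// expRK opprK.
  rewrite (max_idPr _) ?ler_expR ?lerN2 ?ltW// expRK opprK.
  by rewrite !fM ?normr_id ?(ltW Mx)// ger0_norm.
have cg : continuous g.
  move=> y; apply: continuous_comp; last exact: cf.
  apply: cvgN; apply: (@continuous_comp _ _ _ (fun y : R => Num.max y (expR (- M))) (@ln R)).
    by apply: (@continuous_max _ _ id (fun=> expR (- M))); [exact: cvg_id|exact: cvg_cst].
  by apply: continuous_ln; rewrite lt_max expR_gt0 orbT.
have [p gp] := weierstrass01 cg e0; exists p => x.
by have := gp (expR (- `|x|)); rewrite gE; apply; rewrite expR_ge0 /= -[leRHS]expR0 ler_expR oppr_le0 normr_ge0.
Qed.


Lemma cvg_compact_test (f : R -> R) (B : R) : continuous f -> (forall x, `|f x| <= B) ->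
  (exists2 M : R, 0 <= M & forall x : R, M <= `|x| -> f x = 0) ->
  \int[P]_w f `|Z n w| @[n --> \oo] --> \int[nu]_x f `|x|.
Proof.
move=> cf fB fM; apply/cvgrPdist_le => e e0.
have e30 : 0 < e / 3 by rewrite divr_gt0.
have [p fp] := compact_test_poly e30 cf fM.
have mfabs d' (T' : measurableType d') (g : T' -> R) : measurable_fun setT g ->
    measurable_fun setT (fun x => f `|g x|).
  move=> mg; apply: measurableT_comp; first exact: continuous_measurable_fun.
  exact: measurableT_comp.
have close d' (T' : measurableType d') (Q : probability T' R) (g : T' -> R) :
    measurable_fun setT g ->
    `|\int[Q]_x f `|g x| - \int[Q]_x p.[expR (- `|g x|)]| <= e / 3.
  move=> mg; rewrite -[leRHS](Rintegral_cst_prob Q); apply: Rintegral_dist.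
  - by apply: (@bounded_integrable _ _ _ _ _ B) => //; exact: mfabs.
  - by have [] := poly_exp_integrable Q p mg.
  - exact: integrable_cst_prob.
  - by move=> x; exact: fp.
have pcvg : \int[P]_w p.[expR (- `|Z n w|)] @[n --> \oo] -->
    \int[nu]_x p.[expR (- `|x|)].
  have [_ ->] := poly_exp_integrable nu p (@measurable_id _ _ setT).
  under eq_cvg do rewrite (poly_exp_integrable P p (mZ _)).2.
  by apply: cvg_sum => i; apply: cvgMr; exact: ZL.
near=> n.
rewrite [leRHS](_ : _ = e / 3 + (e / 3 + e / 3)); last by field.
have -> : \int[nu]_x f `|x| - \int[P]_w f `|Z n w| =
  (\int[nu]_x f `|x| - \int[nu]_x p.[expR (- `|x|)]) +
  ((\int[nu]_x p.[expR (- `|x|)] - \int[P]_w p.[expR (- `|Z n w|)])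
  - (\int[P]_w f `|Z n w| - \int[P]_w p.[expR (- `|Z n w|)])) by ring.
apply: (le_trans (ler_normD _ _)); apply: lerD.
  exact: (close _ _ nu id (@measurable_id _ _ setT)).
apply: (le_trans (ler_normB _ _)); apply: lerD; last exact: close.
by near: n; move/cvgrPdist_le : pcvg; apply.
Unshelve. all: by end_near. Qed.

Lemma tail_small (e : R) : 0 < e ->
  exists M : nat, (nu [set x : R | M%:R <= `|x|]%R <= e%:E)%E.
Proof.
move=> e0; pose A (n : nat) := [set x : measurableTypeR R | n%:R <= `|x|].
have mA n : measurable (A n) by exact: (@measurable_abs_ge _ _ _ id).
have A0 : \bigcap_n A n = set0.
  rewrite -subset0 => x /(_ (Num.truncn `|x|).+1 I).
  by rewrite /A /= leNgt truncnS_gt.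
have : nu \o A @ \oo --> nu (\bigcap_n A n).
  apply: nonincreasing_cvg_mu => //.
  - by rewrite (le_lt_trans (probability_le1 _ _))// ltry.
  - by rewrite A0.
  - move=> m n mn; apply/subsetPset => x /=; apply: le_trans.
    by rewrite ler_nat.
rewrite A0 measure0 => /fine_cvgP[_ /cvgr0_norm_le /(_ _ e0)] /= [N _ HN].
exists N; have := HN N (leqnn N) => /=; rewrite ger0_norm ?fine_ge0//.
by rewrite -lee_fin fineK// fin_num_measure.
Qed.

Lemma ramp_bound M x : `|ramp M x| <= 1.
Proof. by rewrite ger0_norm; have /andP[] := ramp01 M x. Qed.

Lemma Rintegral_ramp_abs d' (T' : measurableType d') (Q : probability T' R)
    (g : T' -> R) (M : R) : measurable_fun setT g ->
  Q.-integrable setT (EFin \o (fun x => ramp M `|g x|)).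
Proof.
move=> mg; apply: (@bounded_integrable _ _ _ _ _ 1) => [|x]; last exact: ramp_bound.
have mr := continuous_measurable_fun (@continuous_ramp M).
by apply: measurableT_comp => //; exact: measurableT_comp.
Qed.

Lemma ramp_tail (e : R) : 0 < e -> exists2 M : R, 0 <= M &
  1 - \int[nu]_x ramp M `|x| <= e.
Proof.
move=> e0; have [M HM] := tail_small e0; exists M%:R => //.
pose A := [set x : measurableTypeR R | M%:R <= `|x|].
have mA : measurable A by exact: (@measurable_abs_ge _ _ _ id).
apply: (@le_trans _ _ (fine (nu A))); last first.
  by rewrite -lee_fin fineK// fin_num_measure.
have intr := @Rintegral_ramp_abs _ _ nu id M%:R (@measurable_id _ _ setT).
rewrite fine_prob_Rintegral// Rintegral_onem//.
apply: le_Rintegral => //.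
- by apply: integrableBR => //; exact: integrable_cst_prob.
- by apply: (@bounded_integrable _ _ _ _ _ 1) => // x; rewrite indicE; case: (_ \in _); rewrite ?normr1 ?normr0.
move=> x _; rewrite indicE; have [xA|/negP xA] := boolP (x \in A).
  by rewrite /= lerBlDr lerDl; have /andP[] := ramp01 M%:R `|x|.
rewrite ramp1 ?subrr// normr_id; apply: contra_notT xA.
by rewrite -ltNge inE => /ltW.
Qed.

Lemma cvg_ramp M : 0 <= M ->
  \int[P]_w ramp M `|Z n w| @[n --> \oo] --> \int[nu]_x ramp M `|x|.
Proof.
move=> M0; apply: (@cvg_compact_test _ 1).
- exact: continuous_ramp.
- exact: ramp_bound.
- by exists (M + 1) => [|x]; [rewrite addr_ge0|exact: ramp0].
Qed.

(** The indicator of [M + 1 <= |Z|] lies below [1 - ramp M |Z|], whose mean converges to a small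
    tail of [nu]. *)
Lemma tight (e : R) : 0 < e -> exists2 M : R, 0 <= M &
  \forall n \near \oo, (P [set w | M <= `|Z n w|]%R <= e%:E)%E.
Proof.
move=> e0; have e20 : 0 < e / 2 by rewrite divr_gt0.
have [M M0 HM] := ramp_tail e20; exists (M + 1); first by rewrite addr_ge0.
near=> n.
pose A := [set w | M + 1 <= `|Z n w|].
have mA : measurable A by exact: measurable_abs_ge.
rewrite -/A -[leLHS]fineK ?fin_num_measure// lee_fin fine_prob_Rintegral//.
apply: (@le_trans _ _ (1 - \int[P]_w ramp M `|Z n w|)).
  rewrite Rintegral_onem ?Rintegral_ramp_abs//.
  apply: le_Rintegral => //.
  - by apply: (@bounded_integrable _ _ _ _ _ 1) => // x; rewrite indicE; case: (_ \in _); rewrite ?normr1 ?normr0.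
  - by apply: integrableBR; [exact: integrable_cst_prob|exact: Rintegral_ramp_abs].
  move=> x _; rewrite indicE; have [|_] := boolP (x \in A).
    by rewrite inE /A /= => xA; rewrite ramp0 ?normr_id// subr0.
  by rewrite /= subr_ge0; have /andP[] := ramp01 M `|Z n x|.
have : `|\int[nu]_x ramp M `|x| - \int[P]_w ramp M `|Z n w| | <= e / 2.
  by near: n; move/cvgrPdist_le : (cvg_ramp M0); apply.
move=> /ler_normlP[_]; lra.
Unshelve. all: by end_near. Qed.

(** Truncation by [ramp] costs at most [B * (1 - E ramp)] under either law, which is small because
    [ramp] is itself a compactly supported test function. *)
Lemma cvg_laplace (f : R -> R) (B : R) : continuous f -> (forall x, `|f x| <= B) ->
  \int[P]_w f `|Z n w| @[n --> \oo] --> \int[nu]_x f `|x|.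
Proof.
move=> cf fB; apply/cvgrPdist_le => e e0.
have B0 : 0 <= B by rewrite (le_trans _ (fB 0)).
pose e' := e / (4 * (B + 1)).
have e'0 : 0 < e' by rewrite divr_gt0// mulr_gt0// ltr_wpDl.
have [M M0 HM] := ramp_tail e'0.
pose fM x := f x * ramp M x.
have cfM : continuous fM by move=> x; apply: cvgM; [exact: cf|exact: continuous_ramp].
have fMB x : `|fM x| <= B.
  by rewrite normrM (le_trans _ (fB x))// ler_piMr// ramp_bound.
have fMcvg : \int[P]_w fM `|Z n w| @[n --> \oo] --> \int[nu]_x fM `|x|.
  apply: (cvg_compact_test cfM fMB); exists (M + 1); first by rewrite addr_ge0.
  by move=> x Mx; rewrite /fM ramp0// mulr0.
have close d' (T' : measurableType d') (Q : probability T' R) (g : T' -> R) :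
    measurable_fun setT g ->
    `|\int[Q]_x f `|g x| - \int[Q]_x fM `|g x| | <= B * (1 - \int[Q]_x ramp M `|g x|).
  move=> mg; have intr := @Rintegral_ramp_abs _ _ Q g M mg.
  have cmeas (h : R -> R) : continuous h -> measurable_fun setT (fun x => h `|g x|).
    move=> ch; apply: measurableT_comp; first exact: continuous_measurable_fun.
    exact: measurableT_comp.
  have int1 : Q.-integrable setT (EFin \o (fun x => 1 - ramp M `|g x|)).
    by apply: integrableBR => //; exact: integrable_cst_prob.
  rewrite Rintegral_onem//.
  rewrite -RintegralZl//; apply: Rintegral_dist.
  - by apply: (@bounded_integrable _ _ _ _ _ B) => //; exact: cmeas.
  - by apply: (@bounded_integrable _ _ _ _ _ B) => //; exact: cmeas.
  - exact: integrableZR.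
  - move=> x; rewrite /fM -[X in X - _]mulr1 -mulrBr normrM ler_pM//.
    by rewrite ger0_norm// subr_ge0; have /andP[] := ramp01 M `|g x|.
near=> n.
have h1 : `|\int[nu]_x ramp M `|x| - \int[P]_w ramp M `|Z n w| | <= e'.
  by near: n; move/cvgrPdist_le : (cvg_ramp M0); apply.
have h2 : `|\int[nu]_x fM `|x| - \int[P]_w fM `|Z n w| | <= e'.
  by near: n; move/cvgrPdist_le : fMcvg; apply.
have h3 := close _ _ nu id (@measurable_id _ _ setT).
have h4 := close _ _ P (Z n) (mZ n).
have h5 : B * (1 - \int[nu]_x ramp M `|x|) <= B * e' by rewrite ler_wpM2l.
have h6 : B * (1 - \int[P]_w ramp M `|Z n w|) <= B * (e' + e').
  rewrite ler_wpM2l//; move/ler_normlP : h1 => [_]; lra.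
have h7 : e = 4 * (B * e') + 4 * e'.
  by rewrite /e'; field; rewrite gt_eqF// ltr_wpDl.
have Be0 : 0 <= B * e' by rewrite mulr_ge0// ltW.
move: h3 h4 => /ler_normlP[h3 h3'] /ler_normlP[h4 h4'].
move: h2 => /ler_normlP[h2 h2'].
clear - h2 h2' h3 h3' h4 h4' h5 h6 h7 Be0 e'0.
rewrite ler_norml; apply/andP; split; lra.
Unshelve. all: by end_near. Qed.

(** A Slutsky argument. [nu] charges only the half-line, so [f x] may be read as [f |x|]; [S] and
    [|Z|] are close off a small set, and [f] is uniformly continuous on the segment where both lie
    with high probability. *)
Lemma cvg_in_law_laplace (S : nat -> T -> R) :
  (forall n, measurable_fun setT (S n)) ->
  nu [set x : R | x < 0] = 0 ->
  (forall e : R, 0 < e -> whp P (fun n => [set w | `|S n w - `|Z n w| | <= e])) ->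
  cvg_in_law P S nu.
Proof.
move=> mS nu0 SZ; split=> // f cf [B fB].
have B0 : 0 <= B by rewrite (le_trans _ (fB 0)).
have cmeas d' (T' : measurableType d') (g : T' -> R) : measurable_fun setT g -> measurable_fun setT (fun x => f (g x)).
  by move=> mg; apply: measurableT_comp => //; exact: continuous_measurable_fun.
have mabs d' (T' : measurableType d') (g : T' -> R) : measurable_fun setT g -> measurable_fun setT (fun x => `|g x|).
  by move=> mg; exact: measurableT_comp.
have -> : \int[nu]_x f x = \int[nu]_x f `|x|.
  congr fine; apply: ae_eq_integral => //.
  - by apply/measurable_EFinP; exact: (@cmeas _ _ id).
  - apply/measurable_EFinP; apply: (@cmeas _ _ (fun x : measurableTypeR R => `|x|)).
    exact: (@mabs _ _ id).
  exists [set x : R | x < 0]; split=> //.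
    rewrite (_ : [set x | _] = `]-oo, 0[%classic)//.
  move=> x /=; apply: contra_notP => /negP; rewrite -leNgt => x0 _.
  by rewrite ger0_norm.
apply/cvgrPdist_le => e e0.
(* Budget: [e'] for the convergence, [e'] for uniform continuity, and [2 B] times two exceptional
   probabilities of at most [e'] each. *)
pose e' := e / (2 + 4 * B).
have D0 : 0 < 2 + 4 * B by rewrite ltr_pwDl// mulr_ge0.
have e'0 : 0 < e' by rewrite divr_gt0.
have [M M0 HM] := tight e'0.
(* [|Z| < M] together with a distance of at most 1 between [S] and [|Z|] places both in
   [[-1, M + 1]]. *)
have [dl dl0 hdl] := heine_segment (-1) (M + 1) cf e'0.
pose dm := Num.min 1 (dl / 2).
have dm0 : 0 < dm by rewrite lt_min ltr01 divr_gt0.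
near=> n.
have PM : (P [set w | M <= `|Z n w|]%R <= e'%:E)%E by near: n; exact: HM.
have [] : exists A, [/\ measurable A, (P A <= e'%:E)%E &
    ~` A `<=` [set w | `|S n w - `|Z n w| | <= dm]].
  by near: n; exact: SZ.
move=> A [mA PA AQ].
have h1 : `|\int[nu]_x f `|x| - \int[P]_w f `|Z n w| | <= e'.
  by near: n; move/cvgrPdist_le : (cvg_laplace cf fB); apply.
pose C := [set w | M <= `|Z n w|].
have mC : measurable C by exact: measurable_abs_ge.
have int1 D : measurable D -> P.-integrable setT (EFin \o (\1_D : T -> R)).
  move=> mD; apply: (@bounded_integrable _ _ _ _ _ 1) => // x.
  by rewrite indicE; case: (_ \in _); rewrite ?normr1 ?normr0.
have h2 : `|\int[P]_w f `|Z n w| - \int[P]_w f (S n w)| <= e' + 2 * B * (fine (P A) + fine (P C)).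
  have intb : P.-integrable setT (EFin \o (fun w => 2 * B * (\1_A w + \1_C w))).
    by apply: integrableZR; apply: integrableDR; exact: int1.
  rewrite !fine_prob_Rintegral// -RintegralD ?int1// -RintegralZl//; last first.
    by apply: integrableDR; exact: int1.
  rewrite Rintegral_addc//.
  apply: Rintegral_dist.
  - by apply: (@bounded_integrable _ _ _ _ _ B) => //; apply: cmeas; exact: mabs.
  - by apply: (@bounded_integrable _ _ _ _ _ B) => //; exact: cmeas.
  - by apply: integrableDR => //; exact: integrable_cst_prob.
  move=> w.
  have fB2 : `|f `|Z n w| - f (S n w)| <= 2 * B.
    by rewrite (le_trans (ler_normB _ _))// mulr2n mulrDl mul1r lerD.
  rewrite !indicE; have [wA|/negP wA] := boolP (w \in A).
    rewrite (le_trans fB2)// ler_wpDl ?(ltW e'0)// ler_peMr ?mulr_ge0//.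
    by rewrite lerDl.
  have [wC|/negP wC] := boolP (w \in C).
    rewrite (le_trans fB2)// ler_wpDl ?(ltW e'0)// ler_peMr ?mulr_ge0//.
    by rewrite lerDr.
  rewrite /= addr0 mulr0 addr0.
  have ZM : `|Z n w| < M.
    by rewrite ltNge; apply/negP => ZM; apply: wC; rewrite inE.
  have SZd : `|S n w - `|Z n w| | <= dm by apply: AQ => wA'; apply: wA; rewrite inE.
  have SZ1 : `|S n w - `|Z n w| | <= 1 by rewrite (le_trans SZd)// ge_min lexx.
  have Zge0 := normr_ge0 (Z n w).
  move: (SZ1) => /ler_normlP[SZ1a SZ1b].
  apply: ltW; apply: hdl.
  - by rewrite in_itv /=; apply/andP; split; clear - M0 ZM SZ1a SZ1b Zge0; lra.
  - by rewrite in_itv /=; apply/andP; split; clear - M0 ZM SZ1a SZ1b Zge0; lra.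
  rewrite distrC (le_lt_trans SZd)// gt_min; apply/orP; right.
  by rewrite ltr_pdivrMr// ltr_pMr// ltr1n.
have fA : fine (P A) <= e' by rewrite -lee_fin fineK// fin_num_measure.
have fC : fine (P C) <= e' by rewrite -lee_fin fineK// fin_num_measure.
have -> : \int[nu]_x f `|x| - \int[P]_w f (S n w) =
  (\int[nu]_x f `|x| - \int[P]_w f `|Z n w|) + (\int[P]_w f `|Z n w| - \int[P]_w f (S n w)) by ring.
apply: (le_trans (ler_normD _ _)).
have h3 : 2 * B * (fine (P A) + fine (P C)) <= 2 * B * (e' + e').
  by rewrite ler_wpM2l ?mulr_ge0// lerD.
have h7 : e = 2 * e' + 4 * (B * e') by rewrite /e'; field; rewrite gt_eqF.
clear - h1 h2 h3 h7; lra.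
Unshelve. all: by end_near. Qed.

End laplace.

(** * Taylor bounds and Laplace transforms of the chi-squared laws *)

Section derive_kit.
Context (R : realType).
Implicit Types (f g : R -> R) (x : R).

Lemma is_derive_addf f g x (df dg : R) : is_derive x 1 f df -> is_derive x 1 g dg ->
  is_derive x 1 (fun y => f y + g y) (df + dg).
Proof. by move=> hf hg; exact: (is_deriveD hf hg). Qed.

Lemma is_derive_mulf f g x (df dg : R) : is_derive x 1 f df -> is_derive x 1 g dg ->
  is_derive x 1 (fun y => f y * g y) (df * g x + f x * dg).
Proof.
move=> hf hg; apply: (@is_derive_eq _ _ _ _ _ _ _ _ (is_deriveM hf hg)).
by rewrite addrC [g x *: _]mulrC.
Qed.

Lemma is_derive_scalef (c : R) f x (df : R) : is_derive x 1 f df ->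
  is_derive x 1 (fun y => c * f y) (c * df).
Proof. by move=> hf; exact: (is_deriveZ c hf). Qed.

Lemma is_derive_cstf (c : R) x : is_derive x 1 (fun=> c) 0.
Proof. exact: is_derive_cst. Qed.

Lemma is_derive_idf x : is_derive x 1 (fun y : R => y) 1.
Proof. exact: is_derive_id. Qed.

Lemma is_derive_compf f g x (df dg : R) : is_derive (g x) 1 f df ->
  is_derive x 1 g dg -> is_derive x 1 (fun y => f (g y)) (df * dg).
Proof.
move=> hf hg.
apply: (@is_derive_eq _ _ _ _ _ _ _ _ (is_derive1_comp hf hg)).
by rewrite mulrC.
Qed.

Lemma is_derive_powf (k : nat) x : is_derive x 1 (fun y : R => y ^+ k) (k%:R * x ^+ k.-1).
Proof.
elim: k => [|k IH]; first by rewrite mul0r; exact: is_derive_cst.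
under [X in is_derive _ _ X]eq_fun do rewrite exprS.
apply: (@is_derive_eq _ _ _ _ _ _ _ _ (is_derive_mulf (is_derive_idf x) IH)).
case: k {IH} => [|k] /=; first by rewrite !mul0r mulr0 addr0 mulr1.
by rewrite mulrCA -exprS mul1r -[k.+2%:R]nat1r mulrDl mul1r.
Qed.

Lemma is_derive_expf f x (df : R) : is_derive x 1 f df ->
  is_derive x 1 (fun y => expR (f y)) (df * expR (f x)).
Proof.
move=> hf; rewrite mulrC; apply: is_derive_compf => //.
Qed.

Lemma MVT01 (g g' : R -> R) (a : R) : 0 <= a <= 1 ->
  (forall x, 0 <= x <= 1 -> is_derive x 1 g (g' x)) ->
  exists2 c, 0 <= c <= 1 & g a - g 0 = g' c * a.
Proof.
move=> /andP[a0 a1] dg.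
have [x|x|c cin ->] := @MVT_segment R g g' 0 a a0.
- rewrite in_itv /= => /andP[x0 xa]; apply: dg.
  by rewrite (ltW x0) (le_trans (ltW xa)).
- move: x; apply: derivable_within_continuous => x; rewrite in_itv /= => /andP[x0 xa].
  have x01 : 0 <= x <= 1 by rewrite x0 (le_trans xa).
  exact: (@ex_derive _ _ _ _ _ _ _ (dg x x01)).
exists c; last by rewrite subr0.
by move: cin; rewrite in_itv /= => /andP[-> ca]; rewrite (le_trans ca).
Qed.

Lemma taylor2 (f f1 f2 : R -> R) (M : R) :
  (forall x, 0 <= x <= 1 -> is_derive x 1 f (f1 x)) ->
  (forall x, 0 <= x <= 1 -> is_derive x 1 f1 (f2 x)) ->
  (forall x, 0 <= x <= 1 -> `|f2 x| <= M) ->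
  `|f 1 - f 0 - f1 0| <= M.
Proof.
move=> d1 d2 fM.
have h01 : 0 <= (1 : R) <= 1 by rewrite ler01 lexx.
have [c c01 ->] := MVT01 h01 d1.
have [c' c'01] := MVT01 c01 d2; rewrite mulr1 => ->.
have /andP[c0 c1] := c01.
rewrite normrM (ger0_norm c0) -[leRHS]mulr1.
by rewrite ler_pM// fM.
Qed.

(** Three applications of the mean value theorem after subtracting the quadratic Taylor polynomial;
    the crude constant [M], in place of [M / 6], is enough. *)
Lemma taylor3 (f f1 f2 f3 : R -> R) (M : R) :
  (forall x, 0 <= x <= 1 -> is_derive x 1 f (f1 x)) ->
  (forall x, 0 <= x <= 1 -> is_derive x 1 f1 (f2 x)) ->
  (forall x, 0 <= x <= 1 -> is_derive x 1 f2 (f3 x)) ->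
  (forall x, 0 <= x <= 1 -> `|f3 x| <= M) ->
  `|f 1 - f 0 - f1 0 - f2 0 / 2| <= M.
Proof.
move=> d1 d2 d3 fM.
pose g x := f x + (- f1 0) * x + (- (f2 0 / 2)) * x ^+ 2.
pose g' x := f1 x + (- f1 0) * 1 + (- (f2 0 / 2)) * (2%:R * x ^+ 1).
have dg x : 0 <= x <= 1 -> is_derive x 1 g (g' x).
  move=> x01; exact: (is_derive_addf (is_derive_addf (d1 x x01)
    (is_derive_scalef _ (is_derive_idf x))) (is_derive_scalef _ (is_derive_powf 2 x))).
pose h x := f1 x + (- f2 0) * x.
have dh x : 0 <= x <= 1 -> is_derive x 1 h (f2 x + (- f2 0) * 1).
  move=> x01; exact: (is_derive_addf (d2 x x01) (is_derive_scalef _ (is_derive_idf x))).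
have -> : f 1 - f 0 - f1 0 - f2 0 / 2 = g 1 - g 0.
  by rewrite /g expr1n expr0n /=; field.
have h01 : 0 <= (1 : R) <= 1 by rewrite ler01 lexx.
have [c c01 ->] := MVT01 h01 dg.
have -> : g' c * 1 = h c - h 0 by rewrite /g' /h; field.
have [c' c'01 ->] := MVT01 c01 dh.
have -> : f2 c' + - f2 0 * 1 = f2 c' - f2 0 by ring.
have [c2 c201 ->] := MVT01 c'01 d3.
have /andP[c0 c1] := c01; have /andP[c'0 c'1] := c'01.
rewrite 2!normrM (ger0_norm c0) (ger0_norm c'0) -[leRHS]mulr1 -[X in _ <= X * 1]mulr1.
by rewrite !ler_pM// ?mulr_ge0// fM.
Qed.

Lemma expRN_bound (m : nat) (y : R) : 0 < y -> expR (- y) <= m`!%:R / y ^+ m.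
Proof.
move=> y0; rewrite expRN -[leRHS]invrK lef_pV2 ?posrE ?expR_gt0//; last first.
  by rewrite invr_gt0 divr_gt0 ?exprn_gt0// ltr0n fact_gt0.
rewrite invf_div; case: m => [|m].
  by rewrite expr0 fact0 divr1 -[leLHS]expR0 ler_expR ltW.
by apply: le_trans (expR_ge1Dxn m (ltW y0)); rewrite lerDr.
Qed.

End derive_kit.

Section transfer.
Context (R : realType) d (T : measurableType d) (P : {measure set T -> \bar R}).
Context d' (T' : measurableType d') (nu : {measure set T' -> \bar R}).
Local Open Scope ereal_scope.
Import HBNNSimple.

(** Indicators, then simple functions, then monotone convergence. With [Y] the identity it
    introduces a density; with [H] a product of the remaining factors it replaces one indicator in
    an independence formula by a nonnegative function. *)
Lemma weighted_transfer (H : T -> R) (Y : T -> T') (c : R) :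
  measurable_fun setT H -> (forall x, (0 <= H x)%R) -> measurable_fun setT Y ->
  (0 <= c)%R ->
  (forall B, measurable B -> \int[P]_x (H x * \1_B (Y x))%:E = c%:E * nu B) ->
  forall g : T' -> \bar R, measurable_fun setT g -> (forall y, 0 <= g y) ->
  \int[P]_x ((H x)%:E * g (Y x)) = c%:E * \int[nu]_y g y.
Proof.
move=> mH H0 mY c0 HB g mg g0.
pose h := nnsfun_approx measurableT mg.
have -> : \int[nu]_y g y = lim (\int[nu]_y (EFin \o h n) y @[n --> \oo]).
  have gE y : g y = lim ((EFin \o h n) y @[n --> \oo]).
    by apply/esym/cvg_lim => //; exact: cvg_nnsfun_approx.
  under eq_integral do rewrite gE.
  apply: monotone_convergence => //.
  - by move=> n; exact/measurable_EFinP.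
  - by move=> n y _ /=; rewrite lee_fin.
  - by move=> y _ a b ab; rewrite lee_fin; exact/lefP/nd_nnsfun_approx.
have -> : \int[P]_x ((H x)%:E * g (Y x)) =
    lim (\int[P]_x ((H x)%:E * (h n (Y x))%:E) @[n --> \oo]).
  have gE x : (H x)%:E * g (Y x) = lim (((H x)%:E * (h n (Y x))%:E) @[n --> \oo]).
    apply/esym/cvg_lim => //; apply: cvgeZl => //.
    exact: (@cvg_nnsfun_approx _ _ _ _ measurableT _ mg).
  under eq_integral do rewrite gE.
  apply: monotone_convergence => //.
  - move=> n; under eq_fun do rewrite -EFinM.
    by apply/measurable_EFinP; apply: measurable_funM => //; exact: measurableT_comp.
  - by move=> n x _ /=; rewrite -EFinM lee_fin mulr_ge0.
  - move=> x _ a b ab; rewrite -!EFinM lee_fin ler_wpM2l//.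
    exact/lefP/nd_nnsfun_approx.
suff suf n : \int[P]_x ((H x)%:E * (h n (Y x))%:E) = c%:E * \int[nu]_y (EFin \o h n) y.
  under [in LHS]eq_fun do rewrite suf.
  rewrite limeMl//; apply: ereal_nondecreasing_is_cvgn => a b ab.
  apply: ge0_le_integral => //.
  - by move=> y _ /=; rewrite lee_fin.
  - exact/measurable_EFinP.
  - exact/measurable_EFinP.
  - by move=> y _; rewrite lee_fin; exact/lefP/nd_nnsfun_approx.
rewrite (integral_nnsfun _ measurableT) patch_setT sintegralE.
have nH y x : 0 <= y%:E * (H x * \1_(h n @^-1` [set y]) (Y x))%:E.
  have [y0|y0] := leP 0%R y.
    by rewrite -EFinM lee_fin !mulr_ge0.
  rewrite preimage10 ?indic0 ?mulr0 ?mule0//.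
  by move=> -[z _ zy]; move: y0; rewrite -zy ltNge fun_ge0.
transitivity (\int[P]_x (\sum_(y \in range (h n)) (y%:E * (H x * \1_(h n @^-1` [set y]) (Y x))%:E))).
  apply: eq_integral => x _; rewrite (fimfunE (h n)) -fsumEFin// ge0_mule_fsumr.
    by apply: eq_fsbigr => y _; rewrite -!EFinM mulrCA.
  by move=> y; exact: nnfun_muleindic_ge0.
have mHy y : measurable_fun setT (fun x => (H x * \1_(h n @^-1` [set y]) (Y x))%R).
  apply: measurable_funM => //.
  have mi : measurable_fun setT (\1_(h n @^-1` [set y]) : T' -> R).
    exact: measurable_indic.
  exact: (measurableT_comp mi mY).
rewrite ge0_integral_fsum//; last first.
  by move=> y; apply: emeasurable_funM => //; exact/measurable_EFinP.
rewrite ge0_mule_fsumr; last first.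
  move=> y; have [y0|y0] := leP 0%R y; first by rewrite mule_ge0.
  rewrite preimage10 ?measure0 ?mule0//.
  by move=> -[z _ zy]; move: y0; rewrite -zy ltNge fun_ge0.
apply: eq_fsbigr => y /[!inE] -[z _ zy].
rewrite ge0_integralZl//.
- by rewrite HB// muleCA.
- exact/measurable_EFinP.
- by move=> x _; rewrite lee_fin mulr_ge0.
- by rewrite lee_fin -zy fun_ge0.
Qed.

End transfer.

(** * Exponential and polynomial moments of the normal law *)

Section normal_integral.
Context (R : realType) (s : R) (s0 : 0 < s).
Local Notation mu := (@lebesgue_measure R).

Lemma ge0_integral_normal (g : R -> \bar R) : measurable_fun setT g ->
  (forall x, (0 <= g x)%E) ->
  (\int[normal_prob 0 s]_x g x = \int[mu]_x ((normal_pdf 0 s x)%:E * g x))%E.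
Proof.
move=> mg g0.
have := @weighted_transfer R _ _ mu _ _ (normal_prob 0 s) (normal_pdf 0 s) id 1.
move=> ->//; first by rewrite mul1e.
- exact: measurable_normal_pdf.
- exact: normal_pdf_ge0.
move=> B mB; rewrite mul1e /normal_prob [RHS]integral_mkcond.
by apply: eq_integral => x _; rewrite patchE indicE; case: (x \in B); rewrite ?mulr1 ?mulr0.
Qed.

(** The integrand times the density is [1 / sqrt t] times the normal density of scale [s / sqrt t].
    Negative [c] is allowed: such exponential moments dominate all powers. *)
Lemma integral_exp_normal (c : R) : 0 < 1 + 2 * c * s ^+ 2 ->
  (\int[normal_prob 0 s]_x (expR (- (c * x ^+ 2)))%:E =
    (Num.sqrt (1 + 2 * c * s ^+ 2))^-1%:E)%E.
Proof.
move=> c0; set t := 1 + 2 * c * s ^+ 2 in c0 *.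
have st0 : 0 < Num.sqrt t by rewrite sqrtr_gt0.
pose s' := s / Num.sqrt t.
have s'0 : 0 < s' by rewrite divr_gt0.
rewrite ge0_integral_normal; last 2 first.
- apply/measurable_EFinP; apply: measurableT_comp => //.
  by apply: measurableT_comp => //; apply: measurable_funM.
- by move=> x; rewrite lee_fin expR_ge0.
transitivity (\int[mu]_x ((Num.sqrt t)^-1%:E * (normal_pdf 0 s' x)%:E))%E.
  apply: eq_integral => x _; rewrite -!EFinM; congr EFin.
  rewrite !normal_pdfE ?gt_eqF// /= /normal_peak /normal_fun !subr0.
  rewrite -[LHS]mulrA -expRD [RHS]mulrA; congr (_ * expR _).
    rewrite -invfM -sqrtrM ?ltW//; congr (Num.sqrt _)^-1.
    rewrite /s' expr_div_n sqr_sqrtr ?ltW//; field.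
    by rewrite gt_eqF.
  rewrite /s' expr_div_n sqr_sqrtr ?ltW// /t; field.
  by rewrite !gt_eqF.
rewrite ge0_integralZl//; last 2 first.
- by apply/measurable_EFinP; exact: measurable_normal_pdf.
- by move=> x _; rewrite lee_fin normal_pdf_ge0.
by rewrite integral_normal_pdf mule1.
Qed.


Local Notation N := (normal_prob 0 s).

Lemma integrable_exp_normal (c : R) : 0 < 1 + 2 * c * s ^+ 2 ->
  N.-integrable setT (EFin \o (fun x => expR (- (c * x ^+ 2)))).
Proof.
move=> c0; apply/integrableP; split.
  apply/measurable_EFinP; apply: measurableT_comp => //.
  by apply: measurableT_comp => //; apply: measurable_funM.
under eq_integral do rewrite /= ger0_norm ?expR_ge0//.
by rewrite integral_exp_normal// ltry.
Qed.

Lemma integrable_pow_normal (k : nat) :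
  N.-integrable setT (EFin \o (fun x => x ^+ k)).
Proof.
have s20 : 0 < s ^+ 2 by rewrite exprn_gt0.
(* With this [c] the quantity [1 + 2 c s^2] is [3 / 4], and the term of degree [k] in the
   exponential series bounds [x ^+ (2 k)]. *)
pose c := - (8 * s ^+ 2)^-1.
have c0 : 0 < 1 + 2 * c * s ^+ 2.
  rewrite /c (_ : 1 + _ = 3 / 4); first lra.
  by field; rewrite gt_eqF.
pose K := (8 * s ^+ 2) ^+ k * k`!%:R.
apply: (@le_integrableR R _ _ N (fun x : R => x ^+ k)
  (fun x : R => 1 + K * expR (- (c * x ^+ 2)))).
- exact: measurable_funX.
- move=> x.
  have : `|x ^+ k| <= 1 + (x ^+ 2) ^+ k.
    rewrite -exprM mulnC exprM -[leRHS]/(1 + (x ^+ k) ^+ 2) -(real_normK (num_real (x ^+ k))).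
    by set y := `|_|; have := sqr_ge0 (y - 1); have := normr_ge0 (x ^+ k); rewrite -/y; nra.
  move=> /le_trans; apply; rewrite lerD2l /K /c.
  have D0 : 0 < 8 * s ^+ 2 by rewrite mulr_gt0.
  have x20 : 0 <= x ^+ 2 / (8 * s ^+ 2) by rewrite divr_ge0 ?sqr_ge0// ltW.
  have -> : - (- (8 * s ^+ 2)^-1 * x ^+ 2) = x ^+ 2 / (8 * s ^+ 2) by rewrite mulNr opprK mulrC.
  clear K; case: k => [|k]; first by rewrite !expr0 fact0 !mul1r -[leLHS]expR0 ler_expR.
  have := expR_ge1Dxn k x20.
  move=> /(le_trans _) -/(_ _ (ler_wpDl ler01 (lexx _))).
  rewrite ler_pdivrMr ?ltr0n ?fact_gt0// expr_div_n ler_pdivrMr ?exprn_gt0// => h.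
  by apply: (le_trans h); rewrite le_eqVlt; apply/orP; left; apply/eqP; ring.
- apply: integrableDR; first exact: integrable_cst_prob.
  by apply: integrableZR; exact: integrable_exp_normal.
Qed.


Lemma integrable_pow_pdf (k : nat) :
  mu.-integrable setT (EFin \o (fun x : R => x ^+ k * normal_pdf 0 s x)).
Proof.
have mp := @measurable_normal_pdf R 0 s.
apply/integrableP; split.
  by apply/measurable_EFinP; apply: measurable_funM => //; exact: measurable_funX.
have /integrableP[_] := integrable_pow_normal k.
rewrite ge0_integral_normal//; last first.
  by apply: measurableT_comp => //; apply/measurable_EFinP; exact: measurable_funX.
apply: le_lt_trans; rewrite le_eqVlt; apply/orP; left; apply/eqP.
apply: eq_integral => x _ /=; rewrite -EFinM normrM mulrC.
by rewrite (ger0_norm (normal_pdf_ge0 _ _ _)).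
Qed.

Lemma integral_pow_normal (k : nat) :
  \int[N]_x (x ^+ k) = \int[mu]_x (x ^+ k * normal_pdf 0 s x).
Proof.
have mk : measurable_fun setT (EFin \o (fun x : R => x ^+ k)).
  by apply/measurable_EFinP; exact: measurable_funX.
congr fine; rewrite integralE [RHS]integralE; congr (_ - _)%E.
  rewrite ge0_integral_normal//; last exact: measurable_funepos.
  apply: eq_integral => x _; rewrite !funeposE /=.
  by rewrite -!EFin_max -EFinM mulrC maxr_pMl ?normal_pdf_ge0// mul0r.
rewrite ge0_integral_normal//; last exact: measurable_funeneg.
apply: eq_integral => x _; rewrite !funenegE /=.
by rewrite -!EFin_max -EFinM mulrC maxr_pMl ?normal_pdf_ge0// mul0r mulNr.
Qed.

Lemma is_derive_pow_pdf (k : nat) (x : R) : is_derive x 1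
  (fun x : R => x ^+ k * normal_pdf 0 s x)
  (k%:R * x ^+ k.-1 * normal_pdf 0 s x - s ^- 2 * (x ^+ k.+1 * normal_pdf 0 s x)).
Proof.
have -> : (fun x : R => x ^+ k * normal_pdf 0 s x) =
    (fun x : R => x ^+ k * (normal_peak s * expR (- (2 * s ^+ 2)^-1 * x ^+ 2))).
  apply/funext => y; rewrite normal_pdfE ?gt_eqF//= /normal_fun subr0.
  by congr (_ * (_ * expR _)); field; rewrite gt_eqF.
rewrite normal_pdfE ?gt_eqF//= /normal_fun subr0.
rewrite (_ : - x ^+ 2 / (s ^+ 2 *+ 2) = - (2 * s ^+ 2)^-1 * x ^+ 2); last first.
  by field; rewrite gt_eqF.
have dexp : is_derive x 1 (fun y : R => normal_peak s * expR (- (2 * s ^+ 2)^-1 * y ^+ 2))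
    (normal_peak s * (- (2 * s ^+ 2)^-1 * (2%:R * x ^+ 1) * expR (- (2 * s ^+ 2)^-1 * x ^+ 2))).
  exact: (is_derive_scalef _ (is_derive_expf (is_derive_scalef _ (is_derive_powf 2 x)))).
apply: (@is_derive_eq _ _ _ _ _ _ _ _ (is_derive_mulf (is_derive_powf k x) dexp)).
rewrite (exprS x k); field.
by rewrite gt_eqF.
Qed.

(** The boundary terms of the integration by parts at both ends, [sg] being 1 or -1; the exponential
    bound of order [k + 1] leaves the power [- (k + 2)] of [n]. *)
Lemma cvg_pow_pdf (k : nat) (sg : R) : `|sg| = 1 ->
  ((sg * n%:R) ^+ k * normal_pdf 0 s (sg * n%:R)) @[n --> \oo] --> 0.
Proof.
move=> sg1; have s20 : 0 < s ^+ 2 by rewrite exprn_gt0.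
pose a := (2 * s ^+ 2)^-1.
have a0 : 0 < a by rewrite invr_gt0 mulr_gt0.
pose K := normal_peak s * (k.+1)`!%:R / a ^+ k.+1.
have K0 : 0 <= K by rewrite divr_ge0 ?exprn_ge0 ?(ltW a0)// mulr_ge0 ?normal_peak_ge0.
apply/cvgrPdist_le => e e0.
near=> n.
have n0 : (0 < n)%N by near: n; exists 1%N.
have n0R : 0 < n%:R :> R by rewrite ltr0n.
rewrite sub0r normrN normrM normrX normrM sg1 mul1r normr_nat.
rewrite ger0_norm ?normal_pdf_ge0// normal_pdfE ?gt_eqF//= /normal_fun subr0.
rewrite exprMn -[sg ^+ 2]real_normK ?num_real// sg1 expr1n mul1r.
apply: (@le_trans _ _ (K / n%:R)).
  have -> : - n%:R ^+ 2 / (s ^+ 2 *+ 2) = - (a * n%:R ^+ 2) :> R.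
    by rewrite /a; field; rewrite gt_eqF.
  have y0 : 0 < a * n%:R ^+ 2 by rewrite mulr_gt0// exprn_gt0.
  apply: (@le_trans _ _ (n%:R ^+ k * (normal_peak s * ((k.+1)`!%:R / (a * n%:R ^+ 2) ^+ k.+1)))).
    rewrite ler_wpM2l ?exprn_ge0// ler_wpM2l ?normal_peak_ge0//.
    exact: expRN_bound.
  rewrite [leLHS](_ : _ = K / n%:R ^+ k.+2); last first.
    rewrite /K exprMn -exprM mulnC muln2 -addnn !exprS exprD !exprS; field.
    by rewrite !gt_eqF ?exprn_gt0.
  rewrite ler_wpM2l// lef_pV2 ?posrE ?exprn_gt0//.
  by rewrite -[leLHS]expr1 ler_weXn2l// ler1n.
rewrite ler_pdivrMr// mulrC -ler_pdivrMr//.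
by near: n; exact: nbhs_infty_ger.
Unshelve. all: by end_near. Qed.

(** Integration by parts: the derivative of [x ^+ k * normal_pdf 0 s x] has integral 0 over the
    line, as the limit over [[-n, n]]. For [k = 0] the value of [k.-1] does not matter, its
    coefficient being 0. *)
Lemma normal_moment_rec (k : nat) :
  \int[N]_x (x ^+ k.+1) = s ^+ 2 * k%:R * \int[N]_x (x ^+ k.-1).
Proof.
pose f (x : R) : R := x ^+ k * normal_pdf 0 s x.
pose f' (x : R) : R := k%:R * x ^+ k.-1 * normal_pdf 0 s x - s ^- 2 * (x ^+ k.+1 * normal_pdf 0 s x).
have f'E : f' = fun x => k%:R * (x ^+ k.-1 * normal_pdf 0 s x) - s ^- 2 * (x ^+ k.+1 * normal_pdf 0 s x).
  by apply/funext => x; rewrite /f' mulrA.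
have df (x : R) : is_derive x 1 f (f' x) by exact: is_derive_pow_pdf.
have intf' : mu.-integrable setT (EFin \o f').
  rewrite f'E; apply: integrableBR; apply: integrableZR; exact: integrable_pow_pdf.
have cpdf : continuous (normal_pdf 0 s) by apply: continuous_normal_pdf; rewrite gt_eqF.
have cf' : continuous f'.
  move=> x; rewrite f'E; apply: cvgB; apply: cvgMr; apply: cvgM; try exact: cpdf; exact: exprn_continuous.
suff int0 : \int[mu]_x f' x = 0.
  move: int0; rewrite f'E RintegralB//; last 2 first.
  - by apply: integrableZR; exact: integrable_pow_pdf.
  - by apply: integrableZR; exact: integrable_pow_pdf.
  rewrite !RintegralZl ?integrable_pow_pdf//.
  rewrite -!integral_pow_normal => /eqP; rewrite subr_eq0 => /eqP E.
  rewrite -[RHS]mulrA E; field.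
  by rewrite gt_eqF.
pose fn (n : nat) (x : R) : \bar R := ((f' x) * \1_(`[- n%:R, n%:R]%classic : set R) x)%:E.
have mf' : measurable_fun setT f' by exact: continuous_measurable_fun.
have [|||//||_ _ fncvg] := @dominated_convergence _ _ _ mu setT measurableT fn (EFin \o f') (EFin \o (fun x => `|f' x|)).
- by move=> n; apply/measurable_EFinP; apply: measurable_funM => //; exact: measurable_indic.
- exact/measurable_EFinP.
- apply: aeW => x _; apply: cvg_near_cst; near=> n.
  rewrite /fn indicE mem_set ?mulr1//= in_itv /= -ler_norml.
  by near: n; exact: nbhs_infty_ger.
- exact: integrable_normR.
- apply: aeW => x n _; rewrite /fn /= lee_fin normrM ler_piMr// indicE.
  by case: (_ \in _); rewrite ?normr1 ?normr0.
have fnE n : (0 < n)%N -> (\int[mu]_x fn n x = (f n%:R - f (- n%:R))%:E)%E.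
  move=> n0; rewrite EFinB -(@continuous_FTC2 _ f' f)//.
  - by rewrite [RHS]integral_mkcond; apply: eq_integral => x _; rewrite /fn patchE indicE; case: (x \in _); rewrite ?mulr1 ?mulr0.
  - by rewrite -subr_gt0 opprK addr_gt0// ltr0n.
  - exact: continuous_subspaceT.
  - have cf : continuous f.
      by move=> x; apply/differentiable_continuous/derivable1_diffP; have [] := df x.
    split.
    + by move=> x _; have [] := df x.
    + exact/cvg_at_right_filter/cf.
    + exact/cvg_at_left_filter/cf.
  - by move=> x _; rewrite derive1E; exact: derive_val.
have lim0 : (f n%:R - f (- n%:R)) @[n --> \oo] --> (0 : R).
  rewrite -[X in _ --> X](subr0 0); apply: cvgB.
    by have := @cvg_pow_pdf k 1 (normr1 _); under eq_cvg do rewrite mul1r.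
  by have := @cvg_pow_pdf k (-1) (normrN1 _); under eq_cvg do rewrite mulN1r.
have : (\int[mu]_x fn n x)%E @[n --> \oo] --> (0 : R)%:E.
  apply/fine_cvgP; split.
    by near=> n; rewrite fnE//; near: n; exists 1%N.
  apply: cvg_trans lim0; apply: near_eq_cvg; near=> n.
  by rewrite /= fnE//; near: n; exists 1%N.
move=> /(cvg_unique (@ereal_hausdorff R) fncvg) E.
by rewrite /Rintegral; move: E => /= ->.
Unshelve. all: by end_near. Qed.

End normal_integral.

(** * Laplace transform of the chi-squared law and moments of the standard normal law *)

Section chi2_laplace.
Context (R : realType).
Local Notation RB := (measurableTypeR R).

Lemma measurable_neg : measurable ([set x : R | x < 0] : set RB).
Proof.
rewrite (_ : [set x : R | x < 0] = `]-oo, 0[%classic); first exact: measurable_itv.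
by apply/seteqP; split => x /=; rewrite in_itv.
Qed.

Lemma chi2_neg (r : nat) : chi2 R r [set x : R | x < 0] = 0.
Proof.
have mneg := measurable_neg.
elim: r => [|r IH].
  by rewrite /= [LHS]diracE memNset//= ltxx.
rewrite /= /distribution /pushforward; apply/eqP; rewrite -measure_le0.
apply: (@le_trans _ _ ((chi2 R r \x normal_prob 0 1)%E ([set x : R | x < 0] `*` setT))).
  apply: le_measure; rewrite ?inE.
  - by rewrite -[X in measurable X]setTI; exact: measurable_add_sqr.
  - exact: measurableX.
  move=> u /=; rewrite /add_sqr => h; split=> //.
  by apply: le_lt_trans h; rewrite lerDl sqr_ge0.
apply: (@le_trans _ _ (chi2 R r [set x : R | x < 0]%R * normal_prob 0 1 setT)%E).
  by rewrite product_measure1E//; exact: measurable_neg.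
by rewrite IH mul0e.
Qed.

(** By Tonelli each added square contributes one factor [(1 + 2 c) ^ (-1/2)]. *)
Lemma chi2_laplace (r : nat) (c : R) : 0 <= c ->
  (\int[chi2 R r]_x (expR (- (c * x)))%:E = ((Num.sqrt (1 + 2 * c))^-1 ^+ r)%:E)%E.
Proof.
move=> c0.
have mexp : measurable_fun setT (fun x : RB => (expR (- (c * x)))%:E).
  apply/measurable_EFinP; apply: measurableT_comp => //.
  by apply: measurableT_comp => //; exact: measurable_funM.
elim: r => [|r IH].
  by rewrite /= integral_dirac// diracT mul1e mulr0 oppr0 expR0 expr0.
rewrite [LHS](@ge0_integral_distribution _ _ _ _ _ (chi2 R r \x normal_prob 0 1)%E)//.
rewrite fubini_tonelli1//=; last first.
  by apply: measurableT_comp => //; exact: measurable_add_sqr.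
transitivity (\int[chi2 R r]_x ((Num.sqrt (1 + 2 * c))^-1%:E * (expR (- (c * x)))%:E))%E.
  apply: eq_integral => x _; rewrite /fubini_F.
  transitivity (\int[normal_prob 0 1]_y ((expR (- (c * x)))%:E * (expR (- (c * y ^+ 2)))%:E))%E.
    by apply: eq_integral => y _; rewrite -EFinM -expRD /add_sqr /=; congr (expR _)%:E; ring.
  rewrite ge0_integralZl//; last first.
    apply/measurable_EFinP; apply: measurableT_comp => //.
    by apply: measurableT_comp => //; apply: measurable_funM => //; exact: measurable_funX.
  have := @integral_exp_normal R 1 ltr01 c; rewrite expr1n mulr1 => -> //; first by rewrite muleC.
  by rewrite ltr_pwDl// mulr_ge0.
rewrite ge0_integralZl ?lee_fin ?invr_ge0 ?sqrtr_ge0//.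
by rewrite IH exprS EFinM.
Qed.

Lemma chi2_Rlaplace (r : nat) (c : R) : 0 <= c ->
  \int[chi2 R r]_x (expR (- (c * `|x|))) = ((Num.sqrt (1 + 2 * c))^-1 ^+ r).
Proof.
move=> c0; have E := chi2_laplace r c0; rewrite /Rintegral.
transitivity (fine ((Num.sqrt (1 + 2 * c))^-1 ^+ r)%:E); last by [].
rewrite -E; congr fine.
have mexp (f : RB -> R) : measurable_fun setT f -> measurable_fun setT (fun x : RB => (expR (- (c * f x)))%:E).
  move=> mf; apply/measurable_EFinP; apply: measurableT_comp => //.
  by apply: measurableT_comp => //; exact: measurable_funM.
apply: ae_eq_integral => //.
- by apply: (mexp (fun x : RB => `|x : R|)); exact: normr_measurable.
- exact: mexp.
exists [set x : R | x < 0]; split; [exact: measurable_neg|exact: chi2_neg|].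
move=> x /=; apply: contra_notP => /negP; rewrite -leNgt => x0 _.
by rewrite ger0_norm.
Qed.

End chi2_laplace.

Section standard_moments.
Context (R : realType) (s : R) (s0 : 0 < s).
Local Notation N := (normal_prob 0 s).

(** The moments of the standard normal law: 0 in odd degree, double factorials in even degree. *)
Fixpoint gmom (k : nat) : R :=
  match k with 0 => 1 | 1 => 0 | (k'.+1 as k1).+1 => k1%:R * gmom k' end.

Lemma gmomSS k : gmom k.+2 = k.+1%:R * gmom k. Proof. by []. Qed.

Lemma integrable_scaled_pow (k : nat) :
  N.-integrable setT (EFin \o (fun x : R => (x / s) ^+ k)).
Proof.
have -> : (fun x : R => (x / s) ^+ k) = (fun x : R => s ^- k * x ^+ k).
  by apply/funext => x; rewrite expr_div_n mulrC.
by apply: integrableZR; exact: integrable_pow_normal.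
Qed.

Lemma normal_gmom (k : nat) : \int[N]_x ((x / s) ^+ k) = gmom k.
Proof.
have E j : \int[N]_x ((x / s) ^+ j) = s ^- j * \int[N]_x (x ^+ j).
  rewrite -RintegralZl//; last exact: integrable_pow_normal.
  by apply: eq_Rintegral => x _; rewrite expr_div_n mulrC.
have [] : \int[N]_x ((x / s) ^+ k) = gmom k /\ \int[N]_x ((x / s) ^+ k.+1) = gmom k.+1.
  elim: k => [|k [IH1 IH2]].
    split; first by under eq_Rintegral do rewrite expr0; rewrite Rintegral_cst_prob.
    by rewrite E normal_moment_rec// mulr0 mul0r mulr0.
  split=> //; rewrite E normal_moment_rec// gmomSS -IH1 E !exprS; field.
  by rewrite expf_neq0 gt_eqF.
by [].
Qed.

End standard_moments.

(** * Lindeberg replacement along the heat flow *)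

Section product_expectation.
Context (R : realType) d (T : measurableType d) (P : probability T R).
Variables (I : finType) (X : I -> T -> R).
Variable nu : I -> probability (measurableTypeR R) R.
Hypothesis mX : forall i, measurable_fun setT (X i).
Variable F : set (set T).
Hypothesis F_meas : F `<=` measurable.
Hypotheses (FT : F setT) (F0 : F set0).
Hypothesis indep : forall (A : set T) (B : I -> set R), F A ->
  (forall i, measurable (B i)) ->
  P (A `&` [set w | forall i, B i (X i w)]) = (P A * \prod_i nu i (B i))%E.

Let ind (A : set T) (g : I -> R -> R) (w : T) : R := \1_A w * \prod_i g i (X i w).

Let upd (g : I -> R -> R) (a : I) (h : R -> R) (i : I) : R -> R :=
  if i == a then h else g i.

Let nice (g : R -> R) (i : I) := measurable_fun setT g /\ (nu i).-integrable setT (EFin \o g).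

Lemma nice_indic (B : set R) i : measurable B -> nice \1_B i.
Proof.
move=> mB; split; first exact: measurable_indic.
apply: (@bounded_integrable _ _ _ _ _ 1) => [|x]; first exact: measurable_indic.
by rewrite indicE; case: (_ \in _); rewrite ?normr1 ?normr0.
Qed.

Lemma measurable_prodX (g : I -> R -> R) (Q : pred I) : (forall i, measurable_fun setT (g i)) ->
  measurable_fun setT (fun w => \prod_(i | Q i) g i (X i w)).
Proof.
move=> mg.
have -> : (fun w => \prod_(i | Q i) g i (X i w)) = \prod_(i | Q i) (g i \o X i).
  by apply/funext => w; rewrite fct_prodE.
elim/big_ind: _ => [|f h mf mh|i _].
- exact: measurable_cst.
- exact: measurable_funM.
- exact: measurableT_comp.
Qed.

(** [s] lists the coordinates that are no longer indicators. Each induction step frees one of them: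
    the case of an indicator there says that the weighted law of [X a] is a multiple of [nu a], and
    [weighted_transfer] extends it. *)
Lemma prod_ge0_expectation (s : seq I) (g : I -> R -> R) (A : set T) :
  F A -> (forall i, nice (g i) i) -> (forall i x, 0 <= g i x) ->
  (forall i, i \notin s -> exists2 B : set R, measurable B & g i = \1_B) ->
  (\int[P]_w (ind A g w)%:E = (fine (P A) * \prod_i \int[nu i]_x g i x)%:E)%E.
Proof.
move=> FA; elim: s g => [|a s IH] g ng g0 gs.
  have /(_ _)/cid2 B_ i := gs i isT.
  pose B i := s2val (B_ i).
  have mB i : measurable (B i) := s2valP (B_ i).
  have gB i : g i = \1_(B i) := s2valP' (B_ i).
  have mAB : measurable (A `&` [set w | forall i, B i (X i w)]).
    apply: measurableI; first exact: F_meas.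
    rewrite (_ : [set w | _] = \bigcap_(i in [set: I]) (X i @^-1` B i)); last first.
      by apply/seteqP; split => w h i; [move=> _; exact: h|exact: h].
    apply: fin_bigcap_measurable => // i _.
    by rewrite -[X in measurable X]setTI; exact: mX.
  transitivity (P (A `&` [set w | forall i, B i (X i w)])).
    rewrite -[X in P X]setIT -integral_indic//; apply: eq_integral => w _; congr EFin.
    rewrite /ind; under eq_bigr do rewrite gB indicE.
    have [wAB|wAB] := pselect ((A `&` [set w | forall i, B i (X i w)]) w).
      rewrite !indicE !mem_set//; last exact: wAB.1.
      by rewrite mul1r big1// => i _; rewrite mem_set//; exact: wAB.2.
    rewrite [RHS]indicE memNset//.
    have [wA|wA] := pselect (A w); last by rewrite indicE memNset// mul0r.
    have [i wi] : exists i, ~ B i (X i w).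
      by apply: contrapT => h; apply: wAB; split=> // i; apply: contrapT => h2; apply: h; exists i.
    by rewrite (bigD1 i)//= [in X in _ * (X * _)]memNset// mul0r mulr0.
  rewrite indep// EFinM fineK ?fin_num_measure//; last exact: F_meas.
  congr (_ * _)%E; rewrite -prodEFin; apply: eq_bigr => i _.
  have -> : \int[nu i]_x g i x = fine (nu i (B i)) by rewrite gB; exact/esym/(fine_prob_Rintegral (nu i) (mB i)).
  by rewrite fineK//; exact: (fin_num_measure (nu i) _ (mB i)).
have mi B : measurable B -> forall i, nice (upd g a \1_B i) i.
  by move=> mB i; rewrite /upd; case: eqP => [->|_] //; exact: nice_indic.
pose H w := \1_A w * \prod_(i | i != a) g i (X i w).
have HE h w : ind A (upd g a h) w = H w * h (X a w).
  rewrite /ind /H (bigD1 a)//= {1}/upd eqxx mulrCA mulrC; congr (_ * _ * _).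
  by apply: eq_bigr => i ia; rewrite /upd (negbTE ia).
have RE h : \prod_i \int[nu i]_x upd g a h i x =
   \int[nu a]_x h x * \prod_(i | i != a) \int[nu i]_x g i x.
  rewrite (bigD1 a)//= {1}/upd eqxx; congr (_ * _).
  by apply: eq_bigr => i ia; rewrite /upd (negbTE ia).
have gE : g = upd g a (g a).
  by apply/funext => i; rewrite /upd; case: eqP => [->|].
have c0 : 0 <= fine (P A) * \prod_(i | i != a) \int[nu i]_x g i x.
  by rewrite mulr_ge0 ?fine_ge0// prodr_ge0// => i _; apply: Rintegral_ge0.
have trans := @weighted_transfer R _ _ P _ _ (nu a) H (X a) _ _ _ _ c0.
rewrite gE; under eq_integral do rewrite HE EFinM.
rewrite (trans _ _ _ _ (EFin \o g a))//.
- rewrite RE mulrCA [RHS]EFinM [RHS]muleC; congr (_ * _)%E.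
  by rewrite /Rintegral fineK//; apply: integrable_fin_num => //; exact: (ng a).2.
- apply: measurable_funM; first by apply: measurable_indic; exact: F_meas.
  by apply: measurable_prodX => i; exact: (ng i).1.
- by move=> w; rewrite mulr_ge0 ?indicE ?ler0n// prodr_ge0.
- exact: mX.
- move=> B mB; under eq_integral do rewrite -HE.
  rewrite IH//.
  + rewrite RE mulrCA [LHS]EFinM [LHS]muleC; congr (_ * _)%E.
    by rewrite -(fine_prob_Rintegral (nu a) mB) fineK//; exact: (fin_num_measure (nu a) _ mB).
  + exact: mi.
  + by move=> i x; rewrite /upd; case: eqP => // _; rewrite indicE ler0n.
  + move=> i si; rewrite /upd; case: eqP => [_|/eqP ia]; first by exists B.
    by apply: gs; rewrite inE negb_or ia.
- by apply/measurable_EFinP; exact: (ng a).1.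
- by move=> x; rewrite lee_fin.
Qed.


(** The same passage for the weight: the formula on preimages under [W] becomes an integral against
    the law of [W]. The function [pos] is the identity cut at 0, since [weighted_transfer] asks for
    nonnegativity on the whole line. *)
Lemma weight_ge0_expectation (g : I -> R -> R) (W : T -> R) :
  (forall i, nice (g i) i) -> (forall i x, 0 <= g i x) ->
  (forall w, 0 <= W w) -> P.-integrable setT (EFin \o W) ->
  (forall B : set R, measurable B -> F (W @^-1` B)) ->
  (\int[P]_w (W w * \prod_i g i (X i w))%:E =
    (\int[P]_w W w * \prod_i \int[nu i]_x g i x)%:E)%E.
Proof.
move=> ng g0 W0 intW FW.
have mW : measurable_fun setT W by exact/measurable_EFinP/(measurable_int P).
pose W' : {mfun T >-> R} := mfun_Sub (mem_set mW).
have WE w : W' w = W w by [].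
pose H w := \prod_i g i (X i w).
have c0 : 0 <= \prod_i \int[nu i]_x g i x.
  by rewrite prodr_ge0// => i _; apply: Rintegral_ge0.
have trans := @weighted_transfer R _ _ P _ _ (pushforward P W') H W' _ _ _ _ c0.
pose pos (x : R) : \bar R := (Num.max x 0)%:E.
have mpos : measurable_fun setT pos by apply/measurable_EFinP; exact: measurable_maxr.
transitivity (\int[P]_w ((H w)%:E * pos (W' w)))%E.
  by apply: eq_integral => w _; rewrite /pos WE (max_idPl _)// -EFinM mulrC.
rewrite trans//.
- rewrite ge0_integral_pushforward//; last by move=> y _; rewrite lee_fin le_max lexx orbT.
  rewrite mulrC EFinM; congr (_ * _)%E; rewrite preimage_setT.
  rewrite /Rintegral fineK; last by apply: integrable_fin_num.
  by apply: eq_integral => w _; rewrite /pos /= (max_idPl _).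
- by apply: measurable_prodX => i; exact: (ng i).1.
- by move=> w; rewrite prodr_ge0.
- move=> B mB.
  have FB : F (W @^-1` B) by exact: FW.
  transitivity (\int[P]_w (ind (W @^-1` B) g w)%:E)%E.
    by apply: eq_integral => w _; rewrite /ind mulrC !indicE.
  rewrite (prod_ge0_expectation (s := enum I))//; last by move=> i; rewrite mem_enum.
  rewrite EFinM fineK ?fin_num_measure//; last exact: F_meas.
  by rewrite muleC.
- by move=> y; rewrite lee_fin le_max lexx orbT.
Qed.

Lemma nice_pos (g : R -> R) i : nice g i -> nice (fun x => Num.max (g x) 0) i.
Proof.
move=> [mg ig].
have mm : measurable_fun setT (fun x => Num.max (g x) 0) by exact: measurable_maxr.
split=> //; apply: (@le_integrableR _ _ _ (nu i) _ (fun x => `|g x|)) => //.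
- move=> x; rewrite ger0_norm ?le_max ?lexx ?orbT//.
  by rewrite ge_max ler_norm normr_ge0.
- exact: integrable_normR.
Qed.

Lemma niceN (g : R -> R) i : nice g i -> nice (fun x => - g x) i.
Proof.
move=> [mg ig]; split; first exact: measurableT_comp.
have -> : (fun x => - g x) = (fun x => -1 * g x) by apply/funext => x; rewrite mulN1r.
exact: integrableZR.
Qed.

Let goodW (W : T -> R) := forall B : set R, measurable B -> F (W @^-1` B).

(** Sign conditions are dropped one coordinate at a time: [g a] is the difference of its positive
    and negative parts, each covered by the induction hypothesis, and both sides are linear in
    [g a]. *)
Lemma weight_pos_expectation (s : seq I) (g : I -> R -> R) (W : T -> R) :
  (forall i, nice (g i) i) -> (forall i, i \notin s -> forall x, 0 <= g i x) ->
  (forall w, 0 <= W w) -> P.-integrable setT (EFin \o W) -> goodW W ->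
  P.-integrable setT (EFin \o (fun w => W w * \prod_i g i (X i w))) /\
  \int[P]_w (W w * \prod_i g i (X i w)) = \int[P]_w W w * \prod_i \int[nu i]_x g i x.
Proof.
move=> ng gs W0 intW FW.
have mW : measurable_fun setT W by exact/measurable_EFinP/(measurable_int P).
elim: s g ng gs => [|a s IH] g ng gs.
  have g0 i x : 0 <= g i x by exact: gs.
  have E := weight_ge0_expectation ng g0 W0 intW FW.
  split; last by rewrite [LHS]/Rintegral E.
  apply/integrableP; split.
    by apply/measurable_EFinP/measurable_funM => //; apply: measurable_prodX => i; exact: (ng i).1.
  under eq_integral do rewrite /= ger0_norm ?mulr_ge0 ?prodr_ge0//.
  by rewrite E ltry.
pose gp := upd g a (fun x => Num.max (g a x) 0).
pose gm := upd g a (fun x => Num.max (- g a x) 0).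
have ngp i : nice (gp i) i by rewrite /gp /upd; case: eqP => [->|_//]; exact: nice_pos.
have ngm i : nice (gm i) i.
  by rewrite /gm /upd; case: eqP => [->|_//]; apply: nice_pos; exact: niceN.
have [|ip Ep] := IH gp ngp.
  move=> i si x; rewrite /gp /upd; case: eqP => [_|/eqP ia]; first by rewrite le_max lexx orbT.
  by apply: gs; rewrite inE negb_or ia.
have [|im Em] := IH gm ngm.
  move=> i si x; rewrite /gm /upd; case: eqP => [_|/eqP ia]; first by rewrite le_max lexx orbT.
  by apply: gs; rewrite inE negb_or ia.
have gE x : g a x = Num.max (g a x) 0 - Num.max (- g a x) 0.
  by rewrite /Num.max; case: ifPn; case: ifPn; lra.
have E : (fun w => W w * \prod_i g i (X i w)) =
   (fun w => W w * \prod_i gp i (X i w) - W w * \prod_i gm i (X i w)).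
  apply/funext => w; rewrite -mulrBr; congr (_ * _).
  rewrite (bigD1 a)//= [in RHS](bigD1 a)//= [X in _ = _ - X](bigD1 a)//=.
  rewrite /gp /gm {1 3}/upd !eqxx {1}gE mulrBl; congr (_ * _ - _ * _).
    by apply: eq_bigr => i ia; rewrite /upd (negbTE ia).
  by apply: eq_bigr => i ia; rewrite /upd (negbTE ia).
rewrite E; split; first exact: integrableBR.
rewrite RintegralB// Ep Em -mulrBr; congr (_ * _).
rewrite (bigD1 a)//= [X in _ - X](bigD1 a)//= [RHS](bigD1 a)//=.
rewrite /gp /gm {1 3}/upd !eqxx.
have -> : \int[nu a]_x g a x = \int[nu a]_x Num.max (g a x) 0 - \int[nu a]_x Num.max (- g a x) 0.
  rewrite -RintegralB//.
  - by apply: eq_Rintegral => x _; rewrite -gE.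
  - exact: (nice_pos (ng a)).2.
  - exact: (nice_pos (niceN (ng a))).2.
rewrite mulrBl; congr (_ * _ - _ * _).
  by apply: eq_bigr => i ia; rewrite /upd (negbTE ia).
by apply: eq_bigr => i ia; rewrite /upd (negbTE ia).
Qed.

(* [W] plays the role of a bounded random variable of the past [F], which is
   independent of the family [X]. *)
Theorem product_expectation (g : I -> R -> R) (W : T -> R) (M : R) :
  (forall i, measurable_fun setT (g i)) ->
  (forall i, (nu i).-integrable setT (EFin \o g i)) ->
  (forall w, `|W w| <= M) ->
  (forall B : set R, measurable B -> F (W @^-1` B)) ->
  P.-integrable setT (EFin \o (fun w => W w * \prod_i g i (X i w))) /\
  \int[P]_w (W w * \prod_i g i (X i w)) = \int[P]_w W w * \prod_i \int[nu i]_x g i x.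
Proof.
move=> mg ig WM FW.
have ng i : nice (g i) i by split.
have mW : measurable_fun setT W.
  by move=> _ B mB; rewrite setTI; apply: F_meas; exact: FW.
have intW : P.-integrable setT (EFin \o W) by exact: bounded_integrable WM.
have key (V : T -> R) := @weight_pos_expectation (enum I) g V ng.
have ine : forall i, i \notin enum I -> forall x, 0 <= g i x by move=> i; rewrite mem_enum.
(* [W + |M|] and the constant [|M|] are nonnegative weights; their difference is [W]. *)
have [|||i1 E1] := key (fun w => W w + `|M|) ine.
- by move=> w; have /ler_normlP[] := le_trans (WM w) (ler_norm M); lra.
- by apply: integrableDR => //; exact: integrable_cst_prob.
- move=> B mB; rewrite (_ : _ @^-1` B = W @^-1` ((fun x => x + `|M|) @^-1` B))//.
  apply: FW; rewrite -[X in measurable X]setTI.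
  by apply: measurable_funD.
have [|||i2 E2] := key (fun=> `|M|) ine.
- by move=> w.
- exact: integrable_cst_prob.
- by move=> B mB; rewrite preimage_cst; case: ifPn.
have E : (fun w => W w * \prod_i g i (X i w)) =
   (fun w => (W w + `|M|) * \prod_i g i (X i w) - `|M| * \prod_i g i (X i w)).
  by apply/funext => w; ring.
rewrite E; split; first exact: integrableBR.
rewrite RintegralB// E1 E2 -mulrBl; congr (_ * _).
rewrite RintegralD//; last exact: integrable_cst_prob.
by rewrite addrK.
Qed.

End product_expectation.

(** * The heat flow started at a Gaussian bump *)

Section heat.
Context (R : realType) (r : nat) (k : R).
Hypothesis k0 : 0 <= k.

Definition sqs (x : 'I_r -> R) : R := \sum_l x l ^+ 2.

Lemma sqs_ge0 x : 0 <= sqs x. Proof. by apply: sumr_ge0 => l _; exact: sqr_ge0. Qed.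

Let rho : R := r%:R / 2.

Lemma rho_ge0 : 0 <= rho. Proof. by rewrite divr_ge0. Qed.

(* At time s, with tau = 1 + 2 k s, this is the heat flow started at
   exp (- k |x|^2). *)
Definition heat (tau : R) (x : 'I_r -> R) : R := expR (- (rho * ln tau) - k * sqs x / tau).

Lemma expRN_pow1 (z : R) : 0 <= z -> z * expR (- z) <= 1.
Proof.
move=> z0; rewrite expRN ler_pdivrMr ?expR_gt0// mul1r.
by have := expR_ge1Dx z; lra.
Qed.

Lemma expRN_pow2 (z : R) : 0 <= z -> z ^+ 2 * expR (- z) <= 2.
Proof.
move=> z0; rewrite expRN ler_pdivrMr ?expR_gt0//.
by have := expR_ge1Dxn 1 z0; rewrite (_ : 2`! = 2)%N// ; lra.
Qed.

Lemma heat_le (tau : R) x : 1 <= tau -> heat tau x <= expR (- (k * sqs x / tau)).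
Proof.
move=> t1; rewrite ler_expR gerDr oppr_le0 mulr_ge0 ?rho_ge0//.
exact: ln_ge0.
Qed.

Lemma heat_le1 (tau : R) x : 1 <= tau -> heat tau x <= 1.
Proof.
move=> t1; apply: le_trans (heat_le x t1) _; rewrite -[leRHS]expR0 ler_expR oppr_le0.
by rewrite divr_ge0 ?mulr_ge0 ?sqs_ge0// (le_trans ler01).
Qed.

Definition heat_grad (tau : R) (x : 'I_r -> R) (l : 'I_r) : R := - 2 * (k / tau) * x l * heat tau x.
Definition heat_hess (tau : R) (x : 'I_r -> R) (l l' : 'I_r) : R :=
  (4 * (k / tau) ^+ 2 * x l * x l' - 2 * (k / tau) * (l == l')%:R) * heat tau x.

(** Bounds third derivatives along a line: [12] and [8] are [6 * 2] and [2 ^ 3], from the bound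
    [2 Q a] on [q1], while [k ^+ 2 + k] and [k ^+ 3 + 2 k] bound [c ^+ 2 Q] and [c ^+ 3 Q ^+ 3]
    after multiplication by [exp(- c Q ^+ 2)]. *)
Definition taylor_cst : R := 12 * (k ^+ 2 + k) + 8 * (k ^+ 3 + 2 * k).

(** Along the segment from [x] to [x + w] the function is the exponential of a quadratic polynomial,
    so its derivatives are polynomials times itself; Gaussian decay absorbs these polynomials, which
    makes the bound uniform in [x] and in [tau >= 1]. *)
Lemma heat_taylor (tau : R) (x w : 'I_r -> R) : 1 <= tau ->
  `|heat tau (fun l => x l + w l) - heat tau x - \sum_l heat_grad tau x l * w l
    - (\sum_l \sum_l' heat_hess tau x l l' * (w l * w l')) / 2|
  <= taylor_cst * (\sum_l `|w l|) ^+ 3.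
Proof.
move=> t1; have t0 : 0 < tau by rewrite (lt_le_trans ltr01).
pose c := k / tau.
have c0 : 0 <= c by rewrite divr_ge0// ltW.
have ck : c <= k by rewrite ler_pdivrMr// ler_peMr.
pose a := \sum_l `|w l|.
have a0 : 0 <= a by apply: sumr_ge0.
pose p t l := x l + t * w l.
pose q t := sqs (p t).
pose be := \sum_l x l * w l.
pose ga := sqs w.
have qE t : q t = sqs x + 2 * be * t + ga * t ^+ 2.
  rewrite /q /sqs /p /be /ga /sqs [2 * _]mulr_sumr !mulr_suml -!big_split /=.
  by apply: eq_bigr => l _; ring.
pose q1 t := 2 * be + 2 * ga * t.
pose f t := heat tau (p t).
have fE t : f t = expR (- (rho * ln tau)) * expR (- c * (sqs x + 2 * be * t + ga * t ^+ 2)).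
  rewrite -expRD /f /heat -qE; congr expR; rewrite /c /q; field.
  by rewrite gt_eqF.
pose f1 t := (- c * q1 t) * f t.
pose f2 t := (c ^+ 2 * q1 t ^+ 2 - c * (2 * ga)) * f t.
pose f3 t := (6 * c ^+ 2 * q1 t * ga - c ^+ 3 * q1 t ^+ 3) * f t.
have df (t : R) : is_derive t 1 f (f1 t).
  have -> : f = fun t => expR (- (rho * ln tau)) * expR (- c * (sqs x + 2 * be * t + ga * t ^+ 2)).
    by apply/funext => y; exact: fE.
  have d := is_derive_scalef (expR (- (rho * ln tau))) (is_derive_expf (is_derive_scalef (- c)
     (is_derive_addf (is_derive_addf (is_derive_cstf (sqs x) t) (is_derive_scalef (2 * be) (is_derive_idf t)))
        (is_derive_scalef ga (is_derive_powf 2 t))))).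
  by apply: (@is_derive_eq _ _ _ _ _ _ _ _ d); rewrite /f1 fE /q1 /= expr1; ring.
have dq1 (t : R) : is_derive t 1 q1 (2 * ga).
  have d := is_derive_addf (is_derive_cstf (2 * be) t) (is_derive_scalef (2 * ga) (is_derive_idf t)).
  by apply: (@is_derive_eq _ _ _ _ _ _ _ _ d); ring.
have df1 (t : R) : is_derive t 1 f1 (f2 t).
  have d := is_derive_mulf (is_derive_scalef (- c) (dq1 t)) (df t).
  by apply: (@is_derive_eq _ _ _ _ _ _ _ _ d); rewrite /f2 /f1; ring.
have df2 (t : R) : is_derive t 1 f2 (f3 t).
  have dd : is_derive t 1 (fun t => c ^+ 2 * q1 t ^+ 2 + - (c * (2 * ga))) (c ^+ 2 * (2 * (2 * ga * q1 t)) + 0).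
    have dsq := is_derive_mulf (dq1 t) (dq1 t).
    have d := is_derive_addf (is_derive_scalef (c ^+ 2) dsq) (is_derive_cstf (- (c * (2 * ga))) t).
    by apply: (@is_derive_eq _ _ _ _ _ _ _ _ d); ring.
  have d := is_derive_mulf dd (df t).
  by apply: (@is_derive_eq _ _ _ _ _ _ _ _ d); rewrite /f3 /f1; ring.
have f3M (t : R) : `|f3 t| <= taylor_cst * a ^+ 3.
  pose Q := Num.sqrt (q t).
  have Q0 : 0 <= Q by rewrite sqrtr_ge0.
  have QE : Q ^+ 2 = q t by rewrite sqr_sqrtr// sqs_ge0.
  have q1Q : `|q1 t| <= 2 * Q * a.
    have -> : q1 t = 2 * \sum_l p t l * w l.
      rewrite /q1 /be /ga /sqs /p !mulr_sumr mulr_suml -big_split /=.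
      by apply: eq_bigr => l _; ring.
    rewrite normrM ger0_norm// -mulrA ler_wpM2l//.
    apply: (le_trans (ler_norm_sum _ _ _)); rewrite /a mulr_sumr.
    apply: ler_sum => l _; rewrite normrM ler_wpM2r//.
    rewrite -sqrtr_sqr ler_wsqrtr// /q /sqs (bigD1 l)//= lerDl.
    by apply: sumr_ge0 => i _; exact: sqr_ge0.
  have gaa : `|ga| <= a ^+ 2.
    rewrite ger0_norm ?sqs_ge0// expr2 {2}/a mulr_sumr /ga /sqs; apply: ler_sum => l _.
    rewrite -real_normK ?num_real// expr2 ler_wpM2r//.
    by rewrite /a (bigD1 l)//= lerDl; apply: sumr_ge0.
  have f0 : 0 <= f t by exact: expR_ge0.
  have fQ : f t <= expR (- (c * Q ^+ 2)).
    rewrite QE; have := heat_le (p t) t1; rewrite -/(f t) -/(q t).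
    by rewrite /c mulrAC.
  have z0 : 0 <= c * Q ^+ 2 by rewrite mulr_ge0 ?sqr_ge0.
  have e1 := expRN_pow1 z0; have e2 := expRN_pow2 z0.
  set E := expR _ in fQ e1 e2.
  have E1 : E <= 1 by rewrite /E -[leRHS]expR0 ler_expR oppr_le0.
  have E0 : 0 <= E by exact: expR_ge0.
  rewrite /f3 normrM (ger0_norm f0).
  apply: (@le_trans _ _ ((12 * c ^+ 2 * Q + 8 * c ^+ 3 * Q ^+ 3) * a ^+ 3 * E)).
    apply: ler_pM => //; apply: (le_trans (ler_normB _ _)).
    rewrite [leRHS]mulrDl; apply: lerD.
      rewrite 3!normrM (ger0_norm (_ : 0 <= 6))// ger0_norm ?exprn_ge0//.
      rewrite [leRHS](_ : _ = 6 * c ^+ 2 * (2 * Q * a) * a ^+ 2); last by ring.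
      have c60 : 0 <= 6 * c ^+ 2 by rewrite mulr_ge0 ?sqr_ge0.
      by apply: ler_pM => //; [rewrite mulr_ge0|rewrite ler_wpM2l].
    rewrite normrM ger0_norm ?exprn_ge0// normrX.
    rewrite [leRHS](_ : _ = c ^+ 3 * (2 * Q * a) ^+ 3); last by ring.
    rewrite ler_wpM2l ?exprn_ge0// lerXn2r ?nnegrE// !mulr_ge0//.
  rewrite mulrAC ler_wpM2r ?exprn_ge0//.
  have h1 : Q <= 1 + Q ^+ 2 by have := sqr_ge0 (Q - 1); nra.
  have h3 : Q ^+ 3 <= 1 + Q ^+ 4.
    by have := sqr_ge0 (Q ^+ 2 - Q); have := sqr_ge0 (Q ^+ 2 - 1); have := sqr_ge0 (Q - 1); nra.
  have c2 : 0 <= c ^+ 2 by exact: sqr_ge0.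
  have c3 : 0 <= c ^+ 3 by exact: exprn_ge0.
  have ck2 : c ^+ 2 <= k ^+ 2 by rewrite lerXn2r ?nnegrE.
  have ck3 : c ^+ 3 <= k ^+ 3 by rewrite lerXn2r ?nnegrE.
  have g1 : c ^+ 2 * Q * E <= k ^+ 2 + k.
    apply: (@le_trans _ _ (c ^+ 2 * E + c * (c * Q ^+ 2 * E))).
      rewrite [leRHS](_ : _ = c ^+ 2 * (1 + Q ^+ 2) * E); last by ring.
      by rewrite ler_wpM2r// ler_wpM2l.
    apply: lerD; first by rewrite (le_trans _ ck2)// ler_piMr.
    by rewrite (le_trans _ ck)// ler_piMr.
  have g2 : c ^+ 3 * Q ^+ 3 * E <= k ^+ 3 + 2 * k.
    apply: (@le_trans _ _ (c ^+ 3 * E + c * ((c * Q ^+ 2) ^+ 2 * E))).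
      rewrite [leRHS](_ : _ = c ^+ 3 * (1 + Q ^+ 4) * E); last by ring.
      by rewrite ler_wpM2r// ler_wpM2l.
    apply: lerD; first by rewrite (le_trans _ ck3)// ler_piMr.
    by rewrite mulrC ler_pM// mulr_ge0// exprn_ge0.
  rewrite /taylor_cst [leLHS](_ : _ = 12 * (c ^+ 2 * Q * E) + 8 * (c ^+ 3 * Q ^+ 3 * E)); last by ring.
  by apply: lerD; rewrite ler_wpM2l.
have := @taylor3 R f f1 f2 f3 _ (fun t _ => df t) (fun t _ => df1 t) (fun t _ => df2 t) (fun t _ => f3M t).
have p1 : p 1 = (fun l => x l + w l) by apply/funext => l; rewrite /p mul1r.
have p0 : p 0 = x by apply/funext => l; rewrite /p mul0r addr0.
have f10 : f1 0 = \sum_l heat_grad tau x l * w l.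
  rewrite /f1 /q1 mulr0 addr0 /f p0 /heat_grad -/c /be !mulr_sumr mulr_suml.
  by apply: eq_bigr => l _; ring.
have f20 : f2 0 = \sum_l \sum_l' heat_hess tau x l l' * (w l * w l').
  rewrite /f2 /q1 mulr0 addr0 /f p0 /heat_hess -/c.
  transitivity ((4 * c ^+ 2 * be ^+ 2 - 2 * c * ga) * heat tau x); first by ring.
  transitivity (\sum_l ((4 * c ^+ 2 * (x l * w l) * be - 2 * c * w l ^+ 2) * heat tau x)).
    rewrite -mulr_suml sumrB -!mulr_sumr -mulr_suml -mulr_sumr -/be -/ga.
    by rewrite /ga /sqs; ring.
  apply: eq_bigr => l _; rewrite mulrBl {1}/be !mulr_sumr mulr_suml.
  rewrite (_ : 2 * c * w l ^+ 2 * heat tau x =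
     \sum_l' 2 * c * (l == l')%:R * heat tau x * (w l * w l')).
    by rewrite -sumrB; apply: eq_bigr => l' _; ring.
  rewrite (bigD1 l)//= big1 ?addr0; last by move=> i /negbTE il; rewrite eq_sym il !(mulr0, mul0r).
  by rewrite eqxx mulr1; ring.
by rewrite f10 f20 /f p1 p0.
Qed.

Lemma coord_sqs (x : 'I_r -> R) l : x l ^+ 2 <= sqs x.
Proof.
rewrite /sqs (bigD1 l)//= lerDl.
by apply: sumr_ge0 => i _; exact: sqr_ge0.
Qed.

Lemma heat_grad_bound (tau : R) (x : 'I_r -> R) l : 1 <= tau ->
  `|heat_grad tau x l| <= 2 * (k / tau + 1).
Proof.
move=> t1; have t0 : 0 < tau by rewrite (lt_le_trans ltr01).
have := heat_le x t1; rewrite mulrAC /heat_grad; set c := k / tau; set E := expR _ => hE.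
have c0 : 0 <= c by rewrite divr_ge0// ltW.
have z0 : 0 <= c * sqs x by rewrite mulr_ge0 ?sqs_ge0.
have e1 := expRN_pow1 z0; rewrite -/E in e1.
have E1 : E <= 1 by rewrite /E -[leRHS]expR0 ler_expR oppr_le0.
have h0 : 0 <= heat tau x by exact: expR_ge0.
have xq := coord_sqs x l.
have ax : `|x l| <= 1 + sqs x.
  by rewrite ler_norml; apply/andP; split; have := sqr_ge0 (x l - 1); have := sqr_ge0 (x l + 1); nra.
rewrite (_ : - 2 * c * x l * heat tau x = - (2 * (c * (x l * heat tau x)))); last by ring.
clearbody c.
rewrite normrN !normrM (ger0_norm c0) (ger0_norm h0) ger0_norm// ler_wpM2l//.
apply: (@le_trans _ _ (c * ((1 + sqs x) * E))).
  by rewrite ler_wpM2l// ler_pM.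
rewrite (_ : c * _ = c * E + c * sqs x * E); last by ring.
by rewrite lerD// ler_piMr.
Qed.

Lemma heat_hess_bound (tau : R) (x : 'I_r -> R) l l' : 1 <= tau ->
  `|heat_hess tau x l l'| <= 6 * (k / tau).
Proof.
move=> t1; have t0 : 0 < tau by rewrite (lt_le_trans ltr01).
have := heat_le x t1; rewrite mulrAC /heat_hess; set c := k / tau; set E := expR _ => hE.
have c0 : 0 <= c by rewrite divr_ge0// ltW.
have z0 : 0 <= c * sqs x by rewrite mulr_ge0 ?sqs_ge0.
have e1 := expRN_pow1 z0; rewrite -/E in e1.
have E0 : 0 <= E by exact: expR_ge0.
have E1 : E <= 1 by rewrite /E -[leRHS]expR0 ler_expR oppr_le0.
have h0 : 0 <= heat tau x by exact: expR_ge0.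
have xq := coord_sqs x l; have xq' := coord_sqs x l'.
have ax : `|x l * x l'| <= sqs x.
  by rewrite ler_norml; apply/andP; split; have := sqr_ge0 (x l - x l'); have := sqr_ge0 (x l + x l'); nra.
rewrite normrM (ger0_norm h0).
apply: (@le_trans _ _ ((4 * c ^+ 2 * sqs x + 2 * c) * E)).
  apply: ler_pM => //; apply: (le_trans (ler_normB _ _)); apply: lerD.
    have c40 : 0 <= 4 * c ^+ 2 by rewrite mulr_ge0 ?sqr_ge0.
    by rewrite -mulrA normrM (ger0_norm c40) ler_wpM2l.
  have c20 : 0 <= 2 * c by rewrite mulr_ge0.
  by rewrite normrM (ger0_norm c20) ler_piMr//; case: (l == l'); rewrite ?normr1 ?normr0.
rewrite (_ : _ * E = 4 * c * (c * sqs x * E) + 2 * c * E); last by ring.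
rewrite [leRHS](_ : _ = 4 * c + 2 * c); last by ring.
clearbody c; by apply: lerD; rewrite ler_piMr// ?mulr_ge0.
Qed.

(** With [A = k |x|^2 / tau] the second derivative in [tau] is at most [(rho + 2 A + A^2 + 2 rho A +
    rho^2) exp(-A)], where [A exp(-A) <= 1] and [A^2 exp(-A) <= 2]. *)
Definition time_cst : R := 4 + 3 * rho + rho ^+ 2.

(** The bracket is the derivative in [tau]. By the heat equation [2 k] times it is half the trace of
    [heat_hess]; this is what cancels the second-order Taylor term of a random increment. *)
Lemma heat_time (tau eta : R) (x : 'I_r -> R) : 1 <= tau -> 0 <= eta ->
  `|heat (tau + eta) x - heat tau x - eta * ((k * sqs x / tau ^+ 2 - rho / tau) * heat tau x)|
  <= time_cst * eta ^+ 2.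
Proof.
move=> t1 e0; pose a := k * sqs x.
have a0 : 0 <= a by rewrite mulr_ge0// sqs_ge0.
have rho0 := rho_ge0.
pose T t := tau + eta * t.
pose g u := a / u ^+ 2 - rho / u.
pose f t := heat (T t) x.
pose f1 t := eta * (g (T t) * f t).
pose f2 t := eta ^+ 2 * ((rho / T t ^+ 2 - 2 * a / T t ^+ 3 + g (T t) ^+ 2) * f t).
have T1 (t : R) : 0 <= t <= 1 -> 1 <= T t.
  by move=> /andP[t00 _]; rewrite /T (le_trans t1)// lerDl mulr_ge0.
have T0 (t : R) : 0 <= t <= 1 -> 0 < T t.
  by move=> t01; rewrite (lt_le_trans ltr01)// T1.
have dT (t : R) : is_derive t 1 T eta.
  have d := is_derive_addf (is_derive_cstf tau t) (is_derive_scalef eta (is_derive_idf t)).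
  by apply: (@is_derive_eq _ _ _ _ _ _ _ _ d); ring.
have dTV (t : R) : 0 <= t <= 1 -> is_derive t 1 (fun y => (T y)^-1) (- eta / T t ^+ 2).
  move=> t01; have h : T t != 0 by rewrite gt_eqF// T0.
  apply: (@is_derive_eq _ _ _ _ _ _ _ _ (is_deriveV h (dT t))).
  by rewrite /GRing.scale /=; ring.
have df (t : R) : 0 <= t <= 1 -> is_derive t 1 f (f1 t).
  move=> t01; have dln := is_derive_compf (is_derive1_ln (T0 t t01)) (dT t).
  have d := is_derive_expf (is_derive_addf (is_derive_scalef (- rho) dln) (is_derive_scalef (- a) (dTV t t01))).
  have -> : f = fun y => expR (- rho * ln (T y) + - a * (T y)^-1).
    by apply/funext => y; rewrite /f /heat mulNr mulNr.
  apply: (@is_derive_eq _ _ _ _ _ _ _ _ d); rewrite /f1 /f /heat /g -/a !mulNr.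
  by field; rewrite gt_eqF// T0.
have dg (t : R) : 0 <= t <= 1 -> is_derive t 1 (fun y => g (T y)) (eta * (rho / T t ^+ 2 - 2 * a / T t ^+ 3)).
  move=> t01.
  have d := is_derive_addf (is_derive_scalef a (is_derive_mulf (dTV t t01) (dTV t t01))) (is_derive_scalef (- rho) (dTV t t01)).
  have -> : (fun y => g (T y)) = fun y => a * ((T y)^-1 * (T y)^-1) + (- rho) * (T y)^-1.
    by apply/funext => y; rewrite /g mulNr expr2 invfM.
  by apply: (@is_derive_eq _ _ _ _ _ _ _ _ d); field; rewrite gt_eqF// T0.
have df1 (t : R) : 0 <= t <= 1 -> is_derive t 1 f1 (f2 t).
  move=> t01; have d := is_derive_scalef eta (is_derive_mulf (dg t t01) (df t t01)).
  by apply: (@is_derive_eq _ _ _ _ _ _ _ _ d); rewrite /f2 /f1; ring.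
have f2M (t : R) : 0 <= t <= 1 -> `|f2 t| <= time_cst * eta ^+ 2.
  move=> t01; have Tt1 := T1 t t01; have Tt0 := T0 t t01.
  rewrite /f2 normrM ger0_norm ?sqr_ge0// mulrC ler_wpM2r ?sqr_ge0//.
  pose A := a / T t.
  have A0 : 0 <= A by rewrite divr_ge0// ltW.
  have V0 : 0 <= (T t)^-1 by rewrite invr_ge0 ltW.
  have V1 : (T t)^-1 <= 1 by rewrite invf_le1.
  set V := (T t)^-1 in V0 V1.
  have f0 : 0 <= f t by exact: expR_ge0.
  have fA : f t <= expR (- A) by exact: (heat_le x Tt1).
  have e1 := expRN_pow1 A0; have e2 := expRN_pow2 A0.
  set E := expR _ in fA e1 e2.
  have E1 : E <= 1 by rewrite /E -[leRHS]expR0 ler_expR oppr_le0.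
  have E0 : 0 <= E by exact: expR_ge0.
  rewrite normrM (ger0_norm f0).
  have -> : rho / T t ^+ 2 - 2 * a / T t ^+ 3 + g (T t) ^+ 2 = V ^+ 2 * (rho - 2 * A + (A - rho) ^+ 2).
    by rewrite /g /V /A; field; rewrite gt_eqF.
  rewrite normrM ger0_norm ?sqr_ge0//.
  have V2 : V ^+ 2 <= 1 by rewrite exprn_ile1.
  apply: (@le_trans _ _ ((rho + 2 * A + (A ^+ 2 + 2 * rho * A + rho ^+ 2)) * E)).
    apply: ler_pM => //; first by rewrite mulr_ge0 ?sqr_ge0.
    rewrite -[leRHS]mul1r ler_pM ?sqr_ge0//.
    have rA : 0 <= rho * A by rewrite mulr_ge0.
    by rewrite ler_norml; apply/andP; split; nra.
  have rE : rho * E <= rho by rewrite ler_piMr.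
  have r2E : rho ^+ 2 * E <= rho ^+ 2 by rewrite ler_piMr// sqr_ge0.
  have rAE : rho * (A * E) <= rho by rewrite ler_piMr.
  rewrite /time_cst [leLHS](_ : _ = rho * E + 2 * (A * E) + (A ^+ 2 * E + 2 * (rho * (A * E)) + rho ^+ 2 * E)); last by ring.
  lra.
have := @taylor2 R f f1 f2 _ df df1 f2M.
by rewrite /f1 /f /T mulr1 mulr0 addr0 /g -/a.
Qed.

End heat.

Lemma ln_sqrt (R : realType) (a : R) : 0 < a -> ln a = 2 * ln (Num.sqrt a).
Proof.
move=> a0; have s0 : 0 < Num.sqrt a by rewrite sqrtr_gt0.
by rewrite mulr_natl -lnXn// sqr_sqrtr// ltW.
Qed.

(** * One-step replacement and telescoping *)

Section lindeberg.
Context (R : realType) d (T : measurableType d) (P : probability T R).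
Variables (r n : nat) (k C : R).
Hypotheses (k0 : 0 <= k) (n0 : (0 < n)%N) (C0 : 0 <= C).
Variables (v : nat -> 'I_r -> T -> R) (G : nat -> set (set T)).
Hypothesis G_sigma : forall i, sigma_algebra setT (G i).
Hypothesis G_meas : forall i, G i `<=` measurable.

Let S (m : nat) (l : 'I_r) (w : T) : R := \sum_(i < m) v i l w.

Hypothesis v_past : forall m i l, (i < m)%N -> (m <= n)%N ->
  measurable_fun setT (v i l : g_sigma_algebraType (G m) -> R).

(** Testing against all these weights stands for conditioning on [G i]: [v_mean] and [v_cov] below
    say that [v i] has conditional mean zero and conditional identity covariance. *)
Let past (i : nat) (W : T -> R) : Prop :=
  (exists M : R, forall w, `|W w| <= M) /\
  forall B : set R, measurable B -> G i (W @^-1` B).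

Hypothesis v_meas : forall i l, (i < n)%N -> measurable_fun setT (v i l).
Hypothesis v_mean : forall i l W, (i < n)%N -> past i W ->
  P.-integrable setT (EFin \o (fun w => W w * v i l w)) /\
  \int[P]_w (W w * v i l w) = 0.
Hypothesis v_cov : forall i l l' W, (i < n)%N -> past i W ->
  P.-integrable setT (EFin \o (fun w => W w * (v i l w * v i l' w))) /\
  \int[P]_w (W w * (v i l w * v i l' w)) = (l == l')%:R * \int[P]_w W w.
Hypothesis v_third : forall i, (i < n)%N ->
  P.-integrable setT (EFin \o (fun w => (\sum_l `|v i l w|) ^+ 3)) /\
  \int[P]_w ((\sum_l `|v i l w|) ^+ 3) <= C.

Let s : R := Num.sqrt n%:R.
Let s0 : 0 < s. Proof. by rewrite sqrtr_gt0 ltr0n. Qed.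
Let s2 : s ^+ 2 = n%:R. Proof. by rewrite sqr_sqrtr. Qed.

Let x (m : nat) (w : T) (l : 'I_r) : R := s^-1 * S m l w.
(** Encodes the heat time left after [m] of [n] steps: with none left the mean of [heat] is the
    Laplace transform to be estimated, and with all of it left it is the Gaussian value at the
    origin. *)
Let tau (m : nat) : R := 1 + 2 * k * (n - m)%:R / n%:R.

Let tau1 m : 1 <= tau m.
Proof. by rewrite /tau lerDl divr_ge0 ?mulr_ge0. Qed.

Let S_past m l : (m <= n)%N ->
  measurable_fun setT (S m l : g_sigma_algebraType (G m) -> R).
Proof.
move=> mn; rewrite (_ : (S m l : g_sigma_algebraType (G m) -> R) =
  fun w => \sum_(i < m) (v i l : g_sigma_algebraType (G m) -> R) w)//.
by apply: measurable_sum => i; exact: v_past.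
Qed.

Let past_fun m (Phi : ('I_r -> R) -> R) (M : R) : (m <= n)%N ->
  (forall w, `|Phi (x m w)| <= M) ->
  measurable_fun setT (fun w : g_sigma_algebraType (G m) => Phi (x m w)) ->
  past m (fun w => Phi (x m w)).
Proof.
move=> mn PM mP; split; first by exists M.
move=> B mB; have := mP measurableT B mB; rewrite setTI.
by rewrite /measurable /= (sigma_algebra_id (G_sigma m)).
Qed.

Let measurable_x m l : (m <= n)%N ->
  measurable_fun setT (fun w : g_sigma_algebraType (G m) => x m w l).
Proof. by move=> mn; apply: measurable_funM => //; exact: S_past. Qed.

Let measurable_sqs m : (m <= n)%N ->
  measurable_fun setT (fun w : g_sigma_algebraType (G m) => sqs (x m w)).
Proof.
move=> mn; rewrite /sqs; apply: measurable_sum => l.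
by apply: measurable_funX; exact: measurable_x.
Qed.

Let measurable_heat m t : (m <= n)%N ->
  measurable_fun setT (fun w : g_sigma_algebraType (G m) => heat k t (x m w)).
Proof.
move=> mn; apply: measurableT_comp => //; apply: measurable_funB => //.
apply: measurable_funM => //; apply: measurable_funM => //.
exact: measurable_sqs.
Qed.

Let GT m (f : T -> R) : measurable_fun setT (f : g_sigma_algebraType (G m) -> R) ->
  measurable_fun setT f.
Proof.
move=> mf _ B mB; apply: (@G_meas m).
by have := mf measurableT B mB; rewrite /measurable /= (sigma_algebra_id (G_sigma m)).
Qed.

Let past_grad m t l : (m <= n)%N -> 1 <= t -> past m (fun w => heat_grad k t (x m w) l).
Proof.
move=> mn t1; apply: (@past_fun m (fun y => heat_grad k t y l) (2 * (k / t + 1))) => //.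
  by move=> w; exact: heat_grad_bound.
apply: measurable_funM; last exact: measurable_heat.
by apply: measurable_funM => //; exact: measurable_x.
Qed.

Let past_hess m t l l' : (m <= n)%N -> 1 <= t -> past m (fun w => heat_hess k t (x m w) l l').
Proof.
move=> mn t1; apply: (@past_fun m (fun y => heat_hess k t y l l') (6 * (k / t))) => //.
  by move=> w; exact: heat_hess_bound.
apply: measurable_funM; last exact: measurable_heat.
apply: measurable_funB => //; apply: measurable_funM; last exact: measurable_x.
by apply: measurable_funM => //; exact: measurable_x.
Qed.

Let int_heat m t : (m <= n)%N -> 1 <= t ->
  P.-integrable setT (EFin \o (fun w => heat k t (x m w))).
Proof.
move=> mn t1; apply: (@bounded_integrable _ _ _ _ _ 1).
  by apply: (@GT m); exact: measurable_heat.
by move=> w; rewrite ger0_norm ?expR_ge0// heat_le1.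
Qed.

Let A m := \int[P]_w heat k (tau m) (x m w).

Definition lindeberg_cst : R := taylor_cst k * C + time_cst R r * (4 * k ^+ 2).

(** A heat step of duration [1 / n] is exchanged for the increment [v m / s]. Both have the same
    second-order effect in the mean; the remainders are of order [s ^ (-3)] and [n ^ (-2)]. *)
Let step m : (m < n)%N -> `|A m.+1 - A m| <= lindeberg_cst / (s * n%:R).
Proof.
move=> mn; have mn' := ltnW mn.
pose t := tau m.+1; pose eta := 2 * k / n%:R.
have n00 : n%:R != 0 :> R by rewrite pnatr_eq0 -lt0n.
have nR0 : 0 < n%:R :> R by rewrite ltr0n.
have eta0 : 0 <= eta by rewrite divr_ge0 ?mulr_ge0.
have t1 : 1 <= t := tau1 m.+1.
have tE : tau m = t + eta.
  rewrite /t /tau /eta !natrB//.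
  by rewrite -[m.+1%:R]natr1; field.
(* The first- and second-order Taylor terms, the latter recentred by the covariance: every summand
   has mean zero. The recentring terms add up to [eta] times the time derivative. *)
pose D w := \sum_l s^-1 * (heat_grad k t (x m w) l * v m l w) +
  2^-1 * (\sum_l \sum_l' (n%:R^-1 * (heat_hess k t (x m w) l l' * (v m l w * v m l' w))
     - n%:R^-1 * (l == l')%:R * heat_hess k t (x m w) l l')).
have intg l : P.-integrable setT (EFin \o (fun w => s^-1 * (heat_grad k t (x m w) l * v m l w))) /\
    \int[P]_w (s^-1 * (heat_grad k t (x m w) l * v m l w)) = 0.
  have [i1 E1] := v_mean l mn (past_grad l mn' t1).
  split; first exact: integrableZR.
  by rewrite RintegralZl// E1 mulr0.
have bint W : past m W -> P.-integrable setT (EFin \o W).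
  move=> [[M WM] WB]; apply: (@bounded_integrable _ _ _ _ W M) => //.
  by move=> _ B mB; rewrite setTI; apply: (@G_meas m); exact: WB.
have inth l l' : P.-integrable setT (EFin \o (fun w => n%:R^-1 * (heat_hess k t (x m w) l l' * (v m l w * v m l' w))
     - n%:R^-1 * (l == l')%:R * heat_hess k t (x m w) l l')) /\
   \int[P]_w (n%:R^-1 * (heat_hess k t (x m w) l l' * (v m l w * v m l' w))
     - n%:R^-1 * (l == l')%:R * heat_hess k t (x m w) l l') = 0.
  have ph := past_hess l l' mn' t1.
  have [i1 E1] := v_cov l l' mn ph.
  have i2 := bint _ ph.
  split; first by apply: integrableBR; exact: integrableZR.
  rewrite RintegralB//; try exact: integrableZR.
  by rewrite !RintegralZl// E1 mulrA subrr.
have [iD1 ED1] := @integrable_sumR _ _ _ P _ (index_enum 'I_r) xpredT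
  (fun l w => s^-1 * (heat_grad k t (x m w) l * v m l w)) (fun l _ => (intg l).1).
have [iD2 ED2] := @integrable_sumR _ _ _ P _ (index_enum 'I_r) xpredT _
  (fun l _ => (@integrable_sumR _ _ _ P _ (index_enum 'I_r) xpredT _ (fun l' _ => (inth l l').1)).1).
have [intD ED] : P.-integrable setT (EFin \o D) /\ \int[P]_w D w = 0.
  split; first by apply: integrableDR => //; exact: integrableZR.
  rewrite RintegralD//; last exact: integrableZR.
  rewrite RintegralZl// ED1 ED2 big1 ?add0r; last by move=> l _; exact: (intg l).2.
  rewrite big1 ?mulr0// => l _.
  rewrite (@integrable_sumR _ _ _ P _ (index_enum 'I_r) xpredT _ (fun l' _ => (inth l l').1)).2.
  by rewrite big1// => l' _; exact: (inth l l').2.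
have [iv3 Ev3] := v_third mn.
pose h w := s ^- 3 * taylor_cst k * (\sum_l `|v m l w|) ^+ 3 + time_cst R r * eta ^+ 2.
have inth' : P.-integrable setT (EFin \o h).
  by apply: integrableDR; [exact: integrableZR|exact: integrable_cst_prob].
have iA1 := int_heat mn t1.
have iA0 : P.-integrable setT (EFin \o (fun w => heat k (t + eta) (x m w))).
  by apply: int_heat => //; rewrite -tE; exact: tau1.
have -> : A m.+1 - A m = \int[P]_w heat k t (x m.+1 w) - \int[P]_w (heat k (t + eta) (x m w) + D w).
  by rewrite /A -/t tE (RintegralD measurableT iA0 intD) ED addr0.
apply: (@le_trans _ _ (\int[P]_w h w)).
  apply: Rintegral_dist => //; first exact: integrableDR.
  move=> w.
  have xE : x m.+1 w = fun l => x m w l + s^-1 * v m l w.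
    by apply/funext => l; rewrite /x /S big_ord_recr /= mulrDr.
  have h1 := heat_taylor k0 (x m w) (fun l => s^-1 * v m l w) t1.
  have h2 := heat_time k0 (x m w) t1 eta0.
  have -> : heat k t (x m.+1 w) - (heat k (t + eta) (x m w) + D w) =
   (heat k t (fun l => x m w l + s^-1 * v m l w) - heat k t (x m w) -
     \sum_l heat_grad k t (x m w) l * (s^-1 * v m l w) -
     (\sum_l \sum_l' heat_hess k t (x m w) l l' * ((s^-1 * v m l w) * (s^-1 * v m l' w))) / 2) -
   (heat k (t + eta) (x m w) - heat k t (x m w) -
     eta * ((k * sqs (x m w) / t ^+ 2 - r%:R / 2 / t) * heat k t (x m w))).
    have e1 : \sum_l heat_grad k t (x m w) l * (s^-1 * v m l w) =
        \sum_l s^-1 * (heat_grad k t (x m w) l * v m l w).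
      by apply: eq_bigr => l _; ring.
    have e2 : \sum_l \sum_l' heat_hess k t (x m w) l l' * ((s^-1 * v m l w) * (s^-1 * v m l' w)) =
       \sum_l \sum_l' n%:R^-1 * (heat_hess k t (x m w) l l' * (v m l w * v m l' w)).
      apply: eq_bigr => l _; apply: eq_bigr => l' _; rewrite -s2 -exprVn; ring.
    have e3 : \sum_l \sum_l' n%:R^-1 * (l == l')%:R * heat_hess k t (x m w) l l' =
        2 * (eta * ((k * sqs (x m w) / t ^+ 2 - r%:R / 2 / t) * heat k t (x m w))).
      transitivity (\sum_l n%:R^-1 * ((4 * (k / t) ^+ 2 * x m w l ^+ 2 - 2 * (k / t)) * heat k t (x m w))).
        apply: eq_bigr => l _; rewrite (bigD1 l)//= big1 ?addr0; last first.
          by move=> i /negbTE il; rewrite eq_sym il !(mulr0, mul0r).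
        by rewrite eqxx /heat_hess eqxx !mulr1; ring.
      rewrite -mulr_sumr -mulr_suml sumrB -mulr_sumr sumr_const card_ord -/(sqs _).
      rewrite -mulr_natr /eta; field.
      by rewrite n00 gt_eqF// (lt_le_trans ltr01).
    rewrite xE e1 e2 /D.
    under [X in 2^-1 * X]eq_bigr do rewrite sumrB.
    rewrite sumrB e3; set Q := eta * _; set S1 := \sum_l _; set S2 := \sum_l _.
    by clearbody Q S1 S2; field.
  apply: (le_trans (ler_normB _ _)); apply: lerD => //.
  apply: (le_trans h1); rewrite le_eqVlt; apply/orP; left; apply/eqP.
  under eq_bigr do rewrite normrM.
  rewrite -mulr_sumr exprMn ger0_norm ?invr_ge0 ?(ltW s0)// exprVn; ring.
rewrite /h RintegralD//; last 2 first.
- exact: integrableZR.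
- exact: integrable_cst_prob.
rewrite Rintegral_cst_prob RintegralZl//.
have tc0 : 0 <= taylor_cst k.
  by rewrite /taylor_cst addr_ge0// mulr_ge0// addr_ge0// ?exprn_ge0// mulr_ge0.
have sn1 : s ^- 3 = (s * n%:R)^-1 by rewrite -s2 -exprS.
have s1 : 1 <= s by rewrite /s -[leLHS]sqrtr1 ler_wsqrtr// ler1n.
rewrite /lindeberg_cst [leRHS]mulrDl; apply: lerD.
  rewrite sn1 -[leLHS]mulrA [leRHS]mulrC.
  rewrite ler_wpM2l ?invr_ge0 ?mulr_ge0 ?(ltW s0)//.
  by rewrite ler_wpM2l.
have tm0 : 0 <= time_cst R r.
  by rewrite /time_cst !addr_ge0 ?sqr_ge0// mulr_ge0// divr_ge0.
rewrite -mulrA ler_wpM2l// /eta expr_div_n exprMn (_ : 2 ^+ 2 = 4); last by ring.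
rewrite ler_wpM2l ?mulr_ge0 ?sqr_ge0//.
rewrite lef_pV2 ?posrE ?mulr_gt0 ?exprn_gt0// expr2 ler_wpM2r//.
by rewrite -s2 expr2 ler_peMr// ltW.
Qed.

(** The [n] replacement errors, each of order [n ^ (-3/2)], telescope from [A 0] to [A n]. *)
Theorem lindeberg_laplace :
  `|\int[P]_w expR (- (k * \sum_l ((Num.sqrt n%:R)^-1 * \sum_(i < n) v i l w) ^+ 2))
    - (Num.sqrt (1 + 2 * k))^-1 ^+ r| <= lindeberg_cst / Num.sqrt n%:R.
Proof.
have n00 : n%:R != 0 :> R by rewrite pnatr_eq0 -lt0n.
have nR0 : 0 < n%:R :> R by rewrite ltr0n.
have -> : \int[P]_w expR (- (k * \sum_l ((Num.sqrt n%:R)^-1 * \sum_(i < n) v i l w) ^+ 2)) = A n.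
  apply: eq_Rintegral => w _; rewrite /heat /tau subnn mulr0 mul0r addr0 ln1 mulr0 oppr0 add0r divr1.
  by [].
have -> : (Num.sqrt (1 + 2 * k))^-1 ^+ r = A 0.
  have t0 : 0 < 1 + 2 * k by rewrite ltr_pwDl// mulr_ge0.
  rewrite /A; under eq_Rintegral => w _.
    rewrite (_ : heat k (tau 0) (x 0 w) = (Num.sqrt (1 + 2 * k))^-1 ^+ r); first over.
    rewrite /heat (_ : sqs (x 0 w) = 0); last first.
      by apply: big1 => l _; rewrite /x /S big_ord0 mulr0 expr0n.
    rewrite mulr0 mul0r subr0 /tau subn0 mulfK//.
    rewrite -[in RHS](lnK (_ : Num.sqrt (1 + 2 * k) \is Num.pos)) ?posrE ?sqrtr_gt0//.
    rewrite -expRN -expRM_natl; congr expR.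
    by rewrite (ln_sqrt t0); field.
  by rewrite Rintegral_cst_prob.
have tel m : (m <= n)%N -> `|A m - A 0| <= m%:R * (lindeberg_cst / (s * n%:R)).
  elim: m => [_|m IH mn]; first by rewrite subrr normr0 mul0r.
  rewrite -(subrK (A m) (A m.+1)) -addrA -[m.+1%:R]nat1r mulrDl mul1r.
  apply: (le_trans (ler_normD _ _)); apply: lerD; first exact: step.
  by apply: IH; exact: ltnW.
apply: (le_trans (tel n (leqnn n))); rewrite le_eqVlt; apply/orP; left; apply/eqP.
by rewrite -/s; field; rewrite n00 gt_eqF.
Qed.

End lindeberg.

(** * Positive definite matrices and the Kullback-Leibler divergence *)

Section l1norm.
Context (R : realType).

(** The entrywise [l1] norm: submultiplicative, invariant under transposition and additive over
    blocks, which suits inductions on block decompositions. *)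
Definition n1 m n (A : 'M[R]_(m, n)) : R := \sum_i \sum_j `|A i j|.

Lemma n1_ge0 m n (A : 'M[R]_(m, n)) : 0 <= n1 A.
Proof. by apply: sumr_ge0 => i _; apply: sumr_ge0. Qed.

Lemma n10 m n : n1 (0 : 'M[R]_(m, n)) = 0.
Proof. by apply: big1 => i _; apply: big1 => j _; rewrite mxE normr0. Qed.

Lemma n1_entry m n (A : 'M[R]_(m, n)) i j : `|A i j| <= n1 A.
Proof.
rewrite /n1 (bigD1 i)//= (bigD1 j)//= -addrA lerDl addr_ge0//.
  exact: sumr_ge0.
by apply: sumr_ge0 => k _; apply: sumr_ge0.
Qed.

Lemma n1_eq0 m n (A : 'M[R]_(m, n)) : n1 A = 0 -> A = 0.
Proof.
move=> A0; apply/matrixP => i j; rewrite mxE; apply/eqP.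
by rewrite -normr_le0 -A0 n1_entry.
Qed.

Lemma n1D m n (A B : 'M[R]_(m, n)) : n1 (A + B) <= n1 A + n1 B.
Proof.
rewrite /n1 -big_split; apply: ler_sum => i _; rewrite -big_split.
by apply: ler_sum => j _; rewrite mxE ler_normD.
Qed.

Lemma n1N m n (A : 'M[R]_(m, n)) : n1 (- A) = n1 A.
Proof. by apply: eq_bigr => i _; apply: eq_bigr => j _; rewrite mxE normrN. Qed.

Lemma n1B m n (A B : 'M[R]_(m, n)) : n1 (A - B) <= n1 A + n1 B.
Proof. by rewrite (le_trans (n1D _ _))// n1N. Qed.

Lemma n1Z m n (c : R) (A : 'M[R]_(m, n)) : n1 (c *: A) = `|c| * n1 A.
Proof.
rewrite /n1 mulr_sumr; apply: eq_bigr => i _; rewrite mulr_sumr.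
by apply: eq_bigr => j _; rewrite mxE normrM.
Qed.

Lemma n1_sum m n I (s : seq I) (F : I -> 'M[R]_(m, n)) :
  n1 (\sum_(i <- s) F i) <= \sum_(i <- s) n1 (F i).
Proof.
elim/big_ind2: _ => [|x a y b xa yb|i _] //; first by rewrite n10.
by rewrite (le_trans (n1D _ _))// lerD.
Qed.

Lemma n1M m n p (A : 'M[R]_(m, n)) (B : 'M[R]_(n, p)) :
  n1 (A *m B) <= n1 A * n1 B.
Proof.
rewrite {1}/n1.
apply: (@le_trans _ _ (\sum_i \sum_k \sum_j (`|A i j| * `|B j k|))).
  apply: ler_sum => i _; apply: ler_sum => k _; rewrite mxE.
  by rewrite (le_trans (ler_norm_sum _ _ _))//; apply: ler_sum => j _; rewrite normrM.
rewrite /n1 mulr_suml; apply: ler_sum => i _; rewrite exchange_big /= mulr_suml.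
apply: ler_sum => j _; rewrite -mulr_sumr ler_wpM2l//.
rewrite [leRHS](bigD1 j)//= lerDl.
by apply: sumr_ge0 => k _; apply: sumr_ge0.
Qed.

Lemma n1_tr m n (A : 'M[R]_(m, n)) : n1 A^T = n1 A.
Proof.
rewrite /n1 exchange_big; apply: eq_bigr => i _; apply: eq_bigr => j _.
by rewrite mxE.
Qed.

Lemma n1_1 n : n1 (1%:M : 'M[R]_n) = n%:R.
Proof.
rewrite /n1 -[n in RHS]card_ord -sumr_const; apply: eq_bigr => i _.
rewrite (bigD1 i)//= big1 ?addr0 ?mxE ?eqxx ?normr1// => j ji.
by rewrite mxE eq_sym (negbTE ji) normr0.
Qed.

Lemma trace_n1 n (A : 'M[R]_n) : `|\tr A| <= n1 A.
Proof.
rewrite /mxtrace (le_trans (ler_norm_sum _ _ _))//; apply: ler_sum => i _.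
by rewrite (bigD1 i)//= lerDl; apply: sumr_ge0.
Qed.

Lemma n1_block m1 m2 p1 p2 (A : 'M[R]_(m1, p1)) (B : 'M[R]_(m1, p2))
    (C : 'M[R]_(m2, p1)) (D : 'M[R]_(m2, p2)) :
  n1 (block_mx A B C D) = n1 A + n1 B + (n1 C + n1 D).
Proof.
rewrite /n1 big_split_ord /= -!big_split /=; congr (_ + _).
  apply: eq_bigr => i _; rewrite big_split_ord /=.
  by congr (_ + _); apply: eq_bigr => j _; rewrite ?block_mxEul ?block_mxEur.
apply: eq_bigr => i _; rewrite big_split_ord /=.
by congr (_ + _); apply: eq_bigr => j _; rewrite ?block_mxEdl ?block_mxEdr.
Qed.

End l1norm.

(** * Schur complements and roots of positive definite matrices *)

Section schur.
Context (R : realType).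
Implicit Types n : nat.

Definition qf n (A : 'M[R]_n) (x : 'cV[R]_n) : R := (x^T *m A *m x) 0 0.

Definition schur n (A : 'M[R]_(1 + n)) : 'M[R]_n :=
  drsubmx A - (A 0 0)^-1 *: (dlsubmx A *m ursubmx A).

Lemma schur_decomp n (A : 'M[R]_(1 + n)) : A 0 0 != 0 ->
  A = block_mx 1%:M 0 ((A 0 0)^-1 *: dlsubmx A) 1%:M *m
      block_mx (A 0 0)%:M (ursubmx A) 0 (schur A).
Proof.
move=> a0; rewrite mulmx_block !mul1mx !mul0mx ?mulmx0 !addr0 ?add0r.
rewrite -[LHS]submxK; congr block_mx.
- rewrite [LHS]mx11_scalar !mxE; congr (A _ _)%:M; exact: val_inj.
- by rewrite mul_mx_scalar scalerA divff// scale1r.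
- by rewrite /schur -scalemxAl addrC subrK.
Qed.

Lemma det_schur n (A : 'M[R]_(1 + n)) : A 0 0 != 0 ->
  \det A = A 0 0 * \det (schur A).
Proof.
move=> a0; rewrite {1}(schur_decomp a0) det_mulmx det_lblock det_ublock.
by rewrite !det1 !mul1r det_scalar1.
Qed.

Lemma sym_ur n (A : 'M[R]_(1 + n)) : A^T = A -> ursubmx A = (dlsubmx A)^T.
Proof. by move=> Asym; rewrite trmx_dlsub Asym. Qed.

Definition schur_factor n (A : 'M[R]_(1 + n)) : 'M[R]_(1 + n) :=
  block_mx 1%:M 0 ((A 0 0)^-1 *: dlsubmx A) 1%:M.

Lemma schur_factor_unit n (A : 'M[R]_(1 + n)) : schur_factor A \in unitmx.
Proof. by rewrite unitmxE det_lblock !det1 mulr1 unitr1. Qed.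

Lemma schur_diag n (A : 'M[R]_(1 + n)) : A^T = A -> A 0 0 != 0 ->
  A = schur_factor A *m block_mx (A 0 0)%:M 0 0 (schur A) *m (schur_factor A)^T.
Proof.
move=> Asym a0; rewrite {1}(schur_decomp a0) -mulmxA; congr (_ *m _).
rewrite tr_block_mx !trmx1 trmx0 linearZ /= -(sym_ur Asym) mulmx_block.
rewrite !mulmx1 !mul0mx !mulmx0 !addr0 !add0r.
by rewrite -scalemxAr mul_scalar_mx scalerA mulVf// scale1r.
Qed.

Lemma posdef_congr n (A P : 'M[R]_n) : P \in unitmx -> posdef A -> posdef (P *m A *m P^T).
Proof.
move=> uP [Asym Apos]; split; first by rewrite !trmx_mul trmxK Asym mulmxA.
move=> x x0; have := Apos (P^T *m x); rewrite trmx_mul trmxK !mulmxA; apply.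
apply: contra x0 => /eqP Px0.
have uPT : P^T \in unitmx by rewrite unitmx_tr.
by rewrite -(mulKmx uPT x) Px0 mulmx0.
Qed.

Lemma posdef_block n (a : R) (S : 'M[R]_n) :
  posdef (block_mx a%:M 0 0 S : 'M[R]_(1 + n)) <-> 0 < a /\ posdef S.
Proof.
have qE (x0 : 'cV[R]_1) (x : 'cV[R]_n) :
   qf (block_mx a%:M 0 0 S) (col_mx x0 x) = a * (x0 0 0) ^+ 2 + qf S x.
  rewrite /qf tr_col_mx mul_row_block !mulmx0 addr0 add0r mul_row_col mxE; congr (_ + _).
  by rewrite mul_mx_scalar -scalemxAl mxE mxE big_ord1 mxE expr2.
split=> [[sym pos]|[a0 [Ssym Spos]]].
  split.
    have := pos (col_mx 1%:M 0); rewrite -/(qf _ _) qE !mxE expr1n mulr1.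
    rewrite /qf mulmx0 mxE addr0; apply; rewrite col_mx_eq0 negb_and; apply/orP; left.
    by apply/eqP => /matrixP /(_ 0 0); rewrite !mxE; apply/eqP; exact: oner_neq0.
  split.
    by have := congr1 drsubmx sym; rewrite tr_block_mx !block_mxKdr.
  move=> x x0; have := pos (col_mx 0 x); rewrite -/(qf _ _) qE mxE expr0n mulr0 add0r.
  by apply; rewrite col_mx_eq0 negb_and x0 orbT.
split; first by rewrite tr_block_mx tr_scalar_mx !trmx0 Ssym.
move=> x; rewrite -[x]vsubmxK col_mx_eq0 negb_and -/(qf _ _) qE.
set y := usubmx x; set z := dsubmx x.
have qz : 0 <= qf S z.
  have [->|z0] := eqVneq z 0; first by rewrite /qf mulmx0 mxE.
  by apply: ltW; exact: Spos.
have ay : 0 <= a * (y 0 0) ^+ 2 by rewrite mulr_ge0 ?sqr_ge0// ltW.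
move=> /orP[y0|z0]; last by rewrite ltr_wpDl//; exact: Spos.
rewrite ltr_pwDl// mulr_gt0// exprn_even_gt0//=.
by apply: contra y0 => /eqP yy; rewrite [y]mx11_scalar yy; apply/eqP/matrixP => i j; rewrite !mxE mul0rn.
Qed.

Lemma posdef_a0 n (A : 'M[R]_(1 + n)) : posdef A -> 0 < A 0 0.
Proof.
move=> [Asym Apos]; have := Apos (delta_mx 0 0).
rewrite trmx_delta -rowE -colE !mxE; apply.
by apply/eqP => /matrixP /(_ 0 0); rewrite !mxE !eqxx; apply/eqP; exact: oner_neq0.
Qed.

(** Both directions are congruence by the unipotent [schur_factor], which splits [A] into its corner
    entry and its Schur complement. It drives the inductions on the dimension below. *)
Lemma posdef_schur n (A : 'M[R]_(1 + n)) :
  posdef A <-> [/\ A^T = A, 0 < A 0 0 & posdef (schur A)].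
Proof.
have key : A^T = A -> 0 < A 0 0 ->
   posdef A <-> posdef (block_mx (A 0 0)%:M 0 0 (schur A) : 'M[R]_(1 + n)).
  move=> Asym a0; have a00 : A 0 0 != 0 by rewrite gt_eqF.
  have E := schur_diag Asym a00; have uP := schur_factor_unit A.
  split=> pA; last by rewrite E; exact: posdef_congr.
  have uV : invmx (schur_factor A) \in unitmx by rewrite unitmx_inv.
  have := posdef_congr uV pA; rewrite {2}E.
  by rewrite trmx_inv -!mulmxA mulmxV ?unitmx_tr// mulmx1 mulmxA mulVmx// mul1mx.
split=> [pA|[Asym a0 pS]].
  have Asym := pA.1; have a0 := posdef_a0 pA.
  by split=> //; have /posdef_block[] := (key Asym a0).1 pA.
by apply/(key Asym a0)/posdef_block.
Qed.

Lemma posdef_det n (A : 'M[R]_n) : posdef A -> 0 < \det A.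
Proof.
elim: n A => [|n IH] A pA; first by rewrite det_mx00.
have /posdef_schur[_ a0 pS] := pA.
by rewrite (@det_schur n A) ?gt_eqF// mulr_gt0// IH.
Qed.

Lemma posdef_unit n (A : 'M[R]_n) : posdef A -> A \in unitmx.
Proof. by move=> pA; rewrite unitmxE unitfE gt_eqF// posdef_det. Qed.

Lemma cholesky n (A : 'M[R]_n) : posdef A ->
  exists2 L : 'M[R]_n, L \in unitmx & A = L *m L^T.
Proof.
elim: n A => [|n IH] A pA.
  by exists 1%:M; rewrite ?unitmx1//; apply/matrixP; case.
have /posdef_schur[Asym a0 pS] := pA.
have [L uL SL] := IH _ pS.
pose M : 'M[R]_(1 + n) := block_mx (Num.sqrt (A 0 0))%:M 0 0 L.
have MM : M *m M^T = block_mx (A 0 0)%:M 0 0 (schur A).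
  rewrite /M tr_block_mx !trmx0 tr_scalar_mx mulmx_block !mulmx0 !mul0mx addr0 addr0 add0r add0r.
  by rewrite -scalar_mxM -expr2 sqr_sqrtr ?(ltW a0)// -SL.
exists (schur_factor A *m M).
  have uM : M \in @unitmx R (1 + n).
    rewrite unitmxE /M (@det_ublock _ 1 n) det_scalar1 unitrM -unitmxE uL andbT.
    by rewrite unitfE gt_eqF ?sqrtr_gt0.
  by rewrite unitmx_mul schur_factor_unit.
rewrite {1}(@schur_diag n A)// ?gt_eqF// trmx_mul !mulmxA; congr (_ *m _).
rewrite -!mulmxA; congr (_ *m _).
exact: esym MM.
Qed.

End schur.

(** * The divergence and its recursion *)

Section entropy.
Context (R : realType).

(** This is [KL M 1%:M]; every [KL S V] reduces to it by whitening with a root of [V]. *)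
Definition Phi n (M : 'M[R]_n) : R := \tr M - ln (\det M) - n%:R.

Lemma ln_le (x : R) : 0 < x -> 0 <= x - 1 - ln x.
Proof.
move=> x0; rewrite subr_ge0 -ler_expR lnK//.
by rewrite -{1}(subrK 1 x) addrC expR_ge1Dx.
Qed.

(** Three nonnegative terms: a scalar divergence for the corner, the divergence of the Schur
    complement and a weighted square of the off-diagonal column. Positivity and coercivity of [Phi]
    follow from it by induction. *)
Lemma Phi_schur n (M : 'M[R]_(1 + n)) : posdef M ->
  Phi M = (M 0 0 - 1 - ln (M 0 0)) + Phi (schur M) +
    (M 0 0)^-1 * \sum_i (dlsubmx M i 0) ^+ 2.
Proof.
move=> pM; have /posdef_schur[Msym a0 pS] := pM.
have trD : \tr M = M 0 0 + \tr (drsubmx M).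
  rewrite -[in LHS](submxK M) mxtrace_block; congr (_ + _).
  rewrite /mxtrace big_ord1 !mxE; congr (M _ _); exact: val_inj.
have trC : \tr (dlsubmx M *m ursubmx M) = \sum_i (dlsubmx M i 0) ^+ 2.
  rewrite (sym_ur Msym); apply: eq_bigr => i _.
  by rewrite mxE big_ord1 [_^T _ _]mxE expr2.
rewrite /Phi trD (@det_schur _ n M) ?gt_eqF// lnM ?posrE ?posdef_det//.
have -> : \tr (schur M) = \tr (drsubmx M) - (M 0 0)^-1 * \sum_i (dlsubmx M i 0) ^+ 2.
  by rewrite /schur raddfB /= linearZ /= trC.
by rewrite -[(1 + n)%:R]nat1r; ring.
Qed.

Lemma Phi_ge0 n (M : 'M[R]_n) : posdef M -> 0 <= Phi M.
Proof.
elim: n M => [|n IH] M pM; first by rewrite /Phi det_mx00 ln1 /mxtrace big_ord0 !subr0.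
have /posdef_schur[_ a0 pS] := pM.
rewrite (@Phi_schur n M)//; apply: addr_ge0; first by rewrite addr_ge0 ?ln_le ?IH.
by apply: mulr_ge0; [rewrite invr_ge0 ltW|apply: sumr_ge0 => i _; exact: sqr_ge0].
Qed.

(** Twice the Kullback-Leibler divergence of the centred Gaussian law of covariance [S] from that of
    covariance [V]. *)
Definition KL n (S V : 'M[R]_n) : R :=
  ln (\det V) - ln (\det S) + \tr (invmx V *m S) - n%:R.

Lemma invmx_mul n (A B : 'M[R]_n) : A \in unitmx -> B \in unitmx ->
  invmx (A *m B) = invmx B *m invmx A.
Proof.
move=> uA uB; apply: (can_inj (mulKmx (_ : A *m B \in unitmx))); first by rewrite unitmx_mul uA.
by rewrite mulmxV ?unitmx_mul ?uA// mulmxA mulmxK// mulmxV.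
Qed.

Lemma KL_Phi n (S L : 'M[R]_n) : posdef S -> L \in unitmx ->
  posdef (invmx L *m S *m (invmx L)^T) /\
  KL S (L *m L^T) = Phi (invmx L *m S *m (invmx L)^T).
Proof.
move=> pS uL; have uV : invmx L \in unitmx by rewrite unitmx_inv.
split; first exact: posdef_congr.
have dL : \det L != 0 by rewrite -unitfE -unitmxE.
have dS := posdef_det pS.
rewrite /KL /Phi; have -> : \det (L *m L^T) = \det L ^+ 2 by rewrite det_mulmx det_tr expr2.
have -> : \det (invmx L *m S *m (invmx L)^T) = \det S / \det L ^+ 2.
  by rewrite !det_mulmx det_tr det_inv expr2 invfM; ring.
have dL2 : 0 < \det L ^+ 2 by rewrite exprn_even_gt0.
rewrite (lnM (x := \det S)) ?posrE ?invr_gt0// lnV ?posrE//.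
have -> : \tr (invmx (L *m L^T) *m S) = \tr (invmx L *m S *m (invmx L)^T).
  rewrite invmx_mul ?unitmx_tr// -!mulmxA mxtrace_mulC trmx_inv.
  by rewrite mulmxA.
by ring.
Qed.

Lemma KL_ge0 n (S V : 'M[R]_n) : posdef S -> posdef V -> 0 <= KL S V.
Proof.
move=> pS /cholesky[L uL ->]; have [pM ->] := KL_Phi pS uL.
exact: Phi_ge0.
Qed.

Lemma KL_congr n (S V L : 'M[R]_n) : posdef S -> posdef V -> L \in unitmx ->
  KL (L *m S *m L^T) (L *m V *m L^T) = KL S V.
Proof.
move=> pS pV uL; rewrite /KL.
have dL : \det L != 0 by rewrite -unitfE -unitmxE.
have uV := posdef_unit pV.
have dE (x : R) : \det L * x * \det L = \det L ^+ 2 * x by ring.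
rewrite !det_mulmx det_tr !dE.
have dL2 : 0 < \det L ^+ 2 by rewrite exprn_even_gt0.
rewrite (lnM (y := \det V)) ?(lnM (y := \det S)) ?posrE ?posdef_det//.
have -> : \tr (invmx (L *m V *m L^T) *m (L *m S *m L^T)) = \tr (invmx V *m S).
  rewrite !invmx_mul ?unitmx_mul ?unitmx_tr ?uL//.
  rewrite -!mulmxA (mulmxA (invmx L) L) mulVmx// mul1mx mxtrace_mulC -!mulmxA.
  by rewrite mulmxV ?unitmx_tr// mulmx1.
by ring.
Qed.

End entropy.

(** * Second-order expansion at the identity *)

Section expansion.
Context (R : realType).

Lemma ln_expand (e : R) : `|e| <= 2^-1 ->
  `|ln (1 + e) - e + e ^+ 2 / 2| <= 2 * `|e| ^+ 3.
Proof.
move=> e2; have /andP[e_ge e_le] : - 2^-1 <= e <= 2^-1 by rewrite -ler_norml.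
pose g (t : R) := ln (1 + e * t) + (- e) * t + (e ^+ 2 / 2) * t ^+ 2.
have pos t : 0 <= t <= 1 -> 2^-1 <= 1 + e * t by move=> /andP[? ?]; nra.
pose g' (t : R) := (1 + e * t)^-1 * (0 + e * 1) + (- e) * 1 + (e ^+ 2 / 2) * (2%:R * t ^+ 1).
have dg (t : R) : 0 <= t <= 1 -> is_derive t 1 g (g' t).
  move=> t01; have p := pos t t01.
  have dl : is_derive t 1 (fun t : R => ln (1 + e * t)) ((1 + e * t)^-1 * (0 + e * 1)).
    have d0 := is_derive_addf (is_derive_cstf 1 t) (is_derive_scalef e (is_derive_idf t)).
    apply: (@is_derive_compf _ (@ln R) (fun t : R => 1 + e * t) _ _ _ _ d0).
    by apply: is_derive1_ln; lra.
  have d1 := is_derive_addf dl (is_derive_scalef (- e) (is_derive_idf t)).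
  have d2 := is_derive_scalef (e ^+ 2 / 2) (is_derive_powf 2 t).
  exact: (is_derive_addf d1 d2).
have h01 : 0 <= (1 : R) <= 1 by rewrite ler01 lexx.
have [c c01] := MVT01 h01 dg.
have p := pos c c01.
have p0 : 1 + e * c != 0 by rewrite gt_eqF//; lra.
have -> : g 1 - g 0 = ln (1 + e) - e + e ^+ 2 / 2.
  by rewrite /g mulr0 [1 + 0]addr0 ln1 expr1n expr0n /= !mulr1 !mulr0; ring.
rewrite mulr1 => ->; rewrite (_ : g' c = e ^+ 3 * (c ^+ 2 * (1 + e * c)^-1)); last first.
  by rewrite /g' !expr1; field.
rewrite normrM normrX mulrC ler_wpM2r ?exprn_ge0//.
have i0 : 0 < (1 + e * c)^-1 <= 2.
  rewrite invr_gt0; apply/andP; split; first lra.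
  by rewrite -[leRHS]invrK lef_pV2 ?posrE//; lra.
have /andP[i1 i2] := i0; have /andP[c0 c1] := c01.
rewrite ger0_norm ?mulr_ge0 ?sqr_ge0 ?(ltW i1)//.
by rewrite -[leRHS]mul1r ler_pM ?sqr_ge0 ?(ltW i1)// expr_le1.
Qed.

(** Induction by [det_schur]: [det (1 + E) = (1 + e) det (1 + E')] with [E' = D - G] and [G]
    quadratic in [E]. The trace of [G] accounts for the mixed part of [tr (E E)] up to third
    order. *)
Lemma lndet_expand n : exists C delta : R, [/\ 0 <= C, 0 < delta &
  forall E : 'M[R]_n, n1 E <= delta -> 0 < \det (1%:M + E) /\
    `|ln (\det (1%:M + E)) - \tr E + \tr (E *m E) / 2| <= C * n1 E ^+ 3].
Proof.
elim: n => [|n [C [delta [C0 d0 IH]]]].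
  exists 0, 1; split=> // E _; rewrite det_mx00 ln1 /mxtrace !big_ord0.
  by rewrite mul0r subr0 addr0 normr0 mul0r.
(* [8 C] and the radius [delta / 2] come from [n1 E' <= 2 x]; [7 = 2 + 2 + 2 + 1] from the scalar
   logarithm, the factor [b] and the two traces with [G]. *)
exists (8 * C + 7), (Num.min 2^-1 (delta / 2)); split.
- by rewrite addr_ge0 ?mulr_ge0.
- by rewrite lt_min invr_gt0 ltr0n /= divr_gt0.
suff key (E : 'M[R]_(1 + n)) : n1 E <= Num.min 2^-1 (delta / 2) ->
    0 < \det (1%:M + E) /\
    `|ln (\det (1%:M + E)) - \tr E + \tr (E *m E) / 2| <= (8 * C + 7) * n1 E ^+ 3.
  exact: key.
rewrite le_min => /andP[E2 Ed].
pose A : 'M[R]_(1 + n) := 1%:M + E.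
pose e := E 0 0; pose l := @dlsubmx _ 1 n 1 n E; pose u := @ursubmx _ 1 n 1 n E.
pose D := @drsubmx _ 1 n 1 n E.
have EE : (E : 'M[R]_(1 + n)) = block_mx e%:M u l D.
  rewrite -[LHS](@submxK _ 1 n 1 n); congr block_mx; rewrite [LHS]mx11_scalar !mxE.
  by congr (E _ _)%:M; exact: val_inj.
have nE : n1 E = `|e| + n1 u + (n1 l + n1 D).
  rewrite {1}EE (@n1_block _ 1 n 1 n); congr (_ + _ + _).
  by rewrite /n1 !big_ord1 mxE eqxx.
have x0 := n1_ge0 E; set x := n1 E in x0 E2 Ed nE *.
have u0 := n1_ge0 u; have l0 := n1_ge0 l; have D0 := n1_ge0 D; have e0 := normr_ge0 e.
have ex : `|e| <= x by lra.
have e2 : `|e| <= 2^-1 by lra.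
have /andP[e_ge e_le] : - 2^-1 <= e <= 2^-1 by rewrite -ler_norml.
have AE : A = block_mx (1 + e)%:M u l (1%:M + D).
  by rewrite /A {1}EE [1%:M](@scalar_mx_block R 1 n) (@add_block_mx _ 1 n 1 n) !add0r raddfD.
have A00 : A 0 0 = 1 + e by rewrite /A !mxE eqxx.
have a0 : 0 < 1 + e by lra.
pose b := (1 + e)^-1.
have /andP[b0 b2] : 0 < b <= 2.
  rewrite invr_gt0 a0 /= -[leRHS]invrK lef_pV2 ?posrE//; lra.
pose G := b *: (l *m u); pose E' := D - G.
have sA : schur A = 1%:M + E'.
  by rewrite /schur A00 AE block_mxKdr block_mxKdl block_mxKur /E' addrA.
have lux : n1 (l *m u) <= x * x.
  by apply: le_trans (n1M _ _) _; rewrite ler_pM//; lra.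
have nG : n1 G <= 2 * (x * x).
  by rewrite /G n1Z gtr0_norm// ler_pM ?n1_ge0// ltW.
have nE' : n1 E' <= 2 * x.
  apply: le_trans (n1B _ _) _; apply: (@le_trans _ _ (x + 2 * (x * x))).
    by rewrite lerD//; lra.
  by nra.
have [dpos dE'] := IH E' ltac:(lra).
have dA : \det A = (1 + e) * \det (1%:M + E') by rewrite det_schur A00 ?sA ?gt_eqF.
change (0 < \det A /\ `|ln (\det A) - \tr E + \tr (E *m E) / 2| <= (8 * C + 7) * x ^+ 3).
rewrite dA; split; first by rewrite mulr_gt0.
rewrite lnM ?posrE//.
have trE : \tr E = e + \tr D by rewrite EE mxtrace_block mxtrace_scalar mulr1n.
have trEE : \tr (E *m E) = e ^+ 2 + 2 * \tr (l *m u) + \tr (D *m D).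
  rewrite {1 2}EE mulmx_block mxtrace_block !mxtraceD -scalar_mxM mxtrace_scalar mulr1n.
  by rewrite (mxtrace_mulC u l); ring.
have trE' : \tr E' = \tr D - b * \tr (l *m u) by rewrite /E' raddfB /= linearZ.
have trE'E' : \tr (E' *m E') = \tr (D *m D) - 2 * \tr (D *m G) + \tr (G *m G).
  rewrite /E' mulmxBl !mulmxBr !raddfB /= (mxtrace_mulC G D); ring.
rewrite trE trEE.
have -> : ln (1 + e) + ln (\det (1%:M + E')) - (e + \tr D)
    + (e ^+ 2 + 2 * \tr (l *m u) + \tr (D *m D)) / 2 =
  (ln (1 + e) - e + e ^+ 2 / 2) + (ln (\det (1%:M + E')) - \tr E' + \tr (E' *m E') / 2)
  + (e * (b * \tr (l *m u))) + (\tr (D *m G) - \tr (G *m G) / 2).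
  rewrite trE' trE'E'; rewrite (_ : e * (b * _) = \tr (l *m u) - b * \tr (l *m u)); last first.
    by rewrite mulrA -{2}[\tr _]mul1r -mulrBl; congr (_ * _); rewrite /b; field; rewrite gt_eqF.
  by field.
have h1 := ln_expand e2.
have h1' : 2 * `|e| ^+ 3 <= 2 * x ^+ 3.
  by rewrite ler_pM2l// lerXn2r ?nnegrE.
have h2 : C * n1 E' ^+ 3 <= 8 * C * x ^+ 3.
  apply: (@le_trans _ _ (C * (2 * x) ^+ 3)); last by rewrite exprMn; nra.
  by rewrite ler_wpM2l// lerXn2r ?nnegrE ?n1_ge0// mulr_ge0.
have h3 : `|e * (b * \tr (l *m u))| <= 2 * x ^+ 3.
  rewrite !normrM (gtr0_norm b0).
  apply: (@le_trans _ _ (x * (2 * (x * x)))); last by rewrite !exprS expr0; nra.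
  rewrite ler_pM ?mulr_ge0 ?(ltW b0)//; rewrite ler_pM ?(ltW b0)//.
  exact: le_trans (trace_n1 _) lux.
have h4 : `|\tr (D *m G)| <= 2 * x ^+ 3.
  apply: le_trans (trace_n1 _) _; apply: le_trans (n1M _ _) _.
  apply: (@le_trans _ _ (x * (2 * (x * x)))); last by rewrite !exprS expr0; nra.
  by rewrite ler_pM ?n1_ge0//; lra.
have h5 : `|\tr (G *m G)| <= 2 * x ^+ 3.
  apply: le_trans (trace_n1 _) _; apply: le_trans (n1M _ _) _.
  apply: (@le_trans _ _ ((2 * (x * x)) * (2 * (x * x)))).
    by rewrite ler_pM ?n1_ge0.
  have x3 : 0 <= x ^+ 3 by rewrite exprn_ge0.
  rewrite (_ : 2 * (x * x) * _ = 4 * x * x ^+ 3); last by rewrite !exprS expr0; ring.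
  by rewrite ler_wpM2r//; lra.
move: dE' h1 h3 h4 h5; rewrite !ler_norml => /andP[a1 b1] /andP[a2 b2'] /andP[a3 b3] /andP[a4 b4] /andP[a5 b5].
by clear -a1 b1 a2 b2' a3 b3 a4 b4 a5 b5 h1' h2; apply/andP; split; lra.
Qed.

(** From [V^-1 - 1 = - ((V^-1 - 1) (V - 1) + (V - 1))]: the norm of the product is at most half that
    of the left side, and is absorbed. *)
Lemma invmx_near1 n (V : 'M[R]_n) : V \in unitmx -> n1 (V - 1%:M) <= 2^-1 ->
  n1 (invmx V - 1%:M) <= 2 * n%:R * n1 (V - 1%:M).
Proof.
move=> uV V2.
have E : invmx V - 1%:M = - ((invmx V - 1%:M) *m (V - 1%:M) + (V - 1%:M)).
  by rewrite mulmxBl mulmxBr mulVmx// !mulmx1 mul1mx; apply/eqP; rewrite -subr_eq0; apply/eqP/matrixP => i j; rewrite !mxE; ring.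
have h : n1 (invmx V - 1%:M) <= n1 (invmx V - 1%:M) * n1 (V - 1%:M) + n1 (V - 1%:M).
  by rewrite {1}E n1N (le_trans (n1D _ _))// lerD2r n1M.
have := n1_ge0 (invmx V - 1%:M); have := n1_ge0 (V - 1%:M).
case: n => [|n] in V uV V2 E h *.
  by move=> _ _; rewrite {1}/n1 big_ord0 mulr0 mul0r.
have n0 : (1 : R) <= n.+1%:R by rewrite ler1n.
by nra.
Qed.

(* KL(S, V) = tr(V^-1 E) - ln det(1 + V^-1 E) with E = S - V *)
Lemma KL_expand n (eps : R) : 0 < eps -> exists2 delta : R, 0 < delta &
  forall S V : 'M[R]_n, posdef S -> posdef V -> n1 (S - 1%:M) <= delta -> n1 (V - 1%:M) <= delta ->
    `|KL S V - \tr ((S - V) *m (S - V)) / 2| <= eps * n1 (S - V) ^+ 2.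
Proof.
move=> eps0; have [C [d [C0 d0 ex]]] := @lndet_expand n.
pose N : R := n%:R; have N0 : 0 <= N by rewrite /N.
pose c := 1 + N * 2.
have c1 : 1 <= c by rewrite /c; lra.
(* [K] bounds the total coefficient of [m * n1 E ^+ 2] in the error, [m] being the larger distance
   of [S] and [V] from the identity: [2 C c ^+ 3] from the cubic remainder, the rest from the traces
   containing [Q = V^-1 - 1]. *)
pose K := 2 * C * c ^+ 3 + 2 * c ^+ 2 + 1.
have K0 : 1 <= K.
  have ? : 0 <= C * c ^+ 3 by rewrite mulr_ge0// exprn_ge0//; lra.
  have ? : 0 <= c ^+ 2 by rewrite sqr_ge0.
  by rewrite /K; lra.
pose delta := Num.min (Num.min 2^-1 (d / (2 * c))) (eps / K).
exists delta.
  rewrite !lt_min invr_gt0 ltr0n /= !divr_gt0//; first lra.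
  lra.
move=> S V pS pV; rewrite !le_min => /andP[/andP[S2 Sd] Se] /andP[/andP[V2 Vd] Ve].
have uV := posdef_unit pV.
pose E := S - V; pose W := invmx V; pose Q := W - 1%:M.
have W1 : W = 1%:M + Q by rewrite /Q addrC subrK.
have nQ : n1 Q <= 2 * N * n1 (V - 1%:M) := invmx_near1 uV V2.
have Q0 := n1_ge0 Q; have E0 := n1_ge0 E; have V0 := n1_ge0 (V - 1%:M).
set v := n1 (V - 1%:M) in V2 Vd Ve nQ V0.
have nQ' : n1 Q <= N by nra.
have nE : n1 E <= n1 (S - 1%:M) + v.
  by rewrite /E (_ : S - V = (S - 1%:M) - (V - 1%:M)) ?n1B// opprB addrA subrK.
have nWE : n1 (W *m E) <= c * n1 E.
  rewrite W1 mulmxDl mul1mx (le_trans (n1D _ _))// /c mulrDl mul1r lerD2l.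
  apply: le_trans (n1M _ _) _; rewrite ler_wpM2r//; lra.
have WE0 := n1_ge0 (W *m E).
have dc : (d / (2 * c)) * (2 * c) = d by rewrite divfK// gt_eqF// mulr_gt0//; lra.
have nWEd : n1 (W *m E) <= d.
  apply: le_trans nWE _.
  have : c * n1 E <= c * (2 * (d / (2 * c))) by rewrite ler_wpM2l//; lra.
  set r := d / _ in dc *; lra.
have [_ eWE] := ex _ nWEd.
have KLE : KL S V = \tr (W *m E) - ln (\det (1%:M + W *m E)).
  have WS : W *m S = 1%:M + W *m E by rewrite /E mulmxBr mulVmx// addrC subrK.
  rewrite -WS det_mulmx /W det_inv lnM ?posrE ?invr_gt0 ?posdef_det//.
  rewrite lnV ?posrE ?posdef_det// /KL -/W WS mxtraceD mxtrace1; ring.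
have trE : \tr (W *m E *m (W *m E)) = \tr (E *m E) + 2 * \tr (Q *m E *m E) + \tr (Q *m E *m (Q *m E)).
  rewrite W1; move: Q E {W1 nQ Q0 E0 nQ' nE nWE WE0 nWEd eWE KLE} => Q E.
  rewrite !mulmxDl !mul1mx !mulmxDr !mxtraceD.
  by rewrite (mxtrace_mulC E (Q *m E)); ring.
have t1 : `|\tr (Q *m E *m E)| <= n1 Q * n1 E ^+ 2.
  apply: le_trans (trace_n1 _) _; apply: le_trans (n1M _ _) _.
  by rewrite expr2 mulrA ler_wpM2r// n1M.
have t2 : `|\tr (Q *m E *m (Q *m E))| <= N * (n1 Q * n1 E ^+ 2).
  apply: le_trans (trace_n1 _) _; apply: le_trans (n1M _ _) _.
  apply: (@le_trans _ _ ((n1 Q * n1 E) * (n1 Q * n1 E))).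
    by rewrite ler_pM ?n1_ge0 ?n1M.
  rewrite (_ : _ * _ = n1 Q * (n1 Q * n1 E ^+ 2)); last by ring.
  by rewrite ler_wpM2r// mulr_ge0// sqr_ge0.
set T := n1 E ^+ 2 in t1 t2 *.
have T0 : 0 <= T by rewrite sqr_ge0.
pose m := Num.max (n1 (S - 1%:M)) v.
have m0 : 0 <= m by rewrite le_max V0 orbT.
have Sm : n1 (S - 1%:M) <= m by rewrite le_max lexx.
have Vm : v <= m by rewrite le_max lexx orbT.
have mK : m * K <= eps.
  by rewrite -ler_pdivlMr; [rewrite ge_max Se Ve|lra].
have t3 : C * n1 (W *m E) ^+ 3 <= 2 * C * c ^+ 3 * m * T.
  apply: (@le_trans _ _ (C * (c * n1 E) ^+ 3)).
    by rewrite ler_wpM2l// lerXn2r ?nnegrE ?mulr_ge0//; lra.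
  rewrite (_ : C * (c * n1 E) ^+ 3 = (C * c ^+ 3 * n1 E) * T); last by rewrite /T; ring.
  rewrite ler_wpM2r// (_ : 2 * C * c ^+ 3 * m = C * c ^+ 3 * (2 * m)); last by ring.
  rewrite ler_wpM2l; [by []| by rewrite mulr_ge0// exprn_ge0//; lra|clear -nE Sm Vm; lra].
have QT : n1 Q * T <= 2 * N * m * T by rewrite ler_wpM2r//; nra.
have mKT : m * K * T <= eps * T by rewrite ler_wpM2r.
have NQT : N * (n1 Q * T) <= N * (2 * N * m * T) by rewrite ler_wpM2l.
have mT : 0 <= m * T by rewrite mulr_ge0.
have NmT : 0 <= N * (m * T) by rewrite mulr_ge0.
have NNmT : 0 <= N * (N * (m * T)) by rewrite !mulr_ge0.
have KE : m * K * T = 2 * C * c ^+ 3 * m * T + 2 * (m * T) + 8 * (N * (m * T)) + 8 * (N * (N * (m * T))) + m * T.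
  by rewrite /K /c; ring.
rewrite KLE -/E; rewrite trE in eWE.
move: eWE t1 t2; rewrite !ler_norml => /andP[a1 b1] /andP[a2 b2] /andP[a3 b3].
by clear -a1 b1 a2 b2 a3 b3 t3 QT mKT NQT mT NmT NNmT KE; apply/andP; split; lra.
Qed.

End expansion.

Section sqnorm.
Context (R : realType).

Definition nsq n (v : 'cV[R]_n) : R := \sum_i (v i 0) ^+ 2.

Lemma nsq_ge0 n (v : 'cV[R]_n) : 0 <= nsq v.
Proof. by apply: sumr_ge0 => i _; exact: sqr_ge0. Qed.

Lemma nsqE n (v : 'cV[R]_n) : nsq v = (v^T *m v) 0 0.
Proof. by rewrite mxE; apply: eq_bigr => i _; rewrite mxE expr2. Qed.

Lemma n1_cV n (v : 'cV[R]_n) : n1 v = \sum_i `|v i 0|.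
Proof. by apply: eq_bigr => i _; rewrite big_ord1. Qed.

Lemma nsqD_le n (v e : 'cV[R]_n) (a b : R) : n1 v <= a -> n1 e <= b ->
  `|nsq (v + e) - nsq v| <= (2 * a + b) * b.
Proof.
move=> va eb; have v0 := n1_ge0 v; have e0 := n1_ge0 e.
have -> : nsq (v + e) - nsq v = \sum_i (2 * v i 0 + e i 0) * e i 0.
  rewrite /nsq -sumrB; apply: eq_bigr => i _; rewrite mxE; ring.
apply: le_trans (ler_norm_sum _ _ _) _.
apply: (@le_trans _ _ (\sum_i (2 * a + b) * `|e i 0|)).
  apply: ler_sum => i _; rewrite normrM ler_wpM2r// (le_trans (ler_normD _ _))//.
  rewrite lerD//; last exact: le_trans (n1_entry _ _ _) eb.
  by rewrite normrM ger0_norm// ler_pM2l//; exact: le_trans (n1_entry _ _ _) va.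
by rewrite -mulr_sumr -n1_cV ler_wpM2l//; lra.
Qed.

Lemma nsq_n1 n (v : 'cV[R]_n) : nsq v <= n1 v ^+ 2.
Proof.
have := nsqD_le (v := 0) (e := v) (lexx _) (lexx _).
rewrite add0r n10 mulr0 add0r /nsq [X in _ - X]big1 ?subr0 => [|i _]; last by rewrite mxE expr0n.
by rewrite -expr2; apply: le_trans; exact: ler_norm.
Qed.

Lemma nsq_coisometry r n (U : 'M[R]_(r, n)) (v : 'cV[R]_n) : U *m U^T = 1%:M ->
  nsq (U^T *m (U *m v)) = nsq (U *m v).
Proof. by move=> UU; rewrite !nsqE trmx_mul trmxK -!mulmxA (mulmxA U) UU mul1mx. Qed.

Lemma nsq_contract r n (U : 'M[R]_(r, n)) (v : 'cV[R]_n) : U *m U^T = 1%:M ->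
  nsq (U *m v) <= nsq v.
Proof.
move=> UU; rewrite -subr_ge0.
have -> : nsq v - nsq (U *m v) = nsq (v - U^T *m (U *m v)).
  rewrite !nsqE [(v - _)^T]linearB /= mulmxBl !mulmxBr !trmx_mul trmxK -!mulmxA (mulmxA U U^T) UU mul1mx.
  by rewrite !mxE; ring.
exact: nsq_ge0.
Qed.

End sqnorm.

(** * Coercivity of the divergence *)

Section coercivity.
Context (R : realType).

(** Apply [ln s <= s - 1] at [s = sqrt a]: a quadratic lower bound valid for every positive [a]. *)
Lemma ln_coercive (a : R) : 0 < a -> (Num.sqrt a - 1) ^+ 2 <= a - 1 - ln a.
Proof.
move=> a0; have s0 : 0 < Num.sqrt a by rewrite sqrtr_gt0.
have aE : a = Num.sqrt a ^+ 2 by rewrite sqr_sqrtr// ltW.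
have := ln_le s0; set s := Num.sqrt a in s0 aE * => h.
have -> : ln a = 2 * ln s by rewrite aE lnXn// mulr2n; ring.
by rewrite aE (_ : (s - 1) ^+ 2 = s ^+ 2 - 2 * s + 1); [lra|ring].
Qed.

(** The terms of [Phi_schur] are small one by one: the corner is near 1 by [ln_coercive], the Schur
    complement is near the identity by induction, and the column is small because its weight [a^-1]
    is then at least [1 / 2]. *)
Lemma Phi_coercive n (eta : R) : 0 < eta -> exists2 delta : R, 0 < delta &
  forall M : 'M[R]_n, posdef M -> Phi M <= delta -> n1 (M - 1%:M) <= eta.
Proof.
elim: n eta => [|n IH] eta eta0.
  by exists 1 => // M _ _; rewrite /n1 big_ord0 ltW.
(* The four blocks contribute [t], [t], [t] and [t + t / 4], well within [8 t]. *)
pose t := Num.min eta 1 / 8; have t0 : 0 < t by rewrite divr_gt0// lt_min eta0/=.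
have te : 8 * t <= eta by rewrite /t mulrC divfK// ge_min lexx.
have t1 : 8 * t <= 1 by rewrite /t mulrC divfK// ge_min lexx orbT.
have [d d0 hd] := IH t t0.
pose N : R := n.+1%:R; have N1 : 1 <= N by rewrite /N ler1n.
pose del := Num.min d ((t / (4 * N)) ^+ 2).
have b0 : 0 < t / (4 * N) by rewrite divr_gt0//; lra.
exists del; first by rewrite lt_min d0 exprn_gt0.
suff key (M : 'M[R]_(1 + n)) : posdef M -> Phi M <= del -> n1 (M - 1%:M) <= eta.
  exact: key.
move=> pM PM; have /posdef_schur[Msym a0 pS] := pM.
move: PM; rewrite Phi_schur//; set a := M 0 0 in a0 *; set c := dlsubmx M.
have h1 := ln_coercive a0; have h2 := Phi_ge0 pS.
have h3 : 0 <= nsq c := nsq_ge0 c.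
have h4 : 0 <= a^-1 * nsq c by rewrite mulr_ge0// invr_ge0 ltW.
have h5 := sqr_ge0 (Num.sqrt a - 1).
rewrite -/(nsq c) => PM.
have [dd db] : del <= d /\ del <= (t / (4 * N)) ^+ 2.
  by split; rewrite /del ge_min lexx ?orbT.
set b := t / (4 * N) in b0 db.
have bN : b * N = t / 4 by rewrite /b; field; rewrite gt_eqF//; lra.
have bt : 4 * b <= t by nra.
have sb : `|Num.sqrt a - 1| <= b.
  by rewrite -ler_sqr ?nnegrE ?(ltW b0)// real_normK ?num_real//; lra.
have aE : a = Num.sqrt a ^+ 2 by rewrite sqr_sqrtr// ltW.
have s0 := sqrtr_ge0 a.
have at_ : `|a - 1| <= t.
  move: sb; rewrite {2}aE !ler_norml => /andP[? ?]; apply/andP; split; nra.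
have a2 : a <= 2 by move: at_; rewrite ler_norml => /andP[? ?]; lra.
have ai2 : a^-1 <= 2.
  rewrite -[leRHS]invrK lef_pV2 ?posrE//.
  by move: at_; rewrite ler_norml => /andP[? ?]; lra.
have nc : nsq c <= (2 * b) ^+ 2.
  have : a^-1 * nsq c <= b ^+ 2 by lra.
  by rewrite ler_pdivrMl//; nra.
have n1c : n1 c <= t.
  rewrite n1_cV; apply: (@le_trans _ _ (\sum_(i < n) (2 * b))).
    have bb := ltW b0; clearbody b.
    apply: ler_sum => i _; rewrite -ler_sqr ?nnegrE ?mulr_ge0//.
    rewrite real_normK ?num_real//; apply: le_trans nc.
    by rewrite /nsq (bigD1 i)//= lerDl; apply: sumr_ge0 => j _; exact: sqr_ge0.
  rewrite sumr_const card_ord -mulr_natr.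
  have : n%:R <= N by rewrite ler_nat.
  have : 0 <= n%:R :> R by [].
  nra.
have hS : n1 (schur M - 1%:M) <= t by apply: hd => //; lra.
have ME : M - 1%:M = block_mx (a - 1)%:M (c^T) c (schur M - 1%:M + a^-1 *: (c *m c^T)).
  rewrite [1%:M](@scalar_mx_block R 1 n) -[M in LHS](@submxK _ 1 n 1 n) opp_block_mx add_block_mx.
  rewrite !oppr0 !addr0 (sym_ur Msym) -/c; congr block_mx.
    rewrite raddfB /=; congr (_ - _); rewrite [LHS]mx11_scalar !mxE.
    by congr (M _ _)%:M; exact: val_inj.
  by rewrite /schur -/a -/c (sym_ur Msym) -/c addrAC subrK.
rewrite ME n1_block n1_tr.
have -> : n1 ((a - 1)%:M : 'M[R]_1) = `|a - 1| by rewrite /n1 !big_ord1 mxE eqxx.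
have c0 := n1_ge0 c.
have hc : n1 (a^-1 *: (c *m c^T)) <= 2 * (t * t).
  rewrite n1Z gtr0_norm ?invr_gt0// ler_pM ?n1_ge0 ?invr_ge0 ?(ltW a0)//.
  by apply: le_trans (n1M _ _) _; rewrite n1_tr ler_pM.
have := n1D (schur M - 1%:M) (a^-1 *: (c *m c^T)).
have : t * t <= t / 8 by nra.
by lra.
Qed.

Lemma posdef1 n : posdef (1%:M : 'M[R]_n).
Proof.
split; first exact: trmx1.
move=> x x0; rewrite mulmx1 -nsqE lt0r nsq_ge0 andbT.
apply: contra x0; rewrite psumr_eq0 => [/allP h|i _]; last exact: sqr_ge0.
apply/eqP/matrixP => i j; rewrite (ord1 j) mxE.
by have := h i (mem_index_enum _); rewrite /= sqrf_eq0 => /eqP.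
Qed.

(* With S = C C^T, KL(S, V) = Phi(C^T V^-1 C). *)
Lemma KL_coercive n (eta : R) : 0 < eta -> exists2 delta : R, 0 < delta &
  forall S V : 'M[R]_n, posdef S -> posdef V -> n1 (S - 1%:M) <= delta ->
    KL S V <= delta -> n1 (V - 1%:M) <= eta.
Proof.
move=> eta0.
pose N : R := n%:R; have N0 : 0 <= N by rewrite /N.
pose k := 2 * N * N; have k0 : 0 <= k by rewrite !mulr_ge0.
pose k2 := k * (2 * N) * k; have k20 : 0 <= k2 by rewrite !mulr_ge0.
pose e1 := Num.min 2^-1 (eta / 2 / (k2 + 1)).
have e10 : 0 < e1 by rewrite lt_min invr_gt0 ltr0n /= divr_gt0 ?divr_gt0//; lra.
have [d d0 hd] := @Phi_coercive n e1 e10.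
exists (Num.min d (Num.min 1 (eta / 2))); first by rewrite !lt_min d0 ltr01 divr_gt0.
move=> S V pS pV; rewrite !le_min => /andP[_ /andP[S1 Se]] /andP[Kd _].
have [C uC SC] := cholesky pS; have [L uL VL] := cholesky pV.
have uV := posdef_unit pV.
pose M := C^T *m invmx V *m C.
have pM : posdef M.
  have -> : M = (C^T *m (invmx L)^T) *m 1%:M *m (C^T *m (invmx L)^T)^T.
    rewrite mulmx1 trmx_mul !trmxK /M VL invmx_mul ?unitmx_tr// -trmx_inv.
    by rewrite !mulmxA.
  by apply: posdef_congr; rewrite ?unitmx_mul ?unitmx_tr ?unitmx_inv ?uC//; exact: posdef1.
have dC : 0 < \det C * \det C.
  by have := posdef_det pS; rewrite SC det_mulmx det_tr.
have PhM : Phi M = KL S V.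
  rewrite /Phi /KL /M (mxtrace_mulC _ C) mulmxA -SC mxtrace_mulC.
  rewrite !det_mulmx det_tr det_inv SC det_mulmx det_tr.
  have -> : \det C / \det V * \det C = (\det C * \det C) / \det V by rewrite mulrAC.
  by rewrite (lnM (x := \det C * \det C)) ?posrE ?invr_gt0 ?posdef_det// lnV ?posrE ?posdef_det//; ring.
have hM : n1 (M - 1%:M) <= e1 by apply: hd => //; rewrite PhM.
have [e12 e1e] : e1 <= 2^-1 /\ e1 <= eta / 2 / (k2 + 1).
  by split; rewrite /e1 ge_min lexx ?orbT.
have uM := posdef_unit pM.
have hMi : n1 (invmx M - 1%:M) <= 2 * N * e1.
  apply: le_trans (invmx_near1 uM _) _; first exact: le_trans hM e12.
  by rewrite ler_wpM2l// mulr_ge0.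
have VS : V - S = C *m (invmx M - 1%:M) *m C^T.
  rewrite mulmxBr mulmxBl mulmx1 -SC; congr (_ - _).
  rewrite /M !invmx_mul ?unitmx_mul ?unitmx_tr ?unitmx_inv ?uC// invmxK.
  rewrite !mulmxA mulmxV// mul1mx -mulmxA mulVmx ?unitmx_tr// mulmx1.
  by [].
(* The diagonal of [S = C C^T] is at most 2, and it bounds the squares of the entries of [C]. *)
have nC : n1 C <= k.
  rewrite /n1; apply: (@le_trans _ _ (\sum_(i < n) \sum_(j < n) 2)).
    apply: ler_sum => i _; apply: ler_sum => j _.
    rewrite -ler_sqr ?nnegrE// real_normK ?num_real//.
    have : C i j ^+ 2 <= S i i.
      rewrite SC mxE (bigD1 j)//= [C^T j i]mxE -expr2 lerDl.
      by apply: sumr_ge0 => l _; rewrite [C^T l i]mxE -expr2 sqr_ge0.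
    have := le_trans (n1_entry (S - 1%:M) i i) S1.
    by rewrite !mxE eqxx mulr1n ler_norml => /andP[? ?]; lra.
  by rewrite !sumr_const !card_ord -(mulr_natr (2 : R) n) -(mulr_natr (2 * n%:R) n).
have nVS : n1 (V - S) <= eta / 2.
  rewrite VS; apply: (@le_trans _ _ (k * (2 * N * e1) * k)).
    apply: le_trans (n1M _ _) _; rewrite n1_tr ler_pM ?n1_ge0//.
    by apply: le_trans (n1M _ _) _; rewrite ler_pM ?n1_ge0.
  apply: (@le_trans _ _ (k2 * e1)); first by rewrite /k2; lra.
  apply: (@le_trans _ _ ((k2 + 1) * e1)); first by rewrite ler_wpM2r ?(ltW e10)// lerDl.
  by rewrite mulrC -ler_pdivlMr// ltr_wpDl.
rewrite (_ : V - 1%:M = (V - S) + (S - 1%:M)); last by rewrite addrA subrK.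
by apply: le_trans (n1D _ _) _; lra.
Qed.

End coercivity.

(** * The divergence at its minimiser *)

(** Compares [n1] with the Frobenius norm, whose square is [tr (s s)] for symmetric [s]. *)
Lemma n1_sq_trace (R : realType) n (s : 'M[R]_n) : s^T = s ->
  0 <= \tr (s *m s) /\ n1 s ^+ 2 <= (n%:R ^+ 2) ^+ 2 * \tr (s *m s).
Proof.
move=> ssym.
have trE : \tr (s *m s) = \sum_i \sum_j s i j ^+ 2.
  apply: eq_bigr => i _; rewrite mxE; apply: eq_bigr => j _.
  by rewrite expr2 -{2}ssym mxE.
have t0 : 0 <= \tr (s *m s).
  by rewrite trE; apply: sumr_ge0 => i _; apply: sumr_ge0 => j _; exact: sqr_ge0.
split=> //.
have ent i j : `|s i j| <= Num.sqrt (\tr (s *m s)).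
  rewrite -ler_sqr ?nnegrE ?sqrtr_ge0// sqr_sqrtr// real_normK ?num_real//.
  rewrite trE (bigD1 i)//= (bigD1 j)//= -addrA lerDl addr_ge0//.
    by apply: sumr_ge0 => l _; exact: sqr_ge0.
  by apply: sumr_ge0 => l _; apply: sumr_ge0 => l' _; exact: sqr_ge0.
have n1s : n1 s <= n%:R ^+ 2 * Num.sqrt (\tr (s *m s)).
  apply: (@le_trans _ _ (\sum_(i < n) \sum_(j < n) Num.sqrt (\tr (s *m s)))).
    by apply: ler_sum => i _; apply: ler_sum.
  set Q := Num.sqrt _.
  by rewrite !sumr_const !card_ord -(mulr_natr Q n) -(mulr_natr (Q * n%:R) n) expr2; lra.
apply: (@le_trans _ _ ((n%:R ^+ 2 * Num.sqrt (\tr (s *m s))) ^+ 2)).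
  by rewrite lerXn2r ?nnegrE ?n1_ge0 ?mulr_ge0 ?sqrtr_ge0 ?exprn_ge0.
by rewrite exprMn sqr_sqrtr.
Qed.

(** * Nonlinear least squares in abstract coordinates *)

Section minimise.
Context (R : realType) (n N q r : nat).
Variables (y : 'M[R]_n -> 'cV[R]_N) (B : 'M[R]_(N, q)) (U : 'M[R]_(r, N)) (H : 'M[R]_(q, N)).
Hypothesis yB : forall S T, y (S - T) = y S - y T.
Hypothesis y_le : forall s, n1 (y s) <= n1 s.
Hypothesis y_sq : forall s, s^T = s -> \tr (s *m s) / 2 = nsq (y s).
Hypothesis UU : U *m U^T = 1%:M.
Hypothesis UB : U *m B = 0.
Hypothesis HB : H *m B = 1%:M.
Hypothesis BH : forall v : 'cV[R]_N, v - B *m (H *m v) = U^T *m (U *m v).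
Variables (Theta : set 'cV[R]_q) (sig : 'cV[R]_q -> 'M[R]_n) (th0 : 'cV[R]_q).
Hypothesis sig_posdef : forall th, Theta th -> posdef (sig th).
Hypothesis sig_expand : forall eps, 0 < eps -> exists2 delta : R, 0 < delta &
  forall u, n1 u <= delta -> Theta (th0 + u) /\
    n1 (y (sig (th0 + u) - 1%:M) - B *m u) <= eps * n1 u.
Hypothesis sig_ident : forall eta, 0 < eta -> exists2 delta : R, 0 < delta &
  forall th, Theta th -> n1 (sig th - 1%:M) <= delta -> n1 (th - th0) <= eta.

(** [c0] compares [n1] with the length of [y]; [c4] and [c5] bound [n1 (S - V)] and [n1 (th - th0)]
    by multiples of [n1 (S - 1)] at the minimiser; [c2] and [c6] multiply the precision [e1] in the
    upper and in the lower bound. *)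
Let c0 : R := 2 * (n%:R ^+ 2) ^+ 2 + 1.
Let h := n1 H.
Let k := n1 (U^T *m U).
Let w := n1 U.
Let c1 := (2 * k + h) * h.
Let c2 := c1 + (c0 * (k + h)) ^+ 2.
Let c3 := w ^+ 2 + c2.
Let c4 := 2 * c0 * c3 + 1.
Let c5 := 2 * h * (1 + c4).
Let c6 := (2 * w + w * c5) * (w * c5).

Let c0_ge1 : 1 <= c0.
Proof. by rewrite /c0 lerDr mulr_ge0 ?sqr_ge0. Qed.

Let y_lower s : s^T = s -> n1 s ^+ 2 <= c0 * nsq (y s).
Proof.
move=> ssym; rewrite -y_sq//; have [t0 st] := n1_sq_trace ssym.
apply: (le_trans st); rewrite /c0; lra.
Qed.

Let h0 : 0 <= h. Proof. exact: n1_ge0. Qed.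
Let k0 : 0 <= k. Proof. exact: n1_ge0. Qed.
Let w0 : 0 <= w. Proof. exact: n1_ge0. Qed.
Let c1_ge0 : 0 <= c1. Proof. by rewrite mulr_ge0// addr_ge0// mulr_ge0. Qed.
Let c2_ge0 : 0 <= c2. Proof. by rewrite addr_ge0// sqr_ge0. Qed.
Let c3_ge0 : 0 <= c3. Proof. by rewrite addr_ge0// sqr_ge0. Qed.
Let c4_ge1 : 1 <= c4.
Proof. by rewrite /c4 lerDr !mulr_ge0//; exact: le_trans c0_ge1. Qed.
Let c5_ge0 : 0 <= c5.
Proof. by rewrite !mulr_ge0// addr_ge0// (le_trans _ c4_ge1). Qed.
Let c6_ge0 : 0 <= c6.
Proof. by have := mulr_ge0 w0 c5_ge0; rewrite /c6 => ?; rewrite mulr_ge0// addr_ge0// mulr_ge0. Qed.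

(** The competitor is the linear least-squares solution [th0 + H y(S - 1)]: its residual is the
    component of [y(S - 1)] seen by [U], up to the expansion error of [sig]. *)
Let upper (e1 : R) : 0 < e1 -> e1 <= 1 -> exists2 delta : R, 0 < delta &
  forall S, posdef S -> n1 (S - 1%:M) <= delta -> exists2 th, Theta th &
    KL S (sig th) <= nsq (U *m y (S - 1%:M)) + e1 * c2 * n1 (S - 1%:M) ^+ 2.
Proof.
move=> e10 e11.
have [d1 d10 hexp] := sig_expand e10.
have [d2 d20 hKL] := @KL_expand R n e1 e10.
have ckh : 0 <= c0 * (k + h) by rewrite mulr_ge0 ?addr_ge0//; exact: le_trans c0_ge1.
exists (Num.min (d1 / (h + 1)) (d2 / (c0 * (k + h) + 1))).
  by rewrite lt_min !divr_gt0//; apply: ltr_wpDl.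
move=> S pS; set s := S - 1%:M; set a := n1 s; rewrite le_min => /andP[ad1 ad2].
have a0 : 0 <= a := n1_ge0 s.
have had1 : h * a <= d1.
  apply: (@le_trans _ _ ((h + 1) * a)); first by rewrite ler_wpM2r// lerDl.
  by rewrite mulrC -ler_pdivlMr// ltr_wpDl.
have had2 : (c0 * (k + h)) * a + a <= d2.
  rewrite (_ : _ + _ = (c0 * (k + h) + 1) * a); last by ring.
  by rewrite mulrC -ler_pdivlMr// ltr_wpDl.
pose u := H *m y s.
have nys : n1 (y s) <= a := y_le s.
have nu : n1 u <= h * a by apply: le_trans (n1M _ _) _; rewrite ler_pM ?n1_ge0.
have [Tu] := hexp u (le_trans nu had1).
set V := sig (th0 + u) in Tu *; set rem := _ - B *m u => nrem.
have {}nrem : n1 rem <= e1 * (h * a).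
  by apply: le_trans nrem _; rewrite ler_wpM2l// ltW.
have yE : y (S - V) = U^T *m (U *m y s) - rem.
  rewrite -BH -/u /rem (_ : S - V = s - (V - 1%:M)); last by rewrite opprB addrA subrK.
  by rewrite yB opprB addrA subrK.
have nUUy : n1 (U^T *m (U *m y s)) <= k * a.
  by rewrite mulmxA; apply: le_trans (n1M _ _) _; rewrite ler_wpM2l.
have pV : posdef V := sig_posdef Tu.
have SVsym : (S - V)^T = S - V by rewrite linearB /= pS.1 pV.1.
have nyE : n1 (y (S - V)) <= (k + h) * a.
  rewrite yE; apply: le_trans (n1B _ _) _; rewrite mulrDl lerD//.
  by apply: le_trans nrem _; rewrite -[leRHS]mul1r ler_wpM2r// mulr_ge0.
have nSV : n1 (S - V) <= (c0 * (k + h)) * a.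
  have cka : 0 <= (k + h) * a by rewrite mulr_ge0// addr_ge0.
  have cc := mulr_ge0 ckh a0; rewrite -ler_sqr ?nnegrE ?n1_ge0//.
  apply: le_trans (y_lower SVsym) _; rewrite -mulrA exprMn.
  have : nsq (y (S - V)) <= ((k + h) * a) ^+ 2.
    by apply: le_trans (nsq_n1 _) _; rewrite lerXn2r ?nnegrE ?n1_ge0.
  have c01 : c0 <= c0 ^+ 2 by rewrite expr2 ler_peMl// (le_trans _ c0_ge1).
  by move=> h1; rewrite ler_pM ?nsq_ge0// (le_trans _ c0_ge1).
have nV : n1 (V - 1%:M) <= d2.
  rewrite (_ : V - 1%:M = s - (S - V)); last by rewrite /s opprB [RHS]addrC addrA subrK.
  have t := n1B s (S - V); have t' := lerD (lexx a) nSV.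
  by apply: (le_trans t); apply: (le_trans t'); rewrite addrC.
exists (th0 + u) => //; rewrite -/V.
have sd2 : a <= d2 by apply: le_trans had2; rewrite lerDr mulr_ge0.
have := hKL S V pS pV sd2 nV; rewrite y_sq// ler_norml => /andP[_ hk].
have hn := nsqD_le nUUy (e := - rem) (b := e1 * (h * a)).
rewrite n1N -yE nsq_coisometry// in hn; have := hn nrem; rewrite ler_norml => /andP[_ hn'].
have t1 : (2 * (k * a) + e1 * (h * a)) * (e1 * (h * a)) <= e1 * c1 * a ^+ 2.
  rewrite (_ : _ * _ = e1 * a ^+ 2 * ((2 * k + e1 * h) * h)); last by ring.
  rewrite (_ : e1 * c1 * _ = e1 * a ^+ 2 * c1); last by ring.
  rewrite ler_wpM2l ?mulr_ge0 ?(ltW e10) ?sqr_ge0// ler_wpM2r// lerD2l.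
  by rewrite -[leRHS]mul1r ler_wpM2r.
have t2 : e1 * n1 (S - V) ^+ 2 <= e1 * (c0 * (k + h)) ^+ 2 * a ^+ 2.
  rewrite -mulrA -exprMn ler_wpM2l ?(ltW e10)// lerXn2r ?nnegrE ?n1_ge0//.
  by rewrite mulr_ge0.
rewrite /c2 mulrDr mulrDl; lra.
Qed.

(** For the lower bound, a minimiser has small divergence, so [sig th] is near the identity by
    coercivity and [th] near [th0] by identifiability. There [sig] is nearly affine, [U] annihilates
    its linear part [B u], and [U] does not increase lengths. *)
Lemma minimiser_KL (eps : R) : 0 < eps -> exists2 delta : R, 0 < delta &
  forall S th, posdef S -> Theta th -> n1 (S - 1%:M) <= delta ->
    (forall th', Theta th' -> KL S (sig th) <= KL S (sig th')) ->
    `|KL S (sig th) - nsq (U *m y (S - 1%:M))| <= eps * n1 (S - 1%:M) ^+ 2.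
Proof.
move=> eps0.
pose c7 := c2 + c6 + c4 ^+ 2 + 1.
have c7_gt0 : 0 < c7 by rewrite ltr_wpDl// addr_ge0 ?sqr_ge0// addr_ge0.
have c00 : 0 < c0 by apply: lt_le_trans c0_ge1.
pose e1 := Num.min (Num.min 1 (eps / c7)) (Num.min (2 * c0)^-1 (2 * h + 1)^-1).
have h20 : 0 < 2 * h + 1 by rewrite ltr_wpDl// mulr_ge0.
have e10 : 0 < e1 by rewrite !lt_min ltr01 divr_gt0//= !invr_gt0 h20 mulr_gt0.
have : e1 <= e1 by []. rewrite {2}/e1 !le_min => /andP[/andP[e11 e1c7] /andP[e1c0 e1h]].
have {}e1c7 : e1 * c7 <= eps by rewrite -ler_pdivlMr.
have {}e1c0 : e1 * (2 * c0) <= 1 by rewrite -ler_pdivlMr ?mul1r// mulr_gt0.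
have {}e1h : e1 * (2 * h + 1) <= 1 by rewrite -ler_pdivlMr ?mul1r.
have [dU dU0 hU] := upper e10 e11.
have [dE dE0 hE] := sig_expand e10.
have [dI dI0 hI] := sig_ident dE0.
have [dK dK0 hK] := @KL_expand R n e1 e10.
pose m := Num.min dI dK; have m0 : 0 < m by rewrite lt_min dI0.
have [dC dC0 hC] := @KL_coercive R n m m0.
clearbody e1.
exists (Num.min (Num.min dU dK) (Num.min dC (Num.min 1 (dC / (c3 + 1))))).
  by rewrite !lt_min dU0 dK0 dC0 ltr01 divr_gt0// ltr_wpDl.
move=> S th pS Tth; set s := S - 1%:M; set a := n1 s.
rewrite !le_min => /andP[/andP[aU aK] /andP[aC /andP[a1 ac3]]] thmin.
have a0 : 0 <= a := n1_ge0 s.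
have nys : n1 (y s) <= a := y_le s.
have nUy : n1 (U *m y s) <= w * a.
  by apply: le_trans (n1M _ _) _; rewrite ler_wpM2l.
set V := sig th in thmin *; have pV : posdef V := sig_posdef Tth.
have [th' Tth' hth'] := hU S pS aU.
have up : KL S V <= nsq (U *m y s) + e1 * c2 * a ^+ 2.
  exact: le_trans (thmin _ Tth') hth'.
have a20 : 0 <= a ^+ 2 by rewrite sqr_ge0.
have upc3 : KL S V <= c3 * a ^+ 2.
  apply: le_trans up _; rewrite /c3 mulrDl lerD//.
    by apply: le_trans (nsq_n1 _) _; rewrite -exprMn lerXn2r ?nnegrE ?n1_ge0 ?mulr_ge0.
  by rewrite ler_wpM2r// -[leRHS]mul1r ler_wpM2r.
have KC : KL S V <= dC.
  apply: le_trans upc3 _; apply: (@le_trans _ _ ((c3 + 1) * a)).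
    by rewrite ler_pM ?lerDl// expr2 -[leRHS]mul1r ler_wpM2r.
  by rewrite mulrC -ler_pdivlMr// ltr_wpDl.
have := hC S V pS pV aC KC; rewrite le_min => /andP[VI VK].
pose u := th - th0.
have nu : n1 u <= dE := hI _ Tth VI.
have thu : th0 + u = th by rewrite /u addrC subrK.
have [_] := hE u nu; rewrite thu -/V.
set rem := _ - B *m u => nrem.
have SVsym : (S - V)^T = S - V by rewrite linearB /= pS.1 pV.1.
have yl := y_lower SVsym.
have := hK S V pS pV aK VK; rewrite y_sq// ler_norml => /andP[hk1 hk2].
have Y0 := nsq_ge0 (y (S - V)).
(* [e1 * (2 * c0) <= 1] makes the expansion error at most half of the quadratic term; this yields
   the a priori bound on [S - V]. *)
have eSV : e1 * n1 (S - V) ^+ 2 <= nsq (y (S - V)) / 2.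
  apply: (@le_trans _ _ (e1 * (c0 * nsq (y (S - V))))); first by rewrite ler_wpM2l ?(ltW e10).
  rewrite (_ : _ * _ = e1 * (2 * c0) * nsq (y (S - V)) / 2); last by field.
  by rewrite ler_pM2r// -[leRHS]mul1r ler_wpM2r.
have YK : nsq (y (S - V)) <= 2 * (c3 * a ^+ 2) by lra.
have nSV : n1 (S - V) <= c4 * a.
  have c40 : 0 <= c4 by apply: le_trans c4_ge1.
  rewrite -ler_sqr ?nnegrE ?n1_ge0 ?mulr_ge0//.
  apply: le_trans yl _; apply: (@le_trans _ _ (c0 * (2 * (c3 * a ^+ 2)))).
    by rewrite ler_wpM2l// ltW.
  rewrite exprMn (_ : c0 * _ = (2 * c0 * c3) * a ^+ 2); last by ring.
  rewrite ler_wpM2r//; apply: (@le_trans _ _ c4); first by rewrite lerDl.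
  by rewrite expr2 ler_peMl.
have yV : y (V - 1%:M) = y s - y (S - V).
  by rewrite -yB; congr y; rewrite /s opprB [RHS]addrC addrA subrK.
have nyV : n1 (y (V - 1%:M)) <= (1 + c4) * a.
  rewrite yV; apply: le_trans (n1B _ _) _; rewrite mulrDl mul1r lerD//.
  exact: le_trans (y_le _) nSV.
(* [H] is a left inverse of [B], and the smallness of [e1 * h] lets the term in [n1 u] on the right
   be absorbed. *)
have nu5 : n1 u <= c5 * a.
  have uE : u = H *m (y (V - 1%:M) - rem) by rewrite /rem opprB addrC subrK mulmxA HB mul1mx.
  have : n1 u <= h * ((1 + c4) * a + e1 * n1 u).
    rewrite {1}uE; apply: le_trans (n1M _ _) _; rewrite ler_wpM2l//.
    by apply: le_trans (n1B _ _) _; rewrite lerD.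
  have : e1 * (2 * h + 1) * n1 u <= n1 u.
    by rewrite -[leRHS]mul1r ler_wpM2r ?n1_ge0.
  have : 0 <= e1 * n1 u by rewrite mulr_ge0 ?(ltW e10) ?n1_ge0.
  rewrite /c5; set hca := h * _; rewrite /hca => *; lra.
have UyE : U *m y (S - V) = U *m y s - U *m rem.
  rewrite (_ : y (S - V) = y s - y (V - 1%:M)); last by rewrite yV opprB [RHS]addrC subrK.
  rewrite mulmxBr; congr (_ - _).
  by rewrite /rem mulmxBr mulmxA UB mul0mx subr0.
have nUrem : n1 (U *m rem) <= e1 * (w * c5 * a).
  apply: le_trans (n1M _ _) _; rewrite (_ : e1 * _ = w * (e1 * (c5 * a))); last by ring.
  by rewrite ler_wpM2l//; apply: le_trans nrem _; rewrite ler_wpM2l// ltW.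
have hn := nsqD_le nUy (e := - (U *m rem)) (b := e1 * (w * c5 * a)).
rewrite n1N -UyE in hn; have := hn nUrem; rewrite ler_norml => /andP[hn' _].
have t1 : (2 * (w * a) + e1 * (w * c5 * a)) * (e1 * (w * c5 * a)) <= e1 * c6 * a ^+ 2.
  have -> : (2 * (w * a) + e1 * (w * c5 * a)) * (e1 * (w * c5 * a)) =
      e1 * a ^+ 2 * ((2 * w + e1 * (w * c5)) * (w * c5)).
    by move: (w) (c5) => w' c'; ring.
  rewrite (_ : e1 * c6 * _ = e1 * a ^+ 2 * c6); last by ring.
  have wc : 0 <= w * c5 by exact: mulr_ge0.
  apply: ler_wpM2l; first by apply: mulr_ge0 => //; exact: ltW.
  apply: ler_wpM2r => //; rewrite lerD2l -[leRHS]mul1r.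
  exact: ler_wpM2r.
have t2 : e1 * n1 (S - V) ^+ 2 <= e1 * c4 ^+ 2 * a ^+ 2.
  rewrite -mulrA -exprMn ler_wpM2l ?(ltW e10)// lerXn2r ?nnegrE ?n1_ge0//.
  by rewrite mulr_ge0// (le_trans _ c4_ge1).
have ctr := nsq_contract (y (S - V)) UU.
have e1a : e1 * c7 * a ^+ 2 <= eps * a ^+ 2 by rewrite ler_wpM2r.
have e10' := ltW e10.
have p2 : 0 <= e1 * c2 * a ^+ 2 := mulr_ge0 (mulr_ge0 e10' c2_ge0) a20.
have p6 : 0 <= e1 * c6 * a ^+ 2 := mulr_ge0 (mulr_ge0 e10' c6_ge0) a20.
have p4 : 0 <= e1 * c4 ^+ 2 * a ^+ 2 := mulr_ge0 (mulr_ge0 e10' (sqr_ge0 _)) a20.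
have p1 : 0 <= e1 * a ^+ 2 by rewrite mulr_ge0// ltW.
have E7 : e1 * c7 * a ^+ 2 = e1 * c2 * a ^+ 2 + e1 * c6 * a ^+ 2 + e1 * c4 ^+ 2 * a ^+ 2 + e1 * a ^+ 2.
  by rewrite /c7; ring.
rewrite E7 in e1a.
set z1 := e1 * c2 * a ^+ 2 in e1a up p2; set z2 := e1 * c6 * a ^+ 2 in e1a t1 p6.
set z3 := e1 * c4 ^+ 2 * a ^+ 2 in e1a t2 p4.
clearbody z1 z2 z3.
by clear -yB y_le y_sq UU UB HB BH sig_posdef sig_expand sig_ident e1a up t1 t2 hn' hk1 hk2 ctr p1 p2 p4 p6; rewrite ler_norml; apply/andP; split; lra.
Qed.

End minimise.

Section projection.
Context (R : realType).

Lemma posdef_gram m n (A : 'M[R]_(m, n)) : (forall x : 'cV_m, A^T *m x = 0 -> x = 0) ->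
  posdef (A *m A^T).
Proof.
move=> inj; split; first by rewrite trmx_mul trmxK.
move=> x x0; rewrite mulmxA -mulmxA -{1}[A]trmxK -trmx_mul -nsqE lt0r nsq_ge0 andbT.
apply: contra x0; rewrite psumr_eq0 => [/allP h|i _]; last exact: sqr_ge0.
apply/eqP/inj/matrixP => i j; rewrite (ord1 j) [RHS]mxE.
by have := h i (mem_index_enum _); rewrite /= sqrf_eq0 => /eqP.
Qed.

(* U is an orthonormal frame of the orthogonal complement of the range of B, H the least-squares
   solution operator. *)
Lemma orthogonal_complement N q (B : 'M[R]_(N, q)) : (forall u : 'cV_q, B *m u = 0 -> u = 0) ->
  exists (U : 'M[R]_(N - q, N)) (H : 'M[R]_(q, N)),
    [/\ U *m U^T = 1%:M, U *m B = 0, H *m B = 1%:M &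
        forall v : 'cV_N, v - B *m (H *m v) = U^T *m (U *m v)].
Proof.
move=> inj.
have pG : posdef (B^T *m B) by have := @posdef_gram _ _ B^T; rewrite trmxK; exact.
have uG := posdef_unit pG.
pose H := invmx (B^T *m B) *m B^T.
have HB : H *m B = 1%:M by rewrite -mulmxA mulVmx.
pose P := 1%:M - B *m H.
have PT : P^T = P.
  rewrite /P linearB /= trmx1 !trmx_mul trmxK trmx_inv trmx_mul trmxK.
  by rewrite mulmxA.
have PB : P *m B = 0 by rewrite mulmxBl mul1mx -mulmxA HB mulmx1 subrr.
have rB : \rank B = q.
  apply/eqP; rewrite eqn_leq rank_leq_col /= -{1}(mxrank1 R q) -HB.
  exact: mxrankM_maxr.
have [K Kfree KP] : exists2 K : 'M[R]_(N - q, N), row_free K & (K :=: kermx B)%MS.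
  have := mxrank_ker B; rewrite rB => <-.
  by exists (row_base (kermx B)); [exact: row_base_free|exact: eq_row_base].
have KB : K *m B = 0 by apply/sub_kermxP; rewrite KP.
have pK : posdef (K *m K^T).
  apply: posdef_gram => x Kx; have : x^T *m K = 0 by rewrite -[K]trmxK -trmx_mul Kx trmx0.
  by move=> h; apply: trmx_inj; rewrite trmx0; apply: (row_free_inj Kfree); rewrite h mul0mx.
have [C uC KC] := cholesky pK.
pose U := invmx C *m K.
have UU : U *m U^T = 1%:M.
  rewrite /U trmx_mul -mulmxA (mulmxA K) KC mulmxA mulmxA mulVmx// mul1mx.
  by rewrite trmx_inv mulmxV// unitmx_tr.
have UB : U *m B = 0 by rewrite /U -mulmxA KB mulmx0.
have UP : U *m P = U by rewrite /P mulmxBr mulmx1 mulmxA UB mul0mx subr0.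
have PU : P *m U^T = U^T by rewrite -{1}PT -trmx_mul UP.
(* The rows of [P] lie in the left kernel of [B], spanned by those of [U]; then [P U^T = U^T]
   identifies the coefficients [Z] as [U^T]. *)
have [Z PZ] : exists Z, P = Z *m U.
  have /submxP[Z PZ] : (P <= K)%MS by rewrite KP; apply/sub_kermxP.
  by exists (Z *m C); rewrite /U PZ mulmxA mulmxK.
have PE : P = U^T *m U.
  have ZE : Z = U^T by rewrite -PU PZ -mulmxA UU mulmx1.
  by rewrite -ZE.
exists U, H; split=> // v.
by rewrite [RHS]mulmxA -PE /P mulmxBl mul1mx mulmxA.
Qed.

End projection.

(** * Half-vectorisation as an isometry *)

Section half_vectorisation.
Context (R : realType) (n : nat).
Implicit Types s A : 'M[R]_n.

Definition vech_pairs : seq ('I_n * 'I_n) :=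
  [seq (i, j) | j : 'I_n <- enum 'I_n, i : 'I_n <- [seq i : 'I_n <- enum 'I_n | (j <= i)%N]].

Lemma vech_seqE A : vech_seq A = [seq A ij.1 ij.2 | ij <- vech_pairs].
Proof. by rewrite /vech_seq /vech_pairs map_allpairs. Qed.

Lemma size_vech_pairs : size vech_pairs = ((n * n.+1)./2)%N.
Proof. by rewrite -(size_vech_seq (0 : 'M[R]_n)) vech_seqE size_map. Qed.

(** [tr (s s)] counts off-diagonal entries twice and diagonal ones once, so half of it needs weights
    1 and [1 / 2] on the squares. The same weights equalise the variances of [z_i z_j] and
    [z_i^2 - 1] for independent standard normal [z_i]. *)
Definition pair_weight (ij : 'I_n * 'I_n) : R :=
  if ij.1 == ij.2 then (Num.sqrt 2)^-1 else 1.

Definition svech s : 'cV[R]_((n * n.+1)./2) :=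
  \col_k [seq pair_weight ij * s ij.1 ij.2 | ij <- vech_pairs]`_k.

(** The pair is chosen before [f]: [svech], [vech] and any other list indexed by [vech_pairs] are
    then read at the same pair, with no default pair to provide. *)
Lemma pair_at (k : 'I_((n * n.+1)./2)) : exists ij : 'I_n * 'I_n,
  forall f : 'I_n * 'I_n -> R, [seq f x | x <- vech_pairs]`_k = f ij.
Proof.
have : (k < size vech_pairs)%N by rewrite size_vech_pairs.
elim: vech_pairs (nat_of_ord k) => // x l IH [_|m /IH[ij h]]; first by exists x.
by exists ij => f; exact: h.
Qed.

Lemma svechP (k : 'I_((n * n.+1)./2)) : exists i j (c : R), [/\ 0 < c <= 1,
  forall s, svech s k 0 = c * s i j & forall A, vech A k 0 = A i j].
Proof.
have [[i j] h] := pair_at k; exists i, j, (pair_weight (i, j)); split.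
- rewrite /pair_weight; case: ifP => _; last by rewrite ltr01 lexx.
  rewrite invr_gt0 sqrtr_gt0 ltr0n /= invf_le1 ?sqrtr_gt0//.
  by rewrite -[leLHS]sqrtr1 ler_wsqrtr// ler1n.
- by move=> s; rewrite mxE h.
- by move=> A; rewrite mxE vech_seqE h.
Qed.

Lemma svechB s t : svech (s - t) = svech s - svech t.
Proof.
apply/colP => k; have [i [j [c [_ h _]]]] := svechP k.
by rewrite [RHS]mxE [(- svech t) k 0]mxE !h !mxE; ring.
Qed.

Lemma svechZ (a : R) s : svech (a *: s) = a *: svech s.
Proof.
apply/colP => k; have [i [j [c [_ h _]]]] := svechP k.
by rewrite [RHS]mxE !h !mxE; ring.
Qed.

Lemma svechD s t : svech (s + t) = svech s + svech t.
Proof.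
apply/colP => k; have [i [j [c [_ h _]]]] := svechP k.
by rewrite [RHS]mxE !h !mxE; ring.
Qed.

Lemma svech_sum I (l : seq I) (F : I -> 'M[R]_n) :
  svech (\sum_(x <- l) F x) = \sum_(x <- l) svech (F x).
Proof.
elim/big_rec2: _ => [|x v A _ <-]; last by rewrite svechD.
by apply/colP => k; have [i [j [c [_ h _]]]] := svechP k; rewrite h !mxE mulr0.
Qed.

Lemma sum_vech_pairs (f : 'I_n -> 'I_n -> R) :
  \sum_(ij <- vech_pairs) f ij.1 ij.2 = \sum_(j < n) \sum_(i < n | (j <= i)%N) f i j.
Proof.
rewrite /vech_pairs big_allpairs_dep big_enum /=; apply: eq_bigr => j _.
by rewrite big_filter big_enum_cond.
Qed.

Lemma sum_svech (g : R -> R) s :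
  \sum_k g (svech s k 0) = \sum_(ij <- vech_pairs) g (pair_weight ij * s ij.1 ij.2).
Proof.
rewrite -(big_map (fun ij => pair_weight ij * s ij.1 ij.2) predT g).
rewrite (big_nth 0) size_map size_vech_pairs big_mkord.
by apply: eq_bigr => k _; rewrite mxE.
Qed.

Lemma nsq_svech s : s^T = s -> \tr (s *m s) / 2 = nsq (svech s).
Proof.
move=> ssym; have sE i j : s j i = s i j by rewrite -{1}ssym mxE.
rewrite /nsq (sum_svech (fun x => x ^+ 2)).
have -> : \tr (s *m s) = \sum_j \sum_i s i j ^+ 2.
  by apply: eq_bigr => j _; rewrite mxE; apply: eq_bigr => i _; rewrite sE expr2.
pose w (i j : 'I_n) : R := if i == j then 2^-1 else 1.
have -> : \sum_(ij <- vech_pairs) (pair_weight ij * s ij.1 ij.2) ^+ 2 =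
    \sum_(ij <- vech_pairs) w ij.1 ij.2 * s ij.1 ij.2 ^+ 2.
  apply: eq_bigr => ij _; rewrite exprMn; congr (_ * _).
  by rewrite /pair_weight /w; case: ifP; rewrite ?expr1n// exprVn sqr_sqrtr.
rewrite (sum_vech_pairs (fun i j => w i j * s i j ^+ 2)).
have split_sum (f : 'I_n -> 'I_n -> R) :
    \sum_(j < n) \sum_(i < n | (j <= i)%N) w i j * f i j =
    \sum_j f j j / 2 + \sum_(j < n) \sum_(i < n | (j < i)%N) f i j.
  rewrite -big_split; apply: eq_bigr => j _ /=.
  rewrite (bigD1 j)//= /w eqxx mulrC; congr (_ + _).
  apply: eq_big => [i|i /andP[_ ij]]; first by rewrite ltn_neqAle andbC eq_sym.
  by rewrite (negbTE ij) mul1r.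
rewrite split_sum.
have low : \sum_(j < n) \sum_(i < n | (i < j)%N) s i j ^+ 2 =
    \sum_(j < n) \sum_(i < n | (j < i)%N) s i j ^+ 2.
  rewrite (exchange_big_dep predT)//=; apply: eq_bigr => i _.
  by apply: eq_bigr => j _; rewrite sE.
have -> : \sum_j \sum_i s i j ^+ 2 = \sum_j s j j ^+ 2 +
    \sum_(j < n) \sum_(i < n | (j < i)%N) s i j ^+ 2 + \sum_(j < n) \sum_(i < n | (i < j)%N) s i j ^+ 2.
  rewrite -!big_split; apply: eq_bigr => j _ /=.
  rewrite (bigD1 j)//= -addrA; congr (_ + _).
  rewrite (bigID (fun i : 'I_n => (j < i)%N))/=; congr (_ + _); apply: eq_bigl => i.
    by rewrite -(inj_eq val_inj) /=; case: ltngtP.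
  by rewrite -(inj_eq val_inj) /=; case: ltngtP.
rewrite low -mulr_suml; lra.
Qed.

Lemma n1_svech s : n1 (svech s) <= n1 s.
Proof.
rewrite n1_cV (sum_svech (fun x => `|x|)).
apply: (@le_trans _ _ (\sum_(ij <- vech_pairs) `|s ij.1 ij.2|)).
  apply: ler_sum => ij _; rewrite normrM ler_piMl// /pair_weight.
  case: ifP => _; rewrite ?normr1// normfV ger0_norm ?sqrtr_ge0// invf_le1 ?sqrtr_gt0//.
  by rewrite -[leLHS]sqrtr1 ler_wsqrtr// ler1n.
rewrite (sum_vech_pairs (fun i j => `|s i j|)) /n1 [leRHS]exchange_big /=.
by apply: ler_sum => j _; rewrite [leRHS](bigID (fun i : 'I_n => (j <= i)%N)) /= lerDl sumr_ge0.
Qed.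

Lemma svech_eq0 s : s^T = s -> svech s = 0 -> s = 0.
Proof.
move=> ssym s0; have sE i j : s j i = s i j by rewrite -{1}ssym mxE.
have := nsq_svech ssym; rewrite s0 /nsq big1 => [h|i _]; last by rewrite mxE expr0n.
have {h} : \sum_i \sum_j s i j ^+ 2 = 0.
  have <- : \tr (s *m s) = \sum_i \sum_j s i j ^+ 2.
    by apply: eq_bigr => i _; rewrite mxE; apply: eq_bigr => j _; rewrite sE expr2.
  lra.
move/eqP; rewrite psumr_eq0 => [/allP h|i _]; last by apply: sumr_ge0 => j _; exact: sqr_ge0.
apply/matrixP => i j; have := h i (mem_index_enum _) => /=.
rewrite psumr_eq0 => [/allP h'|j' _]; last exact: sqr_ge0.
by have := h' j (mem_index_enum _); rewrite /= sqrf_eq0 mxE => /eqP.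
Qed.

End half_vectorisation.

(** * First-order expansion and local identification of the parametrised covariance *)

Section first_order.
Context (R : realType) (q : nat).
Implicit Types (x v u : 'cV[R]_q) (f : 'cV[R]_q -> R).

Lemma n1_scale_delta (a : R) (j : 'I_q) : n1 (a *: delta_mx j 0 : 'cV[R]_q) = `|a|.
Proof.
rewrite n1Z n1_cV (bigD1 j)//= big1 => [|i ij]; last by rewrite mxE (negbTE ij) normr0.
by rewrite mxE !eqxx normr1 addr0 mulr1.
Qed.

Lemma nbhs_n1 x (A : set 'cV[R]_q) : nbhs x A ->
  exists2 delta : R, 0 < delta & forall v, n1 v <= delta -> A (x + v).
Proof.
rewrite -nbhs_ballE => -[e /= e0 hA]; exists (e / 2); first by rewrite divr_gt0.
move=> v ve; apply: hA; split=> // i j.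
rewrite /ball /= mxE opprD addrA subrr sub0r normrN.
by apply: le_lt_trans (n1_entry v i j) (le_lt_trans ve _); rewrite ltr_pdivrMr// ltr_pMr// ltr1n.
Qed.

Lemma continuous_n1 m (f : 'cV[R]_q -> 'cV[R]_m) x :
  (forall i, {for x, continuous (fun y => f y i 0)}) -> {for x, continuous (fun y => n1 (f y))}.
Proof.
move=> cf; rewrite /continuous_at /n1.
apply: (@cvg_sum _ _ (nbhs x)) => i; apply: (@cvg_sum _ _ (nbhs x)) => j; rewrite (ord1 j).
by apply: cvg_norm; exact: cf.
Qed.

Lemma is_derive_line f x j (s : R) : derivable f (x + s *: delta_mx j 0) (delta_mx j 0) ->
  is_derive s 1 (fun t : R => f (x + t *: delta_mx j 0))
    ('D_(delta_mx j 0) f (x + s *: delta_mx j 0)).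
Proof.
set v : 'cV[R]_q := delta_mx j 0; set g := fun t : R => _ => df.
have gE : (fun h : R => h^-1 *: ((g \o shift s) (h *: (1 : R)) - g s)) =
          (fun h : R => h^-1 *: ((f \o shift (x + s *: v)) (h *: v) - f (x + s *: v))).
  apply/funext => h; rewrite /g /= [h *: 1]mulr1 scalerDl; congr (_ *: (f _ - _)).
  by rewrite addrCA addrA.
by split; rewrite ?/derivable ?/derive gE.
Qed.

Lemma mean_value_line f x j (a : R) (d e : R) :
  (forall t : R, 0 <= t <= 1 -> derivable f (x + (t * a) *: delta_mx j 0) (delta_mx j 0)) ->
  (forall t : R, 0 <= t <= 1 -> `|'D_(delta_mx j 0) f (x + (t * a) *: delta_mx j 0) - d| <= e) ->
  `|f (x + a *: delta_mx j 0) - f x - a * d| <= e * `|a|.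
Proof.
move=> df De.
pose g (t : R) := f (x + (t * a) *: delta_mx j 0).
pose g' (t : R) := 'D_(delta_mx j 0) f (x + (t * a) *: delta_mx j 0) * (1 * a + t * 0).
have dg (t : R) : 0 <= t <= 1 -> is_derive t 1 g (g' t).
  move=> t01; apply: (@is_derive_compf _ (fun s : R => f (x + s *: delta_mx j 0)) (fun t : R => t * a)).
    exact: is_derive_line (df t t01).
  exact: is_derive_mulf (is_derive_idf t) (is_derive_cstf a t).
have h01 : 0 <= (1 : R) <= 1 by rewrite ler01 lexx.
have [c c01] := MVT01 h01 dg.
rewrite {1 2}/g mul1r mul0r scale0r addr0 mulr1 => ->.
rewrite /g' mul1r mulr0 addr0 [X in _ - X]mulrC -mulrBl normrM.
by rewrite ler_wpM2r// De.
Qed.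

(** Continuous partial derivatives give a differential: one coordinate moves at a time, with the
    mean value theorem on each segment, inside a ball where the partial derivatives vary by at most
    [eps]. *)
Lemma class_C_expand (U : set 'cV[R]_q) f x (eps : R) : open U -> class_C 2 U f -> U x ->
  0 < eps -> exists2 delta : R, 0 < delta & forall u, n1 u <= delta ->
    `|f (x + u) - f x - \sum_j u j 0 * 'D_(delta_mx j 0) f x| <= eps * n1 u.
Proof.
move=> oU cf Ux eps0.
have h : nbhs x [set y | U y /\ forall j, `|'D_(delta_mx j 0) f y - 'D_(delta_mx j 0) f x| <= eps].
  apply: filterI; first exact: open_nbhs_nbhs.
  have hj (j : 'I_q) : nbhs x [set y | `|'D_(delta_mx j 0) f y - 'D_(delta_mx j 0) f x| <= eps].
    have [cj _] := cf [:: j] isT x Ux.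
    have /cvgrPdist_le/(_ _ eps0) := cj.
    by apply: filterS => y /=; rewrite distrC.
  exact: (filter_forall (nbhs_filter x) hj).
have {h}[d d0 hd] := nbhs_n1 h.
exists d => // u ud.
pose w (l : seq 'I_q) : 'cV[R]_q := \sum_(j <- l) u j 0 *: delta_mx j 0.
pose N (l : seq 'I_q) := \sum_(j <- l) `|u j 0|.
have nw l : n1 (w l) <= N l.
  by apply: le_trans (n1_sum _ _) _; apply: ler_sum => j _; rewrite n1_scale_delta.
suff key l : N l <= d -> `|f (x + w l) - f x - \sum_(j <- l) u j 0 * 'D_(delta_mx j 0) f x| <= eps * N l.
  have wE : w (index_enum _) = u.
    apply/colP => i; rewrite /w summxE (bigD1 i)//= !mxE !eqxx mulr1 big1 ?addr0// => j ji.
    by rewrite !mxE eq_sym (negbTE ji) mulr0.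
  have NE : N (index_enum _) = n1 u by rewrite n1_cV.
  by have := key (index_enum _); rewrite wE NE; apply.
elim: l => [_|j l IH]; first by rewrite /w /N !big_nil addr0 subrr subr0 normr0 mulr0.
have -> : w (j :: l) = w l + u j 0 *: delta_mx j 0 by rewrite /w big_cons addrC.
rewrite /N !big_cons -/(N l) => Nd.
have N0 : 0 <= N l by apply: sumr_ge0.
have Nld : N l <= d by apply: le_trans Nd; rewrite lerDr.
have pt (t : R) : 0 <= t <= 1 -> n1 (w l + (t * u j 0) *: delta_mx j 0) <= d.
  move=> /andP[t0 t1]; apply: le_trans (n1D _ _) _; apply: le_trans Nd.
  rewrite addrC lerD// n1_scale_delta normrM ger0_norm// ler_piMl//.
have h1 : `|f (x + w l + u j 0 *: delta_mx j 0) - f (x + w l) - u j 0 * 'D_(delta_mx j 0) f x|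
    <= eps * `|u j 0|.
  apply: mean_value_line => t t01; rewrite -addrA; have [Uy De] := hd _ (pt t t01).
    by have [_] := cf [::] isT _ Uy; apply.
  exact: De.
have h2 := IH Nld.
rewrite addrA; set z := _ - _ - _ in h1; set z2 := _ - _ - _ in h2.
have -> : f (x + w l + u j 0 *: delta_mx j 0) - f x -
   (u j 0 * 'D_(delta_mx j 0) f x + \sum_(j0 <- l) u j0 0 * 'D_(delta_mx j0 0) f x) = z + z2.
  by rewrite /z /z2; ring.
by apply: le_trans (ler_normD _ _) _; rewrite mulrDr lerD.
Qed.

End first_order.

Lemma common_radius (R : realType) (I : finType) (n : nat) (Q : I -> 'cV[R]_n -> Prop) :
  (forall i, exists2 delta : R, 0 < delta & forall u, n1 u <= delta -> Q i u) ->
  exists2 delta : R, 0 < delta & forall u, n1 u <= delta -> forall i, Q i u.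
Proof.
move=> h.
suff [d d0 hd] : exists2 delta : R, 0 < delta & forall u, n1 u <= delta ->
    forall i, i \in enum I -> Q i u.
  by exists d => // u /hd + i; apply; rewrite mem_enum.
elim: (enum I) => [|i l [d d0 hd]]; first by exists 1.
have [d' d'0 hd'] := h i; exists (Num.min d d'); first by rewrite lt_min d0.
move=> u; rewrite le_min => /andP[ud ud'] j; rewrite inE => /orP[/eqP ->|jl].
  exact: hd'.
exact: hd.
Qed.

Section local_minimiser.
Context (R : realType) (p q : nat).
Variables (Theta : set 'cV[R]_q) (Sg : 'cV[R]_q -> 'M[R]_p) (th0 : 'cV[R]_q) (L : 'M[R]_p).
Hypothesis Theta_compact : compact Theta.
Hypothesis Sg_smooth : exists U : set 'cV[R]_q, [/\ open U, Theta `<=` U &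
  forall i j, class_C 2 U (fun th => Sg th i j)].
Hypothesis Sg_posdef : forall th, Theta th -> posdef (Sg th).
Hypothesis th0_int : Theta° th0.
Hypothesis identifiable : forall th, Theta th -> Sg th = Sg th0 -> th = th0.
Hypothesis jacobian_rank : \rank (vech_jacobian Sg th0) = q.
Hypothesis L_unit : L \in unitmx.
Hypothesis L_root : Sg th0 = L *m L^T.

Definition white (A : 'M[R]_p) : 'M[R]_p := invmx L *m A *m (invmx L)^T.

Let Theta_th0 : Theta th0.
Proof. exact: (interior_subset th0_int). Qed.

Lemma whiteK A : L *m white A *m L^T = A.
Proof.
rewrite /white !mulmxA mulmxV// mul1mx -mulmxA -trmx_mul.
by rewrite mulmxV// trmx1 mulmx1.
Qed.

Lemma white_inj A : white A = 0 -> A = 0.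
Proof. by move=> h; rewrite -(whiteK A) h mulmx0 mul0mx. Qed.

Lemma white_tr A : A^T = A -> (white A)^T = white A.
Proof. by move=> AT; rewrite /white !trmx_mul trmxK AT mulmxA. Qed.

Lemma whiteB A A' : white (A - A') = white A - white A'.
Proof. by rewrite /white mulmxBr mulmxBl. Qed.

Lemma n1_white A : n1 (white A) <= n1 (invmx L) * n1 A * n1 (invmx L).
Proof.
rewrite /white; apply: le_trans (n1M _ _) _; rewrite n1_tr ler_wpM2r ?n1_ge0//.
exact: n1M.
Qed.

Let sig th := white (Sg th).

Lemma white_root : white (L *m L^T) = 1%:M.
Proof.
by rewrite /white mulmxA mulVmx// mul1mx -trmx_mul mulVmx// trmx1.
Qed.

Let dSg (j : 'I_q) : 'M[R]_p := \matrix_(i, k) 'D_(delta_mx j 0) (fun th => Sg th i k) th0.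

Let B : 'M[R]_((p * p.+1)./2, q) := \matrix_(k, j) svech (white (dSg j)) k 0.

Let BE (u : 'cV[R]_q) : B *m u = svech (white (\sum_j u j 0 *: dSg j)).
Proof.
have -> : white (\sum_j u j 0 *: dSg j) = \sum_j u j 0 *: white (dSg j).
  rewrite /white mulmx_sumr mulmx_suml; apply: eq_bigr => j _.
  by rewrite -scalemxAr -scalemxAl.
rewrite svech_sum; apply/colP => k; rewrite mxE summxE; apply: eq_bigr => j _.
by rewrite svechZ !mxE mulrC.
Qed.

(** [th0] is interior, so [Sg] is symmetric on a neighbourhood and its derivatives inherit the
    symmetry. *)
Let dSg_sym j : (dSg j)^T = dSg j.
Proof.
apply/matrixP => i k; rewrite !mxE; apply: near_eq_derive.
have : \forall th \near th0, Theta th by exact: th0_int.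
apply: filterS => th /Sg_posdef[sym _].
by rewrite -{1}sym mxE.
Qed.

(** [svech] and whitening are injective on symmetric matrices, so a vector killed by [B] is killed
    by the Jacobian of [vech], which has full column rank. *)
Let B_inj (u : 'cV[R]_q) : B *m u = 0 -> u = 0.
Proof.
rewrite BE => /svech_eq0 h.
have {h} : \sum_j u j 0 *: dSg j = 0.
  apply/white_inj/h/white_tr; rewrite linear_sum /=; apply: eq_bigr => j _.
  by rewrite linearZ /= dSg_sym.
move=> s0; have Ju : vech_jacobian Sg th0 *m u = 0.
  apply/colP => k; have [i [l [c [_ _ hv]]]] := @svechP R p k.
  have := congr1 (fun A : 'M[R]_p => A i l) s0; rewrite summxE mxE => e0.
  rewrite mxE [RHS]mxE -[RHS]e0; apply: eq_bigr => j _.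
  have -> : (u j 0 *: dSg j) i l = u j 0 * 'D_(delta_mx j 0) (fun th => Sg th i l) th0.
    by rewrite !mxE.
  rewrite [vech_jacobian _ _ k j]mxE mulrC.
  by have -> : (fun th => vech (Sg th) k 0) = (fun th => Sg th i l) by apply/funext => th; exact: hv.
have Jfree : row_free (vech_jacobian Sg th0)^T by rewrite /row_free mxrank_tr jacobian_rank.
apply: trmx_inj; rewrite trmx0; apply: (row_free_inj Jfree).
by rewrite mul0mx -trmx_mul Ju trmx0.
Qed.

Let sig_expand eps : 0 < eps -> exists2 delta : R, 0 < delta &
  forall u, n1 u <= delta -> Theta (th0 + u) /\
    n1 (svech (sig (th0 + u) - 1%:M) - B *m u) <= eps * n1 u.
Proof.
move=> eps0; have [U [oU TU cU]] := Sg_smooth.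
pose c := n1 (invmx L) * (p%:R * p%:R) * n1 (invmx L).
have c0 : 0 <= c by rewrite !mulr_ge0 ?n1_ge0.
pose e := eps / (c + 1); have e0 : 0 < e by rewrite divr_gt0// ltr_wpDl.
have ec : c * e <= eps.
  by rewrite /e mulrCA ler_piMr ?(ltW eps0)// ler_pdivrMr ?mul1r ?lerDl// ltr_wpDl.
have [d d0 hd] := @common_radius R ('I_p * 'I_p)%type q _ (fun ik : 'I_p * 'I_p =>
  class_C_expand oU (cU ik.1 ik.2) (TU _ Theta_th0) e0).
have [d' d'0 hd'] := nbhs_n1 th0_int.
exists (Num.min d d'); first by rewrite lt_min d0.
move=> u; rewrite le_min => /andP[ud ud']; split; first exact: hd'.
rewrite BE -svechB /sig -white_root -L_root -!whiteB.
apply: le_trans (n1_svech _) _; apply: le_trans (n1_white _) _.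
set E := _ - _ - _.
have nE : n1 E <= p%:R * p%:R * (e * n1 u).
  apply: (@le_trans _ _ (\sum_(i < p) \sum_(k < p) (e * n1 u))).
    apply: ler_sum => i _; apply: ler_sum => k _.
    have := hd u ud (i, k); rewrite /=; apply: le_trans.
    rewrite /E !mxE summxE le_eqVlt; apply/orP; left; apply/eqP; congr `| _ - _|.
    by apply: eq_bigr => j _; rewrite !mxE.
  set z := e * _.
  by rewrite !sumr_const !card_ord -(mulr_natr z p) -(mulr_natr (z * p%:R) p); lra.
apply: (@le_trans _ _ (n1 (invmx L) * (p%:R * p%:R * (e * n1 u)) * n1 (invmx L))).
  by rewrite ler_wpM2r ?n1_ge0// ler_wpM2l ?n1_ge0.
rewrite (_ : _ * _ = c * e * n1 u); last by rewrite /c; ring.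
by rewrite ler_wpM2r ?n1_ge0.
Qed.

(** The distance of [Sg th] from [Sg th0] is continuous and, by identifiability, positive on the
    compact set of parameters at distance at least [eta] from [th0]; its minimum there gives
    [delta]. *)
Let sig_ident eta : 0 < eta -> exists2 delta : R, 0 < delta &
  forall th, Theta th -> n1 (sig th - 1%:M) <= delta -> n1 (th - th0) <= eta.
Proof.
move=> eta0; have [U [oU TU cU]] := Sg_smooth.
pose K := Theta `&` [set th | eta <= n1 (th - th0)].
have cont_dist : continuous (fun th : 'cV[R]_q => n1 (th - th0)).
  move=> th; apply: (@continuous_n1 _ _ _ (fun y => y - th0)) => i.
  have -> : (fun y : 'cV[R]_q => (y - th0) i 0) = (fun y : 'cV[R]_q => y i 0 - th0 i 0).
    by apply/funext => y; rewrite !mxE.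
  by apply: continuousB; [exact: coord_continuous|exact: cst_continuous].
have cK : compact K.
  apply: compact_closedI => //.
  rewrite (_ : [set th | _] = (fun th : 'cV[R]_q => n1 (th - th0)) @^-1` [set x | eta <= x]).
    apply: preimage_closed; last exact: closed_ge.
    by move=> th _; exact: cont_dist.
  by [].
have [K0|] := pselect (K !=set0); last first.
  move=> K0; exists 1 => // th Tth _; rewrite leNgt; apply/negP => /ltW h.
  by apply: K0; exists th.
pose phi th := \sum_i \sum_k `|Sg th i k - Sg th0 i k|.
have cphi : {within K, continuous phi}.
  apply: continuous_in_subspaceT => th; rewrite inE => -[Tth _].
  apply: (@cvg_sum _ _ (nbhs th)) => i; apply: (@cvg_sum _ _ (nbhs th)) => k.
  apply: cvg_norm; apply: cvgB; last exact: cvg_cst.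
  by have [] := cU i k [::] isT th (TU _ Tth).
have [th1 + hmin] := compact_EVT_min K0 cK cphi; rewrite inE => -[Tth1 hth1].
have phi1 : 0 < phi th1.
  rewrite lt_neqAle sumr_ge0 ?andbT; last by move=> i _; exact: sumr_ge0.
  rewrite eq_sym; apply/negP => /eqP phi0.
  have : Sg th1 - Sg th0 = 0.
    apply: n1_eq0; rewrite -[RHS]phi0; apply: eq_bigr => i _; apply: eq_bigr => k _.
    by rewrite !mxE.
  move/eqP; rewrite subr_eq0 => /eqP /(identifiable Tth1) E.
  by move: hth1; rewrite /= E subrr n10 leNgt eta0.
pose c := n1 L * n1 L + 1; have c0 : 0 < c by rewrite ltr_wpDl// mulr_ge0// n1_ge0.
exists (phi th1 / 2 / c); first by rewrite !divr_gt0.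
move=> th Tth hth; rewrite leNgt; apply/negP => /ltW heta.
have : phi th1 <= phi th by apply: hmin; rewrite inE.
have : phi th <= phi th1 / 2.
  have -> : phi th = n1 (Sg th - Sg th0).
    by apply: eq_bigr => i _; apply: eq_bigr => k _; rewrite !mxE.
  have -> : Sg th - Sg th0 = L *m (sig th - 1%:M) *m L^T.
    by rewrite mulmxBr mulmxBl whiteK mulmx1 -L_root.
  apply: (@le_trans _ _ (c * n1 (sig th - 1%:M))); last by rewrite mulrC -ler_pdivlMr.
  apply: le_trans (n1M _ _) _; rewrite n1_tr.
  apply: (@le_trans _ _ (n1 L * n1 (sig th - 1%:M) * n1 L)).
    by rewrite ler_wpM2r ?n1_ge0// n1M.
  by rewrite mulrAC ler_wpM2r ?n1_ge0// lerDl.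
lra.
Qed.

(** [KL] is invariant under congruence, so whitening by [L] moves [Sg th0] to the identity, where
    [minimiser_KL] applies with [svech] for [y]. *)
Lemma local_minimiser : exists2 W : 'M[R]_((p * p.+1)./2 - q, (p * p.+1)./2), W *m W^T = 1%:M &
  forall eps : R, 0 < eps -> exists2 delta : R, 0 < delta &
  forall S th, posdef S -> Theta th -> n1 (white S - 1%:M) <= delta ->
    (forall th', Theta th' -> KL S (Sg th) <= KL S (Sg th')) ->
    `|KL S (Sg th) - nsq (W *m svech (white S - 1%:M))| <= eps * n1 (white S - 1%:M) ^+ 2.
Proof.
have [W [H [WW WB HB BH]]] := orthogonal_complement B_inj.
exists W => // eps eps0.
have uL : invmx L \in unitmx by rewrite unitmx_inv.
have sig_posdef th : Theta th -> posdef (sig th).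
  by move=> /Sg_posdef; exact: posdef_congr.
have [d d0 hd] := @minimiser_KL R p _ q _ (@svech R p) B W H (@svechB R p) (@n1_svech R p)
  (@nsq_svech R p) WW WB HB BH Theta sig th0 sig_posdef sig_expand sig_ident eps eps0.
exists d => // S th pS Tth Sd hmin.
have KLw th' : Theta th' -> KL S (Sg th') = KL (white S) (sig th').
  move=> T'; rewrite -{1}(whiteK S) -{1}(whiteK (Sg th')) KL_congr//.
    exact: posdef_congr.
  exact: sig_posdef.
rewrite KLw//; apply: hd => //; first exact: posdef_congr.
by move=> th' T'; rewrite -!KLw//; exact: hmin.
Qed.

End local_minimiser.

(** * Quadratic forms in Brownian increments *)

Section isserlis.
Context (R : realType) (I : finType).

(** The mean of the product of the independent standard normal variables listed, with repetition, in
    [l]. *)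
Definition mom (l : seq I) : R := \prod_a gmom R (count_mem a l).

Lemma mom_nil : mom [::] = 1.
Proof. by apply: big1. Qed.

(** Isserlis' recursion: the head is paired with each of its other occurrences. *)
Lemma mom_cons b l : mom (b :: l) = (count_mem b l)%:R * mom (rem b l).
Proof.
rewrite /mom (bigD1 b)//.
have -> : count_mem b (b :: l) = (count_mem b l).+1 by rewrite /= eqxx.
have [bl|bl] := boolP (b \in l); last by rewrite (count_memPn bl) /= !mul0r.
rewrite [in RHS](bigD1 b)//.
have -> : count_mem b (rem b l) = (count_mem b l).-1 by rewrite count_rem bl /= eqxx subn1.
have : (0 < count_mem b l)%N by rewrite -has_count has_pred1.
case: (count_mem b l) => // k _; rewrite gmomSS /= -mulrA; congr (_ * (_ * _)).
apply: eq_bigr => a ab; rewrite count_rem bl /=.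
by rewrite eq_sym (negbTE ab) subn0.
Qed.

Lemma mom2 a b : mom [:: a; b] = (a == b)%:R.
Proof.
rewrite mom_cons /= (eq_sym b a) addn0; case: eqVneq => _; rewrite ?mul0r//.
by rewrite mom_nil mulr1.
Qed.

Lemma mom4 a b c d : mom [:: a; b; c; d] =
  (a == b)%:R * (c == d)%:R + (a == c)%:R * (b == d)%:R + (a == d)%:R * (b == c)%:R.
Proof.
rewrite mom_cons /= !addn0 (eq_sym b a) (eq_sym c a) (eq_sym d a).
case: (eqVneq a b) => [->|ab].
  rewrite mom2; case: (eqVneq c d) => [->|cd].
    by case: (b == d) => /=; ring.
  case: (eqVneq b c) => [->|_]; last by rewrite /= !mulr0 !mul0r !addr0.
  by rewrite (negbTE cd) /= !mulr0 !mul0r !addr0.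
case: (eqVneq a c) => [<-|ac].
  rewrite mom2 !mul0r add0r (eq_sym b a) (negbTE ab) mulr0 addr0 add0n mul1r.
  case: (eqVneq b d) => [<-|_]; last by rewrite !mulr0.
  by rewrite (negbTE ab) /= addn0 mulr1.
rewrite !mul0r !add0r !add0n; case: (eqVneq a d) => [_|_]; last by rewrite !mul0r.
by rewrite mom2.
Qed.

End isserlis.

Section expectation.
Context (R : realType) d (T : measurableType d) (P : probability T R).
Variable W : T -> R.

(** For all bounded [W] of the past this says that [f] has conditional mean [m]. Integrability is
    included so that finite linear combinations can be formed directly. *)
Definition wmean (f : T -> R) (m : R) : Prop :=
  P.-integrable setT (EFin \o (fun w => W w * f w)) /\
  \int[P]_w (W w * f w) = \int[P]_w W w * m.

Lemma wmean_eq f g m m' : wmean f m -> f =1 g -> m = m' -> wmean g m'.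
Proof. by move=> h /funext <- <-. Qed.

Lemma wmeanZ f m (c : R) : wmean f m -> wmean (fun w => c * f w) (c * m).
Proof.
move=> [intf Ef]; rewrite /wmean.
have -> : (fun w => W w * (c * f w)) = (fun w => c * (W w * f w)).
  by apply/funext => w; rewrite mulrCA.
split; first exact: integrableZR.
by rewrite RintegralZl// Ef mulrCA.
Qed.

Lemma wmeanD f g m m' : wmean f m -> wmean g m' -> wmean (fun w => f w + g w) (m + m').
Proof.
move=> [intf Ef] [intg Eg]; rewrite /wmean.
have -> : (fun w => W w * (f w + g w)) = (fun w => W w * f w + W w * g w).
  by apply/funext => w; rewrite mulrDr.
split; first exact: integrableDR.
by rewrite RintegralD// Ef Eg mulrDr.
Qed.

Lemma wmean0 : wmean (fun=> 0) 0.
Proof.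
rewrite /wmean; have -> : (fun w => W w * 0) = (fun=> 0) by apply/funext => w; rewrite mulr0.
by split; [exact: integrable0R|rewrite Rintegral_cst_prob mulr0].
Qed.

Lemma wmean_sum (J : Type) (s : seq J) (f : J -> T -> R) (m : J -> R) :
  (forall j, wmean (f j) (m j)) -> wmean (fun w => \sum_(j <- s) f j w) (\sum_(j <- s) m j).
Proof.
move=> h; elim: s => [|j s IH].
  by apply: (wmean_eq wmean0) => [w|]; rewrite big_nil.
by apply: (wmean_eq (wmeanD (h j) IH)) => [w|]; rewrite big_cons.
Qed.

End expectation.

Section pairs.
Context (R : realType) (n : nat).
Local Notation N := ((n * n.+1)./2).

Lemma uniq_vech_pairs : uniq (vech_pairs n).
Proof.
apply: allpairs_uniq_dep; first exact: enum_uniq.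
  by move=> j _; rewrite filter_uniq ?enum_uniq.
by move=> [j i] [j' i'] _ _ /= [-> ->].
Qed.

(** Injectivity and the position in the lower triangle decide which pairings survive in the
    covariance of [svech (z z^T - 1)]. *)
Lemma svech_index : exists pr : 'I_N -> 'I_n * 'I_n,
  [/\ injective pr, forall k, ((pr k).2 <= (pr k).1)%N &
      forall (s : 'M[R]_n) k, svech s k 0 = pair_weight R (pr k) * s (pr k).1 (pr k).2].
Proof.
have [pr hpr] := choice (@pair_at R n).
have sz (k : 'I_N) : (k < size (vech_pairs n))%N by rewrite size_vech_pairs.
exists pr; split.
- move=> k l kl; apply/val_inj => /=.
  (* [pair_at] applied to the position function recovers the index [m] from [pr m]. *)
  have h (m : 'I_N) : (index (pr m) (vech_pairs n))%:R = m%:R :> R.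
    rewrite -(hpr m (fun x => (index x (vech_pairs n))%:R)) (nth_map (pr m))//.
    by rewrite index_uniq// uniq_vech_pairs.
  by have := h k; rewrite kl h => /eqP; rewrite eqr_nat => /eqP.
- move=> k; have := hpr k (fun x => (x.2 <= x.1)%N%:R).
  rewrite (nth_map (pr k))//; set x := nth _ _ _.
  have : x \in vech_pairs n by apply: mem_nth.
  move=> /allpairsPdep[j [i [_ + ->]]]; rewrite mem_filter => /andP[/= -> _] /=.
  by case: (_ <= _)%N => // /eqP; rewrite oner_eq0.
- by move=> s k; rewrite mxE hpr.
Qed.

End pairs.

(** * Moments of a standardised Gaussian increment given the past *)

Section gaussian_increment.
Context (R : realType) d (T : measurableType d) (P : probability T R).
Variables (I : finType) (X : I -> T -> R) (s : R).
Hypothesis s0 : 0 < s.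
Hypothesis mX : forall a, measurable_fun setT (X a).
Variable F : set (set T).
Hypothesis F_meas : F `<=` measurable.
Hypotheses (FT : F setT) (F0 : F set0).
Hypothesis indep : forall (A : set T) (B : I -> set R), F A ->
  (forall a, measurable (B a)) ->
  P (A `&` [set w | forall a, B a (X a w)]) = (P A * \prod_a normal_prob 0 s (B a))%E.

Let x (a : I) (w : T) : R := X a w / s.

Section weight.
Variables (W : T -> R) (M : R).
Hypothesis WM : forall w, `|W w| <= M.
Hypothesis FW : forall B : set R, measurable B -> F (W @^-1` B).

Lemma wmean_monomial (l : seq I) : wmean P W (fun w => \prod_(a <- l) x a w) (mom R l).
Proof.
have E w : \prod_(a <- l) x a w = \prod_a (X a w / s) ^+ (count_mem a l).
  elim: l => [|b l IH]; first by rewrite big_nil big1.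
  rewrite big_cons IH [in RHS](bigD1 b)//= eqxx exprS -[RHS]mulrA; congr (_ * _).
  rewrite (bigD1 b)//=; congr (_ * _); apply: eq_bigr => a ab.
  by rewrite eq_sym (negbTE ab).
have mg a : measurable_fun setT (fun y : R => (y / s) ^+ count_mem a l).
  by apply: measurable_funX; apply: measurable_funM.
have [h1 h2] := product_expectation mX F_meas FT F0 indep mg
  (fun a => integrable_scaled_pow s0 (count_mem a l)) WM FW.
rewrite /wmean (_ : (fun w => W w * _) = (fun w => W w * \prod_a (X a w / s) ^+ (count_mem a l))).
  by split=> //; rewrite h2; congr (_ * _); apply: eq_bigr => a _; exact: normal_gmom.
by apply/funext => w; rewrite E.
Qed.

Variables (p : nat) (O : 'I_p -> I -> R).
Hypothesis OO : forall i j, \sum_a O i a * O j a = (i == j)%:R.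

Let z (w : T) : 'cV[R]_p := \col_i \sum_a O i a * x a w.

Lemma wmean_z2 i j : wmean P W (fun w => z w i 0 * z w j 0) (i == j)%:R.
Proof.
apply: (@wmean_eq _ _ _ _ _ (fun w => \sum_a \sum_b O i a * O j b * \prod_(e <- [:: a; b]) x e w)
    _ (\sum_a \sum_b O i a * O j b * mom R [:: a; b])).
- do 2 (apply: wmean_sum => ?); apply: wmeanZ; exact: wmean_monomial.
- move=> w; rewrite !mxE mulr_suml; apply: eq_bigr => a _.
  rewrite mulr_sumr; apply: eq_bigr => b _; rewrite !big_cons big_nil; ring.
- rewrite -OO; apply: eq_bigr => a _; rewrite (bigD1 a)//= mom2 eqxx mulr1.
  by rewrite big1 ?addr0// => b ba; rewrite mom2 eq_sym (negbTE ba) mulr0.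
Qed.

(** The pairing of neighbours; the two other pairings in [mom4] reduce to it by exchanging sums. *)
Lemma sum_delta2 i j k l : \sum_a \sum_b \sum_c \sum_e
    O i a * O j b * O k c * O l e * ((a == b)%:R * (c == e)%:R) = (i == j)%:R * (k == l)%:R.
Proof.
rewrite -!OO mulr_suml; apply: eq_bigr => a _.
rewrite (bigD1 a)//= [X in _ + X]big1 ?addr0 => [|b ba]; last first.
  by apply: big1 => c _; apply: big1 => e _; rewrite eq_sym (negbTE ba) mul0r mulr0.
rewrite mulr_sumr; apply: eq_bigr => c _.
rewrite (bigD1 c)//= big1 ?addr0 => [|e ec]; last by rewrite (eq_sym c) (negbTE ec) !mulr0.
by rewrite !eqxx !mulr1 -mulrA.
Qed.

Lemma wmean_z4 i j k l : wmean P W (fun w => z w i 0 * z w j 0 * z w k 0 * z w l 0)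
  ((i == j)%:R * (k == l)%:R + (i == k)%:R * (j == l)%:R + (i == l)%:R * (j == k)%:R).
Proof.
apply: (@wmean_eq _ _ _ _ _ (fun w => \sum_a \sum_b \sum_c \sum_e
     O i a * O j b * O k c * O l e * \prod_(e <- [:: a; b; c; e]) x e w)
    _ (\sum_a \sum_b \sum_c \sum_e O i a * O j b * O k c * O l e * mom R [:: a; b; c; e])).
- do 4 (apply: wmean_sum => ?); apply: wmeanZ; exact: wmean_monomial.
- move=> w; rewrite !mxE -!mulrA mulr_suml; apply: eq_bigr => a _.
  rewrite mulr_suml mulr_sumr; apply: eq_bigr => b _.
  rewrite mulr_suml !mulr_sumr; apply: eq_bigr => c _.
  rewrite !mulr_sumr; apply: eq_bigr => e _; rewrite !big_cons big_nil; ring.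
- have -> : (i == k)%:R * (j == l)%:R = \sum_a \sum_b \sum_c \sum_e
      O i a * O j b * O k c * O l e * ((a == c)%:R * (b == e)%:R) :> R.
    rewrite -sum_delta2; apply: eq_bigr => a _; rewrite exchange_big /=.
    apply: eq_bigr => b _; apply: eq_bigr => c _; apply: eq_bigr => e _; ring.
  have -> : (i == l)%:R * (j == k)%:R = \sum_a \sum_b \sum_c \sum_e
      O i a * O j b * O k c * O l e * ((a == e)%:R * (b == c)%:R) :> R.
    rewrite -sum_delta2; apply: eq_bigr => a _.
    under [RHS]eq_bigr do rewrite exchange_big /=.
    rewrite [RHS]exchange_big /=; apply: eq_bigr => e _; apply: eq_bigr => b _.
    apply: eq_bigr => c _; ring.
  rewrite -sum_delta2 -!big_split; apply: eq_bigr => a _ /=.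
  rewrite -!big_split; apply: eq_bigr => b _ /=.
  rewrite -!big_split; apply: eq_bigr => c _ /=.
  rewrite -!big_split; apply: eq_bigr => e _ /=.
  by rewrite mom4; ring.
Qed.

Let N := ((p * p.+1)./2)%N.
Let y (w : T) : 'cV[R]_N := svech (z w *m (z w)^T - 1%:M).

(** Subtracting the means from the fourth moments leaves [(i = i') (j = j') + (i = j') (j = i')].
    For pairs in the lower triangle the second product survives only if both are the same diagonal
    pair, where the weight [1 / 2] turns the sum 2 into 1. *)
Lemma wmean_y : (forall k, wmean P W (fun w => y w k 0) 0) /\
  (forall k l, wmean P W (fun w => y w k 0 * y w l 0) (k == l)%:R).
Proof.
have [pr [pr_inj pr_le prE]] := @svech_index R p.
have yE w k : y w k 0 = pair_weight R (pr k) *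
    (z w (pr k).1 0 * z w (pr k).2 0 + - ((pr k).1 == (pr k).2)%:R).
  by rewrite /y prE !mxE big_ord1 !mxE.
have W1 : wmean P W (fun=> 1) 1.
  by apply: (wmean_eq (wmean_monomial [::])) => [w|]; rewrite ?big_nil ?mom_nil.
have Wc c : wmean P W (fun=> c) c.
  by apply: (wmean_eq (wmeanZ c W1)) => [w|]; rewrite mulr1.
split=> [k|k l].
  apply: (wmean_eq (wmeanZ (pair_weight R (pr k)) (wmeanD (wmean_z2 (pr k).1 (pr k).2) (Wc _)))) => [w|].
    exact/esym/yE.
  by rewrite subrr mulr0.
set c := pair_weight R (pr k); set c' := pair_weight R (pr l).
move: (yE^~ k) (yE^~ l) (pr_le k) (pr_le l); rewrite -/c -/c'.
case Ek : (pr k) => [i j]; case El : (pr l) => [i' j'] /= yk yl ij ij'.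
have h := wmeanZ (c * c') (wmeanD (wmeanD (wmean_z4 i j i' j')
  (wmeanZ (- (i == j)%:R) (wmean_z2 i' j'))) (wmeanD (wmeanZ (- (i' == j')%:R) (wmean_z2 i j))
  (Wc ((i == j)%:R * (i' == j')%:R)))).
apply: (wmean_eq h) => [w|]; first by rewrite yk yl; ring.
transitivity (c * c' * ((i == i')%:R * (j == j')%:R + (i == j')%:R * (j == i')%:R)); first ring.
have [kl|kl] := eqVneq k l.
  move: Ek; rewrite kl El => -[ei ej]; subst i' j'.
  rewrite !eqxx mulr1 (eq_sym j i) /c /c' kl El /pair_weight /=.
  case: (eqVneq i j) => _ /=; last by rewrite mulr0 addr0 !mulr1.
  by rewrite -invfM -expr2 sqr_sqrtr// mulr1; field.
have nkl : ~~ ((i == i') && (j == j')).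
  apply: contra kl => /andP[/eqP ei /eqP ej]; apply/eqP/pr_inj.
  by rewrite Ek El ei ej.
have -> : (i == i')%:R * (j == j')%:R = 0 :> R.
  by rewrite -natrM mulnb (negbTE nkl).
rewrite add0r; have [/andP[/eqP e1 /eqP e2]|nn] := boolP ((i == j') && (j == i')); last first.
  by rewrite -natrM mulnb (negbTE nn) mulr0.
exfalso; subst j' i'; move/negP: nkl; apply.
have -> : i = j by apply/val_inj/anti_leq; rewrite ij ij'.
by rewrite !eqxx.
Qed.

Variables (r : nat) (U : 'M[R]_(r, N)).
Hypothesis UU : U *m U^T = 1%:M.

Let v (l : 'I_r) (w : T) : R := (U *m y w) l 0.

Lemma wmean_v : (forall l, wmean P W (v l) 0) /\
  (forall l m, wmean P W (fun w => v l w * v m w) (l == m)%:R).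
Proof.
have [y1 y2] := wmean_y; split=> [l|l m].
  apply: (@wmean_eq _ _ _ _ _ (fun w => \sum_k U l k * y w k 0) _ (\sum_k U l k * 0)).
  - by apply: wmean_sum => k; apply: wmeanZ.
  - by move=> w; rewrite /v mxE.
  - by apply: big1 => k _; rewrite mulr0.
apply: (@wmean_eq _ _ _ _ _ (fun w => \sum_k \sum_k' U l k * U m k' * (y w k 0 * y w k' 0)) _
  (\sum_k \sum_k' U l k * U m k' * (k == k')%:R)).
- by do 2 (apply: wmean_sum => ?); apply: wmeanZ.
- move=> w; rewrite /v !mxE mulr_suml; apply: eq_bigr => k _.
  by rewrite mulr_sumr; apply: eq_bigr => k' _; ring.
- have <- : (U *m U^T) l m = (l == m)%:R by rewrite UU mxE.
  rewrite mxE; apply: eq_bigr => k _; rewrite (bigD1 k)//= eqxx mulr1 [U^T k m]mxE.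
  by rewrite big1 ?addr0// => k' kk; rewrite eq_sym (negbTE kk) mulr0.
Qed.

End weight.

Section third.
Variables (p : nat) (O : 'I_p -> I -> R).
Let N := ((p * p.+1)./2)%N.
Variables (r : nat) (U : 'M[R]_(r, N)).
Let z (w : T) : 'cV[R]_p := \col_i \sum_a O i a * x a w.

Let v (l : 'I_r) (w : T) : R := (U *m svech (z w *m (z w)^T - 1%:M)) l 0.

(** If [t >= 1] bounds all [|x a|], the sum of the [|v l|] is at most a constant times [t ^+ 2]; and
    with [t] the larger of 1 and the maximum, [t ^+ 6] is at most 1 plus the sum of the sixth
    powers, whose means are explicit. *)
Definition third_cst : R :=
  (n1 U * ((\sum_i \sum_a `|O i a|) ^+ 2 + p%:R)) ^+ 3 * (#|I|.+1%:R ^+ 6) *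
  (1 + \sum_(a : I) mom R (nseq 6 a)).

Lemma integrable_pow_x a (k : nat) :
  P.-integrable setT (EFin \o (fun w => x a w ^+ k)) /\
  \int[P]_w (x a w ^+ k) = mom R (nseq k a).
Proof.
have F1 (B : set R) : measurable B -> F ((fun=> 1 : R) @^-1` B).
  by move=> _; rewrite preimage_cst; case: ifP.
have n11 (w : T) : `|1 : R| <= 1 by rewrite normr1.
have [h1 h2] := @wmean_monomial (fun=> 1) 1 n11 F1 (nseq k a).
move: h1 h2; rewrite (_ : (fun w => 1 * _) = fun w => x a w ^+ k); last first.
  by apply/funext => w; rewrite mul1r big_nseq iter_mulr_1.
by rewrite Rintegral_cst_prob mul1r.
Qed.

Lemma v_third_moment : (forall l, measurable_fun setT (v l)) ->
  P.-integrable setT (EFin \o (fun w => (\sum_l `|v l w|) ^+ 3)) /\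
  \int[P]_w ((\sum_l `|v l w|) ^+ 3) <= third_cst.
Proof.
move=> mv.
pose m : R := #|I|.+1%:R.
pose o : R := \sum_i \sum_a `|O i a|.
have o0 : 0 <= o by apply: sumr_ge0 => i _; exact: sumr_ge0.
pose K : R := (n1 U * (o ^+ 2 + p%:R)) ^+ 3 * (m ^+ 6).
have U0 := n1_ge0 U.
have K0 : 0 <= K by rewrite mulr_ge0// exprn_ge0// mulr_ge0// addr_ge0// exprn_ge0.
pose g w := K * (1 + \sum_a x a w ^+ 6).
have [is1 is2] := @integrable_sumR _ _ _ P I (index_enum I) predT (fun a w => x a w ^+ 6)
  (fun a _ => (integrable_pow_x a 6).1).
have ig : P.-integrable setT (EFin \o g).
  by apply: integrableZR; apply: integrableDR => //; exact: integrable_cst_prob.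
have x6 a w : 0 <= x a w ^+ 6 by rewrite exprn_even_ge0.
have bound w : (\sum_l `|v l w|) ^+ 3 <= g w.
  have [t [t1 tx t6]] : exists t : R, [/\ 1 <= t, forall a, `|x a w| <= t &
      t ^+ 6 <= 1 + \sum_a x a w ^+ 6].
    pose S6 := 1 + \sum_a x a w ^+ 6.
    have S60 : 0 <= \sum_a x a w ^+ 6 by apply: sumr_ge0.
    have S61 : 1 <= S6 by rewrite /S6 lerDl.
    have [S0|] := pselect (forall a, `|x a w| <= 1).
      by exists 1; split=> //; rewrite expr1n.
    move=> /existsNP[a0 /negP]; rewrite -ltNge => a01.
    have [a _ amax] := @Order.TotalTheory.arg_maxP _ _ I a0 xpredT (fun a => `|x a w|) isT.
    exists `|x a w|; split.
    - by apply: ltW; apply: lt_le_trans a01 (amax a0 isT).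
    - by move=> b; exact: amax.
    - rewrite -normrX ger0_norm// (bigD1 a)//= addrCA lerDl addr_ge0//.
      by apply: sumr_ge0 => b _; exact: x6.
  have t0 : 0 <= t by apply: le_trans t1.
  have nz : n1 (z w) <= o * (m * t).
    rewrite n1_cV /o mulr_suml; apply: ler_sum => i _; rewrite mxE.
    apply: le_trans (ler_norm_sum _ _ _) _; rewrite mulr_suml; apply: ler_sum => a _.
    rewrite normrM ler_wpM2l//; apply: le_trans (tx a) _.
    by rewrite ler_peMl// /m ler1n.
  have mt1 : 1 <= m * t by rewrite mulr_ege1// /m ler1n.
  have nv : \sum_l `|v l w| <= n1 U * (o ^+ 2 + p%:R) * (m * t) ^+ 2.
    have -> : \sum_l `|v l w| = n1 (U *m svech (z w *m (z w)^T - 1%:M)) by rewrite n1_cV.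
    apply: le_trans (n1M _ _) _; rewrite -mulrA ler_wpM2l//.
    apply: le_trans (n1_svech _) _; apply: le_trans (n1B _ _) _; rewrite n1_1 mulrDl lerD//.
      apply: le_trans (n1M _ _) _; rewrite n1_tr -exprMn expr2.
      by rewrite ler_pM ?n1_ge0.
    by rewrite ler_peMr// expr_ge1// (le_trans ler01).
  have v0 : 0 <= \sum_l `|v l w| by apply: sumr_ge0.
  have c0 : 0 <= n1 U * (o ^+ 2 + p%:R) by rewrite mulr_ge0// addr_ge0// exprn_ge0.
  apply: (@le_trans _ _ ((n1 U * (o ^+ 2 + p%:R) * (m * t) ^+ 2) ^+ 3)).
    by rewrite lerXn2r ?nnegrE// mulr_ge0// exprn_ge0// (le_trans ler01).
  rewrite (_ : _ ^+ 3 = K * t ^+ 6); last by rewrite /K; ring.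
  exact: ler_wpM2l.
have iv : P.-integrable setT (EFin \o (fun w => (\sum_l `|v l w|) ^+ 3)).
  apply: (@le_integrableR _ _ _ P _ g) => //.
    apply: measurable_funX; apply: measurable_sum => l.
    by apply: measurableT_comp (mv l).
  by move=> w; rewrite ger0_norm ?exprn_ge0 ?sumr_ge0.
split=> //; apply: (@le_trans _ _ (\int[P]_w g w)).
  by apply: le_Rintegral => // w _; exact: bound.
rewrite RintegralZl//; last by apply: integrableDR => //; exact: integrable_cst_prob.
rewrite RintegralD//; last exact: integrable_cst_prob.
rewrite Rintegral_cst_prob is2 /third_cst -/o -/m -/K ler_wpM2l// lerD2l.
by apply: ler_sum => a _; rewrite (integrable_pow_x a 6).2.
Qed.

End third.

End gaussian_increment.

Lemma near_inv_le (R : realType) (C e : R) : 0 < e -> \forall n \near \oo, C / n%:R <= e.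
Proof.
move=> e0; near=> n.
have n0 : 0 < n%:R :> R by rewrite ltr0n; near: n; exact: nbhs_infty_gt.
rewrite ler_pdivrMr// mulrC -ler_pdivrMr//.
by near: n; exact: nbhs_infty_ger.
Unshelve. all: by end_near. Qed.

(** * Central limit theorem and size of the increments along the grid *)

Section brownian_family.
Context (R : realType) d (Om : measurableType d) (P : probability Om R).
Variables (F : R -> set (set Om)) (I : finType) (W : R -> I -> Om -> R).
Hypothesis F_filtration : filtration F.
Hypothesis W_adapted : forall (t : R) a (B : set R), 0 <= t -> measurable B -> F t (W t a @^-1` B).
Hypothesis W_indep : forall (s t : R) A (B : I -> set R), 0 <= s -> s < t -> F s A ->
  (forall a, measurable (B a)) ->
  P (A `&` [set w | forall a, B a (W t a w - W s a w)]) =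
  (P A * \prod_a normal_prob 0 (Num.sqrt (t - s)) (B a))%E.
Variables (T : R) (T0 : 0 < T).

Let h n : R := T / n%:R.
Let h0 n : (0 < n)%N -> 0 < h n.
Proof. by move=> n0; rewrite divr_gt0// ltr0n. Qed.
Let tm n i : R := i%:R * h n.
Let tm0 n i : 0 <= tm n i.
Proof. by rewrite mulr_ge0// divr_ge0// ltW. Qed.
Let tm_le n i j : (i <= j)%N -> tm n i <= tm n j.
Proof. by move=> ij; rewrite ler_wpM2r ?ler_nat// divr_ge0// ltW. Qed.
Let tm_step n i : tm n i.+1 - tm n i = h n.
Proof. by rewrite /tm -mulrBl -natrB// subSnn mul1r. Qed.

Definition incr_bm n i (a : I) (w : Om) : R := W (tm n i.+1) a w - W (tm n i) a w.

Let s n := Num.sqrt (h n).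
Let s0 n : (0 < n)%N -> 0 < s n.
Proof. by move=> n0; rewrite sqrtr_gt0 h0. Qed.

Let x n i a w := incr_bm n i a w / s n.

Let F_meas t : 0 <= t -> F t `<=` measurable.
Proof. by have [_ h2 _] := F_filtration; exact: h2. Qed.

Let F_sigma t : 0 <= t -> sigma_algebra setT (F t).
Proof. by have [h1 _ _] := F_filtration; exact: h1. Qed.

Let F0 t : 0 <= t -> F t set0.
Proof. by move=> /F_sigma[]. Qed.

Let FT t : 0 <= t -> F t setT.
Proof. by move=> /F_sigma[h1 h2 _]; rewrite -(setD0 setT); exact: h2. Qed.

Let W_past (u t : R) a : 0 <= u -> u <= t ->
  measurable_fun setT (W u a : g_sigma_algebraType (F t) -> R).
Proof.
move=> u0 ut _ B mB; rewrite setTI; apply: sub_sigma_algebra.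
have [_ _ mono] := F_filtration.
exact/(mono _ _ u0 ut)/W_adapted.
Qed.

Let W_meas (u : R) a : 0 <= u -> measurable_fun setT (W u a).
Proof.
by move=> u0 _ B mB; rewrite setTI; apply: (F_meas u0); exact: W_adapted.
Qed.

Lemma incr_bm_meas n i a : measurable_fun setT (incr_bm n i a).
Proof. by apply: measurable_funB; exact: W_meas. Qed.

Let x_past n i m a : (i < m)%N -> measurable_fun setT (x n i a : g_sigma_algebraType (F (tm n m)) -> R).
Proof.
move=> im; apply: measurable_funM => //.
by apply: measurable_funB; apply: W_past => //; apply: tm_le => //; exact: ltnW.
Qed.

Let indep n i (A : set Om) (B : I -> set R) : (0 < n)%N -> F (tm n i) A -> (forall a, measurable (B a)) ->
  P (A `&` [set w | forall a, B a (incr_bm n i a w)]) =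
  (P A * \prod_a normal_prob 0 (s n) (B a))%E.
Proof.
move=> n0 FA mB; rewrite /s -(tm_step n i); apply: W_indep => //.
by rewrite -subr_gt0 tm_step h0.
Qed.

Section clt.
Variables (p : nat) (O : 'I_p -> I -> R).
Hypothesis OO : forall i j, \sum_a O i a * O j a = (i == j)%:R.
Let N := ((p * p.+1)./2)%N.

Definition zinc n i (w : Om) : 'cV[R]_p := \col_j \sum_a O j a * (incr_bm n i a w / s n).

Definition Qn n (w : Om) : 'M[R]_p := n%:R^-1 *: \sum_(i < n) zinc n i w *m (zinc n i w)^T.

Variables (r : nat) (U : 'M[R]_(r, N)).

Let v n i (l : 'I_r) (w : Om) : R := (U *m svech (zinc n i w *m (zinc n i w)^T - 1%:M)) l 0.

Lemma measurable_v_generic d' (T' : measurableType d') (g : I -> T' -> R) l :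
  (forall a, measurable_fun setT (g a)) ->
  measurable_fun setT (fun w => (U *m svech ((\col_j \sum_a O j a * g a w) *m
     (\col_j \sum_a O j a * g a w)^T - 1%:M)) l 0 : R).
Proof.
move=> mg; have [pr [_ _ prE]] := @svech_index R p.
under eq_fun do rewrite mxE; apply: measurable_sum => k.
apply: measurable_funM => //.
under eq_fun do rewrite prE; apply: measurable_funM => //.
under eq_fun do rewrite !mxE big_ord1 !mxE; apply: measurable_funB => //.
by apply: measurable_funM; apply: measurable_sum => a; apply: measurable_funM.
Qed.

Lemma Qn_sum n w : (0 < n)%N ->
  Num.sqrt n%:R *: (U *m svech (Qn n w - 1%:M)) =
  \col_l ((Num.sqrt n%:R)^-1 * \sum_(i < n) v n i l w).
Proof.
move=> n0; have nn : n%:R != 0 :> R by rewrite pnatr_eq0 -lt0n.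
have sn : Num.sqrt (n%:R : R) ^+ 2 = n%:R by rewrite sqr_sqrtr.
have -> : Qn n w - 1%:M = n%:R^-1 *: \sum_(i < n) (zinc n i w *m (zinc n i w)^T - 1%:M).
  rewrite /Qn sumrB scalerBr; congr (_ - _).
  by rewrite sumr_const card_ord -[1%:M *+ n]scaler_nat scalerA mulVf// scale1r.
rewrite svechZ -scalemxAr scalerA svech_sum mulmx_sumr; apply/colP => l.
rewrite !mxE summxE; congr (_ * _).
have q0 : Num.sqrt (n%:R : R) != 0 by rewrite gt_eqF// sqrtr_gt0 ltr0n.
by move: sn q0; set q := Num.sqrt _ => <- q0; field.
Qed.

Hypothesis UU : U *m U^T = 1%:M.

(** [lindeberg_laplace] along the filtration at the grid times: the summands are white given the
    past by [wmean_v], and their third moments are bounded by a constant free of [n]. *)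
Lemma clt_laplace (k : nat) :
  \int[P]_w expR (- (k%:R * `|nsq (Num.sqrt n%:R *: (U *m svech (Qn n w - 1%:M)))|)) @[n --> \oo]
    --> \int[chi2 R r]_x expR (- (k%:R * `|x|)).
Proof.
rewrite chi2_Rlaplace//; apply/cvgrPdist_le => e e0.
pose C := third_cst O U.
pose L := lindeberg_cst r (k%:R : R) C.
near=> n.
have n0 : (0 < n)%N by near: n; exact: nbhs_infty_gt.
have bound : `|\int[P]_w expR (- (k%:R * \sum_(l < r) ((Num.sqrt n%:R)^-1 * \sum_(i < n) v n i l w) ^+ 2))
    - (Num.sqrt (1 + 2 * k%:R))^-1 ^+ r| <= L / Num.sqrt n%:R.
  have third i := v_third_moment (s0 n0) (incr_bm_meas n i) (F_meas (tm0 n i)) (FT (tm0 n i))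
      (F0 (tm0 n i)) (fun A B => @indep n i A B n0) (O := O) (U := U).
  have mv i l : measurable_fun setT (v n i l).
    by apply: measurable_v_generic => a; apply: measurable_funM => //; exact: incr_bm_meas.
  have wm i W' : (exists M : R, forall w, `|W' w| <= M) /\
     (forall B : set R, measurable B -> F (tm n i) (W' @^-1` B)) -> _ := fun hW =>
     let: conj (ex_intro M WM) FW := hW in
     wmean_v (s0 n0) (incr_bm_meas n i) (F_meas (tm0 n i)) (FT (tm0 n i))
      (F0 (tm0 n i)) (fun A B => @indep n i A B n0) WM FW OO UU.
  apply: (@lindeberg_laplace R d Om P r n k%:R C _ n0 (v n) (fun m => F (tm n m))) => //.
  - by move=> i; exact: F_sigma.
  - by move=> i; exact: F_meas.
  - move=> m i l im mn; apply: (@measurable_v_generic _ (g_sigma_algebraType (F (tm n m))) (x n i)) => a.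
    exact: x_past.
  - move=> i l W' _ /(wm i W')[h1 _]; have [h2 h3] := h1 l; split=> //.
    by rewrite h3 mulr0.
  - move=> i l l' W' _ /(wm i W')[_ h1]; have [h2 h3] := h1 l l'; split=> //.
    by rewrite h3 mulrC.
  - by move=> i _; exact: third (mv i).
rewrite distrC; apply: le_trans (le_trans _ bound) _.
  set a := (X in `|X - _| <= _); set b := (X in _ <= `|X - _|).
  suff -> : a = b by [].
  apply: eq_Rintegral => w _; congr (expR (- (_ * _))).
  rewrite Qn_sum// ger0_norm ?nsq_ge0//; apply: eq_bigr => l _.
  by rewrite mxE.
rewrite ler_pdivrMr ?sqrtr_gt0 ?ltr0n// mulrC -ler_pdivrMr//.
apply: le_trans (ler_norm _) _; rewrite -sqrtr_sqr ler_wsqrtr//.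
near: n; exact: nbhs_infty_ger.
Unshelve. all: by end_near. Qed.

End clt.

(** Markov's inequality with moments of order [2 k]: each of the [n] time steps contributes at most
    a constant times [h ^ (2 k (1/2 - rho))], and [k] makes this exponent at least 2, so the total
    is [O(1 / n)]. *)
Lemma increments_small (rho kappa : R) : rho < 2^-1 -> 0 < kappa ->
  whp P (fun n => [set w | forall i a, (i < n)%N -> `|incr_bm n i a w| <= kappa * h n `^ rho]).
Proof.
move=> rho2 kappa0 e e0.
have g0 : 0 < 1 - 2 * rho by lra.
have [k hk] : exists k : nat, 2 <= k%:R * (1 - 2 * rho).
  have [k hk] : exists k : nat, 2 / (1 - 2 * rho) <= k%:R.
    exists (Num.truncn (2 / (1 - 2 * rho))).+1; exact/ltW/truncnS_gt.
  by exists k; rewrite -ler_pdivrMr.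
pose K := \sum_(a : I) mom R (nseq (2 * k) a) / (kappa ^+ (2 * k)).
have gm0 j : 0 <= gmom R j.
  have [] : 0 <= gmom R j /\ 0 <= gmom R j.+1; last by [].
  by elim: j => [|j [h1 h2]]; split=> //; rewrite gmomSS mulr_ge0.
have K0 : 0 <= K.
  apply: sumr_ge0 => a _; rewrite divr_ge0 ?exprn_ge0 ?(ltW kappa0)//.
  by apply: prodr_ge0 => b _.
near=> n.
have n0 : (0 < n)%N by near: n; exact: nbhs_infty_gt.
have h1 : h n <= 1 by near: n; apply: near_inv_le.
have hn0 := h0 n0.
pose b := h n `^ (2^-1 - rho).
have b0 : 0 < b by exact: powR_gt0.
have bk : b ^+ (2 * k) <= h n ^+ 2.
  rewrite /b -powR_mulrn ?powR_ge0// -powRrM.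
  rewrite -[leRHS]powR_mulrn ?(ltW hn0)//.
  rewrite ger_powR ?hn0 ?h1//.
  by rewrite natrM; apply: (le_trans hk); lra.
have sb : h n `^ rho = s n / b.
  rewrite /s /b -powR12_sqrt ?(ltW hn0)// -powRN -powRD; last by apply/implyP => _; rewrite gt_eqF.
  by congr (_ `^ _); lra.
pose S w := \sum_(i < n) \sum_a (b / kappa) ^+ (2 * k) * (x n i a w) ^+ (2 * k).
have even_ge0 (y : R) : 0 <= y ^+ (2 * k) by rewrite exprM exprn_ge0// sqr_ge0.
have ex i a := integrable_pow_x (s0 n0) (incr_bm_meas n i) (F_meas (tm0 n i)) (FT (tm0 n i))
      (F0 (tm0 n i)) (fun A B => @indep n i A B n0) a (2 * k).
have exs i : P.-integrable setT (EFin \o (fun w => \sum_a (b / kappa) ^+ (2 * k) * (x n i a w) ^+ (2 * k))) /\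
    \int[P]_w (\sum_a (b / kappa) ^+ (2 * k) * (x n i a w) ^+ (2 * k)) = b ^+ (2 * k) * K.
  have [] := @integrable_sumR _ _ _ P I (index_enum I) predT
    (fun a w => (b / kappa) ^+ (2 * k) * (x n i a w) ^+ (2 * k)).
    by move=> a _; apply: integrableZR; have [] := ex i a.
  move=> h2 h3; split=> //; rewrite h3 /K mulr_sumr; apply: eq_bigr => a _.
  have [h4 h5] := ex i a.
  by rewrite RintegralZl// h5 expr_div_n mulrA mulrAC.
have [iS ES] := @integrable_sumR _ _ _ P 'I_n (index_enum 'I_n) predT
    (fun i w => \sum_a (b / kappa) ^+ (2 * k) * (x n i a w) ^+ (2 * k)) (fun i _ => (exs i).1).
have S0 w : 0 <= S w by apply: sumr_ge0 => i _; apply: sumr_ge0 => a _; rewrite mulr_ge0.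
have mS : measurable_fun setT S by exact/measurable_EFinP/(measurable_int P).
have mA : measurable [set w | 1 <= `|S w|] by exact: measurable_abs_ge.
exists [set w | 1 <= `|S w|]; split=> //.
  have fP : P [set w | 1 <= `|S w|] \is a fin_num by exact: fin_num_measure.
  rewrite -(fineK fP) lee_fin fine_prob_Rintegral//.
  apply: (@le_trans _ _ (\int[P]_w S w)).
    apply: le_Rintegral => //.
      apply: (@bounded_integrable _ _ _ _ _ 1) => [|w]; first exact: measurable_indic.
      by rewrite indicE; case: (_ \in _); rewrite ?normr1 ?normr0.
    move=> w _; rewrite indicE; case: (boolP (w \in _)) => [|_ //].
    by rewrite inE /= ger0_norm.
  have -> : \int[P]_w S w = n%:R * (b ^+ (2 * k) * K).
    rewrite /S ES (eq_bigr (fun=> b ^+ (2 * k) * K)) => [|i _]; last by have [] := exs i.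
    by rewrite sumr_const card_ord [RHS]mulr_natl.
  apply: (@le_trans _ _ (n%:R * (h n ^+ 2 * K))).
    by rewrite ler_wpM2l// ler_wpM2r.
  rewrite (_ : _ * _ = (T ^+ 2 * K) / n%:R); last first.
    by rewrite /h; field; rewrite pnatr_eq0 -lt0n.
  by near: n; apply: near_inv_le.
move=> w /= /negP; rewrite -ltNge ger0_norm// => S1 i a i_n.
rewrite leNgt; apply/negP => big.
move: S1; apply/negP; rewrite -leNgt.
apply: (@le_trans _ _ ((b / kappa) ^+ (2 * k) * x n (Ordinal i_n) a w ^+ (2 * k))).
  rewrite -exprMn exprM; apply: exprn_ege1; rewrite -real_normK ?num_real//; apply: exprn_ege1.
  rewrite /x normrM (gtr0_norm (divr_gt0 b0 kappa0)) normrM normfV (gtr0_norm (s0 n0)).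
  rewrite mulf_div ler_pdivlMr ?mulr_gt0 ?s0// mul1r [b * _]mulrC.
  by move: big; rewrite sb mulrA ltr_pdivrMr// => /ltW.
rewrite /S (bigD1 (Ordinal i_n))//= (bigD1 a)//= -addrA lerDl addr_ge0//.
  by apply: sumr_ge0 => a' _; rewrite mulr_ge0.
by apply: sumr_ge0 => j _; apply: sumr_ge0 => a' _; rewrite mulr_ge0.
Unshelve. all: by end_near. Qed.

End brownian_family.

(** * The four Wiener processes as one family *)

Section combined_noise.
Context (R : realType) d (Om : measurableType d) (P : probability Om R).
Variables (F : R -> set (set Om)).
Hypothesis F_filtration : filtration F.

Lemma measurable_box r (B : 'I_r -> set R) : (forall j, measurable (B j)) ->
  measurable [set v : 'cV[R]_r | forall j, B j (v j 0)].
Proof.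
move=> mB.
rewrite (_ : [set v | _] = \bigcap_(j in [set: 'I_r]) ((fun v : 'cV[R]_r => v j 0) @^-1` B j)).
  apply: fin_bigcap_measurable => // j _; rewrite -[X in measurable X]setTI.
  exact: measurable_entry.
by apply/seteqP; split=> v /= h j; [move=> _; exact: h|exact: h].
Qed.

Variables (r1 r2 r3 r4 : nat).
Variables (W1 : R -> Om -> 'cV[R]_r1) (W2 : R -> Om -> 'cV[R]_r2).
Variables (W3 : R -> Om -> 'cV[R]_r3) (W4 : R -> Om -> 'cV[R]_r4).
Hypotheses (BM1 : wiener P F W1) (BM2 : wiener P F W2) (BM3 : wiener P F W3) (BM4 : wiener P F W4).
Variables J1 J2 J3 J4 : R -> set (set Om).
Hypotheses (J1T : forall t, J1 t setT) (J2T : forall t, J2 t setT)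
  (J3T : forall t, J3 t setT) (J4T : forall t, J4 t setT).
Hypothesis indep : forall t : R, 0 <= t -> mutually_independent P
  [:: F t; wiener_future t W1; wiener_future t W2; wiener_future t W3; wiener_future t W4;
      J1 t; J2 t; J3 t; J4 t].

(** A disjoint union of coordinates, so that the four Wiener processes form one family of
    independent real ones. *)
Definition noise_index := ('I_r1 + 'I_r2 + ('I_r3 + 'I_r4))%type.

Definition combined (t : R) (a : noise_index) (w : Om) : R :=
  match a with
  | inl (inl j) => W1 t w j 0
  | inl (inr j) => W2 t w j 0
  | inr (inl j) => W3 t w j 0
  | inr (inr j) => W4 t w j 0
  end.

Let adapted_entry r (W : R -> Om -> 'cV[R]_r) (t : R) j (B : set R) : wiener P F W -> 0 <= t ->
  measurable B -> F t ((fun w => W t w j 0) @^-1` B).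
Proof.
move=> [ad _ _ _] t0 mB.
have := ad t t0 ((fun v : 'cV[R]_r => v j 0) @^-1` B); apply.
by rewrite -[X in measurable X]setTI; exact: measurable_entry.
Qed.

Lemma combined_adapted (t : R) a (B : set R) : 0 <= t -> measurable B ->
  F t (combined t a @^-1` B).
Proof.
by move: a => [[j|j]|[j|j]] t0 mB;
  [exact: (adapted_entry _ BM1)|exact: (adapted_entry _ BM2)
  |exact: (adapted_entry _ BM3)|exact: (adapted_entry _ BM4)].
Qed.

Let box r (W : R -> Om -> 'cV[R]_r) (s t : R) (B : 'I_r -> set R) : set Om :=
  [set w | forall j, B j ((W t w - W s w) j 0)].

Let box_future r (W : R -> Om -> 'cV[R]_r) (s t : R) (B : 'I_r -> set R) : s <= t ->
  (forall j, measurable (B j)) -> wiener_future s W (box W s t B).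
Proof.
move=> st mB; apply: sub_sigma_algebra; exists t, [set v : 'cV[R]_r | forall j, B j (v j 0)].
by split=> //; exact: measurable_box.
Qed.

Let box_prob r (W : R -> Om -> 'cV[R]_r) (s t : R) (B : 'I_r -> set R) : wiener P F W ->
  0 <= s -> s < t -> (forall j, measurable (B j)) ->
  P (box W s t B) = (\prod_j normal_prob 0 (Num.sqrt (t - s)) (B j))%E.
Proof. by move=> [_ _ _ h] s0 st mB; exact: h. Qed.

(** The joint independence is used with the sure event in the jump components; the probabilities of
    the four boxes then factor coordinate by coordinate. *)
Lemma combined_indep (s t : R) A (B : noise_index -> set R) : 0 <= s -> s < t -> F s A ->
  (forall a, measurable (B a)) ->
  P (A `&` [set w | forall a, B a (combined t a w - combined s a w)]) =
  (P A * \prod_a normal_prob 0 (Num.sqrt (t - s)) (B a))%E.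
Proof.
move=> s0 st FA mB; have st' := ltW st.
pose E1 := box W1 s t (fun j => B (inl (inl j))).
pose E2 := box W2 s t (fun j => B (inl (inr j))).
pose E3 := box W3 s t (fun j => B (inr (inl j))).
pose E4 := box W4 s t (fun j => B (inr (inr j))).
pose L := [:: A; E1; E2; E3; E4; setT; setT; setT; setT].
have := indep s0 (A := fun i => nth setT L i).
set G := [:: F s; _; _; _; _; _; _; _; _].
have hG (i : 'I_(size G)) : nth set0 G i (nth setT L i).
  case: i => -[|[|[|[|[|[|[|[|[|//]]]]]]]]] /= _ //; try exact: box_future.
move/(_ hG).
rewrite !big_ord_recl big_ord0 /= probability_setT !mule1.
rewrite !box_prob// => E.
transitivity (P [set w | forall i : 'I_(size G), nth setT L i w]).
  congr (P _); apply/seteqP; split=> w /=.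
    move=> [Aw hw] i; case: i => -[|[|[|[|[|[|[|[|[|//]]]]]]]]] /= _ // j.
    - by have := hw (inl (inl j)); rewrite /= !mxE.
    - by have := hw (inl (inr j)); rewrite /= !mxE.
    - by have := hw (inr (inl j)); rewrite /= !mxE.
    - by have := hw (inr (inr j)); rewrite /= !mxE.
  move=> h; split; first exact: (h (@Ordinal 9 0 isT)).
  have h1 := h (@Ordinal 9 1 isT); have h2 := h (@Ordinal 9 2 isT).
  have h3 := h (@Ordinal 9 3 isT); have h4 := h (@Ordinal 9 4 isT).
  move=> [[j|j]|[j|j]] /=.
  - by have := h1 j; rewrite !mxE.
  - by have := h2 j; rewrite !mxE.
  - by have := h3 j; rewrite !mxE.
  - by have := h4 j; rewrite !mxE.
rewrite E; congr (_ * _)%E.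
by rewrite !big_sumType /= !muleA.
Qed.

End combined_noise.

(** * Paths of the latent processes *)

Section regulated.
Context (R : realType) (T : R).
Hypothesis T0 : 0 <= T.

(** Left-continuous step functions, spanned by the indicators of [x <= b]: over []s, t]] such an
    indicator integrates to [min t b - min s b]. *)
Definition step (l : seq (R * R)) (x : R) : R := \sum_(p <- l) p.1 * (x <= p.2)%R%:R.

(* Regulated functions on ]0, T] that are left-continuous. *)
Definition caglad_fun (phi : R -> R) : Prop :=
  (forall t, 0 < t <= T -> forall eps, 0 < eps -> exists2 delta, 0 < delta &
     forall s, t - delta < s -> s <= t -> `|phi s - phi t| <= eps) /\
  (forall t, 0 <= t < T -> forall eps, 0 < eps -> exists c : R, exists2 delta, 0 < delta &
     forall s, t < s -> s < t + delta -> `|phi s - c| <= eps).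

Lemma step_cut (l : seq (R * R)) (t : R) : exists l', forall x : R,
  step l' x = step l x * (x <= t)%R%:R.
Proof.
exists [seq (p.1, Num.min p.2 t) | p <- l] => x.
rewrite /step big_map mulr_suml; apply: eq_bigr => p _ /=.
by rewrite le_min -mulrA -natrM mulnb.
Qed.

Lemma step_append (l : seq (R * R)) (t u c : R) : t <= u -> exists l', forall x : R, x <= u ->
  step l' x = if x <= t then step l x else c.
Proof.
move=> tu; have [l' hl'] := step_cut l t.
exists ((c, u) :: (- c, t) :: l') => x xu; rewrite /step !big_cons -/(step l' x) hl' /= xu mulr1.
by case: ifP => _; rewrite -/(step l x) /=; ring.
Qed.

(** Take the supremum of the [t] for which the claim holds on []0, t]]. Left continuity shows that
    it is attained, and the existence of right limits that it cannot lie below [T]. *)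
Lemma caglad_approx phi (eps : R) : caglad_fun phi -> 0 < eps ->
  exists l, forall s, 0 < s <= T -> `|phi s - step l s| <= eps.
Proof.
move=> [hl hr] eps0.
pose A := [set t : R | 0 <= t <= T /\ exists l, forall s, 0 < s <= t -> `|phi s - step l s| <= eps].
have A0 : A 0.
  split; first by rewrite lexx.
  by exists [::] => s /andP[s0 s1]; move: (lt_le_trans s0 s1); rewrite ltxx.
have supA : has_sup A by split; [exists 0|exists T => t [/andP[]]].
pose tau := sup A.
have tau0 : 0 <= tau by exact: (sup_upper_bound supA).
have tauT : tau <= T by apply: sup_le_ub; [exists 0|move=> t [/andP[]]].
have Atau : A tau.
  split; first by rewrite tau0.
  have [->|tau_neq0] := eqVneq tau 0; first by have [_] := A0.
  have tau_gt0 : 0 < tau by rewrite lt_neqAle eq_sym tau_neq0.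
  have [d d0 hd] := hl tau ltac:(by rewrite tau_gt0) eps eps0.
  have [t At tt] := sup_adherent d0 supA.
  have [/andP[t0 tT] [l hlt]] := At.
  have t_tau : t <= tau by exact: (sup_upper_bound supA).
  have [l' hl'] := step_append l (phi tau) t_tau.
  exists l' => s /andP[s0 s_tau]; rewrite hl'//; case: ifP => [st|/negbT].
    by apply: hlt; rewrite s0.
  by rewrite -ltNge => ts; apply: hd => //; exact: lt_trans tt ts.
have [_ [l hltau]] := Atau.
have [tauE|tau_neq] := eqVneq tau T; first by exists l => s; rewrite -tauE; exact: hltau.
have tau_lt : tau < T by rewrite lt_neqAle tau_neq.
have [c [d d0 hd]] := hr tau ltac:(by rewrite tau0) eps eps0.
exfalso; pose u := Num.min T (tau + d / 2).
have tau_u : tau < u by rewrite lt_min tau_lt ltrDl divr_gt0.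
have : A u.
  split; first by rewrite (ltW (le_lt_trans tau0 tau_u)) ge_min lexx.
  have [l' hl'] := step_append l c (ltW tau_u).
  exists l' => s /andP[s0 su]; rewrite hl'//; case: ifP => [st|/negbT].
    by apply: hltau; rewrite s0.
  rewrite -ltNge => ts; apply: hd => //.
  apply: le_lt_trans su _; rewrite gt_min; apply/orP; right.
  by rewrite ltrD2l ltr_pdivrMr// ltr_pMr// ltr1n.
by move/(sup_upper_bound supA); rewrite -/tau leNgt tau_u.
Qed.

Local Notation mu := (@lebesgue_measure R).

Lemma measurable_step D l : measurable D -> measurable_fun D (step l).
Proof.
move=> mD; apply: measurable_sum => p; apply: measurable_funM => //.
rewrite (_ : (fun x : R => _) = \1_(`]-oo, p.2]%classic)); first exact: measurable_indic.
apply/funext => x; rewrite indicE; congr ((nat_of_bool _)%:R); apply/idP/idP.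
  by move=> h; rewrite inE /= in_itv.
by rewrite inE /= in_itv.
Qed.

Lemma measurable_caglad phi : caglad_fun phi -> measurable_fun `]0, T] phi.
Proof.
move=> hphi.
have h (k : nat) : exists l, forall s, 0 < s <= T -> `|phi s - step l s| <= k.+1%:R^-1.
  by apply: caglad_approx.
have [l hl] := choice h.
apply: (measurable_fun_cvg (fun k => measurable_step (l k) (measurable_itv _))) => x.
rewrite /= in_itv /= => x0T; apply/cvgrPdist_le => e e0; near=> k.
apply: le_trans (hl k x x0T) _.
by apply: ltW; near: k; exact: (near_infty_natSinv_lt (PosNum e0)).
Unshelve. all: by end_near. Qed.

Lemma caglad_bounded phi : caglad_fun phi -> exists2 M : R, 0 < M &
  forall s, 0 < s <= T -> `|phi s| <= M.
Proof.
move=> /caglad_approx/(_ ltr01)[l hl].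
pose M := \sum_(p <- l) `|p.1| + 1.
have M0 : 0 < M by rewrite ltr_wpDl// sumr_ge0.
exists M => // s /hl h; rewrite -[phi s](subrK (step l s)) (le_trans (ler_normD _ _))//.
rewrite /M addrC lerD// /step (le_trans (ler_norm_sum _ _ _))//; apply: ler_sum => p _.
by rewrite normrM; case: (s <= p.2); rewrite ?normr1 ?normr0 ?mulr1 ?mulr0.
Qed.

Let mu_itv (s t : R) : s <= t -> mu `]s, t] = (t - s)%:E.
Proof.
move=> st; rewrite lebesgue_measure_itv /= lte_fin; case: ltP => // ts.
by have -> : s = t; [apply/eqP; rewrite eq_le st ts|rewrite subrr].
Qed.

Let mu_itv0 (s t : R) : t <= s -> mu `]s, t] = 0%E.
Proof. by move=> ts; rewrite lebesgue_measure_itv /= lte_fin ltNge ts. Qed.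

Let integrable_itv (f : R -> R) (s t M : R) : 0 <= s -> s <= t -> t <= T -> measurable_fun `]0, T] f ->
  (forall x, 0 < x <= T -> `|f x| <= M) -> mu.-integrable `]s, t] (EFin \o f).
Proof.
move=> s0 st tT mf fM.
have sub : `]s, t]%classic `<=` `]0, T]%classic.
  move=> x; rewrite /= !in_itv /= => /andP[sx xt].
  by rewrite (le_lt_trans s0 sx) (le_trans xt tT).
apply: measurable_bounded_integrable => //.
- by rewrite [X in (X < _)%E](mu_itv st) ltry.
- exact: measurable_funS sub mf.
- exists M; split; first exact: num_real.
  move=> N MN x /sub; rewrite /= in_itv /= => /fM h; exact: le_trans h (ltW MN).
Qed.

Let integral_ind (s t b : R) : 0 <= s -> s <= t -> t <= T ->
  mu.-integrable `]s, t] (EFin \o (fun x => (x <= b)%R%:R)) /\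
  \int[mu]_(x in `]s, t]) (x <= b)%R%:R = Num.min t b - Num.min s b.
Proof.
move=> s0 st tT.
have E : (fun x : R => (x <= b)%R%:R) = \1_(`]-oo, b]%classic) :> (R -> R).
  apply/funext => x; rewrite indicE; congr ((nat_of_bool _)%:R); apply/idP/idP.
    by move=> h; rewrite inE /= in_itv.
  by rewrite inE /= in_itv.
split.
  apply: (@integrable_itv _ _ _ 1) => // [|x _].
    by rewrite E; exact: measurable_indic.
  by case: (x <= b); rewrite ?normr1 ?normr0.
rewrite E /Rintegral integral_indic//.
rewrite (_ : _ `&` _ = `]s, Num.min t b]%classic); last first.
  apply/seteqP; split=> x /=; rewrite !in_itv /= le_min.
    by move=> [-> /andP[-> ->]].
  by move=> /andP[-> /andP[-> ->]].
have [sb|bs] := leP s (Num.min t b); last first.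
  transitivity (fine (0%E : \bar R)); first by congr fine; exact: (mu_itv0 (ltW bs)).
  have bs' : b < s by move: bs; rewrite gt_min => /orP[|//]; rewrite ltNge st.
  by rewrite !min_r ?subrr// ltW// (lt_le_trans bs').
transitivity (fine ((Num.min t b - s)%:E)); first by congr fine; exact: (mu_itv sb).
by rewrite /= [Num.min s b]min_l//; move: sb; rewrite le_min => /andP[].
Qed.

(** [G] grows like the primitive of a step function, up to [eps] times the length of the interval.
    Written with [min], the property is stable under linear combinations and ready for summation by
    parts. *)
Definition slope_approx (G : R -> R) : Prop := forall eps : R, 0 < eps ->
  exists l : seq (R * R), forall s t, 0 <= s -> s <= t -> t <= T ->
    `|G t - G s - \sum_(p <- l) p.1 * (Num.min t p.2 - Num.min s p.2)| <= eps * (t - s).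

Lemma slope_approx_primitive phi : caglad_fun phi ->
  slope_approx (fun t => \int[mu]_(x in `]0, t]) phi x).
Proof.
move=> hphi eps eps0; have [l hl] := caglad_approx hphi eps0.
have [M M0 hM] := caglad_bounded hphi; have mphi := measurable_caglad hphi.
exists l => s t s0 st tT; have t0 := le_trans s0 st.
rewrite Rintegral_itvB ?bnd_simp//; last exact: (@integrable_itv _ _ _ M).
have [istep Estep] : mu.-integrable `]s, t] (EFin \o step l) /\ \int[mu]_(x in `]s, t]) step l x =
    \sum_(p <- l) p.1 * (Num.min t p.2 - Num.min s p.2).
  elim: (l) => [|p l' [IH1 IH2]].
    rewrite (_ : step [::] = cst 0); last by apply/funext => x; rewrite /step big_nil.
    by rewrite big_nil; split; [exact: integrable0|rewrite Rintegral_cst// mul0r].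
  have [i1 i2] := integral_ind p.2 s0 st tT.
  rewrite (_ : step (p :: l') = fun x => p.1 * (x <= p.2)%R%:R + step l' x); last first.
    by apply/funext => x; rewrite /step big_cons.
  have i3 : mu.-integrable `]s, t] (EFin \o (fun x => p.1 * (x <= p.2)%R%:R)).
    rewrite (_ : EFin \o _ = (fun x => p.1%:E * (EFin \o (fun x => (x <= p.2)%R%:R)) x)%E).
      by apply: integrableZl.
    by apply/funext => x; rewrite /= EFinM.
  split; first by apply: (integrableD _ i3 IH1).
  by rewrite RintegralD// RintegralZl// i2 IH2 big_cons.
have iphi : mu.-integrable `]s, t] (EFin \o phi) by exact: (@integrable_itv _ _ _ M).
have id_ : mu.-integrable `]s, t] (EFin \o (fun x => phi x - step l x)).
  by apply: (integrableB _ iphi istep).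
rewrite -Estep -RintegralB//; apply: le_trans (le_normr_Rintegral _ _) _ => //.
have -> : eps * (t - s) = \int[mu]_(x in `]s, t]) eps.
  by rewrite Rintegral_cst//; congr (_ * _); transitivity (fine (t - s)%:E); last by congr fine; exact: esym (mu_itv st).
apply: le_Rintegral => //; first exact: (integrable_abse id_).
  apply: (@integrable_itv _ _ _ `|eps|) => //.
move=> x; rewrite /= in_itv /= => /andP[sx xt]; apply: hl.
by rewrite (le_lt_trans s0 sx) (le_trans xt tT).
Qed.

Lemma slope_approxD G H : slope_approx G -> slope_approx H -> slope_approx (fun t => G t + H t).
Proof.
move=> hG hH eps eps0; have e2 : 0 < eps / 2 by rewrite divr_gt0.
have [l hl] := hG _ e2; have [l' hl'] := hH _ e2; exists (l ++ l') => s t s0 st tT.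
rewrite big_cat /=; have := hl s t s0 st tT; have := hl' s t s0 st tT.
set a := _ - \sum_(_ <- l') _; set b := _ - \sum_(_ <- l) _ => ha hb.
have -> : G t + H t - (G s + H s) - (\sum_(p <- l) p.1 * (Num.min t p.2 - Num.min s p.2) +
   \sum_(p <- l') p.1 * (Num.min t p.2 - Num.min s p.2)) = b + a by rewrite /a /b; ring.
by apply: le_trans (ler_normD _ _) _; lra.
Qed.

Lemma slope_approxZ (c : R) G : slope_approx G -> slope_approx (fun t => c * G t).
Proof.
move=> hG eps eps0; have e1 : 0 < eps / (`|c| + 1) by rewrite divr_gt0// ltr_wpDl.
have [l hl] := hG _ e1; exists [seq (c * p.1, p.2) | p <- l] => s t s0 st tT.
rewrite big_map /=; under eq_bigr do rewrite -mulrA.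
rewrite -mulr_sumr -!mulrBr normrM.
have := hl s t s0 st tT; set z := `|G t - _ - _| => hz.
apply: (@le_trans _ _ ((`|c| + 1) * z)); first by apply: ler_wpM2r; [exact: normr_ge0|rewrite lerDl].
by rewrite mulrC -ler_pdivlMr ?ltr_wpDl// mulrAC.
Qed.

Lemma slope_approx0 : slope_approx (fun=> 0).
Proof.
move=> eps eps0; exists [::] => s t s0 st tT; rewrite big_nil !subr0 normr0.
by rewrite mulr_ge0 ?(ltW eps0)// subr_ge0.
Qed.

Lemma slope_approx_sum (I : Type) (r : seq I) (G : I -> R -> R) :
  (forall i, slope_approx (G i)) -> slope_approx (fun t => \sum_(i <- r) G i t).
Proof.
move=> hG; elim: r => [|i r IH].
  by under eq_fun do rewrite big_nil; exact: slope_approx0.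
by under eq_fun do rewrite big_cons; exact: slope_approxD.
Qed.

Lemma slope_approx_lip G : slope_approx G -> exists2 M : R, 0 < M &
  forall s t, 0 <= s -> s <= t -> t <= T -> `|G t - G s| <= M * (t - s).
Proof.
move=> /(_ _ ltr01)[l hl]; exists (1 + \sum_(p <- l) `|p.1|).
  by rewrite ltr_pwDl// sumr_ge0.
move=> s t s0 st tT.
have := hl s t s0 st tT; set z := \sum_(p <- l) _ => h.
rewrite -[G t - G s](subrK z) (le_trans (ler_normD _ _))// mulrDl lerD//.
rewrite /z (le_trans (ler_norm_sum _ _ _))// mulr_suml; apply: ler_sum => p _.
rewrite normrM ler_wpM2l//; rewrite ger0_norm; last first.
  by rewrite subr_ge0 le_min ge_min st ge_min lexx orbT.
have [tp|pt] := leP t p.2; have [sp|ps] := leP s p.2; lra.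
Qed.

End regulated.

(** * Integrals over null sets and left limits of paths *)

Section null_set.
Context d (T : measurableType d) (R : realType) (mu : {measure set T -> \bar R}).
Import HBNNSimple.

(** [f] is arbitrary because the jump integrand along a path is not known to be measurable. For
    nonnegative [f] the integral is a supremum over simple functions below [f], and setting these to
    0 on [N] leaves their integrals unchanged. *)
Lemma integral_setU_null (D N : set T) (f : T -> \bar R) : measurable D -> measurable N ->
  mu N = 0%E -> (\int[mu]_(x in D `|` N) f x = \int[mu]_(x in D) f x)%E.
Proof.
move=> mD mN N0.
suff ge0 (g : T -> \bar R) : (forall x, 0 <= g x)%E ->
    (\int[mu]_(x in D `|` N) g x = \int[mu]_(x in D) g x)%E.
  by rewrite integralE [in RHS]integralE !ge0.
move=> g0; rewrite !ge0_integralE//; apply/eqP; rewrite eq_le; apply/andP; split.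
  apply: ge_ereal_sup => _ [h /= hg <-].
  have mNC := measurableC mN; pose h' := proj_nnsfun h mNC.
  have -> : sintegral mu h = sintegral mu h'.
    rewrite -!integralT_nnsfun; apply: ae_eq_integral => //.
    - by apply/measurable_EFinP; exact: measurable_funPT.
    - by apply/measurable_EFinP; exact: measurable_funPT.
    exists N; split=> // x /=; apply: contra_notP => Nx _.
    by rewrite mindicE mem_set ?mulr1.
  apply: ereal_sup_ubound; exists h' => //= x.
  have [Nx|Nx] := pselect (N x).
    rewrite mindicE memNset; last by move=> /(_ Nx).
    by rewrite mulr0 patchE; case: ifP.
  rewrite mindicE mem_set// mulr1; apply: le_trans (hg x) _.
  rewrite !patchE; case: ifP => [|_]; last by case: ifP.
  by rewrite inE => -[Dx|//]; rewrite mem_set.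
apply: ge_ereal_sup => _ [h /= hg <-]; apply: ereal_sup_ubound; exists h => //= x.
apply: le_trans (hg x) _; rewrite !patchE; case: ifP => [|_]; last by case: ifP.
by rewrite inE => Dx; rewrite mem_set//; left.
Qed.

End null_set.

Section left_limits.
Context (R : realType) (d : nat).
Implicit Types x : R -> 'cV[R]_d.

Lemma enorm_n1 m n (A : 'M[R]_(m, n)) : enorm A <= n1 A.
Proof.
rewrite -[leRHS]ger0_norm ?n1_ge0// -sqrtr_sqr ler_wsqrtr//.
rewrite [leRHS]expr2 {2}/n1 mulr_sumr; apply: ler_sum => i _; rewrite mulr_sumr.
apply: ler_sum => j _; rewrite -real_normK ?num_real// expr2.
by rewrite ler_wpM2r// n1_entry.
Qed.

Lemma continuous_dist (l c : 'cV[R]_d) : {for l, continuous (fun v : 'cV[R]_d => n1 (v - c))}.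
Proof.
apply: (@continuous_n1 _ _ _ (fun v => v - c)) => i.
rewrite (_ : (fun y : 'cV[R]_d => (y - c) i 0) = (fun y => y i 0 - c i 0)); last first.
  by apply/funext => y; rewrite !mxE.
by apply: continuousB; [exact: coord_continuous|exact: cst_continuous].
Qed.

Lemma cvg_dist (F : set_system R) {FF : Filter F} x (l c : 'cV[R]_d) :
  x s @[s --> F] --> l -> n1 (x s - c) @[s --> F] --> n1 (l - c).
Proof. by move=> xl; exact: (continuous_cvg _ (@continuous_dist l c) xl). Qed.

Lemma left_limit_bound x (t : R) (c : 'cV[R]_d) (e : R) : cvg (x s @[s --> t^'-]) ->
  (\forall s \near t^'-, n1 (x s - c) <= e) -> n1 (left_limit x t - c) <= e.
Proof. by move=> cx h; exact: (cvgr_to_le (cvg_dist (c := c) cx) h). Qed.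

Lemma left_limit_left x (t : R) : cadlag x -> 0 < t -> forall eps, 0 < eps ->
  exists2 delta, 0 < delta & forall s, t - delta < s -> s <= t ->
    n1 (left_limit x s - left_limit x t) <= eps.
Proof.
move=> [_ hx] t0 eps eps0.
have : n1 (x s - left_limit x t) @[s --> t^'-] --> n1 (left_limit x t - left_limit x t).
  by apply: cvg_dist; exact: hx.
rewrite subrr n10 => /cvgrPdist_le/(_ _ eps0)[d' /= d'0 hd].
exists (Num.min d' t); first by rewrite lt_min d'0.
move=> s ts; rewrite le_eqVlt => /orP[/eqP ->|st]; first by rewrite subrr n10 ltW.
have s0 : 0 < s by apply: le_lt_trans ts; rewrite subr_ge0 ge_min lexx orbT.
have sd : t - d' < s by apply: le_lt_trans ts; rewrite lerB// ge_min lexx.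
apply: left_limit_bound (hx s s0) _; near=> r.
have rs : r < s by near: r; exact: nbhs_left_lt.
have tr : t - d' < r by near: r; exact: nbhs_left_gt.
have rt := lt_trans rs st.
have hr : ball_ Num.norm t d' r by rewrite /ball_ /= gtr0_norm ?subr_gt0//; lra.
by have := hd r hr rt; rewrite sub0r normrN ger0_norm ?n1_ge0.
Unshelve. all: by end_near. Qed.

Lemma left_limit_right x (t : R) : cadlag x -> 0 <= t -> forall eps, 0 < eps ->
  exists2 delta, 0 < delta & forall s, t < s -> s < t + delta ->
    n1 (left_limit x s - x t) <= eps.
Proof.
move=> [rx hx] t0 eps eps0.
have : n1 (x s - x t) @[s --> t^'+] --> n1 (x t - x t).
  by apply: cvg_dist; exact: rx.
rewrite subrr n10 => /cvgrPdist_le/(_ _ eps0)[d' /= d'0 hd].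
exists d' => // s ts sd; have s0 := le_lt_trans t0 ts.
apply: left_limit_bound (hx s s0) _; near=> r.
have rs : r < s by near: r; exact: nbhs_left_lt.
have tr : t < r by near: r; exact: nbhs_left_gt.
have hr : ball_ Num.norm t d' r by rewrite /ball_ /= distrC gtr0_norm ?subr_gt0//; lra.
by have := hd r hr tr; rewrite sub0r normrN ger0_norm ?n1_ge0.
Unshelve. all: by end_near. Qed.

(** The left limits of a cadlag path form a left-continuous path whose right limits are the values
    [x t], and a Lipschitz [g] preserves this; the drift integrand has this form. *)
Lemma caglad_comp (T : R) x (g : 'cV[R]_d -> R) (M : R) : cadlag x -> 0 <= M ->
  (forall v v', `|g v - g v'| <= M * n1 (v - v')) ->
  caglad_fun T (fun s => g (left_limit x s)).
Proof.
move=> cx M0 gM.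
have M1 : 0 < M + 1 by rewrite ltr_wpDl.
have bound e v v' : n1 (v - v') <= e / (M + 1) -> `|g v - g v'| <= e.
  move=> h; apply: le_trans (gM _ _) _; apply: (@le_trans _ _ ((M + 1) * n1 (v - v'))).
    by rewrite ler_wpM2r ?n1_ge0// lerDl.
  by rewrite mulrC -ler_pdivlMr.
split=> t /andP[t0 tT] eps eps0; have e0 : 0 < eps / (M + 1) by rewrite divr_gt0.
  have [d' d'0 hd] := left_limit_left cx t0 e0; exists d' => // s ts st.
  exact/bound/hd.
have [d' d'0 hd] := left_limit_right cx t0 e0; exists (g (x t)), d' => // s ts sd.
exact/bound/hd.
Qed.

End left_limits.

(** * Finite jump activity and jump-free increments *)

Section jumps.
Context (R : realType) (d : nat).

Lemma measurable_punctured : measurable (@punctured R d).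
Proof.
rewrite (_ : @punctured R d = ~` \bigcap_(i in [set: 'I_d]) ((fun v : 'cV[R]_d => v i 0) @^-1` [set 0])).
  apply: measurableC; apply: fin_bigcap_measurable => // i _.
  by rewrite -[X in measurable X]setTI; exact: measurable_entry.
apply/seteqP; split=> v /=; rewrite /punctured /=.
  move=> /eqP v0 h; apply: v0; apply/colP => i; rewrite [RHS]mxE; exact: h.
by move=> h; apply/eqP => v0; apply: h => i _; rewrite /= v0 mxE.
Qed.

Definition jump_strip (s t : R) : set (R * 'cV[R]_d) := `]s, t] `*` @punctured R d.

Lemma measurable_jump_strip s t : measurable (jump_strip s t).
Proof. by apply: measurableX => //; exact: measurable_punctured. Qed.

Lemma jump_strip_space s t : 0 <= s -> jump_strip s t `<=` @jump_space R d.
Proof.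
move=> s0 [u z] [/=]; rewrite in_itv /= => /andP[su _] pz.
by split=> //=; exact: le_trans s0 (ltW su).
Qed.

Lemma jump_strip_split r s t : r <= s -> s <= t ->
  jump_strip r t = jump_strip r s `|` jump_strip s t.
Proof.
move=> rs st; apply/seteqP; split=> -[u z] /=; rewrite /jump_strip /= !in_itv /=.
  move=> [/andP[ru ut] pz]; have [us|su] := leP u s; first by left; split; rewrite ?in_itv /= ?ru.
  by right; split; rewrite ?in_itv /= ?su.
move=> [[+ pz]|[+ pz]] => /andP[h1 h2]; split=> //.
  by rewrite h1 (le_trans h2 st).
by rewrite h2 (le_lt_trans rs h1).
Qed.

(* Every strip of nonzero mass has mass at least 1. *)
Lemma jump_count (mu : {measure set (R * 'cV[R]_d) -> \bar R}) (t : nat -> R) (n K : nat) :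
  (forall A, measurable A -> A `<=` @jump_space R d ->
     mu A = +oo%E \/ exists k : nat, mu A = k%:R%:E) ->
  0 <= t 0%N -> (forall i, t i <= t i.+1) -> mu (jump_strip (t 0%N) (t n)) = K%:R%:E ->
  (\sum_(i < n | mu (jump_strip (t i) (t i.+1)) != 0%E) 1 <= K)%N.
Proof.
move=> hmu t0 tm muK.
have tmono i j : (i <= j)%N -> t i <= t j.
  move=> /subnK <-; elim: (j - i)%N => // k IH; apply: le_trans IH _; exact: tm.
have key m : ((\sum_(i < m | mu (jump_strip (t i) (t i.+1)) != 0%E) 1)%N%:R%:E <=
    mu (jump_strip (t 0%N) (t m)))%E.
  elim: m => [|m IH]; first by rewrite big_ord0 measure_ge0.
  rewrite big_mkcond big_ord_recr -big_mkcond /= natrD EFinD.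
  rewrite (jump_strip_split (tmono _ _ (leq0n m)) (tm m)).
  rewrite measureU; first last.
  - apply/seteqP; split=> // -[u z] [[/= + _] [/= + _]]; rewrite !in_itv /=.
    by move=> /andP[_ um] /andP[mu' _]; move: (lt_le_trans mu' um); rewrite ltxx.
  - exact: measurable_jump_strip.
  - exact: measurable_jump_strip.
  apply: leeD => //; case: ifPn => [nz|_]; last by rewrite measure_ge0.
  have tm0 : 0 <= t m by apply: le_trans (tmono _ _ (leq0n m)).
  have [E|[k E]] := hmu _ (measurable_jump_strip (t m) (t m.+1)) (jump_strip_space tm0).
    suff h : (1 <= mu (jump_strip (t m) (t m.+1)))%E by exact: h.
    by rewrite (E : mu (jump_strip (t m) (t m.+1)) = _) leey.
  have {}E : mu (jump_strip (t m) (t m.+1)) = k%:R%:E := E.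
  suff h : (1 <= mu (jump_strip (t m) (t m.+1)))%E by exact: h.
  rewrite E in nz *; rewrite lee_fin ler1n lt0n.
  by apply: contra nz => /eqP ->.
by have := key n; rewrite muK lee_fin ler_nat.
Qed.

End jumps.

Section latent_path.
Context (R : realType) (dO : measure_display) (Om : measurableType dO) (P : probability Om R).
Context (F : R -> set (set Om)) (F_filtration : filtration F).
Context (d : nat) (L : latent R Om d) (model : latent_model P F L).
Variables (T : R) (T0 : 0 < T).

Let prm : poisson_random_measure P F (jump_intensity L) (jump_meas L).
Proof. by have [_ _ _ [_ ?] _] := model. Qed.

(** By Tonelli the strip has mass [T] times the jump rate, the jump density having total mass 1. *)
Lemma jump_intensity_strip : (jump_intensity L (@jump_strip R d 0 T) < +oo)%E.
Proof.
have [_ _ [r0 mdens dens0 dens1] _ _] := model.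
have mS := @measurable_jump_strip R d 0 T.
have mP := @measurable_punctured R d.
have mlevy : measurable_fun (@punctured R d) (fun z => (levy_dens L z)%:E).
  by apply/measurable_EFinP; apply: measurable_funM.
rewrite /jump_intensity /jump_strip.
pose f (u : R * 'cV[R]_d) := ((fun z => (levy_dens L z)%:E) \_ (@punctured R d)) u.2.
have f0 u : (0 <= f u)%E.
  rewrite /f patchE; case: ifP => // ; rewrite inE => pu.
  by rewrite lee_fin mulr_ge0 ?dens0// ltW.
have mf : measurable_fun setT f.
  apply: (measurableT_comp _ measurable_snd).
  exact/(measurable_restrictT _ mP).
have -> : (\int[@lebesgue_measure R \x lebesgue_vec R d]_(u in `]0%R, T] `*` @punctured R d)
    (levy_dens L u.2)%:E = \int[@lebesgue_measure R \x lebesgue_vec R d]_(u in `]0%R, T] `*` @punctured R d)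
    f u)%E.
  by apply: eq_integral => -[u z]; rewrite inE => -[_ pz]; rewrite /f patchE mem_set.
rewrite integral_mkcond.
rewrite (_ : (fun u => f u) \_ _ = fun u : R * 'cV[R]_d => ((\1_(`]0, T]%classic) u.1)%:E * f u)%E); last first.
  apply/funext => -[u z]; rewrite patchE indicE /=.
  case: ifPn => [|/negP nu].
    by rewrite inE => -[/= uT _]; rewrite mem_set// mul1e.
  have [pz|pz] := pselect (punctured z); last first.
    have -> : f (u, z) = 0%E by rewrite /f patchE memNset.
    by rewrite mule0.
  rewrite memNset ?mul0e// => uT; apply: nu; rewrite inE; split=> //.
have m1 : measurable_fun setT (fun u : R * 'cV[R]_d => (\1_(`]0, T]%classic) u.1)%:E : \bar R).
  have mi : measurable_fun setT (\1_(`]0, T]%classic) : R -> R) by exact: measurable_indic.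
  apply/measurable_EFinP; exact: (measurableT_comp mi measurable_fst).
rewrite fubini_tonelli1 => [||u].
- apply: (@le_lt_trans _ _ (\int[@lebesgue_measure R]_x ((\1_(`]0, T]%classic) x)%:E * (jump_rate L)%:E))%E).
    rewrite le_eqVlt; apply/orP; left; apply/eqP; apply: eq_integral => x _.
    pose g : 'cV[R]_d -> \bar R := (fun z => (levy_dens L z)%:E) \_ (@punctured R d).
    have mg : measurable_fun setT g by exact/(measurable_restrictT _ mP).
    have g0 z : setT z -> (0 <= g z)%E by move=> _; exact: (f0 (0, z)).
    have c0 : (0 <= (\1_(`]0, T]%classic) x : R)%:E)%E by rewrite lee_fin.
    transitivity (\int[lebesgue_vec R d]_z ((\1_(`]0, T]%classic) x : R)%:E * g z))%E; first by [].
    rewrite (@ge0_integralZl _ _ _ (lebesgue_vec R d) _ measurableT _ mg _ g0 c0); congr (_ * _)%E.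
    rewrite /g -integral_mkcond.
    transitivity (\int[lebesgue_vec R d]_(z in @punctured R d) ((jump_rate L)%:E * (jump_dens L z)%:E))%E.
      by apply: eq_integral => z _; rewrite /levy_dens EFinM.
    have md : measurable_fun (@punctured R d) (EFin \o jump_dens L) by exact/measurable_EFinP.
    have d0 z : punctured z -> (0 <= (EFin \o jump_dens L) z)%E by move=> pz; rewrite /= lee_fin dens0.
    have l0 : (0 <= (jump_rate L)%:E)%E by rewrite lee_fin ltW.
    by rewrite (@ge0_integralZl _ _ _ (lebesgue_vec R d) _ mP _ md _ d0 l0) dens1 mule1.
  rewrite ge0_integralZr//; last by rewrite lee_fin ltW.
    rewrite integral_indic// setIT [X in (X * _)%E](_ : _ = T%:E) -?EFinM ?ltry//.
    have E : @lebesgue_measure R `]0, T] = T%:E.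
      by rewrite lebesgue_measure_itv /= lte_fin T0 sube0.
    exact: E.
  exact/measurable_EFinP/measurable_indic.
- exact: emeasurable_funM.
- by rewrite mule_ge0// lee_fin.
Qed.

(** The Poisson weights of the finite counts add up to 1, so the disjoint events of exactly [k]
    jumps cover almost every path. *)
Lemma finite_jumps : {ae P, forall w, exists k : nat, jump_meas L w (@jump_strip R d 0 T) = k%:R%:E}.
Proof.
have [h1 h2 h3 _] := prm.
set A := @jump_strip R d 0 T; have mA : measurable A := @measurable_jump_strip R d 0 T.
have sA : A `<=` @jump_space R d := jump_strip_space (lexx 0).
have [h4 _] := h3 A mA sA; have h5 := h4 jump_intensity_strip.
pose E (k : nat) := [set w | jump_meas L w A = k%:R%:E].
have mE k : measurable (E k).
  have [_ Fm _] := F_filtration.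
  apply: (Fm T (ltW T0)); apply: (h2 T A [set k%:R%:E]) => //; first exact: ltW.
  move=> [u z] Auz; split; first exact: sA.
  by move: Auz => [/=]; rewrite in_itv /= => /andP[].
have tE : trivIset setT E.
  apply/trivIsetP => i j _ _ ij; apply/seteqP; split=> // w [/= E1 E2].
  have /eqP : (i%:R%:E : \bar R) = j%:R%:E := etrans (esym E1) E2.
  by rewrite eqe eqr_nat (negbTE ij).
have P1 : P (\bigcup_k E k) = 1%E.
  have c1 := @measure_semi_sigma_additive _ _ _ P E mE tE (bigcup_measurable (fun k _ => mE k)).
  have c2 := @measure_semi_sigma_additive _ _ _ (poisson_prob (fine (jump_intensity L A)) 0)
    (fun k => [set k]) (fun k => I) _ I.
  have <- : poisson_prob (fine (jump_intensity L A)) 0 (\bigcup_k [set k]) = 1%E.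
    rewrite (_ : \bigcup_k [set k] = setT); first exact: probability_setT.
    by apply/seteqP; split=> // k _; exists k.
  apply: (cvg_unique _ c1) => //.
  rewrite (_ : (fun n => _) = (fun n => (\sum_(0 <= i < n)
    poisson_prob (fine (jump_intensity L A)) 0 [set i])%E)); last first.
    by apply/funext => n; apply: eq_bigr => i _; exact: h5.
  apply: c2; apply/trivIsetP => i j _ _ ij; apply/seteqP; split=> // k [/= -> /eqP].
  by rewrite (negbTE ij).
exists (~` \bigcup_k E k); split.
- by apply: measurableC; exact: bigcup_measurable.
- by rewrite probability_setC ?P1 ?subee//; exact: bigcup_measurable.
- by move=> w /= nh [k _ Ek]; apply: nh; exists k.
Qed.

Let drift_int (w : Om) (j : 'I_d) (t : R) : R :=
  \int[@lebesgue_measure R]_(s in `]0, t]) (drift L (left_limit (fun r => process L r w) s) j 0).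

Definition drift_primitive w j t := drift_int w j t.

Lemma drift_primitive_slope w j : lipschitz_growth L -> slope_approx T (drift_primitive w j).
Proof.
move=> [l [g [l0 _ _ lip _]]]; have [[_ cx] _ _ _ _] := model.
apply: slope_approx_primitive; first exact: ltW.
apply: (@caglad_comp _ _ _ _ (fun v => drift L v j 0) l (cx w)); first exact: ltW.
move=> v v'; apply: (@le_trans _ _ (l * enorm (v - v'))).
  apply: le_trans (lip v v'); rewrite /enorm -sqrtr_sqr ler_wsqrtr//.
  rewrite [leRHS](bigD1 j)//= big_ord1 !mxE lerDl sumr_ge0// => i _.
  by apply: sumr_ge0 => k _; exact: sqr_ge0.
by rewrite ler_wpM2l ?(ltW l0)// enorm_n1.
Qed.

(** If the strip over []s, t]] has mass zero, the jump integrals up to [s] and up to [t] coincide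
    and cancel. *)
Lemma path_increment : {ae P, forall w, forall s t, 0 <= s -> s <= t ->
  jump_meas L w (@jump_strip R d s t) = 0%E ->
  process L t w - process L s w =
    (\col_j (drift_primitive w j t - drift_primitive w j s)) +
    diffusion L *m (noise L t w - noise L s w)}.
Proof.
have [_ _ _ _ sde] := model.
apply: filterS sde => w sde s t s0 st nojump.
have t0 := le_trans s0 st.
rewrite (sde t t0) (sde s s0) /=.
have E j : \int[jump_meas L w]_(u in `]0, t] `*` @punctured R d)
    jump_coef L (left_limit (process L ^~ w) u.1) u.2 j 0 =
  \int[jump_meas L w]_(u in `]0, s] `*` @punctured R d)
    jump_coef L (left_limit (process L ^~ w) u.1) u.2 j 0.
  rewrite /Rintegral -!/(@jump_strip R d 0 _) (jump_strip_split d s0 st).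
  by rewrite integral_setU_null//; exact: measurable_jump_strip.
apply/colP => j; rewrite mulmxBr !mxE E /drift_primitive /drift_int; ring.
Qed.

End latent_path.

(** * The truncated realised covariance *)

(** Summation by parts: the weights decrease, so their total variation is at most [l 0]. The case
    [n = 0] is set apart because the hypotheses then say nothing about the sign of [l 0]. *)
Lemma abel_bound (R : realType) (l u : nat -> R) (B : R) (n : nat) :
  (forall i, (i < n)%N -> 0 <= l i) -> (forall i, (i.+1 < n)%N -> l i.+1 <= l i) ->
  (forall i, (i <= n)%N -> `|u i| <= B) ->
  `|\sum_(i < n) l i * (u i.+1 - u i)| <= 2 * B * l 0%N \/ n = 0%N.
Proof.
case: n => [|n] l0 lm uB; [by right|left].
have B0 : 0 <= B by apply: le_trans (uB 0%N _).
(* Keeping the boundary term [l m * u m.+1] on the left makes the bound inductive. *)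
suff key m : (m <= n)%N ->
    `|\sum_(i < m.+1) l i * (u i.+1 - u i) - l m * u m.+1| <= B * (2 * l 0%N - l m).
  have h := key n (leqnn n); have un := uB n.+1 (leqnn _); have ln := l0 n (ltnSn n).
  rewrite -[\sum_(_ < _) _](subrK (l n * u n.+1)) (le_trans (ler_normD _ _))//.
  have : `|l n * u n.+1| <= l n * B by rewrite normrM ger0_norm// ler_wpM2l.
  lra.
elim: m => [_|m IH mn].
  rewrite big_ord1 /= (_ : _ - _ = - (l 0%N * u 0%N)); last by ring.
  rewrite normrN normrM ger0_norm ?l0// mulrC.
  have := uB 0%N isT; have := l0 0%N isT; nra.
rewrite big_ord_recr /= (_ : _ - _ = (\sum_(i < m.+1) l i * (u i.+1 - u i) - l m * u m.+1)
  + (l m - l m.+1) * u m.+1); last by ring.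
apply: le_trans (ler_normD _ _) _.
have h1 := IH (ltnW mn).
have h2 : `|(l m - l m.+1) * u m.+1| <= (l m - l m.+1) * B.
  rewrite normrM ger0_norm ?subr_ge0 ?lm//.
  by rewrite ler_wpM2l ?subr_ge0 ?lm// uB// ltnW.
lra.
Qed.

(** Monotonicity, slope at most 1 and concavity of [t |-> min t c] on a uniform grid; they make its
    increments admissible weights in [abel_bound]. *)
Lemma min_step (R : realFieldType) (a k c : R) : 0 <= k ->
  [/\ 0 <= Num.min (a + k) c - Num.min a c, Num.min (a + k) c - Num.min a c <= k &
      Num.min (a + k + k) c - Num.min (a + k) c <= Num.min (a + k) c - Num.min a c].
Proof.
move=> k0; have [c1|c1] := leP c a.
  by rewrite !min_r; [split; lra|lra|lra].
have [c2|c2] := leP c (a + k); first by rewrite !min_r; [split; lra|lra].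
by have [c3|c3] := leP c (a + k + k); split; lra.
Qed.

(** * Pathwise comparison of the truncated covariance with that of the noise *)

Section grid.
Context (R : realType) (T : R).
Hypothesis T0 : 0 < T.

Definition grid (n i : nat) : R := i%:R * (T / n%:R).

Let h (n : nat) : R := T / n%:R.

Lemma grid_step n i : grid n i.+1 = grid n i + h n.
Proof. by rewrite /grid -natr1 mulrDl mul1r. Qed.

Lemma grid_ge0 n i : 0 <= grid n i.
Proof. by rewrite mulr_ge0// divr_ge0// ltW. Qed.

Lemma grid_le n i j : (i <= j)%N -> grid n i <= grid n j.
Proof. by move=> ij; rewrite ler_wpM2r ?ler_nat// divr_ge0// ltW. Qed.

Lemma grid_n n : (0 < n)%N -> grid n n = T.
Proof. by move=> n0; rewrite /grid mulrC divfK// pnatr_eq0 -lt0n. Qed.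

Lemma grid_leT n i : (i <= n)%N -> grid n i <= T.
Proof.
move=> i_n; case: n i_n => [|n] i_n; last by rewrite -[leRHS](grid_n (ltn0Sn n)) grid_le.
by rewrite /grid invr0 mulr0 mulr0 ltW.
Qed.

(** The step part of the drift is handled by [abel_bound] and costs [C * h]. The rest is [eps] times
    [h] times the variation of [u] on the grid, which for Brownian noise is of order
    [eps * sqrt h]. *)
Lemma slope_sum (G u : R -> R) (B eps : R) : slope_approx T G ->
  (forall t, 0 <= t <= T -> `|u t| <= B) -> 0 < eps -> exists2 C : R, 0 <= C &
  forall n, (0 < n)%N ->
    `|\sum_(i < n) (G (grid n i.+1) - G (grid n i)) * (u (grid n i.+1) - u (grid n i))|
    <= eps * (h n * \sum_(i < n) `|u (grid n i.+1) - u (grid n i)|) + C * h n.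
Proof.
move=> hG uB eps0; have [l hl] := hG eps eps0.
have B0 : 0 <= B by apply: le_trans (uB 0 _); rewrite ?normr_ge0// lexx ltW.
exists (\sum_(p <- l) `|p.1| * (2 * B)).
  by apply: sumr_ge0 => p _; rewrite !mulr_ge0.
move=> n n0; have h0 : 0 < h n by rewrite divr_gt0// ltr0n.
pose Q (t : R) := \sum_(p <- l) p.1 * Num.min t p.2.
pose du i := u (grid n i.+1) - u (grid n i).
have uBn i : (i <= n)%N -> `|u (grid n i)| <= B.
  by move=> i_n; rewrite uB// grid_ge0 grid_leT.
have split_sum : \sum_(i < n) (G (grid n i.+1) - G (grid n i)) * du i =
   \sum_(i < n) (G (grid n i.+1) - G (grid n i) - (\sum_(p <- l) p.1 * (Num.min (grid n i.+1) p.2 - Num.min (grid n i) p.2))) * du i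
   + \sum_(p <- l) p.1 * \sum_(i < n) (Num.min (grid n i.+1) p.2 - Num.min (grid n i) p.2) * du i.
  have -> : \sum_(p <- l) p.1 * \sum_(i < n) (Num.min (grid n i.+1) p.2 - Num.min (grid n i) p.2) * du i =
     \sum_(i < n) (\sum_(p <- l) p.1 * (Num.min (grid n i.+1) p.2 - Num.min (grid n i) p.2)) * du i.
    rewrite (eq_bigr (fun p => \sum_(i < n) p.1 * ((Num.min (grid n i.+1) p.2 - Num.min (grid n i) p.2) * du i))); last first.
      by move=> p _; rewrite mulr_sumr.
    rewrite exchange_big /=; apply: eq_bigr => i _; rewrite mulr_suml.
    by apply: eq_bigr => p _; rewrite mulrA.
  by rewrite -big_split; apply: eq_bigr => i _ /=; ring.
rewrite split_sum; apply: le_trans (ler_normD _ _) _; apply: lerD.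
  apply: le_trans (ler_norm_sum _ _ _) _; rewrite !mulr_sumr; apply: ler_sum => i _.
  rewrite normrM -/(du i) mulrA ler_wpM2r//.
  have := hl (grid n i) (grid n i.+1) (grid_ge0 n i) (grid_le n (leqnSn i)) (grid_leT (ltn_ord i)).
  by rewrite grid_step [grid n i + h n]addrC addrK.
apply: le_trans (ler_norm_sum _ _ _) _; rewrite mulr_suml; apply: ler_sum => p _.
rewrite normrM -mulrA ler_wpM2l//.
pose lp (i : nat) := Num.min (grid n i.+1) p.2 - Num.min (grid n i) p.2.
have step i : [/\ 0 <= lp i, lp i <= h n & lp i.+1 <= lp i].
  by rewrite /lp !grid_step; exact: min_step (ltW h0).
have lp0 i : (i < n)%N -> 0 <= lp i by have [] := step i.
have lpm i : (i.+1 < n)%N -> lp i.+1 <= lp i by have [] := step i.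
have [_ lph _] := step 0%N.
have [hb|n00] := abel_bound lp0 lpm uBn; last by move: n0; rewrite n00.
by apply: le_trans hb _; rewrite ler_wpM2l// mulr_ge0.
Qed.

Lemma near_mesh_pow (C gamma e : R) : 0 < gamma -> 0 < e -> \forall n \near \oo, C * h n `^ gamma <= e.
Proof.
move=> g0 e0; pose C' := `|C| + 1; have C'0 : 0 < C' by rewrite ltr_wpDl.
pose b := (e / C') `^ gamma^-1; have b0 : 0 < b by rewrite powR_gt0// divr_gt0.
near=> n.
have n0 : (0 < n)%N by near: n; exact: nbhs_infty_gt.
have hb : h n <= b.
  rewrite /h ler_pdivrMr ?ltr0n// mulrC -ler_pdivrMr//.
  by near: n; exact: nbhs_infty_ger.
have h0 : 0 < h n by rewrite divr_gt0// ltr0n.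
have : h n `^ gamma <= e / C'.
  have -> : e / C' = b `^ gamma.
    by rewrite /b -powRrM mulVf ?gt_eqF// powRr1// ltW// divr_gt0.
  by apply: ge0_ler_powR => //; rewrite ?nnegrE; exact: ltW.
rewrite ler_pdivlMr// => hh; apply: le_trans hh; rewrite mulrC ler_wpM2l ?powR_ge0//.
by rewrite /C' (le_trans (ler_norm _))// lerDl.
Unshelve. all: by end_near. Qed.

Section comparison.
Variables (p : nat) (X : R -> 'cV[R]_p) (G u : 'I_p -> R -> R) (D rho Bu : R) (K : nat).
Hypothesis D0 : 0 < D.
Hypothesis rho4 : 4^-1 < rho.
Hypothesis rho1 : rho < 1.
Hypothesis G_slope : forall a, slope_approx T (G a).
Hypothesis u_bound : forall a t, 0 <= t <= T -> `|u a t| <= Bu.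
Hypothesis few_jumps : forall n, exists J : pred nat,
  (\sum_(i < n | J i) 1 <= K)%N /\
  forall i, (i < n)%N -> ~~ J i -> forall a,
    (X (grid n i.+1) - X (grid n i)) a 0 =
    (G a (grid n i.+1) - G a (grid n i)) + (u a (grid n i.+1) - u a (grid n i)).

(** When drift and noise are both at most [kappa * h ^ rho] in each of the [p] coordinates, the norm
    of a jump-free increment is at most [D * h ^ rho]. Writing [p.+1] avoids a division by 0. *)
Definition kappa : R := D / (2 * p.+1%:R).

Let dX n i : 'cV[R]_p := X (grid n i.+1) - X (grid n i).
Let g n i a : R := G a (grid n i.+1) - G a (grid n i).
Let Z n i a : R := u a (grid n i.+1) - u a (grid n i).
Let small n i : bool := enorm (dX n i) <= D * h n `^ rho.
Let tr n : R := T^-1 * \sum_(i < n) \sum_a Z n i a ^+ 2.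

Let tr_ge0 n : 0 <= tr n.
Proof.
rewrite mulr_ge0 ?invr_ge0 ?(ltW T0)//; apply: sumr_ge0 => i _.
by apply: sumr_ge0 => a _; exact: sqr_ge0.
Qed.

Let kappa0 : 0 < kappa.
Proof. by rewrite divr_gt0// mulr_gt0// ltr0n. Qed.

Let sum_Z n a : \sum_(i < n) Z n i a ^+ 2 <= T * tr n.
Proof.
rewrite /tr mulrA divff ?gt_eqF// mul1r; apply: ler_sum => i _.
by rewrite (bigD1 a)//= lerDl; apply: sumr_ge0 => b _; exact: sqr_ge0.
Qed.

(** From [s |Z| <= s^2 + Z^2] with [s = sqrt h]: the variation of the noise on the grid is
    controlled by its realised variance [tr n]. *)
Let h_sum_Z n a : (0 < n)%N -> h n * \sum_(i < n) `|Z n i a| <= T * (Num.sqrt (h n) * (1 + tr n)).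
Proof.
move=> n0; have h0 : 0 < h n by rewrite divr_gt0// ltr0n.
pose s := Num.sqrt (h n); have s0 : 0 < s by rewrite sqrtr_gt0.
have ss : h n = s * s by rewrite -expr2 sqr_sqrtr// ltW.
have hn : h n * n%:R = T by rewrite /h divfK// pnatr_eq0 -lt0n.
have pt i : s * `|Z n i a| <= h n + Z n i a ^+ 2.
  rewrite ss -[Z n i a ^+ 2]real_normK ?num_real//; set z := `|_|.
  have z0 : 0 <= z by exact: normr_ge0.
  have := sqr_ge0 (s - z); nra.
rewrite {1}ss -mulrA mulr_sumr.
rewrite (_ : T * _ = s * (T * (1 + tr n))); last by rewrite -/s; ring.
rewrite ler_wpM2l ?(ltW s0)//; apply: le_trans (_ : \sum_(i < n) (h n + Z n i a ^+ 2) <= _).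
  by apply: ler_sum => i _; exact: pt.
by rewrite big_split /= sumr_const card_ord -[h n *+ n]mulr_natr hn mulrDr mulr1 lerD2l sum_Z.
Qed.

Let SX n : 'M[R]_p := \sum_(i < n | small n i) dX n i *m (dX n i)^T.
Let SZ n : 'M[R]_p := \sum_(i < n) (\col_a Z n i a) *m (\col_a Z n i a)^T.
Let Nn n : nat := (\sum_(i < n | small n i) 1)%N.

Let good n : Prop := forall i a, (i < n)%N -> `|Z n i a| <= kappa * h n `^ rho.

(** Under [good n] an interval outside [J] is always kept. There the two covariances differ by drift
    terms alone; on the at most [K] remaining intervals, kept or not, every product is bounded by a
    constant times [h ^ (2 rho)]. *)
Let entry_bound (e1 : R) : 0 < e1 -> exists C M : R, 0 < M /\ forall n, (0 < n)%N -> h n <= 1 ->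
  M * h n `^ (1 - rho) <= kappa -> good n ->
  (n - K <= Nn n)%N /\
  forall a b, `|SX n a b - SZ n a b| <= C * h n + 2 * e1 * T * (Num.sqrt (h n) * (1 + tr n))
     + C * h n `^ (2 * rho).
Proof.
move=> e10.
have [M M0 hM] : exists2 M : R, 0 < M & forall a s t, 0 <= s -> s <= t -> t <= T ->
    `|G a t - G a s| <= M * (t - s).
  have ex a := slope_approx_lip (G_slope a).
  pose Ma a := sval (cid2 (ex a)).
  have MaP a : 0 < Ma a by rewrite /Ma; case: cid2.
  have MaQ a s t : 0 <= s -> s <= t -> t <= T -> `|G a t - G a s| <= Ma a * (t - s).
    by rewrite /Ma; case: cid2 => m ? hm /=; exact: hm.
  exists (1 + \sum_a Ma a); first by rewrite ltr_pwDl// sumr_ge0// => a _; exact: ltW.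
  move=> a s t s0 st tT; apply: le_trans (MaQ a s t s0 st tT) _.
  rewrite ler_wpM2r ?subr_ge0// (bigD1 a)//= addrCA lerDl addr_ge0//.
  by apply: sumr_ge0 => b _; exact: ltW.
have [C1 C10 hC1] : exists2 C1 : R, 0 <= C1 & forall n a b, (0 < n)%N ->
    `|\sum_(i < n) g n i a * Z n i b| <= e1 * (h n * \sum_(i < n) `|Z n i b|) + C1 * h n.
  have ex a b := slope_sum (G_slope a) (u_bound b) e10.
  pose Cab a b := sval (cid2 (ex a b)).
  have Cab0 a b : 0 <= Cab a b by rewrite /Cab; case: cid2.
  have CabQ a b n : (0 < n)%N -> `|\sum_(i < n) g n i a * Z n i b| <=
      e1 * (h n * \sum_(i < n) `|Z n i b|) + Cab a b * h n.
    by rewrite /Cab; case: cid2 => c ? hc /=; exact: hc.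
  exists (\sum_a \sum_b Cab a b).
    by apply: sumr_ge0 => a _; apply: sumr_ge0.
  move=> n a b n0; apply: le_trans (CabQ a b n n0) _; rewrite lerD2l ler_wpM2r//.
    by rewrite divr_ge0// ltW.
  rewrite (bigD1 a)//= (bigD1 b)//= -addrA lerDl addr_ge0 ?sumr_ge0//.
  by move=> c _; apply: sumr_ge0.
pose C := T * M ^+ 2 + 2 * C1 + K%:R * (D ^+ 2 + 4 * kappa ^+ 2).
exists C, M; split=> // n n0 h1 Mh gd.
have h0 : 0 < h n by rewrite divr_gt0// ltr0n.
have hr0 := powR_ge0 (h n) rho; set hr := h n `^ rho in gd hr0 *.
have hr2 : h n `^ (2 * rho) = hr ^+ 2.
  by rewrite -[RHS]powR_mulrn ?powR_ge0// -powRrM mulrC.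
have hT : h n * n%:R = T by rewrite /h divfK// pnatr_eq0 -lt0n.
have gM i a : (i < n)%N -> `|g n i a| <= M * h n.
  move=> i_n; apply: le_trans (hM a (grid n i) (grid n i.+1) _ _ _) _.
  - exact: grid_ge0.
  - exact: grid_le.
  - exact: grid_leT.
  - by rewrite grid_step [grid n i + h n]addrC addrK.
have gk i a : (i < n)%N -> `|g n i a| <= kappa * hr.
  move=> i_n; apply: le_trans (gM i a i_n) _.
  have -> : h n = h n `^ (1 - rho) * hr.
    rewrite /hr -powRD ?subrK ?powRr1 ?(ltW h0)//.
    by apply/implyP => _; rewrite gt_eqF.
  by rewrite mulrA ler_wpM2r.
have [J [JK hJ]] := few_jumps n.
have smallJ i : (i < n)%N -> ~~ J i -> small n i.
  move=> i_n nJ; rewrite /small.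
  apply: le_trans (enorm_n1 _) _; rewrite n1_cV.
  apply: (@le_trans _ _ (\sum_(a < p) (2 * kappa * hr))).
    apply: ler_sum => a _; rewrite /dX (hJ i i_n nJ a).
    apply: le_trans (ler_normD _ _) _; rewrite -/(g n i a) -/(Z n i a).
    by have := gk i a i_n; have := gd i a i_n; rewrite -/hr; lra.
  rewrite sumr_const card_ord -[_ *+ p]mulr_natr /kappa -/hr.
  rewrite (_ : 2 * (D / (2 * p.+1%:R)) * hr * p%:R = D * hr * (p%:R / p.+1%:R)); last first.
    by field; rewrite nat1r pnatr_eq0.
  rewrite ler_piMr ?mulr_ge0 ?(ltW D0)// ler_pdivrMr ?ltr0n// mul1r ler_nat.
  exact: leqnSn.
split.
  rewrite leq_subLR; apply: (@leq_trans (\sum_(i < n | J i) 1 + Nn n)%N); last by rewrite leq_add2r.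
  rewrite /Nn -[X in (X <= _)%N](card_ord n) -sum1_card.
  rewrite (bigID (fun i : 'I_n => J i)) /= leq_add2l.
  rewrite big_mkcond /= [X in (_ <= X)%N]big_mkcond /=; apply: leq_sum => i _.
  by case: ifPn => // nJ; rewrite smallJ.
move=> a b.
(* [dab i] is the difference of the two summands, and [gz i] is its value off [J]. Extending the sum
   of [gz] to all intervals is what allows [slope_sum]. *)
pose dab i := (if small n i then dX n i a 0 * dX n i b 0 else 0) - Z n i a * Z n i b.
pose gz i := g n i a * g n i b + g n i a * Z n i b + Z n i a * g n i b.
have -> : SX n a b - SZ n a b = \sum_(i < n) gz i + \sum_(i < n | J i) (dab i - gz i).
  have SXE : SX n a b = \sum_(i < n) (if small n i then dX n i a 0 * dX n i b 0 else 0).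
    rewrite /SX summxE big_mkcond /=; apply: eq_bigr => i _; case: ifP => // _.
    by rewrite mxE big_ord1 [_^T _ _]mxE.
  have SZE : SZ n a b = \sum_(i < n) Z n i a * Z n i b.
    by rewrite /SZ summxE; apply: eq_bigr => i _; rewrite !mxE big_ord1 !mxE.
  rewrite SXE SZE -sumrB [X in _ + X]big_mkcond -big_split /=; apply: eq_bigr => i _.
  rewrite -/(dab i); case: ifPn => [_|nJ]; first by rewrite addrC subrK.
  rewrite addr0 /dab smallJ// /dX !hJ// /gz /g /Z; ring.
have b1 : `|\sum_(i < n) gz i| <= (T * M ^+ 2 + 2 * C1) * h n + 2 * e1 * T * (Num.sqrt (h n) * (1 + tr n)).
  rewrite /gz !big_split /=.
  have x1 : `|\sum_(i < n) g n i a * g n i b| <= T * M ^+ 2 * h n.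
    apply: (@le_trans _ _ (\sum_(i < n) (M * h n) * (M * h n))).
      apply: le_trans (ler_norm_sum _ _ _) _; apply: ler_sum => i _.
      by rewrite normrM ler_pM ?gM.
    rewrite sumr_const card_ord -[_ *+ n]mulr_natr -hT.
    by rewrite (_ : M * h n * (M * h n) * n%:R = h n * n%:R * M ^+ 2 * h n)//; ring.
  have x2 : `|\sum_(i < n) g n i a * Z n i b| <= e1 * T * (Num.sqrt (h n) * (1 + tr n)) + C1 * h n.
    apply: le_trans (hC1 n a b n0) _; rewrite lerD2r -mulrA ler_wpM2l ?(ltW e10)//.
    exact: h_sum_Z.
  have x3 : `|\sum_(i < n) Z n i a * g n i b| <= e1 * T * (Num.sqrt (h n) * (1 + tr n)) + C1 * h n.
    under eq_bigr do rewrite mulrC.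
    apply: le_trans (hC1 n b a n0) _; rewrite lerD2r -mulrA ler_wpM2l ?(ltW e10)//.
    exact: h_sum_Z.
  apply: le_trans (ler_normD _ _) _; have := ler_normD (\sum_(i < n) g n i a * g n i b) (\sum_(i < n) g n i a * Z n i b).
  lra.
have b2 : `|\sum_(i < n | J i) (dab i - gz i)| <= K%:R * (D ^+ 2 + 4 * kappa ^+ 2) * h n `^ (2 * rho).
  rewrite hr2; apply: (@le_trans _ _ (\sum_(i < n | J i) (D ^+ 2 + 4 * kappa ^+ 2) * hr ^+ 2)).
    apply: le_trans (ler_norm_sum _ _ _) _; apply: ler_sum => i _.
    have Za := gd i a (ltn_ord i); have Zb := gd i b (ltn_ord i).
    have ga := gk i a (ltn_ord i); have gb := gk i b (ltn_ord i).
    have k0 : 0 <= kappa * hr by rewrite mulr_ge0// ltW.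
    have m1 : `|g n i a * g n i b| <= (kappa * hr) ^+ 2 by rewrite normrM expr2 ler_pM.
    have m2 : `|g n i a * Z n i b| <= (kappa * hr) ^+ 2 by rewrite normrM expr2 ler_pM.
    have m3 : `|Z n i a * g n i b| <= (kappa * hr) ^+ 2 by rewrite normrM expr2 ler_pM.
    have m4 : `|Z n i a * Z n i b| <= (kappa * hr) ^+ 2 by rewrite normrM expr2 ler_pM.
    have m5 : `|if small n i then dX n i a 0 * dX n i b 0 else 0| <= (D * hr) ^+ 2.
      have Dh : 0 <= D * hr by rewrite mulr_ge0// ltW.
      case: ifP => [sm|_]; last by rewrite normr0 sqr_ge0.
      have ent c : `|dX n i c 0| <= D * hr.
        apply: le_trans sm; rewrite -sqrtr_sqr ler_wsqrtr//.
        rewrite (bigD1 c)//= big_ord1 lerDl; apply: sumr_ge0 => c' _.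
        by apply: sumr_ge0 => j _; exact: sqr_ge0.
      by rewrite normrM expr2 ler_pM.
    have kE : (kappa * hr) ^+ 2 = kappa ^+ 2 * hr ^+ 2 by exact: exprMn.
    have DE : (D * hr) ^+ 2 = D ^+ 2 * hr ^+ 2 by exact: exprMn.
    rewrite /dab /gz; move: m1 m2 m3 m4 m5; rewrite !ler_norml kE DE.
    set y := (if _ then _ else _); move=> /andP[? ?] /andP[? ?] /andP[? ?] /andP[? ?] /andP[? ?].
    by apply/andP; split; lra.
  set z := (_ * hr ^+ 2); have z0 : 0 <= z.
    by rewrite mulr_ge0 ?sqr_ge0// addr_ge0 ?sqr_ge0// mulr_ge0 ?sqr_ge0.
  have -> : \sum_(i < n | J i) z = z * (\sum_(i < n | J i) 1)%N%:R.
    by rewrite sumr_const -sum1_card mulr_natr.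
  by rewrite -[leRHS]mulrA -/z mulrC ler_wpM2r// ler_nat.
apply: le_trans (ler_normD _ _) _.
have Ch : 0 <= K%:R * (D ^+ 2 + 4 * kappa ^+ 2).
  by rewrite mulr_ge0// addr_ge0 ?sqr_ge0// mulr_ge0 ?sqr_ge0.
have Ch2 : 0 <= T * M ^+ 2 + 2 * C1.
  by rewrite addr_ge0 ?mulr_ge0 ?sqr_ge0// ltW.
have p0 := powR_ge0 (h n) (2 * rho).
rewrite /C; set y := h n `^ _ in b2 p0 *; set A1 := T * M ^+ 2 + 2 * C1 in b1 Ch2 *.
set A2 := K%:R * _ in b2 Ch *.
have : 0 <= A2 * h n by rewrite mulr_ge0// ltW.
have : 0 <= A1 * y by rewrite mulr_ge0.
lra.
Qed.

(** Entries differ by [o(sqrt h)], and [sqrt n * sqrt h = sqrt T]. Replacing [N h] by [T] costs a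
    relative [K / n]. The factor [1 + tr n] keeps the noise level explicit; it is bounded in
    probability only later. *)
Lemma realised_comparison (eps : R) : 0 < eps -> \forall n \near \oo, good n ->
  (1 - eps) * n%:R <= (Nn n)%:R /\
  Num.sqrt n%:R * n1 (((Nn n)%:R * h n)^-1 *: SX n - T^-1 *: SZ n) <= eps * (1 + tr n).
Proof.
move=> eps0.
pose P : R := p%:R * p%:R + 1; have P1 : 1 <= P by rewrite lerDr mulr_ge0.
pose sT := Num.sqrt T; have sT0 : 0 < sT by rewrite sqrtr_gt0.
have sTT : sT * sT = T by rewrite -expr2 sqr_sqrtr// ltW.
(* [e1] and [e2] together contribute [4 / 10] of [eps]; the other half of [eps] is for the
   normalisation by [N h]. *)
pose e1 := eps / (20 * P * sT).
have c0 : 0 < 20 * P * sT by rewrite !mulr_gt0//; lra.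
have e10 : 0 < e1 by rewrite divr_gt0.
have [C [M [M0 hC]]] := entry_bound e10.
pose e2 := eps * sT / (20 * P).
have e20 : 0 < e2 by rewrite !divr_gt0 ?mulr_gt0//; lra.
have r0 : 0 < 2 * rho - 2^-1 by have := rho4; lra.
near=> n.
have n0 : (0 < n)%N by near: n; exact: nbhs_infty_gt.
have h0 : 0 < h n by rewrite divr_gt0// ltr0n.
have hT : h n * n%:R = T by rewrite /h divfK// pnatr_eq0 -lt0n.
have h1 : h n <= 1.
  have : 1 * h n `^ 1 <= 1 by near: n; exact: near_mesh_pow.
  by rewrite powRr1 ?(ltW h0)// mul1r.
have Mh : M * h n `^ (1 - rho) <= kappa by near: n; apply: near_mesh_pow => //; rewrite subr_gt0.
have nR : 0 < n%:R :> R by rewrite ltr0n.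
have Kn : K%:R <= Num.min eps 2^-1 * n%:R.
  rewrite mulrC -ler_pdivrMr; last by rewrite lt_min eps0 invr_gt0 /=.
  by near: n; exact: nbhs_infty_ger.
have K1 : `|C| * h n `^ 2^-1 <= e2 by near: n; apply: near_mesh_pow.
have K2 : `|C| * h n `^ (2 * rho - 2^-1) <= e2 by near: n; exact: near_mesh_pow.
have K3 : (2 * K%:R * P) <= (eps / 2) * Num.sqrt n%:R.
  have h3 : (2 * K%:R * P / (eps / 2)) ^+ 2 <= n%:R by near: n; exact: nbhs_infty_ger.
  rewrite [leRHS]mulrC -ler_pdivrMr ?divr_gt0//.
  apply: le_trans (ler_norm _) _; rewrite -sqrtr_sqr ler_wsqrtr//.
move=> gd; have [NK hab] := hC n n0 h1 Mh gd.
have NKR : n%:R - K%:R <= (Nn n)%:R :> R by rewrite lerBlDr -natrD ler_nat addnC -leq_subLR.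
have Nle : (Nn n)%:R <= n%:R :> R.
  rewrite ler_nat /Nn -[X in (_ <= X)%N](card_ord n) -sum1_card big_mkcond /=.
  by apply: leq_sum => i _; case: ifP.
have Ke : K%:R <= eps * n%:R.
  by apply: (le_trans Kn); rewrite ler_wpM2r// ge_min lexx.
have K2n : K%:R <= 2^-1 * n%:R :> R.
  by apply: (le_trans Kn); rewrite ler_wpM2r// ge_min lexx orbT.
split; first by rewrite mulrBl mul1r; lra.
set Nr : R := (Nn n)%:R in NKR Nle *.
have N2 : n%:R / 2 <= Nr by lra.
have N0 : 0 < Nr by lra.
pose s := Num.sqrt (h n); have s0 : 0 < s by rewrite sqrtr_gt0.
have ss : s * s = h n by rewrite -expr2 sqr_sqrtr// ltW.
pose sn := Num.sqrt (n%:R : R); have sn0 : 0 < sn by rewrite sqrtr_gt0.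
have snn : sn * sn = n%:R by rewrite -expr2 sqr_sqrtr// ltW.
have sns : sn * s = sT by rewrite /sn /s /sT -sqrtrM ?ler0n// mulrC hT.
have t0 := tr_ge0 n; set t := tr n in t0 hab *.
have s12 : h n `^ 2^-1 = s by rewrite powR12_sqrt// ltW.
have hs2r : h n `^ (2 * rho) = s * h n `^ (2 * rho - 2^-1).
  rewrite -s12 -powRD; first by rewrite addrC subrK.
  by apply/implyP => _; rewrite gt_eqF.
have ent a b : `|SX n a b - SZ n a b| <= s * ((2 * e2 + 2 * e1 * T) * (1 + t)).
  apply: le_trans (hab a b) _.
  have q1 : C * h n <= s * e2.
    rewrite -ss mulrCA mulrC -mulrA mulrCA ler_wpM2l ?(ltW s0)//.
    by apply: le_trans K1; rewrite s12 ler_wpM2r ?(ltW s0)// ler_norm.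
  have q2 : C * h n `^ (2 * rho) <= s * e2.
    rewrite hs2r mulrCA ler_wpM2l ?(ltW s0)//; apply: le_trans K2.
    by rewrite ler_wpM2r ?powR_ge0// ler_norm.
  have q3 : 0 <= s * e2 * t.
    by apply: mulr_ge0 => //; apply: mulr_ge0; exact: ltW.
  rewrite -/s; lra.
have Qab a b : `|SZ n a b| <= T * t.
  rewrite /SZ summxE; apply: le_trans (ler_norm_sum _ _ _) _.
  apply: (@le_trans _ _ (\sum_(i < n) (Z n i a ^+ 2 / 2 + Z n i b ^+ 2 / 2))).
    apply: ler_sum => i _; rewrite !mxE big_ord1 !mxE normrM.
    rewrite -[Z n i a ^+ 2]real_normK ?num_real// -[Z n i b ^+ 2]real_normK ?num_real//.
    have := sqr_ge0 (`|Z n i a| - `|Z n i b|); lra.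
  rewrite big_split /= -!mulr_suml; have := sum_Z n a; have := sum_Z n b.
  rewrite -/t; lra.
have Nh0 : 0 < Nr * h n by rewrite mulr_gt0.
have iNh : (Nr * h n)^-1 <= 2 / T.
  rewrite -[leRHS]invrK lef_pV2 ?posrE ?invr_gt0 ?divr_gt0// invf_div.
  by rewrite -hT; nra.
have diff : (Nr * h n)^-1 - T^-1 <= 2 * K%:R / (n%:R * T).
  have -> : (Nr * h n)^-1 - T^-1 = (n%:R - Nr) / (Nr * T).
    by rewrite -hT; field; rewrite !gt_eqF.
  rewrite ler_pdivrMr ?mulr_gt0// mulrAC ler_pdivlMr ?mulr_gt0//.
  have : (n%:R - Nr) * n%:R <= 2 * K%:R * Nr by nra.
  by move=> hh; rewrite !mulrA; rewrite ler_wpM2r// ltW.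
have diff0 : 0 <= (Nr * h n)^-1 - T^-1.
  by rewrite subr_ge0 lef_pV2 ?posrE// -hT mulrC ler_wpM2l// ltW.
have entry a b : `|((Nr * h n)^-1 *: SX n - T^-1 *: SZ n) a b| <=
    2 / T * (s * ((2 * e2 + 2 * e1 * T) * (1 + t))) + 2 * K%:R / (n%:R * T) * (T * t).
  have -> : ((Nr * h n)^-1 *: SX n - T^-1 *: SZ n) a b =
     (Nr * h n)^-1 * (SX n a b - SZ n a b) + ((Nr * h n)^-1 - T^-1) * SZ n a b.
    rewrite !(mxE, mulrBl, mulrBr) -/(SX n) -/(SZ n); ring.
  apply: le_trans (ler_normD _ _) _; rewrite !normrM (ger0_norm diff0) gtr0_norm ?invr_gt0//.
  by rewrite lerD// ler_pM// invr_ge0 ltW.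
have n1b : n1 ((Nr * h n)^-1 *: SX n - T^-1 *: SZ n) <=
   P * (2 / T * (s * ((2 * e2 + 2 * e1 * T) * (1 + t))) + 2 * K%:R / (n%:R * T) * (T * t)).
  set y := 2 / T * _ + _ in entry *.
  have y0 : 0 <= y.
    have d1 : 0 <= e2 * 2 + e1 * T *+ 2 by rewrite addr_ge0 ?mulrn_wge0// mulr_ge0// ltW.
    have d2 : 0 <= 2 * e2 + 2 * e1 * T by move: d1; rewrite -mulr_natr; lra.
    have d3 : 0 <= 2 / T by rewrite divr_ge0// ltW.
    have d4 : 0 <= 2 * K%:R / (n%:R * T) * (T * t).
      have := ltW T0 => T0'; apply: mulr_ge0; last exact: mulr_ge0.
      by apply: divr_ge0; exact: mulr_ge0.
    apply: addr_ge0 => //; apply: mulr_ge0 => //; apply: mulr_ge0; first exact: ltW.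
    by apply: mulr_ge0 => //; exact: addr_ge0.
  apply: (@le_trans _ _ (\sum_(a < p) \sum_(b < p) y)).
    by apply: ler_sum => a _; apply: ler_sum => b _; exact: entry.
  rewrite !sumr_const !card_ord -(mulr_natr y p) -(mulr_natr (y * p%:R) p) /P.
  by move: (p%:R) => z; lra.
apply: (@le_trans _ _ (sn * (P * (2 / T * (s * ((2 * e2 + 2 * e1 * T) * (1 + t))) + 2 * K%:R / (n%:R * T) * (T * t))))).
  by rewrite ler_wpM2l// ltW.
have -> : sn * (P * (2 / T * (s * ((2 * e2 + 2 * e1 * T) * (1 + t))) + 2 * K%:R / (n%:R * T) * (T * t))) =
  (sn * s) * (2 * P / T * (2 * e2 + 2 * e1 * T)) * (1 + t) + (2 * K%:R * P) * t / sn.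
  rewrite -snn; field; rewrite !gt_eqF//.
have x1 : (sn * s) * (2 * P / T * (2 * e2 + 2 * e1 * T)) <= eps / 2.
  rewrite sns /e1 /e2 -sTT.
  rewrite (_ : sT * _ = eps * (4 / 10)); last by field; rewrite !gt_eqF//; lra.
  lra.
have x2 : (2 * K%:R * P) * t / sn <= (eps / 2) * t.
  by rewrite ler_pdivrMr// [leRHS]mulrAC; apply: ler_wpM2r.
apply: (@le_trans _ _ (eps / 2 * (1 + t) + eps / 2 * t)).
  by apply: lerD => //; apply: ler_wpM2r => //; exact: addr_ge0.
lra.
Unshelve. all: by end_near. Qed.

End comparison.

End grid.

(** * Measurability and almost sure comparison *)

Section measurable_matrices.
Context (R : realType) d (T : measurableType d).

(** Away from 0 the inverse is [exp (- ln)] up to sign, and at 0 it is 0. *)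
Lemma measurable_inv (f : T -> R) : measurable_fun setT f -> measurable_fun setT (fun w => (f w)^-1).
Proof.
move=> mf.
rewrite (_ : (fun w => _) = fun w => if 0 < f w then expR (- ln (f w)) else
   if f w < 0 then - expR (- ln (- f w)) else 0); last first.
  apply/funext => w; have [f0|f0|<-] := ltgtP 0 (f w).
  - by rewrite expRN lnK// posrE.
  - by rewrite expRN lnK ?posrE ?oppr_gt0// invrN opprK.
  - by rewrite invr0.
have mexp (g : T -> R) : measurable_fun setT g -> measurable_fun setT (fun w => expR (- ln (g w))).
  move=> mg; apply: measurableT_comp; first exact: measurable_expR.
  apply: measurable_funN; apply: measurableT_comp mg; exact: measurable_ln.
apply: measurable_fun_ifT; first exact: measurable_fun_ltr.
  exact: mexp.
apply: measurable_fun_ifT => //; first exact: measurable_fun_ltr.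
by apply: measurable_funN; apply: mexp; exact: measurable_funN.
Qed.

Lemma measurable_set_of_bool (f : T -> bool) : measurable_fun setT f -> measurable [set w | f w].
Proof.
move=> mf; rewrite (_ : [set w | _] = setT `&` f @^-1` [set true]); first exact: mf.
by rewrite setTI; apply/seteqP; split.
Qed.

Lemma measurable_sum_if (n : nat) (c : 'I_n -> T -> bool) (f : 'I_n -> T -> R) :
  (forall i, measurable_fun setT (c i)) -> (forall i, measurable_fun setT (f i)) ->
  measurable_fun setT (fun w => \sum_(i < n | c i w) f i w).
Proof.
move=> mc mf; under eq_fun do rewrite big_mkcond /=.
by apply: measurable_sum => i; exact: measurable_fun_ifT.
Qed.

Definition measurable_mx m n (A : T -> 'M[R]_(m, n)) : Prop :=
  forall i j, measurable_fun setT (fun w => A w i j).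

Lemma measurable_det n (A : T -> 'M[R]_n) : measurable_mx A ->
  measurable_fun setT (fun w => \det (A w)).
Proof.
move=> mA; apply: measurable_sum => s; apply: measurable_funM => //.
by apply: measurable_prod => i _; exact: mA.
Qed.

Lemma measurable_tr_invmx n (S A : T -> 'M[R]_n) : measurable_mx S -> measurable_mx A ->
  (forall w, S w \in unitmx) -> measurable_fun setT (fun w => \tr (invmx (S w) *m A w)).
Proof.
move=> mS mA uS; apply: measurable_sum => i; under eq_fun do rewrite mxE.
apply: measurable_sum => j; apply: measurable_funM; last exact: mA.
under eq_fun do rewrite /invmx uS !mxE.
apply: measurable_funM; first exact/measurable_inv/measurable_det.
apply: measurable_funM => //; apply: measurable_det => k l.
under eq_fun do rewrite !mxE; exact: mS.
Qed.

(** By [posdef_schur] the event is symmetry, a positive corner and positive definiteness of the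
    Schur complement, whose entries are again measurable. *)
Lemma measurable_posdef n (A : T -> 'M[R]_n) : measurable_mx A ->
  measurable [set w | posdef (A w)].
Proof.
elim: n A => [|n IH] A mA.
  rewrite (_ : [set w | _] = setT)//; apply/seteqP; split=> // w _ /=; split=> [|x].
    by rewrite [RHS]flatmx0 [LHS]flatmx0.
  by rewrite [x]flatmx0 eqxx.
suff key (B : T -> 'M[R]_(1 + n)) : measurable_mx B -> measurable [set w | posdef (B w)].
  exact: key.
move=> mB.
rewrite (_ : [set w | _] = [set w | [forall i, [forall j, B w j i == B w i j]]] `&`
    ([set w | 0 < B w 0 0] `&` [set w | posdef (schur (B w))])); last first.
  apply/seteqP; split=> w /=.
    move=> /posdef_schur[BT B0 pB]; split=> //.
    by apply/forallP => i; apply/forallP => j; rewrite -{1}BT mxE.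
  move=> [/forallP h [h0 h1]]; apply/posdef_schur; split=> //; apply/matrixP => i j.
  by rewrite mxE; apply/eqP; move: (h i) => /forallP.
apply: measurableI; last apply: measurableI.
- rewrite (_ : [set w | _] = \bigcap_(ij in [set: 'I_(1 + n) * 'I_(1 + n)]) [set w | B w ij.2 ij.1 == B w ij.1 ij.2]).
    apply: fin_bigcap_measurable => // ij _; apply: measurable_set_of_bool.
    exact: measurable_fun_eqr.
  apply/seteqP; split=> w /=.
    by move=> /forallP h [i j] _ /=; move: (h i) => /forallP.
  by move=> h; apply/forallP => i; apply/forallP => j; exact: (h (i, j)).
- by apply: measurable_set_of_bool; exact: measurable_fun_ltr.
- apply: IH => i j; under eq_fun do rewrite /schur !mxE.
  apply: measurable_funB; first exact: mB.
  apply: measurable_funM; first exact/measurable_inv/mB.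
  apply: measurable_sum => k; under eq_fun do rewrite !mxE.
  by apply: measurable_funM; exact: mB.
Qed.

(* Rounding down the coordinates of g reduces the claim to maps with countably many values. *)
Lemma measurable_continuous_comp q (U : set 'cV[R]_q) (f : 'cV[R]_q -> R) (g : T -> 'cV[R]_q) :
  (forall x, U x -> {for x, continuous f}) -> (forall w, U (g w)) ->
  (forall j, measurable_fun setT (fun w => g w j 0)) ->
  measurable_fun setT (fun w => f (g w)).
Proof.
move=> cf gU mg.
pose z (k : nat) w : 'cV[int]_q := \col_j Num.floor (g w j 0 * k.+1%:R).
pose r (k : nat) (m : 'cV[int]_q) : 'cV[R]_q := \col_j ((m j 0)%:~R / k.+1%:R).
have mz k (m : 'cV[int]_q) : measurable [set w | z k w = m].
  rewrite (_ : [set w | _] = \bigcap_(j in [set: 'I_q])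
      [set w | (m j 0)%:~R <= g w j 0 * k.+1%:R < (m j 0 + 1)%:~R]).
    apply: fin_bigcap_measurable => // j _; apply: measurable_set_of_bool.
    have mgk : measurable_fun setT (fun w => g w j 0 * k.+1%:R) by exact: measurable_funM.
    by apply: measurable_and; [exact: measurable_fun_ler|exact: measurable_fun_ltr].
  apply/seteqP; split=> w /=.
    by move=> <- j _ /=; rewrite !mxE floor_itv.
  by move=> h; apply/colP => j; rewrite mxE; apply: floor_def; exact: h.
apply: (measurable_fun_cvg (h := fun k w => f (r k (z k w)))).
  move=> k _ B mB; rewrite setTI.
  rewrite (_ : _ @^-1` B = \bigcup_(m in [set: 'cV[int]_q])
      ([set w | z k w = m] `&` [set w | B (f (r k m))])); last first.
    by apply/seteqP; split=> w /=; [move=> h; exists (z k w)|move=> [m _ [<-]]].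
  apply: countable_bigcupT_measurable => // m; apply: measurableI; first exact: mz.
  have [h|h] := pselect (B (f (r k m))).
    by rewrite (_ : [set w | _] = setT)//; apply/seteqP; split.
  by rewrite (_ : [set w | _] = set0)//; apply/seteqP; split.
move=> w _ A /(cf _ (gU w)) /nbhs_n1[delta d0 hd].
have dq : 0 < delta / q.+1%:R by rewrite divr_gt0// ltr0n.
suff : \forall k \near \oo, A (f (r k (z k w))) by [].
near=> k.
suff : n1 (r k (z k w) - g w) <= delta by move=> /hd; rewrite addrC subrK.
apply: (@le_trans _ _ (\sum_(j < q) (k.+1%:R^-1 : R))).
  rewrite n1_cV; apply: ler_sum => j _; rewrite !mxE.
  have k0 : 0 < k.+1%:R :> R by rewrite ltr0n.
  rewrite -[X in _ - X](mulfK (lt0r_neq0 k0)) -mulrBl normrM [X in _ * X]gtr0_norm ?invr_gt0//.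
  rewrite ler_piMl ?invr_ge0 ?(ltW k0)//.
  have /andP[f1 f2] := floor_itv (g w j 0 * k.+1%:R).
  by move: f2; rewrite intrD => f2; rewrite ler_norml; apply/andP; split; lra.
rewrite sumr_const card_ord -[leLHS]mulr_natr.
apply: (@le_trans _ _ (delta / q.+1%:R * q%:R)).
  by rewrite ler_wpM2r//; apply: ltW; near: k; exact: (near_infty_natSinv_lt (PosNum dq)).
by rewrite -mulrA ler_piMr ?(ltW d0)// mulrC ler_pdivrMr ?ltr0n// mul1r ler_nat.
Unshelve. all: by end_near. Qed.

End measurable_matrices.

(** * From almost every path to high probability *)

Section almost_sure_comparison.
Context (R : realType) d (Om : measurableType d) (P : probability Om R).

(** The event that [E] fails at some index from [n] on decreases to a null set, so its probability
    tends to 0. The index from which [E] holds may depend on the path. *)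
Lemma whp_eventually (E : nat -> set Om) : (forall n, measurable (E n)) ->
  {ae P, forall w, \forall n \near \oo, E n w} -> whp P E.
Proof.
move=> mE ae e e0; pose B n := \bigcup_k ~` E (n + k)%N.
have mB n : measurable (B n) by apply: bigcupT_measurable => k; exact: measurableC.
have B0 : P (\bigcap_n B n) = 0.
  have [N [mN N0 sN]] := ae; apply: (subset_measure0 _ mN _ N0).
    exact: bigcapT_measurable.
  move=> w hB; apply: sN => /= -[n _ hn]; have [k _] := hB n I; apply.
  by apply: hn; rewrite /= leq_addr.
have cB : P (B n) @[n --> \oo] --> 0%E.
  rewrite -B0; apply: nonincreasing_cvg_mu => //.
  - by rewrite -ge0_fin_numE// fin_num_measure.
  - exact: bigcapT_measurable.
  - move=> n m nm; rewrite subsetEset => w [k _ hk]; exists (m - n + k)%N => //.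
    by rewrite addnA subnKC.
have : \forall n \near \oo, (P (B n) < e%:E)%E.
  move/fine_cvgP : cB => [fB /cvgrPdist_lt/(_ e e0) cB]; near=> n.
  have h : `|0 - fine (P (B n))| < e by near: n; exact: cB.
  by rewrite -[P _]fineK ?fin_num_measure// lte_fin; move: h; rewrite sub0r normrN ger0_norm ?fine_ge0.
apply: filterS => n Bn; exists (B n); split=> //; first exact: ltW.
by move=> w nB; apply: contra_notP nB => nE; exists 0%N => //; rewrite addn0.
Unshelve. all: by end_near. Qed.

Variables (T : R) (p : nat) (X : R -> Om -> 'cV[R]_p) (u : 'I_p -> R -> Om -> R) (D rho : R).
Hypothesis T0 : 0 < T.
Hypothesis D0 : 0 < D.
Hypothesis rho4 : 4^-1 < rho.
Hypothesis rho1 : rho < 1.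
Hypothesis mX : forall t a, 0 <= t -> measurable_fun setT (fun w => X t w a 0).
Hypothesis mu : forall t a, 0 <= t -> measurable_fun setT (u a t).
Hypothesis regular : {ae P, forall w, exists (G : 'I_p -> R -> R) (Bu : R) (K : nat),
  [/\ forall a, slope_approx T (G a), forall a t, 0 <= t <= T -> `|u a t w| <= Bu &
  forall n, exists J : pred nat, (\sum_(i < n | J i) 1 <= K)%N /\
  forall i, (i < n)%N -> ~~ J i -> forall a,
    (X (grid T n i.+1) w - X (grid T n i) w) a 0 =
    (G a (grid T n i.+1) - G a (grid T n i)) + (u a (grid T n i.+1) w - u a (grid T n i) w)]}.

Definition dX n i w : 'cV[R]_p := X (grid T n i.+1) w - X (grid T n i) w.
Definition du n i w : 'cV[R]_p := \col_a (u a (grid T n i.+1) w - u a (grid T n i) w).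
Definition kept n i w : bool := enorm (dX n i w) <= D * (T / n%:R) `^ rho.
Definition n_kept n w : nat := (\sum_(i < n | kept n i w) 1)%N.
Definition S_kept n w : 'M[R]_p :=
  ((n_kept n w)%:R * (T / n%:R))^-1 *: \sum_(i < n | kept n i w) dX n i w *m (dX n i w)^T.
Definition S_du n w : 'M[R]_p := T^-1 *: \sum_(i < n) du n i w *m (du n i w)^T.

Definition close_to (eps : R) n w : Prop :=
  (1 - eps) * n%:R <= (n_kept n w)%:R /\
  Num.sqrt n%:R * n1 (S_kept n w - S_du n w) <= eps * (1 + \tr (S_du n w)).

Lemma measurable_dX n i : measurable_mx (dX n i).
Proof.
move=> a b; rewrite (ord1 b); under eq_fun do rewrite /dX !mxE.
by apply: measurable_funB; apply: mX; exact: grid_ge0.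
Qed.

Lemma measurable_du n i : measurable_mx (du n i).
Proof.
move=> a b; under eq_fun do rewrite /du !mxE.
by apply: measurable_funB; apply: mu; exact: grid_ge0.
Qed.

Lemma measurable_kept n i : measurable_fun setT (kept n i).
Proof.
apply: measurable_fun_ler => //; rewrite /enorm.
rewrite (_ : (fun w => _) = Num.sqrt \o (fun w => \sum_a \sum_b dX n i w a b ^+ 2))//.
apply: measurableT_comp.
  by apply: continuous_measurable_fun; exact: sqrt_continuous.
apply: measurable_sum => a; apply: measurable_sum => b.
by apply: measurable_funX; exact: measurable_dX.
Qed.

Lemma n_keptE n w : (n_kept n w)%:R = \sum_(i < n | kept n i w) 1 :> R.
Proof. by rewrite /n_kept natr_sum. Qed.

Lemma measurable_n_kept n : measurable_fun setT (fun w => (n_kept n w)%:R : R).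
Proof.
under eq_fun do rewrite n_keptE.
by apply: measurable_sum_if => i; first exact: measurable_kept.
Qed.

Lemma measurable_S_kept n : measurable_mx (S_kept n).
Proof.
move=> a b; under eq_fun do rewrite !mxE summxE.
apply: measurable_funM.
  by apply: measurable_inv; apply: measurable_funM => //; exact: measurable_n_kept.
apply: measurable_sum_if => i; first exact: measurable_kept.
under eq_fun do rewrite mxE; apply: measurable_sum => c; under eq_fun do rewrite [_^T _ _]mxE.
by apply: measurable_funM; exact: measurable_dX.
Qed.

Lemma measurable_S_du n : measurable_mx (S_du n).
Proof.
move=> a b; under eq_fun do rewrite !mxE summxE.
apply: measurable_funM => //; apply: measurable_sum => i.
under eq_fun do rewrite mxE; apply: measurable_sum => c; under eq_fun do rewrite [_^T _ _]mxE.
by apply: measurable_funM; exact: measurable_du.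
Qed.

Lemma tr_S_du n w : \tr (S_du n w) = T^-1 * \sum_(i < n) \sum_a (u a (grid T n i.+1) w - u a (grid T n i) w) ^+ 2.
Proof.
rewrite /S_du mxtraceZ raddf_sum /=; congr (_ * _); apply: eq_bigr => i _.
by apply: eq_bigr => a _; rewrite !mxE big_ord1 !mxE expr2.
Qed.

(** Smallness of the noise increments is a premise inside the event: [increments_small] supplies it
    with high probability, whereas the implication itself holds eventually on almost every path. *)
Lemma comparison_whp (eps : R) : 0 < eps -> whp P (fun n => [set w |
  (forall i a, (i < n)%N -> `|u a (grid T n i.+1) w - u a (grid T n i) w| <= kappa p D * (T / n%:R) `^ rho) ->
  close_to eps n w]).
Proof.
move=> eps0; apply: whp_eventually.
  move=> n.
  pose b w : bool := [forall i : 'I_n, [forall a : 'I_p, `|du n i w a 0| <= kappa p D * (T / n%:R) `^ rho]].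
  pose c w : bool := ((1 - eps) * n%:R <= (n_kept n w)%:R) &&
    (Num.sqrt n%:R * n1 (S_kept n w - S_du n w) <= eps * (1 + \tr (S_du n w))).
  rewrite (_ : [set w | _] = ~` [set w | b w] `|` [set w | c w]).
    apply: measurableU.
      apply: measurableC.
      rewrite (_ : [set w | _] = \bigcap_(ia in [set: 'I_n * 'I_p])
         [set w | `|du n ia.1 w ia.2 0| <= kappa p D * (T / n%:R) `^ rho]).
        apply: fin_bigcap_measurable => // ia _; apply: measurable_set_of_bool.
        apply: measurable_fun_ler => //; apply: measurableT_comp => //; exact: measurable_du.
      apply/seteqP; split=> w /=.
        by move=> /forallP h [i a] _ /=; move: (h i) => /forallP.
      by move=> h; apply/forallP => i; apply/forallP => a; exact: (h (i, a)).
    apply: measurable_set_of_bool; apply: measurable_and; apply: measurable_fun_ler => //.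
    - exact: measurable_n_kept.
    - apply: measurable_funM => //; apply: measurable_sum => a; apply: measurable_sum => a'.
      apply: measurableT_comp => //; under eq_fun do rewrite mxE [X in _ + X]mxE.
      by apply: measurable_funB; [exact: measurable_S_kept|exact: measurable_S_du].
    - apply: measurable_funM => //; apply: measurable_funD => //.
      by apply: measurable_sum => a; exact: measurable_S_du.
  apply/seteqP; split=> w /=.
    move=> h; have [bw|] := boolP (b w); last by left; exact/negP.
    right; apply/andP; apply: h => i a i_n.
    by move: bw => /forallP/(_ (Ordinal i_n))/forallP/(_ a); rewrite mxE.
  move=> [nb|/andP[c1 c2]] h; last by split.
  exfalso; apply: nb; apply/forallP => i; apply/forallP => a; rewrite mxE.
  exact: h.
apply: filterS regular => w [G [Bu [K [hG hu hJ]]]].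
have := realised_comparison T0 (X := X ^~ w) (u := fun a t => u a t w) D0 rho4 rho1 hG hu hJ eps0.
apply: filterS => n h /= gd; have [h1 h2] := h gd.
split; first exact: h1.
rewrite tr_S_du; exact: h2.
Qed.

End almost_sure_comparison.

(** * The quasi-likelihood ratio statistic *)

Section near_identity.
Context (R : realType) (p : nat).
Implicit Types A S Q : 'M[R]_p.

(** The quadratic form of [A - 1] is at most [n1 (A - 1)] times the squared length. *)
Lemma posdef_near1 A : A^T = A -> n1 (A - 1%:M) < 1 -> posdef A.
Proof.
move=> AT A1; split=> // x x0.
have q0 : 0 < nsq x.
  rewrite lt_neqAle nsq_ge0 andbT eq_sym; apply: contra x0 => /eqP q0.
  apply/eqP/colP => i; rewrite mxE; apply/eqP; rewrite -sqrf_eq0 eq_le sqr_ge0 andbT.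
  by rewrite -q0 /nsq (bigD1 i)//= lerDl sumr_ge0// => j _; exact: sqr_ge0.
have xi i : `|x i 0| <= Num.sqrt (nsq x).
  rewrite -ler_sqr ?nnegrE ?sqrtr_ge0// sqr_sqrtr ?nsq_ge0// real_normK ?num_real//.
  by rewrite /nsq (bigD1 i)//= lerDl sumr_ge0// => j _; exact: sqr_ge0.
have bound : `|(x^T *m (A - 1%:M) *m x) 0 0| <= n1 (A - 1%:M) * nsq x.
  rewrite mxE; apply: le_trans (ler_norm_sum _ _ _) _.
  rewrite /n1 exchange_big mulr_suml; apply: ler_sum => j _.
  rewrite mxE normrM; apply: le_trans (_ : (\sum_i `|(A - 1%:M) i j| * Num.sqrt (nsq x)) * Num.sqrt (nsq x) <= _).
    rewrite ler_pM//; apply: le_trans (ler_norm_sum _ _ _) _; apply: ler_sum => i _.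
    by rewrite normrM [`|x^T _ _|](_ : _ = `|x i 0|) ?mxE// mulrC ler_wpM2l.
  by rewrite -mulr_suml -mulrA -expr2 sqr_sqrtr// nsq_ge0.
have -> : (x^T *m A *m x) 0 0 = nsq x + (x^T *m (A - 1%:M) *m x) 0 0.
  rewrite mulmxBr mulmx1 mulmxBl nsqE.
  by move: (x^T *m A *m x) (x^T *m x) => a b; rewrite !mxE; ring.
move: bound; rewrite ler_norml => /andP[b _].
have : n1 (A - 1%:M) * nsq x < nsq x by rewrite gtr_pMl.
lra.
Qed.

Variable L : 'M[R]_p.
Hypothesis L_unit : L \in unitmx.

Lemma white_congr Q : white L (L *m Q *m L^T) = Q.
Proof.
rewrite /white !mulmxA mulVmx// mul1mx -mulmxA -trmx_mul mulVmx// trmx1 mulmx1//.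
Qed.

Lemma posdef_white S : posdef (white L S) -> posdef S.
Proof. by move=> h; rewrite -[S](whiteK L_unit); exact: posdef_congr. Qed.

Lemma svech_tight (s : 'M[R]_p) : s^T = s -> n1 s ^+ 2 <= 2 * (p%:R ^+ 2) ^+ 2 * nsq (svech s).
Proof.
by move=> ss; have [_ h] := n1_sq_trace ss; apply: (le_trans h); rewrite -nsq_svech//; lra.
Qed.

Variables (q r : nat) (Theta : set 'cV[R]_q) (V : 'cV[R]_q -> 'M[R]_p).
Variable (W : 'M[R]_(r, (p * p.+1)./2)).
Hypothesis WW : W *m W^T = 1%:M.
Hypothesis local_min : forall eps : R, 0 < eps -> exists2 delta : R, 0 < delta &
  forall S th, posdef S -> Theta th -> n1 (white L S - 1%:M) <= delta ->
  (forall th', Theta th' -> KL S (V th) <= KL S (V th')) ->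
  `|KL S (V th) - nsq (W *m svech (white L S - 1%:M))| <= eps * n1 (white L S - 1%:M) ^+ 2.

(** Deterministic and uniform in [S], [Q], [th] and [N]. With [x] the squared length attached to the
    whitened [S], the error splits into [N (KL - x)], [(N - n) x] and the effect on [n x] of
    replacing [S] by [L Q L^T], each at most [e / 3]. *)
Lemma statistic_expansion (M e : R) : 0 <= M -> 0 < e -> exists2 eps1 : R, 0 < eps1 < 1 &
  \forall n \near \oo, forall S Q th (N : nat), S^T = S -> (N <= n)%N ->
    (1 - eps1) * n%:R <= N%:R ->
    Num.sqrt n%:R * n1 (S - L *m Q *m L^T) <= eps1 * (1 + \tr (L *m Q *m L^T)) ->
    Num.sqrt n%:R * n1 (Q - 1%:M) <= M -> Theta th ->
    (posdef S -> forall th', Theta th' -> KL S (V th) <= KL S (V th')) ->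
    posdef S /\ `|N%:R * KL S (V th) - nsq (Num.sqrt n%:R *: (W *m svech (Q - 1%:M)))| <= e.
Proof.
move=> M0 e0.
pose M1 := M + 1; have M1_gt0 : 0 < M1 by rewrite ltr_wpDl.
pose eps2 := e / (3 * M1 ^+ 2).
have cancel a : 0 < a -> e / (3 * a) * a = e / 3.
  by move=> a0; field; rewrite gt_eqF.
have M12 : 0 < M1 ^+ 2 by rewrite exprn_gt0.
have eps20 : 0 < eps2 by rewrite divr_gt0// mulr_gt0.
have [delta delta0 hdelta] := local_min eps20.
pose lam := n1 L * n1 L; have lam0 : 0 <= lam by rewrite mulr_ge0 ?n1_ge0.
pose c := n1 (invmx L) * n1 (invmx L); have c0 : 0 <= c by rewrite mulr_ge0 ?n1_ge0.
pose C := c * (1 + lam * (p%:R + M)) + 1.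
have C0 : 1 <= C by rewrite /C lerDr mulr_ge0// addr_ge0// mulr_ge0// addr_ge0.
pose w := n1 W; have w0 : 0 <= w := n1_ge0 W.
pose C3 := (2 * (w * M) + w) * w + 1.
have C30 : 1 <= C3.
  by rewrite /C3 lerDr; apply: mulr_ge0 => //; rewrite addr_ge0// mulr_ge0// mulr_ge0.
(* [1 / 2] keeps [e1] below 1, [C^-1] keeps [n1 (A - Q)] below [1 / sqrt n], and the last two
   entries bound the second and third errors by [e / 3]. *)
pose e1 := Num.min (Num.min 2^-1 C^-1) (Num.min (e / (3 * M1 ^+ 2)) (e / (3 * (C3 * C)))).
have Cp : 0 < C by lra.
have C3p : 0 < C3 by lra.
have e10 : 0 < e1.
  rewrite !lt_min; apply/andP; split; apply/andP; split; rewrite ?invr_gt0//.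
  by apply: divr_gt0 => //; apply: mulr_gt0 => //; exact: mulr_gt0.
have e1_half : e1 <= 2^-1 by rewrite !ge_min lexx.
have e1C : e1 * C <= 1.
  by rewrite -ler_pdivlMr// div1r !ge_min lexx orbT.
have e1M : e1 * M1 ^+ 2 <= e / 3.
  have h : e1 <= e / (3 * M1 ^+ 2) by rewrite !ge_min lexx !orbT.
  apply: (@le_trans _ _ (e / (3 * M1 ^+ 2) * M1 ^+ 2)); first by rewrite ler_wpM2r// ltW.
  by rewrite cancel.
have e1C3 : C3 * (e1 * C) <= e / 3.
  have h : e1 <= e / (3 * (C3 * C)) by rewrite !ge_min lexx !orbT.
  rewrite mulrCA; apply: (@le_trans _ _ (e / (3 * (C3 * C)) * (C3 * C))).
    by rewrite ler_wpM2r// mulr_ge0// ltW.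
  by rewrite cancel// mulr_gt0.
exists e1; first by rewrite e10 (le_lt_trans e1_half)// invf_lt1 ?ltr1n.
clearbody e1; near=> n => S Q th N ST Nn Nlow hS hQ Tth hmin.
have n1_gt0 : (0 < n)%N by near: n; exact: nbhs_infty_gt.
pose sn := Num.sqrt (n%:R : R).
have sn1 : 1 <= sn by rewrite -sqrtr1 ler_wsqrtr// ler1n.
have sn0 : 0 < sn by lra.
have snn : sn ^+ 2 = n%:R by rewrite sqr_sqrtr.
have sn_delta : M1 <= delta * sn.
  have h3 : (M1 / delta) ^+ 2 <= n%:R by near: n; exact: nbhs_infty_ger.
  rewrite mulrC -ler_pdivrMr//; apply: le_trans (ler_norm _) _.
  by rewrite -sqrtr_sqr ler_wsqrtr.
have sn_half : M1 <= 2^-1 * sn.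
  have h3 : (M1 / 2^-1) ^+ 2 <= n%:R by near: n; exact: nbhs_infty_ger.
  rewrite mulrC -ler_pdivrMr//; apply: le_trans (ler_norm _) _.
  by rewrite -sqrtr_sqr ler_wsqrtr.
rewrite -/sn in hS hQ *.
pose A := white L S.
have AT : A^T = A by exact: white_tr.
have QM : n1 Q <= p%:R + M.
  rewrite -[Q](subrK 1%:M) addrC; apply: le_trans (n1D _ _) _; rewrite n1_1 lerD2l.
  apply: le_trans hQ; rewrite ler_peMl ?n1_ge0//.
have trQ : 1 + \tr (L *m Q *m L^T) <= 1 + lam * (p%:R + M).
  rewrite lerD2l; apply: le_trans (ler_norm _) _; apply: le_trans (trace_n1 _) _.
  apply: le_trans (n1M _ _) _; rewrite n1_tr /lam mulrAC ler_wpM2r ?n1_ge0//.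
  by apply: le_trans (n1M _ _) _; rewrite ler_wpM2l ?n1_ge0.
have AQ : sn * n1 (A - Q) <= e1 * C.
  rewrite /A -{1}(white_congr Q) -whiteB.
  apply: (@le_trans _ _ (sn * (c * n1 (S - L *m Q *m L^T)))).
    by rewrite ler_wpM2l ?(ltW sn0)// /c mulrAC n1_white.
  rewrite mulrCA; apply: (@le_trans _ _ (c * (e1 * (1 + lam * (p%:R + M))))).
    rewrite ler_wpM2l//; apply: (le_trans hS); rewrite ler_wpM2l//; exact: ltW.
  by rewrite /C mulrCA ler_wpM2l ?(ltW e10)// lerDl.
have A1 : sn * n1 (A - 1%:M) <= M1.
  rewrite -[A](subrK Q) -addrA; apply: (@le_trans _ _ (sn * (n1 (A - Q) + n1 (Q - 1%:M)))).
    by rewrite ler_wpM2l ?n1D ?(ltW sn0).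
  by rewrite mulrDr /M1 addrC lerD// (le_trans AQ).
have A1' a : 0 < a -> M1 <= a * sn -> n1 (A - 1%:M) <= a.
  by move=> a0 h; rewrite -(ler_pM2l sn0); apply: (le_trans A1); rewrite mulrC.
have pA : posdef A.
  apply: posdef_near1 => //; apply: (le_lt_trans (A1' 2^-1 _ sn_half)) => //.
  by rewrite invf_lt1 ?ltr1n.
have pS : posdef S by exact: posdef_white.
split=> //.
have := hdelta S th pS Tth (A1' _ delta0 sn_delta) (hmin pS); rewrite -/A => hKL.
have a0 := n1_ge0 (A - 1%:M); set a := n1 (A - 1%:M) in A1 a0 hKL *.
have na : n%:R * a ^+ 2 <= M1 ^+ 2.
  by rewrite -snn -exprMn lerXn2r ?nnegrE ?mulr_ge0// ltW.
set k := KL S (V th) in hKL *.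
set x := nsq (W *m svech (A - 1%:M)) in hKL *.
have x0 : 0 <= x by exact: nsq_ge0.
have xa : x <= a ^+ 2.
  apply: le_trans (nsq_contract _ WW) _; apply: le_trans (nsq_n1 _) _.
  by rewrite lerXn2r ?nnegrE ?n1_ge0// n1_svech.
have NR : N%:R <= n%:R :> R by rewrite ler_nat.
have N0 : 0 <= N%:R :> R by [].
set Nr : R := N%:R in Nlow NR N0 *; set nr : R := n%:R in Nlow NR na snn *.
have t1 : `|Nr * (k - x)| <= e / 3.
  rewrite normrM ger0_norm//; apply: (@le_trans _ _ (nr * (eps2 * a ^+ 2))).
    by rewrite ler_pM.
  rewrite mulrCA; apply: (@le_trans _ _ (eps2 * M1 ^+ 2)); first by rewrite ler_wpM2l// ltW.
  by rewrite /eps2 cancel.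
have t2 : `|(Nr - nr) * x| <= e / 3.
  have d0 : 0 <= nr - Nr by rewrite subr_ge0.
  have d1 : nr - Nr <= e1 * nr by lra.
  rewrite normrM distrC (ger0_norm d0) (ger0_norm x0).
  apply: le_trans e1M; apply: (@le_trans _ _ (e1 * (nr * a ^+ 2))); last by rewrite ler_wpM2l// ltW.
  by rewrite mulrA; apply: ler_pM.
have t3 : `|nr * x - nsq (sn *: (W *m svech (Q - 1%:M)))| <= e / 3.
  have -> : nr * x = nsq (sn *: (W *m svech (Q - 1%:M)) + sn *: (W *m svech (A - Q))).
    rewrite -scalerDr -mulmxDr -svechD [Q - _ + _]addrC addrA subrK -snn /x /nsq mulr_sumr.
    by apply: eq_bigr => i _; rewrite [in RHS]mxE exprMn.
  have b1 : n1 (sn *: (W *m svech (Q - 1%:M))) <= w * M.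
    rewrite n1Z gtr0_norm//; apply: (@le_trans _ _ (sn * (w * n1 (svech (Q - 1%:M))))).
      by rewrite ler_wpM2l ?(ltW sn0)// n1M.
    rewrite mulrCA ler_wpM2l//; apply: le_trans hQ; rewrite ler_wpM2l ?(ltW sn0)//.
    exact: n1_svech.
  have b2 : n1 (sn *: (W *m svech (A - Q))) <= w * (e1 * C).
    rewrite n1Z gtr0_norm//; apply: (@le_trans _ _ (sn * (w * n1 (svech (A - Q))))).
      by rewrite ler_wpM2l ?(ltW sn0)// n1M.
    rewrite mulrCA ler_wpM2l//; apply: le_trans AQ; rewrite ler_wpM2l ?(ltW sn0)//.
    exact: n1_svech.
  apply: le_trans (nsqD_le b1 b2) _; apply: le_trans e1C3.
  have eC0 : 0 <= e1 * C by rewrite mulr_ge0// ltW.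
  set z := e1 * C in e1C eC0 *; rewrite mulrA; apply: ler_wpM2r => //.
  rewrite /C3; apply: (@le_trans _ _ ((2 * (w * M) + w) * w)); last by rewrite lerDl.
  by rewrite ler_wpM2r// lerD2l ler_piMr.
have -> : Nr * k - nsq (sn *: (W *m svech (Q - 1%:M))) =
  Nr * (k - x) + (Nr - nr) * x + (nr * x - nsq (sn *: (W *m svech (Q - 1%:M)))) by ring.
apply: le_trans (ler_normD _ _) _; have := ler_normD (Nr * (k - x)) ((Nr - nr) * x).
lra.
Unshelve. all: by end_near. Qed.

End near_identity.

(** * The statistic as a minimal divergence, and its measurability *)

Section statistic.
Context (R : realType) d (Om : measurableType d) (p q : nat).
Variables (X : R -> Om -> 'cV[R]_p) (Sg : 'cV[R]_q -> 'M[R]_p) (Theta : set 'cV[R]_q).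
Variables (T D rho : R).
Hypothesis T0 : 0 < T.
Hypothesis Sg_posdef : forall th, Theta th -> posdef (Sg th).

Local Notation kept := (kept T X D rho).
Local Notation n_kept := (n_kept T X D rho).
Local Notation Sk := (S_kept T X D rho).
Local Notation dX := (dX T X).

Lemma sum_small n w (V : nmodType) (f : nat -> V) :
  \sum_(1 <= i < n.+1 | small_incr X T D rho n i w) f i = \sum_(i < n | kept n i w) f i.+1.
Proof. by rewrite big_add1 big_mkord. Qed.

Lemma n_smallE n w : n_small X T D rho n w = n_kept n w.
Proof. by rewrite /n_small big_add1 big_mkord. Qed.

Lemma Sigma_hatE n w : n_kept n w != 0%N -> Sigma_hat X T D rho n w = Sk n w.
Proof. by move=> N0; rewrite /Sigma_hat n_smallE (negbTE N0) sum_small. Qed.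

Lemma S_kept_tr n w : (Sk n w)^T = Sk n w.
Proof.
rewrite /S_kept linearZ /= linear_sum /=; congr (_ *: _); apply: eq_bigr => i _.
by rewrite trmx_mul trmxK.
Qed.

Lemma qlr_KL n (th_hat : Om -> 'cV[R]_q) w : n_kept n w != 0%N -> posdef (Sk n w) ->
  qlr_statistic X Sg T D rho n th_hat w = (n_kept n w)%:R * KL (Sk n w) (Sg (th_hat w)).
Proof.
move=> N0 pS; rewrite /qlr_statistic /Sigma_tilde n_smallE Sigma_hatE//.
case: asboolP => // _; rewrite /KL; ring.
Qed.

(** The quasi-likelihood is a decreasing affine function of the divergence, with coefficients free
    of [th]; the trace of each rank-one term gives back its quadratic form. *)
Lemma quasi_loglik_KL n w th : (0 < n)%N -> n_kept n w != 0%N ->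
  quasi_loglik X Sg T D rho n w th =
  - ((n_kept n w)%:R / 2) * (KL (Sk n w) (Sg th) + ln (\det (Sk n w)) + p%:R).
Proof.
move=> n0 N0; have h0 : mesh T n != 0 by rewrite mulf_neq0 ?invr_neq0 ?pnatr_eq0 -?lt0n// gt_eqF.
have Nh0 : (n_kept n w)%:R * mesh T n != 0 by apply: mulf_neq0; rewrite ?pnatr_eq0.
rewrite /quasi_loglik !sum_small.
have -> : \sum_(i < n | kept n i w) ln (\det (Sg th)) = (n_kept n w)%:R * ln (\det (Sg th)).
  by rewrite n_keptE mulr_suml; apply: eq_bigr => i _; rewrite mul1r.
have -> : \sum_(i < n | kept n i w) ((incr X T n i.+1 w)^T *m invmx (Sg th) *m incr X T n i.+1 w) 0 0 =
   (n_kept n w)%:R * mesh T n * \tr (invmx (Sg th) *m Sk n w).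
  rewrite /S_kept -scalemxAr mxtraceZ mulVKf//.
  rewrite mulmx_sumr raddf_sum /=; apply: eq_bigr => i _.
  by rewrite mulmxA mxtrace_mulC mulmxA trace_mx11.
by rewrite /KL; move: (mesh T n) h0 => m m0; field.
Qed.

(** Nonnegativity of [KL] bounds the quasi-likelihood from above, so [sup] is a genuine supremum and
    a maximiser minimises the divergence. *)
Lemma argmax_KL n w th : (0 < n)%N -> n_kept n w != 0%N -> posdef (Sk n w) -> Theta th ->
  quasi_loglik X Sg T D rho n w th = sup [set quasi_loglik X Sg T D rho n w th' | th' in Theta] ->
  forall th', Theta th' -> KL (Sk n w) (Sg th) <= KL (Sk n w) (Sg th').
Proof.
move=> n0 N0 pS Tth Eth th' Tth'.
have N2 : 0 < (n_kept n w)%:R / 2 :> R by rewrite divr_gt0// ltr0n lt0n.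
suff : quasi_loglik X Sg T D rho n w th' <= quasi_loglik X Sg T D rho n w th.
  by rewrite !quasi_loglik_KL// !mulNr lerN2 ler_pM2l// lerD2r lerD2r.
rewrite Eth; apply: ub_le_sup; last by exists th'.
exists (- ((n_kept n w)%:R / 2) * (ln (\det (Sk n w)) + p%:R)) => _ [t Tt <-].
rewrite quasi_loglik_KL// !mulNr lerN2 ler_pM2l// -addrA lerDr.
exact: KL_ge0 pS (Sg_posdef Tt).
Qed.

Hypothesis mX : forall t a, 0 <= t -> measurable_fun setT (fun w => X t w a 0).
Hypothesis Sg_smooth : exists U : set 'cV[R]_q, [/\ open U, Theta `<=` U &
  forall i j, class_C 2 U (fun th => Sg th i j)].

(** Convergence in law includes measurability of the statistics. [Sg] enters through its continuity
    near [Theta], and the two default values, for no kept increment and for a singular estimate, are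
    selected by measurable events. *)
Lemma measurable_qlr n (th_hat : Om -> 'cV[R]_q) : measurable_fun setT th_hat ->
  (forall w, Theta (th_hat w)) -> measurable_fun setT (qlr_statistic X Sg T D rho n th_hat).
Proof.
move=> mth hth; have [U [oU TU CU]] := Sg_smooth.
have mSg : measurable_mx (fun w => Sg (th_hat w)).
  move=> i j; apply: (@measurable_continuous_comp _ _ _ _ U (fun th => Sg th i j)).
  - by move=> x Ux; have [] := CU i j [::] isT x Ux.
  - by move=> w; exact: TU.
  - by move=> k; exact: (measurableT_comp (measurable_entry k 0) mth).
have mN : measurable_fun setT (fun w => (n_small X T D rho n w)%:R : R).
  by under eq_fun do rewrite n_smallE; exact: measurable_n_kept.
have mhat : measurable_mx (Sigma_hat X T D rho n).
  move=> i j.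
  rewrite (_ : (fun w => _) = fun w => if ((n_kept n w)%:R == 0 :> R) then
     (n%:R * mesh T n)^-1 * (\sum_(k < n | kept n k w) dX n k w *m (dX n k w)^T) i j
     else Sk n w i j); last first.
    apply/funext => w; rewrite pnatr_eq0; case: eqP => [N0|/eqP N0]; last by rewrite Sigma_hatE.
    by rewrite /Sigma_hat n_smallE N0 eqxx sum_small mxE.
  apply: measurable_fun_ifT; last exact: measurable_S_kept.
    by apply: measurable_fun_eqr => //; exact: measurable_n_kept.
  apply: measurable_funM => //; under eq_fun do rewrite summxE.
  apply: measurable_sum_if => k; first exact: measurable_kept.
  under eq_fun do rewrite mxE; apply: measurable_sum => c; under eq_fun do rewrite [_^T _ _]mxE.
  by apply: measurable_funM; exact: measurable_dX.
have mtilde : measurable_mx (Sigma_tilde X T D rho n).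
  move=> i j; rewrite (_ : (fun w => _) = fun w =>
    if `[< posdef (Sigma_hat X T D rho n w) >] then Sigma_hat X T D rho n w i j else (1%:M : 'M[R]_p) i j).
    apply: measurable_fun_ifT => //; apply: (measurable_fun_bool true); rewrite setTI.
    rewrite (_ : _ @^-1` _ = [set w | posdef (Sigma_hat X T D rho n w)]); first exact: measurable_posdef.
    by apply/seteqP; split=> w /= /asboolP.
  by apply/funext => w; rewrite /Sigma_tilde; case: asboolP.
have mln (A : Om -> 'M[R]_p) : measurable_mx A -> measurable_fun setT (fun w => ln (\det (A w))).
  by move=> mA; apply: measurableT_comp; [exact: measurable_ln|exact: measurable_det].
apply: measurable_funB; last exact: measurable_funM.
apply: measurable_funD; last first.
  apply: measurable_funM => //; apply: measurable_tr_invmx => // w.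
  exact/posdef_unit/Sg_posdef.
by apply: measurable_funB; apply: measurable_funM => //; exact: mln.
Qed.

End statistic.

(** * Assembling the limit law *)

Section limit_law.
Context (R : realType) d (Om : measurableType d) (P : probability Om R).
Variables (F : R -> set (set Om)) (I : finType) (B : R -> I -> Om -> R).
Hypothesis F_filtration : filtration F.
Hypothesis B_adapted : forall (t : R) a (E : set R), 0 <= t -> measurable E -> F t (B t a @^-1` E).
Hypothesis B_indep : forall (s t : R) A (E : I -> set R), 0 <= s -> s < t -> F s A ->
  (forall a, measurable (E a)) ->
  P (A `&` [set w | forall a, E a (B t a w - B s a w)]) =
  (P A * \prod_a normal_prob 0 (Num.sqrt (t - s)) (E a))%E.
Variables (p q : nat) (X : R -> Om -> 'cV[R]_p) (Sg : 'cV[R]_q -> 'M[R]_p).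
Variables (Theta : set 'cV[R]_q) (th0 : 'cV[R]_q) (th_hat : nat -> Om -> 'cV[R]_q).
Variables (T D rho : R).
Hypothesis T0 : 0 < T.
Hypothesis D0 : 0 < D.
Hypothesis rho4 : 4^-1 < rho.
Hypothesis rho2 : rho < 2^-1.
Hypothesis Theta_compact : compact Theta.
Hypothesis Sg_smooth : exists U : set 'cV[R]_q, [/\ open U, Theta `<=` U &
  forall i j, class_C 2 U (fun th => Sg th i j)].
Hypothesis Sg_posdef : forall th, Theta th -> posdef (Sg th).
Hypothesis th0_int : Theta° th0.
Hypothesis identifiable : forall th, Theta th -> Sg th = Sg th0 -> th = th0.
Hypothesis jacobian_rank : \rank (vech_jacobian Sg th0) = q.
Variables (L : 'M[R]_p) (O : 'I_p -> I -> R).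
Hypothesis L_unit : L \in unitmx.
Hypothesis L_root : Sg th0 = L *m L^T.
Hypothesis OO : forall i j, \sum_a O i a * O j a = (i == j)%:R.

(** The noise of the observed process: [L] applied to the combinations, with orthonormal coefficient
    rows [O], of the independent Wiener coordinates. *)
Definition gaussian_part (a : 'I_p) (t : R) (w : Om) : R := \sum_b L a b * \sum_i O b i * B t i w.

Hypothesis mX : forall t a, 0 <= t -> measurable_fun setT (fun w => X t w a 0).
Hypothesis regular : {ae P, forall w, exists (G : 'I_p -> R -> R) (Bu : R) (K : nat),
  [/\ forall a, slope_approx T (G a), forall a t, 0 <= t <= T -> `|gaussian_part a t w| <= Bu &
  forall n, exists J : pred nat, (\sum_(i < n | J i) 1 <= K)%N /\
  forall i, (i < n)%N -> ~~ J i -> forall a,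
    (X (grid T n i.+1) w - X (grid T n i) w) a 0 =
    (G a (grid T n i.+1) - G a (grid T n i)) +
    (gaussian_part a (grid T n i.+1) w - gaussian_part a (grid T n i) w)]}.
Hypothesis th_hat_measurable : forall n, (0 < n)%N -> measurable_fun setT (th_hat n).
Hypothesis th_hat_argmax : forall n w, (0 < n)%N -> Theta (th_hat n w) /\
  quasi_loglik X Sg T D rho n w (th_hat n w) =
  sup [set quasi_loglik X Sg T D rho n w th | th in Theta].

Local Notation Q := (Qn B T O).

Let mB t a : 0 <= t -> measurable_fun setT (B t a).
Proof.
move=> t0 _ E mE; rewrite setTI; have [_ Fm _] := F_filtration.
exact: Fm t0 _ (B_adapted a t0 mE).
Qed.

Let m_gauss t a : 0 <= t -> measurable_fun setT (gaussian_part a t).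
Proof.
move=> t0; apply: measurable_sum => b; apply: measurable_funM => //.
by apply: measurable_sum => i; apply: measurable_funM => //; exact: mB.
Qed.

Lemma gaussian_incr n i w a :
  gaussian_part a (grid T n i.+1) w - gaussian_part a (grid T n i) w =
  \sum_b L a b * \sum_c O b c * incr_bm B T n i c w.
Proof.
rewrite /gaussian_part -sumrB; apply: eq_bigr => b _; rewrite -mulrBr -sumrB.
by congr (_ * _); apply: eq_bigr => c _; rewrite -mulrBr.
Qed.

(** An exact identity, so the whole approximation error lies in the comparison of the data with the
    noise. *)
Lemma S_duE n w : (0 < n)%N -> S_du T gaussian_part n w = L *m Q n w *m L^T.
Proof.
move=> n0; have nn : n%:R != 0 :> R by rewrite pnatr_eq0 -lt0n.
have h0 : 0 < T / n%:R by rewrite divr_gt0// ltr0n.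
pose s := Num.sqrt (T / n%:R); have s0 : s != 0 by rewrite gt_eqF// sqrtr_gt0.
have ss : s * s = T / n%:R by rewrite -expr2 sqr_sqrtr// ltW.
have duE i : du T gaussian_part n i w = s *: (L *m zinc B T O n i w).
  apply/colP => a; rewrite mxE gaussian_incr !mxE mulr_sumr; apply: eq_bigr => b _.
  rewrite mxE mulrCA; congr (_ * _); rewrite mulr_sumr; apply: eq_bigr => c _.
  by rewrite mulrCA [s * _]mulrC divfK.
rewrite /S_du /Qn -scalemxAr -scalemxAl mulmx_sumr mulmx_suml.
have -> : \sum_(i < n) du T gaussian_part n i w *m (du T gaussian_part n i w)^T =
   (T / n%:R) *: \sum_(i < n) L *m (zinc B T O n i w *m (zinc B T O n i w)^T) *m L^T.
  rewrite scaler_sumr; apply: eq_bigr => i _.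
  by rewrite duE linearZ /= -scalemxAl -scalemxAr scalerA ss trmx_mul !mulmxA.
by rewrite scalerA mulrA mulVf ?mul1r// gt_eqF.
Qed.

Let Q_tr n w : (Q n w)^T = Q n w.
Proof.
rewrite /Qn linearZ /= linear_sum /=; congr (_ *: _); apply: eq_bigr => i _.
by rewrite trmx_mul trmxK.
Qed.

Let measurable_nsq r (W : 'M[R]_(r, (p * p.+1)./2)) n :
  measurable_fun setT (fun w => nsq (Num.sqrt n%:R *: (W *m svech (Q n w - 1%:M)))).
Proof.
apply: measurable_sum => l; apply: measurable_funX.
case: n => [|n].
  by under eq_fun do rewrite sqrtr0 scale0r mxE; exact: measurable_cst.
under eq_fun do rewrite /Qn Qn_sum// mxE.
apply: measurable_funM => //; apply: measurable_sum => i.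
rewrite (_ : (fun w => _) = fun w => (W *m svech ((\col_j \sum_a O j a *
   (incr_bm B T n.+1 i a w / Num.sqrt (T / n.+1%:R))) *m (\col_j \sum_a O j a *
   (incr_bm B T n.+1 i a w / Num.sqrt (T / n.+1%:R)))^T - 1%:M)) l 0)//.
apply: (@measurable_v_generic R I p O r W d Om (fun a w => incr_bm B T n.+1 i a w / Num.sqrt (T / n.+1%:R))) => a.
by apply: measurable_funM => //; apply: measurable_funB; apply: mB; apply: grid_ge0.
Qed.

(** Carries the smallness of the Wiener increments over to the coordinates of the observed noise;
    [c] is the total weight of the coefficients [L] and [O], plus 1. *)
Let noise_small : exists2 k : R, 0 < k & forall n w,
  (forall i a, (i < n)%N -> `|incr_bm B T n i a w| <= k * (T / n%:R) `^ rho) ->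
  forall i a, (i < n)%N ->
  `|gaussian_part a (grid T n i.+1) w - gaussian_part a (grid T n i) w| <= kappa p D * (T / n%:R) `^ rho.
Proof.
pose c := \sum_a \sum_b \sum_i `|L a b| * `|O b i| + 1.
have c0 : 0 < c.
  by rewrite ltr_wpDl// sumr_ge0// => a _; rewrite sumr_ge0// => b _; rewrite sumr_ge0.
have kp : 0 < kappa p D by rewrite divr_gt0// mulr_gt0.
exists (kappa p D / c); first by rewrite divr_gt0.
move=> n w h i a i_n; rewrite gaussian_incr.
set y := (T / n%:R) `^ rho in h *; have y0 : 0 <= y by exact: powR_ge0.
apply: (@le_trans _ _ ((\sum_b \sum_i `|L a b| * `|O b i|) * (kappa p D / c * y))).
  rewrite mulr_suml; apply: le_trans (ler_norm_sum _ _ _) _; apply: ler_sum => b _.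
  rewrite normrM mulr_suml; under [leRHS]eq_bigr do rewrite -mulrA.
  rewrite -mulr_sumr ler_wpM2l//; apply: le_trans (ler_norm_sum _ _ _) _; apply: ler_sum => j _.
  by rewrite normrM ler_wpM2l// h.
apply: (@le_trans _ _ (c * (kappa p D / c * y))).
  rewrite ler_wpM2r//; first by rewrite mulr_ge0// divr_ge0// ltW.
  rewrite /c [X in _ <= X + 1](bigD1 a)//= -addrA lerDl addr_ge0// sumr_ge0// => a' _.
  by rewrite sumr_ge0// => b _; rewrite sumr_ge0.
by rewrite mulrA [c * _]mulrC divfK ?gt_eqF.
Qed.

Theorem qlr_cvg_chi2 : cvg_in_law P
  (fun n => qlr_statistic X Sg T D rho n (th_hat n)) (chi2 R ((p * p.+1)./2 - q)).
Proof.
have [W WW local_min] := local_minimiser Theta_compact Sg_smooth Sg_posdef th0_int identifiable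
  jacobian_rank L_unit L_root.
have clt := @clt_laplace _ _ _ _ _ _ _ F_filtration B_adapted B_indep _ T0 _ _ OO.
pose Z n w := nsq (Num.sqrt n%:R *: (W *m svech (Q n w - 1%:M))).
apply: (@cvg_in_law_laplace _ _ _ P Z _ _ (clt _ _ WW)).
- exact: measurable_nsq.
- case=> [|n]; last first.
    apply: (@measurable_qlr _ _ _ _ _ X Sg Theta T D rho) => //; first exact: th_hat_measurable.
    by move=> w; have [] := th_hat_argmax w (ltn0Sn n).
  (* At [n = 0] nothing is known about [th_hat 0], but no increment is counted and the statistic is
     0. *)
  rewrite (_ : qlr_statistic _ _ _ _ _ _ _ = cst 0)//; apply/funext => w.
  by rewrite /qlr_statistic /n_small big_geq//= !mul0r !(addr0, subr0).
- exact: chi2_neg.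
move=> e e0 e' e'0; have e2 : 0 < e' / 2 by rewrite divr_gt0.
(* With the identity in place of [W] the same limit theorem gives tightness of all coordinates of
   [sqrt n * svech (Q - 1)]; this provides the bound [M] that [statistic_expansion] needs. *)
pose Zf n w := nsq (Num.sqrt n%:R *: ((1%:M : 'M[R]_((p * p.+1)./2)) *m svech (Q n w - 1%:M))).
have W1 : (1%:M : 'M[R]_((p * p.+1)./2)) *m 1%:M^T = 1%:M by rewrite trmx1 mulmx1.
have [M' M'0 tightZ] := @tight _ _ _ P Zf _ (@measurable_nsq _ 1%:M) (clt _ _ W1) _ e2.
pose cp : R := 2 * (p%:R ^+ 2) ^+ 2; have cp0 : 0 <= cp by rewrite mulr_ge0// sqr_ge0.
pose M := Num.sqrt (cp * M').
have [eps1 /andP[eps10 eps11] expansion] := statistic_expansion L_unit WW local_min (sqrtr_ge0 (cp * M')) e0.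
have [k k0 small] := noise_small.
have rho1 : rho < 1 by have := rho2; lra.
have h1 := comparison_whp T0 D0 rho4 rho1 mX m_gauss regular eps10.
have h2 := increments_small F_filtration B_adapted B_indep T0 rho2 k0.
have h12 := whpI h1 h2; have {}h12 := h12 _ e2.
near=> n.
have n0 : (0 < n)%N by near: n; exact: nbhs_infty_gt.
have [] : exists A, [/\ measurable A, (P A <= (e' / 2)%:E)%E & ~` A `<=`
   [set w | (forall i a, (i < n)%N -> `|gaussian_part a (grid T n i.+1) w - gaussian_part a (grid T n i) w| <= kappa p D * (T / n%:R) `^ rho) ->
     close_to T X gaussian_part D rho eps1 n w] `&`
   [set w | forall i a, (i < n)%N -> `|incr_bm B T n i a w| <= k * (T / n%:R) `^ rho]].
  by near: n; exact: h12.
move=> A [mA PA AQ].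
have PZ : (P [set w | (M' <= `|Zf n w|)%R] <= (e' / 2)%:E)%E by near: n; exact: tightZ.
have mZ : measurable [set w | (M' <= `|Zf n w|)%R].
  by apply: measurable_abs_ge; exact: measurable_nsq.
exists (A `|` [set w | (M' <= `|Zf n w|)%R]); split.
- exact: measurableU.
- by rewrite [e']splitr EFinD (le_trans (measureU2 _ _ _))//; exact: leeD.
move=> w /= /not_orP[nA /negP]; rewrite -ltNge ger0_norm ?nsq_ge0// => Zfw.
have [hclose hsmall] := AQ w nA; have [Nlow hS] := hclose (small n w hsmall).
have N0 : n_kept T X D rho n w != 0%N.
  apply/eqP => N00; move: Nlow; rewrite N00 leNgt => /negP; apply.
  by rewrite mulr_gt0 ?subr_gt0// ltr0n.
have Nn : (n_kept T X D rho n w <= n)%N.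
  rewrite /n_kept -[X in (_ <= X)%N](card_ord n) -sum1_card big_mkcond /=.
  by apply: leq_sum => i _; case: ifP.
rewrite S_duE// in hS.
have hQ : Num.sqrt n%:R * n1 (Q n w - 1%:M) <= M.
  rewrite -ler_sqr ?nnegrE ?mulr_ge0 ?sqrtr_ge0 ?n1_ge0// exprMn !sqr_sqrtr ?mulr_ge0//.
  have Qs : (Q n w - 1%:M)^T = Q n w - 1%:M by rewrite linearB /= trmx1 Q_tr.
  apply: (@le_trans _ _ (n%:R * (cp * nsq (svech (Q n w - 1%:M))))).
    by rewrite ler_wpM2l// svech_tight.
  rewrite mulrCA ler_wpM2l//; apply: ltW; move: Zfw; rewrite /Zf mul1mx.
  rewrite (_ : nsq (_ *: _) = n%:R * nsq (svech (Q n w - 1%:M)))//.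
  rewrite /nsq mulr_sumr; apply: eq_bigr => i _.
  by rewrite [in LHS]mxE exprMn sqr_sqrtr.
have [Tth argm] := th_hat_argmax w n0.
have hexp : forall S Q' th (N : nat), S^T = S -> (N <= n)%N ->
    (1 - eps1) * n%:R <= N%:R ->
    Num.sqrt n%:R * n1 (S - L *m Q' *m L^T) <= eps1 * (1 + \tr (L *m Q' *m L^T)) ->
    Num.sqrt n%:R * n1 (Q' - 1%:M) <= M -> Theta th ->
    (posdef S -> forall th', Theta th' -> KL S (Sg th) <= KL S (Sg th')) ->
    posdef S /\ `|N%:R * KL S (Sg th) - nsq (Num.sqrt n%:R *: (W *m svech (Q' - 1%:M)))| <= e.
  by near: n; exact: expansion.
have [pS hfin] := hexp _ _ _ _ (@S_kept_tr _ _ _ _ X T D rho n w) Nn Nlow hS hQ Tth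
  (fun pS => argmax_KL T0 Sg_posdef n0 N0 pS Tth argm).
by rewrite qlr_KL// [`|Z n w|]ger0_norm ?nsq_ge0.
Unshelve. all: by end_near. Qed.

End limit_law.

(** * Regularity of the observed paths *)

Section regular_paths.
Context (R : realType) (T : R).
Hypothesis T0 : 0 < T.

(** [G] is the drift, [u] the noise and [J] marks the intervals with jumps; the constants may depend
    on the path but not on [n]. *)
Definition regular_path p (Y : R -> 'cV[R]_p) (u : 'I_p -> R -> R) : Prop :=
  exists (G : 'I_p -> R -> R) (Bu : R) (K : nat),
  [/\ forall a, slope_approx T (G a), forall a t, 0 <= t <= T -> `|u a t| <= Bu &
  forall n, exists J : pred nat, (\sum_(i < n | J i) 1 <= K)%N /\
  forall i, (i < n)%N -> ~~ J i -> forall a,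
    (Y (grid T n i.+1) - Y (grid T n i)) a 0 =
    (G a (grid T n i.+1) - G a (grid T n i)) + (u a (grid T n i.+1) - u a (grid T n i))].

Lemma regular_pathD p (Y Y' : R -> 'cV[R]_p) u u' : regular_path Y u -> regular_path Y' u' ->
  regular_path (fun t => Y t + Y' t) (fun a t => u a t + u' a t).
Proof.
move=> [G [Bu [K [hG hu hJ]]]] [G' [Bu' [K' [hG' hu' hJ']]]].
exists (fun a t => G a t + G' a t), (Bu + Bu'), (K + K')%N; split.
- by move=> a; exact: slope_approxD.
- by move=> a t tT; apply: le_trans (ler_normD _ _) _; apply: lerD; [exact: hu|exact: hu'].
move=> n; have [J [JK JE]] := hJ n; have [J' [JK' JE']] := hJ' n.
exists (predU J J'); split.
  apply: leq_trans (leq_add JK JK').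
  rewrite big_mkcond [X in (_ <= X + _)%N]big_mkcond [X in (_ <= _ + X)%N]big_mkcond -big_split /=.
  by apply: leq_sum => i _; case: (J i); case: (J' i).
move=> i i_n /norP[nJ nJ'] a.
have := JE i i_n nJ a; have := JE' i i_n nJ' a; rewrite !mxE => h h'.
by rewrite opprD addrACA h h'; ring.
Qed.

Lemma regular_path_ext p (Y Y' : R -> 'cV[R]_p) u u' :
  (forall t, 0 <= t -> Y t = Y' t) -> (forall a t, u a t = u' a t) ->
  regular_path Y u -> regular_path Y' u'.
Proof.
move=> hY hu [G [Bu [K [hG hB hJ]]]]; exists G, Bu, K; split=> //.
  by move=> a t tT; rewrite -hu; exact: hB.
move=> n; have [J [JK JE]] := hJ n; exists J; split=> // i i_n nJ a.
by rewrite -!hY ?grid_ge0// -!hu; exact: JE.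
Qed.

Context (dO : measure_display) (Om : measurableType dO) (P : probability Om R).
Context (F : R -> set (set Om)) (F_filtration : filtration F).

Lemma wiener_bounded r (W : R -> Om -> 'cV[R]_r) : wiener P F W ->
  {ae P, forall w, exists B : R, forall t, 0 <= t <= T -> n1 (W t w) <= B}.
Proof.
move=> [_ cW _ _]; apply: filterS cW => w [_ cw].
have cn (x : 'cV[R]_r) : {for x, continuous (fun v : 'cV[R]_r => n1 v)}.
  by apply: (@continuous_n1 _ _ _ id) => i; exact: coord_continuous.
have c0T : {within `[0, T], continuous (fun t => n1 (W t w))}.
  have sub : `[0, T]%classic `<=` [set t : R | 0 <= t].
    by move=> t; rewrite /= in_itv /= => /andP[].
  have ct := continuous_subspaceW sub cw.
  by move=> t; apply: continuous_comp; [exact: ct|exact: cn].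
have [c _ hc] := EVT_max (ltW T0) c0T.
by exists (n1 (W c w)) => t tT; apply: hc; rewrite in_itv.
Qed.

(** The marked intervals are those whose jump strip has nonzero mass; by [jump_count] their number
    is at most the number of jumps on []0, T]], whatever the mesh. *)
Lemma latent_regular_path d p (L : latent R Om d) (M : 'M[R]_(p, d)) :
  latent_model P F L -> lipschitz_growth L ->
  {ae P, forall w, regular_path (fun t => M *m process L t w)
     (fun a t => (M *m diffusion L *m noise L t w) a 0)}.
Proof.
move=> model lip.
have [_ _ _ [bm [mu01 _ _ _]] _] := model.
move: (path_increment model) (finite_jumps F_filtration model T0) (wiener_bounded bm).
apply: filterS3 => w inc [K hK] [B hB].
exists (fun a t => \sum_j M a j * drift_primitive L w j t), (n1 (M *m diffusion L) * B), K; split.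
- move=> a; apply: slope_approx_sum => j; apply: slope_approxZ.
  exact: (drift_primitive_slope model T0 w j lip).
- move=> a t tT; apply: le_trans (n1_entry _ _ _) _; apply: le_trans (n1M _ _) _.
  by rewrite ler_wpM2l ?n1_ge0// hB.
(* For [n = 0] the mesh [T / 0] is 0 and the grid does not reach [T], but there is no interval to
   treat. *)
case=> [|n].
  by exists pred0; split=> //; rewrite big_ord0.
exists (fun i => jump_meas L w (@jump_strip R d (grid T n.+1 i) (grid T n.+1 i.+1)) != 0%E); split.
  apply: jump_count; first exact: mu01.
  - exact: grid_ge0.
  - by move=> i; exact: grid_le.
  - by rewrite grid_n// /grid mul0r.
move=> i _ /negPn/eqP nojump a.
rewrite -mulmxBr (inc (grid T n.+1 i) (grid T n.+1 i.+1))//; first last.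
- exact: grid_le.
- exact: grid_ge0.
rewrite mulmxDr mulmxA mulmxBr !mxE; congr (_ + _); rewrite -sumrB.
by apply: eq_bigr => j _; rewrite mxE mulrBr.
Qed.

Lemma measurable_process d (L : latent R Om d) t : latent_model P F L -> 0 <= t ->
  measurable_mx (process L t).
Proof.
move=> [[ad _] _ _ _ _] t0 i j; rewrite (ord1 j) => _ E mE; rewrite setTI.
have [_ Fm _] := F_filtration; apply: (Fm t t0).
have := ad t t0 ((fun v : 'cV[R]_d => v i 0) @^-1` E); apply.
by rewrite -[X in measurable X]setTI; exact: measurable_entry.
Qed.

End regular_paths.

(** * Loadings of the latent processes and whitening of the noise *)

Section decomposition.
Context (R : realType) (p1 p2 k1 k2 : nat).
Variables (L1 : 'M[R]_(p1, k1)) (L2 : 'M[R]_(p2, k2)) (G : 'M[R]_(k2, k1)) (Ps : 'M[R]_k2).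
Hypothesis Ps_unit : Ps \in unitmx.

(** Once [eta] is eliminated through [Ps], the observed process is a linear image of the four latent
    ones. These are the coefficients, and congruence by the same four matrices assembles
    [sem_cov]. *)
Definition load_xi : 'M[R]_(p1 + p2, k1) := col_mx L1 (L2 *m invmx Ps *m G).
Definition load_delta : 'M[R]_(p1 + p2, p1) := col_mx 1%:M 0.
Definition load_eps : 'M[R]_(p1 + p2, p2) := col_mx 0 1%:M.
Definition load_zeta : 'M[R]_(p1 + p2, k2) := col_mx 0 (L2 *m invmx Ps).

Lemma sem_cov_sum (C1 : 'M[R]_k1) (C2 : 'M[R]_p1) (C3 : 'M[R]_p2) (C4 : 'M[R]_k2) : C1^T = C1 ->
  sem_cov (Sem L1 L2 G Ps C1 C2 C3 C4) =
  load_xi *m C1 *m load_xi^T + load_delta *m C2 *m load_delta^T +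
  (load_eps *m C3 *m load_eps^T + load_zeta *m C4 *m load_zeta^T).
Proof.
move=> C1T; rewrite /sem_cov /= /load_xi /load_delta /load_eps /load_zeta.
rewrite !tr_col_mx (mul_col_mx _ _ C1) (mul_col_mx _ _ C2) (mul_col_mx _ _ C3) (mul_col_mx _ _ C4) !mul_col_row !add_block_mx.
rewrite !trmx_mul !trmx0 !trmx1 !mulmx0 !mul0mx !mul1mx !mulmx1 !addr0 ?add0r !mulmxA.
congr block_mx; rewrite ?trmxK ?C1T ?mulmxA//.
by rewrite mulmxDr !mulmxDl !mulmxA addrAC addrA.
Qed.

Lemma observed_sum (x : 'cV[R]_k1) (dl : 'cV[R]_p1) (ep : 'cV[R]_p2) (z y : 'cV[R]_k2) :
  Ps *m y = G *m x + z ->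
  col_mx (L1 *m x + dl) (L2 *m y + ep) =
  load_xi *m x + load_delta *m dl + (load_eps *m ep + load_zeta *m z).
Proof.
move=> Ey; have -> : y = invmx Ps *m (G *m x + z) by rewrite -Ey mulKmx.
rewrite !mul_col_mx !add_col_mx !mul0mx !mul1mx !addr0; congr col_mx.
by rewrite !mulmxDr !mulmxA -!addrA; congr (_ + _); rewrite addrC.
Qed.

End decomposition.

Section whitening.
Context (R : realType) (p r1 r2 r3 r4 : nat).
Variables (N1 : 'M[R]_(p, r1)) (N2 : 'M[R]_(p, r2)) (N3 : 'M[R]_(p, r3)) (N4 : 'M[R]_(p, r4)).
Variable L : 'M[R]_p.
Hypothesis L_unit : L \in unitmx.

(** The rows of [L^-1] times the joint loadings of all Wiener coordinates. Each latent noise may be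
    degenerate; the rows are orthonormal because the joint covariance is [L L^T] with [L]
    invertible. *)
Definition whitening (b : 'I_p) (a : noise_index r1 r2 r3 r4) : R :=
  match a with
  | inl (inl j) => (invmx L *m N1) b j
  | inl (inr j) => (invmx L *m N2) b j
  | inr (inl j) => (invmx L *m N3) b j
  | inr (inr j) => (invmx L *m N4) b j
  end.

Lemma whitening_orthonormal :
  L *m L^T = N1 *m N1^T + N2 *m N2^T + (N3 *m N3^T + N4 *m N4^T) ->
  forall i j, \sum_a whitening i a * whitening j a = (i == j)%:R.
Proof.
move=> E i j; have := @white_root R p L L_unit; rewrite E /white !mulmxDr !mulmxDl.
have sq r (N : 'M[R]_(p, r)) : invmx L *m (N *m N^T) *m (invmx L)^T = (invmx L *m N) *m (invmx L *m N)^T.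
  by rewrite trmx_mul !mulmxA.
rewrite !sq => /matrixP/(_ i j); rewrite mxE [X in _ = X]mxE => <-.
rewrite [X in _ = _ + X]mxE [X in _ = X + _]mxE !big_sumType /=.
by congr (_ + _ + (_ + _)); rewrite mxE; apply: eq_bigr => l _; rewrite [_^T _ _]mxE.
Qed.

Lemma whitening_noise d (Om : measurableType d) (W1 : R -> Om -> 'cV[R]_r1) (W2 : R -> Om -> 'cV[R]_r2)
    (W3 : R -> Om -> 'cV[R]_r3) (W4 : R -> Om -> 'cV[R]_r4) a t w :
  gaussian_part (combined W1 W2 W3 W4) L whitening a t w =
  (N1 *m W1 t w) a 0 + (N2 *m W2 t w) a 0 + ((N3 *m W3 t w) a 0 + (N4 *m W4 t w) a 0).
Proof.
have E : N1 *m W1 t w + N2 *m W2 t w + (N3 *m W3 t w + N4 *m W4 t w) =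
  L *m (invmx L *m N1 *m W1 t w + invmx L *m N2 *m W2 t w +
    (invmx L *m N3 *m W3 t w + invmx L *m N4 *m W4 t w)).
  by rewrite -!mulmxA -!mulmxDr mulKVmx.
transitivity ((N1 *m W1 t w + N2 *m W2 t w + (N3 *m W3 t w + N4 *m W4 t w)) a 0); last first.
  by rewrite mxE [X in X + _]mxE [X in _ + X]mxE.
rewrite E mxE /gaussian_part; apply: eq_bigr => b _; congr (_ * _).
rewrite !big_sumType /= mxE [X in _ = X + _]mxE [X in _ = _ + X]mxE.
by congr (_ + _ + (_ + _)); rewrite mxE.
Qed.

End whitening.

Theorem theorem3 (R : realType)
  (* stochastic basis *)
  (dO : measure_display) (Om : measurableType dO) (P : probability Om R)
  (F : R -> set (set Om)) (F_filtration : filtration F)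
  (p1 p2 k1 k2 q : nat)
  (k1_gt0 : (0 < k1)%N) (k2_gt0 : (0 < k2)%N)
  (k1_le : (k1 <= p1)%N) (k2_le : (k2 <= p2)%N)
  (* latent processes *)
  (xi : latent R Om k1) (delta : latent R Om p1)
  (eps : latent R Om p2) (zeta : latent R Om k2)
  (xi_model : latent_model P F xi) (delta_model : latent_model P F delta)
  (eps_model : latent_model P F eps) (zeta_model : latent_model P F zeta)
  (indep : forall t : R, 0 <= t -> mutually_independent P
    [:: F t; wiener_future t (noise xi); wiener_future t (noise delta);
        wiener_future t (noise eps); wiener_future t (noise zeta);
        jump_future t (jump_meas xi); jump_future t (jump_meas delta);
        jump_future t (jump_meas eps); jump_future t (jump_meas zeta)])
  (* observable processes *)
  (L1 : 'M[R]_(p1, k1)) (L2 : 'M[R]_(p2, k2)) (G : 'M[R]_(k2, k1))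
  (B0 : 'M[R]_k2)
  (L1_rank : \rank L1 = k1) (L2_rank : \rank L2 = k2)
  (B0_diag : forall i, B0 i i = 0) (Psi_unit : 1%:M - B0 \in unitmx)
  (eta : R -> Om -> 'cV[R]_k2)
  (eta_eq : forall (t : R) (w : Om), 0 <= t ->
    eta t w = B0 *m eta t w + G *m process xi t w + process zeta t w)
  (X : R -> Om -> 'cV[R]_(p1 + p2))
  (X_eq : forall (t : R) (w : Om), 0 <= t ->
    X t w = col_mx (L1 *m process xi t w + process delta t w)
                   (L2 *m eta t w + process eps t w))
  (Sigma : 'M[R]_(p1 + p2))
  (Sigma_eq : Sigma = sem_cov (Sem L1 L2 G (1%:M - B0) (latent_cov xi)
                 (latent_cov delta) (latent_cov eps) (latent_cov zeta)))
  (Sigma_posdef : posdef Sigma)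
  (* parametrization *)
  (Theta : set 'cV[R]_q) (par : 'cV[R]_q -> sem_matrices R p1 p2 k1 k2)
  (Theta_convex : convex_set (Theta : set (convex_lmodType 'cV[R]_q)))
  (Theta_compact : compact Theta)
  (par_ok : sem_parametrization Theta par)
  (* observation scheme and estimator *)
  (T D rho : R) (T_gt0 : 0 < T) (D_gt0 : 0 < D)
  (rho_ge : 3^-1 <= rho) (rho_lt : rho < 2^-1)
  (th_hat : nat -> Om -> 'cV[R]_q)
  (th_hat_measurable : forall n, (0 < n)%N -> measurable_fun setT (th_hat n))
  (th_hat_argmax : forall n w, (0 < n)%N -> Theta (th_hat n w) /\
    quasi_loglik X (fun th => sem_cov (par th)) T D rho n w (th_hat n w) =
    sup [set quasi_loglik X (fun th => sem_cov (par th)) T D rho n w th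
        | th in Theta])
  (* assumptions of the theorem *)
  (xi_assumptions : latent_assumptions xi)
  (delta_assumptions : latent_assumptions delta)
  (eps_assumptions : latent_assumptions eps)
  (zeta_assumptions : latent_assumptions zeta)
  (* null hypothesis *)
  (th0 : 'cV[R]_q) (th0_int : Theta° th0)
  (H0 : Sigma = sem_cov (par th0))
  (identifiable : forall th, Theta th ->
    sem_cov (par th) = sem_cov (par th0) -> th = th0)
  (Delta0_rank : \rank (vech_jacobian (fun th => sem_cov (par th)) th0) = q) :
  cvg_in_law P
    (fun n => qlr_statistic X (fun th => sem_cov (par th)) T D rho n (th_hat n))
    (chi2 R (((p1 + p2) * (p1 + p2).+1)./2 - q)).

Proof.
pose Ps := 1%:M - B0.
pose M1 := load_xi L1 L2 G Ps; pose M2 := load_delta R p1 p2.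
pose M3 := load_eps R p1 p2; pose M4 := load_zeta p1 L2 Ps.
pose N1 := M1 *m diffusion xi; pose N2 := M2 *m diffusion delta.
pose N3 := M3 *m diffusion eps; pose N4 := M4 *m diffusion zeta.
pose Sg th := sem_cov (par th).
have [_ _ _ [bm1 _] _] := xi_model; have [_ _ _ [bm2 _] _] := delta_model.
have [_ _ _ [bm3 _] _] := eps_model; have [_ _ _ [bm4 _] _] := zeta_model.
(* Under the null hypothesis this root of [Sigma] is also a root of [Sg th0]. *)
have [L L_unit L_root] := cholesky Sigma_posdef.
have covE d p (M : 'M[R]_(p, d)) (l : latent R Om d) :
    M *m latent_cov l *m M^T = (M *m diffusion l) *m (M *m diffusion l)^T.
  by rewrite /latent_cov trmx_mul !mulmxA.
have LN : L *m L^T = N1 *m N1^T + N2 *m N2^T + (N3 *m N3^T + N4 *m N4^T).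
  rewrite -L_root Sigma_eq sem_cov_sum ?covE//.
  by rewrite /latent_cov trmx_mul trmxK.
have X_sum t w : 0 <= t -> X t w = M1 *m process xi t w + M2 *m process delta t w +
    (M3 *m process eps t w + M4 *m process zeta t w).
  move=> t0; rewrite X_eq//; apply: observed_sum => //.
  by rewrite /Ps mulmxBl mul1mx {1}eta_eq// -addrA addrC addrA subrK addrC.
have [_ _ _ Sg_posdef Sg_smooth] := par_ok.
have JT d (mu : Om -> {measure set (R * 'cV[R]_d) -> \bar R}) t : jump_future t mu setT.
  by apply: sub_sigma_algebra; exists set0, setT; split.
have rho4 : 4^-1 < rho by apply: lt_le_trans rho_ge; rewrite ltf_pV2 ?posrE// ltr_nat.
apply: (@qlr_cvg_chi2 R dO Om P F _ (combined (noise xi) (noise delta) (noise eps) (noise zeta))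
  F_filtration _ _ _ _ X Sg Theta th0 th_hat T D rho T_gt0 D_gt0 rho4 rho_lt Theta_compact
  Sg_smooth Sg_posdef th0_int identifiable Delta0_rank L (whitening N1 N2 N3 N4 L) L_unit) => //.
- move=> t a E t0 mE; exact: (combined_adapted bm1 bm2 bm3 bm4).
- move=> s t A E s0 st FA mE.
  apply: (combined_indep bm1 bm2 bm3 bm4 (J1 := fun t => jump_future t (jump_meas xi))
   (J2 := fun t => jump_future t (jump_meas delta)) (J3 := fun t => jump_future t (jump_meas eps))
   (J4 := fun t => jump_future t (jump_meas zeta))) => //.
- by rewrite -L_root H0.
- exact: whitening_orthonormal.
- move=> t a t0; rewrite (_ : (fun w => _) = fun w =>
    (M1 *m process xi t w) a 0 + (M2 *m process delta t w) a 0 +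
    ((M3 *m process eps t w) a 0 + (M4 *m process zeta t w) a 0)); last first.
    by apply/funext => w; rewrite X_sum// mxE [X in X + _]mxE [X in _ + X]mxE.
  have mM d (M : 'M[R]_(p1 + p2, d)) (l : latent R Om d) : latent_model P F l ->
      measurable_fun setT (fun w => (M *m process l t w) a 0).
    move=> ml; under eq_fun do rewrite mxE; apply: measurable_sum => j.
    by apply: measurable_funM => //; exact: (measurable_process F_filtration ml t0 j 0).
  by apply: measurable_funD; apply: measurable_funD; exact: mM.
have [lip1 _ _ _] := xi_assumptions; have [lip2 _ _ _] := delta_assumptions.
have [lip3 _ _ _] := eps_assumptions; have [lip4 _ _ _] := zeta_assumptions.
have r1 := latent_regular_path T_gt0 F_filtration M1 xi_model lip1.
have r2 := latent_regular_path T_gt0 F_filtration M2 delta_model lip2.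
have r3 := latent_regular_path T_gt0 F_filtration M3 eps_model lip3.
have r4 := latent_regular_path T_gt0 F_filtration M4 zeta_model lip4.
have r12 : {ae P, forall w, regular_path T (fun t => M1 *m process xi t w + M2 *m process delta t w)
   (fun a t => (N1 *m noise xi t w) a 0 + (N2 *m noise delta t w) a 0)}.
  by move: r1 r2; apply: filterS2 => w; exact: regular_pathD.
have r34 : {ae P, forall w, regular_path T (fun t => M3 *m process eps t w + M4 *m process zeta t w)
   (fun a t => (N3 *m noise eps t w) a 0 + (N4 *m noise zeta t w) a 0)}.
  by move: r3 r4; apply: filterS2 => w; exact: regular_pathD.
move: r12 r34; apply: filterS2 => w h12 h34.
apply: (@regular_path_ext _ _ T_gt0 _ _ (X ^~ w) _
  (fun a t => gaussian_part (combined (noise xi) (noise delta) (noise eps) (noise zeta)) L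
     (whitening N1 N2 N3 N4 L) a t w) _ _ (regular_pathD h12 h34)).
- by move=> t t0; rewrite X_sum.
- by move=> a t; rewrite whitening_noise.
Qed.
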